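(* Let $X$ be a finite-dimensional CAT(0) cube complex and let $\Gamma \leq \mathrm{Aut}(X)$ be a group acting essentially without fixed point at infinity. Then for any two half-spaces $\mathfrak{d} \subset \mathfrak{h}$ of $X$, there exists $\gamma \in \Gamma$ such that $\gamma\mathfrak{h} \subsetneq \mathfrak{d} \subset \mathfrak{h}$.
   Context: A CAT(0) cube complex is a simply connected cell complex all of whose cells are Euclidean cubes with edge length one and such that the link of each vertex is a flag complex; it is endowed with the induced length metric, which is CAT(0). It is finite-dimensional if the supremum of the dimensions of its cubes is finite. $\mathrm{Aut}(X)$ is the group of automorphisms of the cube complex $X$. A fixed point at infinity is a fixed point in the visual boundary $\partial_\infty X$. The midpoint of each edge of $X$ belongs to a unique hyperplane; a hyperplane is a closed convex subspace (a union of midcubes) whose complement has exactly two connected components, both convex. The closures of these two components are called half-spaces. A group $\Gamma \leq \mathrm{Aut}(X)$ acts essentially on $X$ if no $\Gamma$-orbit remains in a bounded neighbourhood of a half-space of $X$. *)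

(* Defs.v *)
From HB Require Import structures.
From mathcomp Require Import all_boot all_order all_algebra.
From mathcomp Require Import all_classical all_reals all_analysis.
From Stdlib Require Import Relation_Operators.

Set Implicit Arguments.
Unset Strict Implicit.
Unset Printing Implicit Defensive.

Import Order.TTheory GRing.Theory Num.Theory.
Import numFieldNormedType.Exports.

Local Open Scope classical_set_scope.
Local Open Scope ring_scope.

(* The library norm on row vectors is the sup norm, hence this definition. *)
Definition euclid_dist (R : realType) (n : nat) (x y : 'rV[R]_n) : R :=
  Num.sqrt (\sum_(j < n) (x ord0 j - y ord0 j) ^+ 2).

(* A nonempty closed face of [0,1]^n: [Some b] fixes a coordinate to b,
   [None] leaves it free. *)
Definition face (n : nat) := {ffun 'I_n -> option bool}.

Definition full_face (n : nat) : face n := [ffun _ => None].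

Definition face_dim (n : nat) (f : face n) : nat := #|[pred j | f j == None]|.

Definition face_set (R : realType) (n : nat) (f : face n) : set 'rV[R]_n :=
  [set x | forall j, 0 <= x ord0 j <= 1 /\
                     forall b : bool, f j = Some b -> x ord0 j = b%:R].
Arguments face_set R {n} f _.

Definition cube (R : realType) (n : nat) : set 'rV[R]_n :=
  face_set R (full_face n).
Arguments cube R n _ : clear implicits.

Definition face_isometry (R : realType) (m n : nat) (f : face m) (g : face n)
    (h : 'rV[R]_m -> 'rV[R]_n) : Prop :=
  h @` face_set R f = face_set R g /\
  forall x y, face_set R f x -> face_set R f y ->
    euclid_dist (h x) (h y) = euclid_dist x y.

(* [cube_string chart x y l]: some finite sequence of points from x to y, any
   two consecutive ones lying in a common cube, has total length l. *)
Inductive cube_string (R : realType) (X I : Type) (dim : I -> nat)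
    (chart : forall i, 'rV[R]_(dim i) -> X) : X -> X -> R -> Prop :=
| cube_string_nil x : cube_string chart x x 0
| cube_string_cons i a b y l : cube R (dim i) a -> cube R (dim i) b ->
    cube_string chart (chart i b) y l ->
    cube_string chart (chart i a) y (euclid_dist a b + l).

(* Cubical complexes in the sense of Bridson and Haefliger, Definition I.7.32,
   on the point set X: unit cubes glued along isometries of faces.  Every cube
   is embedded and two cubes that meet do so in a common face.  A chart is only
   meaningful on the unit cube.  The distance of X is the induced length metric: the
   infimum of the lengths of such sequences of points. *)
Record cubeComplex (R : realType) (X : metricType R) := CubeComplex {
  cube_index : Type;
  cube_dim : cube_index -> nat;
  chart : forall i, 'rV[R]_(cube_dim i) -> X;
  chart_cover : forall x, exists i, (@chart i @` cube R (cube_dim i)) x;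
  chart_inj : forall i a b, cube R (cube_dim i) a -> cube R (cube_dim i) b ->
    chart a = chart b -> a = b;
  chart_meet : forall i j,
    (@chart i @` cube R (cube_dim i)) `&` (@chart j @` cube R (cube_dim j))
      !=set0 ->
    exists (f : face (cube_dim i)) (g : face (cube_dim j)) h,
      face_isometry f g h /\
      forall a b, cube R (cube_dim i) a -> cube R (cube_dim j) b ->
        (chart a = chart b <-> face_set R f a /\ b = h a);
  mdist_length : forall x y : X,
    (mdist x y)%:E = ereal_inf [set l%:E | l in cube_string (@chart) x y]
}.
Arguments cube_dim {R X} K i : rename.
Arguments chart {R X} K i a : rename.

(* The cells are the closed faces of all the cubes. *)
Definition cell (R : realType) (X : metricType R) (K : cubeComplex X)
    (n : nat) (C : set X) : Prop :=
  exists i (f : face (cube_dim K i)),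
    face_dim f = n /\ C = chart K i @` face_set R f.

Definition finite_dimensional (R : realType) (X : metricType R)
    (K : cubeComplex X) : Prop :=
  exists N, forall n C, cell K n C -> (n <= N)%N.

(* An abstract simplicial complex is given by its set of nonempty finite
   simplices; the case a = b below says that the members of S are vertices. *)
Definition flag (T : Type) (Delta : set (set T)) : Prop :=
  forall S : set T, finite_set S -> S !=set0 ->
    (forall a b, S a -> S b -> Delta [set a; b]) -> Delta S.

(* The vertices of the link of v are the edges at v; the simplices are the sets
   of all edges at v of a given cell of positive dimension. *)
Definition link (R : realType) (X : metricType R) (K : cubeComplex X) (v : X) :
    set (set (set X)) :=
  [set S : set (set X) | exists n C, cell K n.+1 C /\ C v /\
                       S = [set E : set X | cell K 1 E /\ E v /\ E `<=` C]].

Definition path_connected (R : realType) (X : topologicalType) : Prop :=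
  forall x y : X, exists p : R -> X,
    {within `[0, 1]%classic, continuous p} /\ p 0 = x /\ p 1 = y.

Definition simply_connected (R : realType) (X : topologicalType) : Prop :=
  path_connected R X /\
  forall p : R -> X, {within `[0, 1]%classic, continuous p} -> p 0 = p 1 ->
    exists F : R * R -> X,
      {within `[0, 1]%classic `*` `[0, 1]%classic, continuous F} /\
      forall t, 0 <= t <= 1 ->
        [/\ F (t, 0) = p t, F (t, 1) = p 0, F (0, t) = p 0 & F (1, t) = p 0].

Definition CAT0_cube_complex (R : realType) (X : metricType R)
    (K : cubeComplex X) : Prop :=
  simply_connected R X /\ forall v, cell K 0 [set v] -> flag (link K v).

(* Disjoint edges of a common square, i.e. opposite ones. *)
Definition opposite (R : realType) (X : metricType R) (K : cubeComplex X)
    (E E' : set X) : Prop :=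
  [/\ cell K 1 E, cell K 1 E', E `&` E' = set0 &
      exists Q, cell K 2 Q /\ E `|` E' `<=` Q].

Definition parallel (R : realType) (X : metricType R) (K : cubeComplex X) :
    set X -> set X -> Prop :=
  clos_refl_sym_trans (set X) (opposite K).

Definition midcube (R : realType) (X : metricType R) (K : cubeComplex X)
    (C M : set X) : Prop :=
  exists i (f : face (cube_dim K i)) (j : 'I_(cube_dim K i)),
    f j = None /\ C = chart K i @` face_set R f /\
    M = chart K i @` (face_set R f `&` [set a | a ord0 j = 2^-1]).

(* The only midcube of an edge is its midpoint. *)
Definition midpoint (R : realType) (X : metricType R) (K : cubeComplex X)
    (E : set X) (m : X) : Prop :=
  cell K 1 E /\ midcube K E [set m].

Definition dual_hyperplane (R : realType) (X : metricType R)
    (K : cubeComplex X) (E : set X) : set X :=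
  [set x | exists E' m C M, parallel K E E' /\ midpoint K E' m /\
                            midcube K C M /\ M m /\ M x].

Definition hyperplane (R : realType) (X : metricType R) (K : cubeComplex X)
    (H : set X) : Prop :=
  exists E, cell K 1 E /\ H = dual_hyperplane K E.

Definition halfspace (R : realType) (X : metricType R) (K : cubeComplex X)
    (h : set X) : Prop :=
  exists H x, hyperplane K H /\ (~` H) x /\
              h = closure (connected_component (~` H) x).

Definition cubical (R : realType) (X : metricType R) (K : cubeComplex X)
    (g : X -> X) : Prop :=
  forall i, exists j (f : face (cube_dim K j)) h,
    face_isometry (full_face (cube_dim K i)) f h /\
    forall a, cube R (cube_dim K i) a -> g (chart K i a) = chart K j (h a).

Definition Aut (R : realType) (X : metricType R) (K : cubeComplex X) :
    set (X -> X) :=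
  [set g | exists g', [/\ cancel g g', cancel g' g, cubical K g &
                          cubical K g']].

Definition subgroup_Aut (R : realType) (X : metricType R) (K : cubeComplex X)
    (Gamma : set (X -> X)) : Prop :=
  [/\ Gamma `<=` Aut K,
      Gamma id,
      forall g g', Gamma g -> Gamma g' -> Gamma (g \o g') &
      forall g, Gamma g ->
        exists g', [/\ Gamma g', cancel g g' & cancel g' g]].

Definition essential (R : realType) (X : metricType R) (K : cubeComplex X)
    (Gamma : set (X -> X)) : Prop :=
  forall h, halfspace K h -> forall x : X,
    ~ exists r : R, forall g, Gamma g -> exists y, h y /\ mdist (g x) y <= r.

(* Rays are only meaningful on [0, +oo[. *)
Definition geodesic_ray (R : realType) (X : metricType R) (c : R -> X) : Prop :=
  forall s t, 0 <= s -> 0 <= t -> mdist (c s) (c t) = `|s - t|.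

Definition asymptotic (R : realType) (X : metricType R) (c c' : R -> X) : Prop :=
  exists B : R, forall t, 0 <= t -> mdist (c t) (c' t) <= B.

Definition visual_boundary (R : realType) (X : metricType R) :
    set (set (R -> X)) :=
  [set xi | exists c, geodesic_ray c /\
                      xi = [set c' | geodesic_ray c' /\ asymptotic c c']].
Arguments visual_boundary {R} X _.

Definition fixed_point_at_infinity (R : realType) (X : metricType R)
    (Gamma : set (X -> X)) : Prop :=
  exists2 xi, visual_boundary X xi &
    forall g, Gamma g -> [set g \o c | c in xi] = xi.

(* Main.v *)
(* A wall is identified with a half-space of the vertex graph, and a point of X
   with its coordinates in [0,1] along all the walls; a topological half-space is
   then the set of the points with coordinate at least 1/2.  The main step is
   that every half-space h can be flipped: some g in Gamma satisfies
   gh /\ h = empty.  Otherwise the translates of h meet pairwise, hence finitely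
   many of them have a common vertex by the Helly property.  If all of them do,
   the orbit of that vertex stays in h, against essentiality.  If not, the
   distances to the finite intersections, normalized at a base point, have as
   upper limit a convex function that is invariant under Gamma up to additive
   constants.  It decreases at a linear rate along vertices: each time cross at
   once all the walls adjacent to the current vertex that separate it from the
   intersection.  As X is complete and CAT(0), points descending at nearly the
   best possible rate converge to a geodesic ray, moved by each element of Gamma
   by a bounded amount, that is, to a fixed point at infinity.  Now pick a
   half-space d' properly contained in d, by essentiality, and compose a flip of h
   with a flip of the complement of d' to map h into d'. *)
Require Import Defs.
From HB Require Import structures.
From mathcomp Require Import all_boot all_order all_algebra.
From mathcomp Require Import all_classical all_reals all_analysis.
From mathcomp Require Import lra zify.
From Stdlib Require Import Relation_Operators.

Set Implicit Arguments.
Unset Strict Implicit.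
Unset Printing Implicit Defensive.

Local Open Scope classical_set_scope.

(** * Paths in square complexes *)

(** The complex is only known to be simply connected with flag links; neither the CAT(0) inequality
    nor any property of hyperplanes is available at the start. Both come from one combinatorial
    fact: a reduced edge path is determined by its ends up to moves across squares. It makes the
    vertex graph bipartite with the quadrangle condition, from which walls, gates and the Helly
    property follow. The CAT(0) inequality is proved by cutting, not by a local-to-global theorem: a
    convex region crossed by finitely many walls is the union of a smaller region and a strip along
    an extremal wall, the strip is a metric product with an interval, and Reshetnyak gluing puts the
    two together. Any three points lie in such a region. Limits run over the finite subsets of the
    orbit and not along a sequence, because the group may be uncountable. Finite dimension gives
    completeness, and it bounds the diagonal of a cube, hence the length of a simultaneous crossing
    that lowers the distance by at least one. *)

Section SquarePaths.
Variables (V : choiceType) (adj : V -> V -> Prop) (sq : V -> V -> V -> V -> Prop).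
Hypothesis adj_sym : forall a b, adj a b -> adj b a.
Hypothesis sq_adj : forall a b c d, sq a b c d -> adj a b.
Hypothesis sq_rot : forall a b c d, sq a b c d -> sq b c d a.
Hypothesis sq_rev : forall a b c d, sq a b c d -> sq a d c b.
Hypothesis sq_ne : forall a b c d, sq a b c d -> a <> c.
Hypothesis sq_uniq : forall a b c d d', sq a b c d -> sq a b c d' -> d = d'.
Hypothesis sq_cube : forall v a b c x y z,
  sq a v b x -> sq b v c y -> sq a v c z ->
  exists w, [/\ sq a x w z, sq b x w y & sq c y w z].

(* Paths are listed from their end point back to their origin. *)
Inductive swap : seq V -> seq V -> Prop :=
| swap_here a b c d p : sq a b c d -> swap (a :: b :: c :: p) (a :: d :: c :: p)
| swap_cons a p q : swap p q -> swap (a :: p) (a :: q).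

Inductive swaps : seq V -> seq V -> Prop :=
| swaps_refl p : swaps p p
| swaps_step p q r : swap p q -> swaps q r -> swaps p r.

Lemma swap_sym p q : swap p q -> swap q p.
Proof.
elim=> [a b c d r /sq_rev S|a r s _ IH]; last exact: swap_cons.
exact: swap_here.
Qed.

Lemma swaps_trans p q r : swaps p q -> swaps q r -> swaps p r.
Proof.
by elim=> // a b c ab _ IH /IH; apply: swaps_step ab.
Qed.

Lemma swaps1 p q : swap p q -> swaps p q.
Proof. by move=> pq; apply: swaps_step pq (swaps_refl _). Qed.

Lemma swaps_sym p q : swaps p q -> swaps q p.
Proof.
elim=> [r|a b c /swap_sym ab _ IH]; first exact: swaps_refl.
exact: swaps_trans IH (swaps1 ab).
Qed.

Lemma swaps_cons a p q : swaps p q -> swaps (a :: p) (a :: q).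
Proof.
elim=> [r|x y z xy _]; first exact: swaps_refl.
by apply: swaps_step; apply: swap_cons.
Qed.

Lemma swaps_here a b c d p : sq a b c d ->
  swaps (a :: b :: c :: p) (a :: d :: c :: p).
Proof. by move=> S; apply/swaps1/swap_here. Qed.

Lemma swap_size p q : swap p q -> size p = size q.
Proof. by elim=> //= a r s _ ->. Qed.

Lemma swaps_size p q : swaps p q -> size p = size q.
Proof. by elim=> // a b c /swap_size -> _. Qed.

Lemma swap_head x p q : swap p q -> head x p = head x q.
Proof. by case. Qed.

Lemma swaps_head x p q : swaps p q -> head x p = head x q.
Proof. by elim=> // a b c /(swap_head x) -> _. Qed.

(* Two-step form of Levi's lemma for partially commutative words. *)
Definition levi v a p b q :=
  (a = b /\ swaps (a :: p) (a :: q)) \/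
  exists c r, [/\ sq a v b c, swaps (a :: p) (a :: c :: r) &
                  swaps (b :: q) (b :: c :: r)].


Local Ltac sqs :=
  match goal with
  | H : sq _ _ _ _ |- sq _ _ _ _ =>
    first [ exact H | exact (sq_rot H) | exact (sq_rot (sq_rot H))
          | exact (sq_rot (sq_rot (sq_rot H)))
          | exact (sq_rev H) | exact (sq_rot (sq_rev H))
          | exact (sq_rot (sq_rot (sq_rev H)))
          | exact (sq_rot (sq_rot (sq_rot (sq_rev H)))) ]
  end.

(** The induction on length serves to compose two instances: when both are squares at [v], the
    hypothesis compares their tails one edge further on, and [sq_cube] (or [sq_uniq], if the two
    squares coincide) closes the remaining square. *)
Lemma swaps_levi v a p b q :
  swaps (v :: a :: p) (v :: b :: q) -> levi v a p b q.
Proof.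
have [n] := ubnP (size p).
elim: n v a p b q => // n IHn v a p b q sp.
have trans a1 p1 a2 p2 a3 p3 : size p2 <= n ->
    levi v a1 p1 a2 p2 -> levi v a2 p2 a3 p3 -> levi v a1 p1 a3 p3.
  move=> s2 [[<-]|[c [r [S1 e1 e2]]]] E.
    case=> [[<-] E'|[c [r [S1 e1 e2]]]].
      by left; split=> //; apply: swaps_trans E E'.
    by right; exists c, r; split=> //; apply: swaps_trans E e1.
  case: E => [[<- E']|[c' [r' [S2 e3 e4]]]].
    right; exists c, r; split=> //.
    exact: swaps_trans (swaps_sym E') e2.
  have e5 := swaps_trans (swaps_sym e2) e3.
  have sr : size r < n by have := swaps_size e2; rewrite /=; lia.
  have [[ecc e6]|[t [s [S3 e6 e7]]]] := IHn _ _ _ _ _ sr e5.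
    subst c'; left.
    have ea : a1 = a3 by apply: (@sq_uniq v a2 c); sqs.
    subst a3; split=> //; apply: swaps_trans e1 _.
    exact: swaps_trans (swaps_cons a1 e6) (swaps_sym e4).
  have Q1 : sq v a2 c a1 by sqs.
  have Q2 : sq v a2 c' a3 by sqs.
  have [w [W1 W2 W3]] := sq_cube Q1 S3 Q2.
  right; exists w, (t :: s); split; first by sqs.
  - apply: swaps_trans e1 _; apply: swaps_trans (swaps_cons a1 e6) _.
    by apply: swaps_here; sqs.
  - apply: swaps_trans e4 _; apply: swaps_trans (swaps_cons a3 e7) _.
    by apply: swaps_here; sqs.
move Ex: (v :: a :: p) => x; move Ey: (v :: b :: q) => y E.
elim: E a p b q Ex Ey sp => [r|x' y' z' xy _ IH] a p b q Ex Ey sp.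
  by left; move: Ey; rewrite -Ex => -[-> ->]; split=> //; apply: swaps_refl.
subst x' z'; case: y' xy IH => [|v' [|a' p']] xy IH.
- by have := swap_size xy.
- by have := swap_size xy.
have sz := swap_size xy.
have ev : v = v' := swap_head v xy.
subst v'; apply: (trans a p a' p'); first by move: sz => /=; lia.
  inversion xy; subst.
    by right; exists c, p0; split; [sqs | exact: swaps_refl | exact: swaps_refl].
  have ea : a = a' := swap_head a H0.
  by subst a'; left; split=> //; apply: swaps1.
by apply: IH => //; move: sz => /=; lia.
Qed.

Inductive backtrack : seq V -> Prop :=
| backtrack_here a b p : backtrack (a :: b :: a :: p)
| backtrack_cons a p : backtrack p -> backtrack (a :: p).

(** Asked of the whole class under square moves, since a path may show a backtrack only after some
    moves. *)
Definition reduced p := forall q, swaps p q -> ~ backtrack q.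

Lemma reduced_swaps p q : swaps p q -> reduced p -> reduced q.
Proof. by move=> pq rp r qr; apply: rp; apply: swaps_trans pq qr. Qed.

Lemma reduced_behead a p : reduced (a :: p) -> reduced p.
Proof.
move=> rp q pq bq; apply: (rp (a :: q)); first exact: swaps_cons.
exact: backtrack_cons.
Qed.

Lemma reduced1 o : reduced [:: o].
Proof.
move=> q E bq; have := swaps_size E; case: bq => // a p [b c r|b r] //.
Qed.

(** If a path in the class of [v :: a :: p] backtracks, [swaps_levi] shows that the class of
    [a :: p] already arrives through [v], or pushes the backtrack across a square into a shorter
    path, where induction applies. *)
Lemma reduced_push v a p : reduced (a :: p) ->
  ~ (exists p', swaps (a :: p) (a :: v :: p')) -> reduced (v :: a :: p).
Proof.
have [n] := ubnP (size p).
elim: n v a p => // n IHn v a p sp ra no q E bq; apply: no.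
case: q E bq => [|v' [|b q]] E bq.
- by have := swaps_size E.
- by have := swaps_size E.
have ev : v = v' := swaps_head v E; subst v'.
have sz := swaps_size E.
have [[eab E']|[c [r [S e1 e2]]]] := swaps_levi E.
  subst b; inversion bq; subst; first by exists p0.
  by case: (ra _ E').
inversion bq; subst.
  have [[evc _]|[t [r' [S2 e3 e4]]]] := swaps_levi e2.
    by case: (sq_ne (sq_rot S)).
  have eta : t = a by apply: (@sq_uniq v b c); sqs.
  subst t; case: (ra _ (swaps_trans e1 (swaps_cons a e4))).
  exact: backtrack_here.
have rc : reduced (c :: r).
  by apply: (@reduced_behead a); apply: reduced_swaps e1 ra.
have [[r' Er]|no] := EM (exists p', swaps (c :: r) (c :: b :: p')).
  exists (b :: r'); apply: swaps_trans e1 _.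
  apply: swaps_trans (swaps_cons a Er) _; apply: swaps_here; sqs.
have sr : size r < n by have := swaps_size e1; move: sp; rewrite /=; lia.
by have := IHn b c r sr rc no _ (swaps_sym e2); case.
Qed.

Inductive walk (o : V) : seq V -> Prop :=
| walk_nil : walk o [:: o]
| walk_cons v a p : adj a v -> walk o (a :: p) -> walk o (v :: a :: p).

Lemma walk_swap o p q : swap p q -> walk o p -> walk o q.
Proof.
elim=> [a b c d r S|a r s rs IH] W.
  inversion W as [|? ? ? _ W1]; subst; inversion W1 as [|? ? ? _ W2]; subst.
  apply: walk_cons; first by apply: adj_sym; apply: (@sq_adj _ d c b); sqs.
  by apply: walk_cons => //; apply: (@sq_adj _ d a b); sqs.
inversion W as [|? b r' ab W1]; subst; first by inversion rs.
case: s rs IH => [|b' s] rs /(_ W1) W2; first by inversion rs.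
have eb : b = b' := swap_head b rs.
by subst b'; apply: walk_cons.
Qed.

Lemma walk_swaps o p q : swaps p q -> walk o p -> walk o q.
Proof. by elim=> // x y z xy _ IH W; apply: IH; apply: walk_swap xy W. Qed.

Fixpoint transport (S : Type) (step : S -> V -> S) (s : S) (p : seq V) : S :=
  if p is v :: p' then
    if p' is [::] then s else step (transport step s p') v
  else s.

(** Simple connectivity as trivial monodromy: [S] with [pos] is a covering of the square complex,
    given by its lifting of edges, and closed walks must lift to closed walks. In this form it can
    be proved from a contraction of loops and applied to the covering by classes of paths. *)
Definition square_simply_connected : Prop :=
  forall (S : Type) (ok : S -> Prop) (pos : S -> V) (step : S -> V -> S),
  (forall s v, ok s -> adj (pos s) v ->
     [/\ ok (step s v), pos (step s v) = v & step (step s v) (pos s) = s]) ->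
  (forall s b c d, ok s -> sq (pos s) b c d ->
     step (step s b) c = step (step s d) c) ->
  forall s o p, ok s -> pos s = o -> walk o (o :: p) ->
    transport step s (o :: p) = s.

(** Edge lifting in the universal cover, whose points are classes of reduced paths from a fixed
    origin: going to [v] undoes the last edge if some path of the class arrived from [v], and
    extends the class otherwise. *)
Definition pop_or_push (s : V * set (seq V)) (v : V) : V * set (seq V) :=
  let: (a, c) := s in
  (v, if `[< exists p, c (a :: v :: p) >]
      then [set q | exists2 p, c (a :: v :: p) & swaps (v :: p) q]
      else [set q | exists2 p, c (a :: p) & swaps (v :: a :: p) q]).

Arguments pop_or_push : simpl never.

Lemma swaps_cancel a v p q :
  swaps (a :: v :: p) (a :: v :: q) -> swaps (v :: p) (v :: q).
Proof. by case/swaps_levi=> [[]//|[c [r [/sq_ne]]]]. Qed.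

Lemma pop_or_push_pop a v p p' : swaps (a :: p) (a :: v :: p') ->
  pop_or_push (a, swaps (a :: p)) v = (v, swaps (v :: p')).
Proof.
move=> E; rewrite /pop_or_push; case: asboolP; last by case; exists p'.
move=> _; congr pair; apply/seteqP; split=> [q [p'' E' E'']|q E'] /=.
  apply: swaps_trans E''; apply: (@swaps_cancel a).
  exact: swaps_trans (swaps_sym E) E'.
by exists p'.
Qed.

Lemma pop_or_push_push a v p : ~ (exists p', swaps (a :: p) (a :: v :: p')) ->
  pop_or_push (a, swaps (a :: p)) v = (v, swaps (v :: a :: p)).
Proof.
move=> no; rewrite /pop_or_push; case: asboolP => // _.
congr pair; apply/seteqP; split=> [q [p' E' E'']|q E'] /=.
  exact: swaps_trans (swaps_cons v E') E''.
by exists p => //; apply: swaps_refl.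
Qed.

Lemma swaps_class p q : swaps p q -> swaps p = swaps q.
Proof.
move=> E; apply/seteqP; split=> r /= E'; last exact: swaps_trans E E'.
exact: swaps_trans (swaps_sym E) E'.
Qed.

Section Based.
Variable o : V.

Definition reduced_state (s : V * set (seq V)) := exists p,
  [/\ reduced (s.1 :: p), walk o (s.1 :: p) & s.2 = swaps (s.1 :: p)].

Lemma reduced_step s v : reduced_state s -> adj s.1 v ->
  [/\ reduced_state (pop_or_push s v), (pop_or_push s v).1 = v &
      pop_or_push (pop_or_push s v) s.1 = s].
Proof.
case: s => a _ [p /= [rp wp ->]] av.
have [[p' E]|no] := EM (exists p', swaps (a :: p) (a :: v :: p')).
  rewrite (pop_or_push_pop E) /=.
  have r1 := reduced_swaps E rp; have w1 := walk_swaps E wp.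
  split=> //.
    exists p'; split=> //=; first exact: reduced_behead r1.
    by inversion w1.
  rewrite pop_or_push_push ?(swaps_class E)//.
  case=> p'' E'; apply: (r1 _ (swaps_cons a E')); exact: backtrack_here.
rewrite (pop_or_push_push no) /=; split=> //.
  by exists (a :: p); split=> //; [exact: reduced_push | exact: walk_cons].
rewrite (@pop_or_push_pop _ _ _ p)//; exact: swaps_refl.
Qed.

(** The four cases are whether the class can be shortened through [b] and through [d]. If through
    both, [swaps_levi] yields a common further step, which is [c] by uniqueness of squares; if
    through one only, the other route first extends the class and then shortens it to the same
    result. *)
Lemma reduced_square s b c d : reduced_state s -> sq s.1 b c d ->
  pop_or_push (pop_or_push s b) c = pop_or_push (pop_or_push s d) c.
Proof.
case: s => a _ [p /= [rp wp ->]].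
have mix e e' : sq a e c e' ->
    (exists p', swaps (a :: p) (a :: e :: p')) ->
    ~ (exists p', swaps (a :: p) (a :: e' :: p')) ->
    pop_or_push (pop_or_push (a, swaps (a :: p)) e) c =
    pop_or_push (pop_or_push (a, swaps (a :: p)) e') c.
  move=> S [p1 E1] no2.
  rewrite (pop_or_push_pop E1) (pop_or_push_push no2).
  rewrite pop_or_push_push; last first.
    case=> r E; apply: no2; exists (c :: r); apply: swaps_trans E1 _.
    by apply: swaps_trans (swaps_cons a E) _; apply: swaps_here; sqs.
  rewrite (@pop_or_push_pop _ _ _ (e :: p1))//.
  apply: swaps_trans (swaps_cons e' E1) _; apply: swaps_here; sqs.
move=> S.
have [[p1 E1]|no1] := EM (exists p', swaps (a :: p) (a :: b :: p'));
have [[p2 E2]|no2] := EM (exists p', swaps (a :: p) (a :: d :: p')).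
- have E := swaps_trans (swaps_sym E1) E2.
  rewrite (pop_or_push_pop E1) (pop_or_push_pop E2).
  have [[bd _]|[c' [r [S' e1 e2]]]] := swaps_levi E.
    by have := sq_ne (sq_rot S); rewrite bd.
  have ec : c' = c by apply: (@sq_uniq b a d); sqs.
  by subst c'; rewrite (pop_or_push_pop e1) (pop_or_push_pop e2).
- by apply: mix => //; exists p1.
- by symmetry; apply: mix; [sqs | exists p2 | ].
- have push b' d' : sq a b' c d' ->
      ~ (exists p', swaps (a :: p) (a :: d' :: p')) ->
      ~ (exists p', swaps (b' :: a :: p) (b' :: c :: p')).
    move=> S' no [r E].
    have [[ac _]|[c' [r' [S1 e1 _]]]] := swaps_levi E.
      by have := sq_ne S'.
    apply: no; exists r'.
    suff <- : c' = d' by [].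
    apply: (@sq_uniq a b' c); sqs.
  rewrite (pop_or_push_push no1) (pop_or_push_push no2).
  rewrite (pop_or_push_push (push _ _ S no2)).
  rewrite (pop_or_push_push (push _ _ (sq_rev S) no1)).
  congr pair; apply: swaps_class; apply: swaps_here; sqs.
Qed.

Lemma transport_reduced v p : reduced (v :: p) -> walk o (v :: p) ->
  transport pop_or_push (o, swaps [:: o]) (v :: p) = (v, swaps (v :: p)).
Proof.
elim: p v => [|a p IH] v rp wp.
  by inversion wp.
have ra := reduced_behead rp; have wa : walk o (a :: p) by inversion wp.
have -> : transport pop_or_push (o, swaps [:: o]) [:: v, a & p] =
  pop_or_push (transport pop_or_push (o, swaps [:: o]) (a :: p)) v by [].
rewrite IH// pop_or_push_push// => -[p' E].
apply: (rp _ (swaps_cons v E)); exact: backtrack_here.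
Qed.

Lemma transport_ok s v p : reduced_state s -> walk s.1 (v :: p) ->
  reduced_state (transport pop_or_push s (v :: p)) /\
  (transport pop_or_push s (v :: p)).1 = v.
Proof.
move=> os; elim: p v => [|a p IH] v W; first by inversion W.
inversion W as [|? ? ? av W1]; subst.
have -> : transport pop_or_push s [:: v, a & p] =
  pop_or_push (transport pop_or_push s (a :: p)) v by [].
have [os1 e1] := IH _ W1.
by have [|? ? _] := @reduced_step _ v os1; rewrite ?e1.
Qed.

End Based.

Lemma walk_behead o v a p : walk o (v :: a :: p) -> adj a v /\ walk o (a :: p).
Proof. by move=> W; inversion W. Qed.

(** As walks are listed from the end, [catrev q (v :: p)] is [p] followed by [q] walked backwards.
    Each backward edge is undone by the invertibility of [pop_or_push]. *)
Lemma transport_catrev o v p q s s' : reduced_state o s -> reduced_state o s' ->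
  walk s.1 (v :: p) -> walk s'.1 (v :: q) ->
  transport pop_or_push s (catrev q (v :: p)) = s' ->
  transport pop_or_push s (v :: p) = transport pop_or_push s' (v :: q).
Proof.
move=> os os'; elim: q v p => [|a q IH] v p W W' E; first exact: E.
have [av W1] := walk_behead W'.
have [os1 e1] := transport_ok os W.
have := IH a (v :: p) (walk_cons (adj_sym av) W) W1 E.
have -> : transport pop_or_push s [:: a, v & p] =
  pop_or_push (transport pop_or_push s (v :: p)) a by [].
move=> E1.
have -> : transport pop_or_push s' [:: v, a & q] =
  pop_or_push (transport pop_or_push s' (a :: q)) v by [].
rewrite -E1; have [|_ _] := @reduced_step o _ a os1.
  by rewrite e1; apply: adj_sym.
by rewrite e1 => ->.
Qed.

Lemma walk_catrev o o' v p q : walk o (v :: p) -> walk o' (v :: q) ->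
  walk o (catrev q (v :: p)) /\ exists r, catrev q (v :: p) = o' :: r.
Proof.
elim: q v p => [|a q IH] v p W W' /=.
  by split=> //; exists p; inversion W'.
have [av W1] := walk_behead W'.
by apply: IH => //; apply: walk_cons => //; apply: adj_sym.
Qed.

Lemma walk_cat o o' v p q : walk o (o' :: p) -> walk o' (v :: q) ->
  exists2 r, walk o (v :: r) & size r = size p + size q.
Proof.
move=> W; elim: q v => [|a q IH] v W'.
  by inversion W'; subst; exists p; rewrite //= addn0.
have [av W1] := walk_behead W'.
have [r Wr sr] := IH _ W1; exists (a :: r); first exact: walk_cons.
by rewrite /= sr addnS.
Qed.

Lemma size_catrev (T : Type) (s t : seq T) : size (catrev s t) = size s + size t.
Proof. by rewrite catrevE size_cat size_rev. Qed.

Hypothesis sconn : square_simply_connected.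
Hypothesis conn : forall o v, exists p, walk o (v :: p).

Lemma reduced_state0 o : reduced_state o (o, swaps [:: o]).
Proof. by exists [::]; split=> //=; [exact: reduced1 | exact: walk_nil]. Qed.

Lemma reduced_walk o v : exists p, reduced (v :: p) /\ walk o (v :: p).
Proof.
have [p W] := conn o v.
by have [[q [r w _]] <-] := transport_ok (reduced_state0 o) W; exists q.
Qed.

(** The loop made of [p] and the reverse of [q] has trivial monodromy in the covering by classes of
    reduced paths, and transporting the trivial class along a reduced path gives the class of that
    path. *)
Lemma reduced_walk_uniq o v p q : reduced (v :: p) -> walk o (v :: p) ->
  reduced (v :: q) -> walk o (v :: q) -> swaps (v :: p) (v :: q).
Proof.
move=> rp wp rq wq; have o0 := reduced_state0 o.
have [W [r E]] := walk_catrev wp wq.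
have e0 : transport pop_or_push (o, swaps [:: o]) (catrev q (v :: p)) =
          (o, swaps [:: o]).
  rewrite E; apply: (@sconn _ (reduced_state o) fst) => //.
  - exact: reduced_step.
  - exact: reduced_square.
  - by rewrite -E.
have := transport_catrev o0 o0 wp wq e0.
rewrite (transport_reduced rp wp) (transport_reduced rq wq) => -[->].
exact: swaps_refl.
Qed.

(** Well defined because reduced walks with the same ends differ by square moves, which keep the
    length; [gdist_walk] shows that they are shortest. *)
Definition gdist o v : nat :=
  size (xget [::] [set p | reduced (v :: p) /\ walk o (v :: p)]).

Lemma gdist_reduced o v p : reduced (v :: p) -> walk o (v :: p) ->
  gdist o v = size p.
Proof.
move=> rp wp; rewrite /gdist; case: xgetP => [q _ [rq wq]|/(_ p)]; last by case.
by have /swaps_size[] := reduced_walk_uniq rq wq rp wp.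
Qed.

Lemma gdist_adj_path o v w : adj v w ->
  (gdist o v = (gdist o w).+1 /\
   exists p, reduced [:: v, w & p] /\ walk o [:: v, w & p]) \/
  (gdist o w = (gdist o v).+1 /\
   exists p, reduced [:: w, v & p] /\ walk o [:: w, v & p]).
Proof.
move=> vw; have [p [rp wp]] := reduced_walk o v.
have [[p' E]|no] := EM (exists p', swaps (v :: p) (v :: w :: p')).
  have r1 := reduced_swaps E rp; have w1 := walk_swaps E wp.
  left; split; last by exists p'.
  rewrite (gdist_reduced r1 w1) (@gdist_reduced _ w p')//.
    exact: reduced_behead r1.
  by inversion w1.
have r1 := reduced_push rp no; have w1 := walk_cons vw wp.
right; split; last by exists p.
by rewrite (gdist_reduced r1 w1) (gdist_reduced rp wp).
Qed.

Lemma gdist_adj o v w : adj v w ->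
  gdist o v = (gdist o w).+1 \/ gdist o w = (gdist o v).+1.
Proof. by move=> /(gdist_adj_path o)[[-> _]|[-> _]]; [left|right]. Qed.

Lemma gdist_last o v w : adj v w -> gdist o v = (gdist o w).+1 ->
  exists p, reduced [:: v, w & p] /\ walk o [:: v, w & p].
Proof. by move=> /(gdist_adj_path o)[[_ ?]|[-> _]] // ?; lia. Qed.

Lemma gdist0 o v : gdist o v = 0 <-> o = v.
Proof.
split=> [|<-]; last by rewrite (gdist_reduced (@reduced1 o) (walk_nil o)).
have [p [rp wp]] := reduced_walk o v; rewrite (gdist_reduced rp wp).
by case: p wp {rp} => // W _; inversion W.
Qed.

Lemma gdist_pred o v : o <> v -> exists2 w, adj v w & gdist o v = (gdist o w).+1.
Proof.
move=> ov; have [p [rp wp]] := reduced_walk o v.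
inversion wp as [|? w p' wv W]; subst; first by case: ov.
exists w; first exact: adj_sym.
rewrite (gdist_reduced rp wp) (gdist_reduced _ W)//.
exact: reduced_behead rp.
Qed.

Lemma gdist_quadrangle o v a b : adj v a -> adj v b -> a <> b ->
  gdist o v = (gdist o a).+1 -> gdist o v = (gdist o b).+1 ->
  exists2 c, sq a v b c & gdist o a = (gdist o c).+1.
Proof.
move=> va vb ab da db.
have [p [rp wp]] := gdist_last va da.
have [q [rq wq]] := gdist_last vb db.
have [[/ab[]]|[c [r [S E _]]]] := swaps_levi (reduced_walk_uniq rp wp rq wq).
exists c => //.
have ra := reduced_swaps E (reduced_behead rp).
have wa : walk o [:: a, c & r] by apply: walk_swaps E _; inversion wp.
rewrite (gdist_reduced ra wa) (@gdist_reduced _ _ r)//.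
  exact: reduced_behead ra.
by inversion wa.
Qed.

Lemma gdist_walk o v p : walk o (v :: p) -> gdist o v <= size p.
Proof.
elim: p v => [|a p IH] v W.
  by inversion W; subst; rewrite (gdist0 v v).2.
have [av W1] := walk_behead W.
have := IH _ W1; case: (gdist_adj o av) => /=; lia.
Qed.

Lemma gdist_geodesic o v : exists2 p, walk o (v :: p) & size p = gdist o v.
Proof.
by have [p [rp wp]] := reduced_walk o v; exists p; rewrite // (gdist_reduced rp wp).
Qed.

Lemma gdist_sym o v : gdist o v = gdist v o.
Proof.
have le a b : gdist a b <= gdist b a.
  have [p W <-] := gdist_geodesic b a.
  have [W' [r E]] := walk_catrev (walk_nil a) W.
  rewrite E in W'; have := gdist_walk W'.
  by have := congr1 size E; rewrite size_catrev /=; lia.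
by apply/eqP; rewrite eqn_leq !le.
Qed.

Lemma gdist_triangle u v w : gdist u w <= gdist u v + gdist v w.
Proof.
have [p W1 <-] := gdist_geodesic u v; have [q W2 <-] := gdist_geodesic v w.
by have [r W <-] := walk_cat W1 W2; apply: gdist_walk.
Qed.

End SquarePaths.

(** * Walls of a graph with squares *)

(** [d] is the distance of a bipartite graph with the quadrangle condition of median graphs: two
    neighbours of [v] nearer to [u] lie with [v] on a square whose fourth vertex is nearer still. *)
Record quadrangle_graph (V : choiceType) (adj : V -> V -> Prop)
    (sq : V -> V -> V -> V -> Prop) (d : V -> V -> nat) : Prop := QuadrangleGraph {
  qg_adj_sym : forall a b, adj a b -> adj b a;
  qg_sq_adj : forall a b c e, sq a b c e -> adj a b;
  qg_sq_rot : forall a b c e, sq a b c e -> sq b c e a;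
  qg_sq_rev : forall a b c e, sq a b c e -> sq a e c b;
  qg_sq_ne : forall a b c e, sq a b c e -> a <> c;
  qg_sq_uniq : forall a b c e e', sq a b c e -> sq a b c e' -> e = e';
  qg_dist0 : forall u v, d u v = 0 <-> u = v;
  qg_dist_sym : forall u v, d u v = d v u;
  qg_dist_triangle : forall u v w, d u w <= d u v + d v w;
  qg_dist_adj : forall u v w, adj v w ->
    d u v = (d u w).+1 \/ d u w = (d u v).+1;
  qg_dist_pred : forall u v, u <> v -> exists2 w, adj v w & d u v = (d u w).+1;
  qg_quadrangle : forall u v a b, adj v a -> adj v b -> a <> b ->
    d u v = (d u a).+1 -> d u v = (d u b).+1 ->
    exists2 c, sq a v b c & d u a = (d u c).+1
}.

Section Walls.
Variables (V : choiceType) (adj : V -> V -> Prop).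
Variables (sq : V -> V -> V -> V -> Prop) (d : V -> V -> nat).
Hypothesis G : quadrangle_graph adj sq d.

Let adj_sym := qg_adj_sym G.
Let sq_rot := qg_sq_rot G.
Let sq_rev := qg_sq_rev G.
Let sq_uniq := qg_sq_uniq G.
Let dsym := qg_dist_sym G.
Let dtri := qg_dist_triangle G.
Let dadj := qg_dist_adj G.
Let quad := qg_quadrangle G.

Local Ltac sqs :=
  match goal with
  | H : sq _ _ _ _ |- sq _ _ _ _ =>
    first [ exact H | exact (sq_rot H) | exact (sq_rot (sq_rot H))
          | exact (sq_rot (sq_rot (sq_rot H)))
          | exact (sq_rev H) | exact (sq_rot (sq_rev H))
          | exact (sq_rot (sq_rot (sq_rev H)))
          | exact (sq_rot (sq_rot (sq_rot (sq_rev H)))) ]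
  end.

Local Ltac sqa := apply: (qg_sq_adj G); sqs.

Lemma distxx u : d u u = 0. Proof. exact/(qg_dist0 G). Qed.

Lemma dist_adj1 a b : adj a b -> d a b = 1.
Proof. by case/(dadj a); rewrite distxx. Qed.

Lemma dist1_adj a b : d a b = 1 -> adj a b.
Proof.
move=> ab; have ne : b <> a by move=> E; rewrite E distxx in ab.
have [w aw] := qg_dist_pred G ne; rewrite dsym ab => -[/esym/(qg_dist0 G)->] //.
Qed.

Definition side a b : set V := [set v | d v a < d v b].

Definition halfsp (h : set V) := exists a b, adj a b /\ h = side a b.

Lemma sideC a b : adj a b -> side b a = ~` side a b.
Proof.
move=> ab; apply/seteqP; split=> v; rewrite /side /=; first by lia.
by case: (dadj v ab); lia.
Qed.

Lemma halfsp_side a b : adj a b -> halfsp (side a b).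
Proof. by exists a, b. Qed.

Lemma halfspC h : halfsp h -> halfsp (~` h).
Proof.
by move=> [a [b [ab ->]]]; rewrite -sideC//; apply/halfsp_side/adj_sym.
Qed.

Lemma side_l a b : adj a b -> side a b a.
Proof. by move=> ab; rewrite /side /= distxx dist_adj1. Qed.

Lemma side_r a b : adj a b -> ~ side a b b.
Proof. by move=> ab; rewrite /side /= distxx. Qed.

(** Were [v] on the wrong side of [ce], both [a] and [e] would be nearer to [v] than [c]. The square
    completed at [c] by the quadrangle condition is the given one, so [b] would be nearer to [v]
    than [a]. *)
Lemma side_opposite_sub a b c e : sq a b e c -> side a b `<=` side c e.
Proof.
move=> S v; rewrite /side /= => va.
have ab : adj a b by sqa. have ce : adj c e by sqa.
have ac : adj a c by sqa. have be : adj b e by sqa.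
have vab : d v b = (d v a).+1 by case: (dadj v ab); lia.
case: (dadj v ac) => vac; case: (dadj v be) => vbe; case: (dadj v ce) => vce;
  try lia.
have ne : a <> e by apply: (qg_sq_ne G) S.
have ca : adj c a by apply: adj_sym.
have [x Q dx] := quad ca ce ne vac vce.
have ex : x = b by apply: (@sq_uniq a c e); sqs.
by subst x; lia.
Qed.

Lemma side_opposite a b c e : sq a b e c -> side a b = side c e.
Proof.
by move=> S; apply/seteqP; split; apply: side_opposite_sub; sqs.
Qed.

Inductive parallel_edges (a b : V) : V -> V -> Prop :=
| parallel_refl : parallel_edges a b a b
| parallel_step c e e' c' : parallel_edges a b c e -> sq c e e' c' ->
    parallel_edges a b c' e'.

Lemma parallel_side a b c e : parallel_edges a b c e -> side a b = side c e.
Proof. by elim=> // c1 e1 e2 c2 _ -> /side_opposite. Qed.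

(** The quadrangle condition at [c], seen from [b], moves the crossing edge by one square towards
    [ab]; the induction builds a ladder of squares between the two edges. *)
Lemma crossing_parallel a b c e : adj a b -> adj c e ->
  side a b c -> ~ side a b e ->
  parallel_edges a b c e /\ d a c = d b e.
Proof.
move=> ab; move En: (d a c) => n; elim: n c e En => [|n IH] c e En ce hc he.
  have ac : a = c by apply/(qg_dist0 G).
  subst c; move: he; rewrite /side /= (dsym e a) (dist_adj1 ce) (dsym e b) => /negP he.
  have be : b = e.
    apply/(qg_dist0 G); have := dadj b ce.
    by rewrite (dist_adj1 (adj_sym ab)); lia.
  by subst e; split; [exact: parallel_refl|rewrite distxx].
have ac : a <> c by move=> E; rewrite E distxx in En.
have [c' cc' dc'] := qg_dist_pred G ac.
move: (hc) (he); rewrite /side /= !(dsym c) !(dsym e) => hc1 /negP he1.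
have cb : d b c = n.+2 by have := dadj c ab; rewrite (dsym c a) (dsym c b); lia.
have eb : d b e = n.+1 by have := dadj b ce; have := dadj a ce; have := dadj e ab;
  rewrite (dsym e a) (dsym e b); lia.
have c'b : d b c' = n.+1.
  have := dadj b cc'; have := dtri b a c'; have := dist_adj1 (adj_sym ab).
  lia.
have ne : c' <> e.
  move=> E; subst e; move: he1; have := dadj c' ab; rewrite !(dsym c'); lia.
have [x S dx] := quad cc' ce ne (etrans cb (congr1 S (esym c'b)))
  (etrans cb (congr1 S (esym eb))).
have c'x : adj c' x by sqa.
have ae : d a e = n.+2 by have := dadj e ab; rewrite (dsym e a) (dsym e b); lia.
have xe : adj x e by sqa.
have hc' : side a b c' by rewrite /side /= !(dsym c'); lia.
have hx : ~ side a b x.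
  rewrite /side /= !(dsym x); apply/negP.
  by have := dadj a xe; have := dadj b xe; lia.
have dn : d a c' = n by lia.
have [P dd] := IH c' x dn c'x hc' hx.
split; last by lia.
by apply: parallel_step P _; sqs.
Qed.

Lemma crossing_side a b c e : adj a b -> adj c e ->
  side a b c -> ~ side a b e -> side a b = side c e.
Proof.
by move=> ab ce hc he; have [/parallel_side] := crossing_parallel ab ce hc he.
Qed.

Lemma crossing_halfsp h c e : halfsp h -> adj c e -> h c -> ~ h e ->
  h = side c e.
Proof. by move=> [a [b [ab ->]]]; apply: crossing_side. Qed.

Lemma crossing_edge (h : set V) u w : h u -> ~ h w ->
  exists x y, [/\ adj x y, h x, ~ h y & d u x + (d y w).+1 = d u w].
Proof.
move En: (d u w) => n; elim: n w En => [|n IH] w En hu hw.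
  by move/(qg_dist0 G): En hw => <-.
have uw : u <> w by move=> E; rewrite E distxx in En.
have [w' ww' dw] := qg_dist_pred G uw.
have [hw'|nw'] := EM (h w').
  by exists w', w; split=> //; [exact: adj_sym | rewrite distxx; lia].
have [|x [y [xy hx hy D]]] := IH w' _ hu nw'; first by lia.
exists x, y; split=> //.
have := dtri y w' w; have := dtri u x w; have := dtri x y w.
by rewrite (dist_adj1 xy) (dist_adj1 (adj_sym ww')); lia.
Qed.

Definition gconvex (C : set V) :=
  forall u v w, C u -> C v -> d u w + d w v = d u v -> C w.

Lemma halfsp_convex h : halfsp h -> gconvex h.
Proof.
move=> hh u v w hu hv D; apply: contrapT => hw.
have [x [y [xy hx hy D']]] := crossing_edge hu hw.
move: hv; rewrite (crossing_halfsp hh xy hx hy) /side /= !(dsym v).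
have := dtri u x v; have := dtri y w v; have := dtri u y v; have := dadj v xy.
rewrite !(dsym v); lia.
Qed.

Lemma gconvexI C D : gconvex C -> gconvex D -> gconvex (C `&` D).
Proof.
by move=> cC cD u v w [Cu Du] [Cv Dv] e; split; [apply: cC e|apply: cD e].
Qed.

(** The gate is a nearest point [p] of [C]. It lies on a geodesic from [x] to every point of [C], so
    a half-space containing [p] but not [x] contains [C], by convexity of its complement. *)
Lemma gate_exists C c0 x : gconvex C -> C c0 -> exists2 p, C p &
  forall h, halfsp h -> h p -> ~ h x -> C `<=` h.
Proof.
move=> cC Cc0.
have [p Cp near] : exists2 p, C p & forall c, C c -> d x p <= d x c.
  have [n] := ubnP (d x c0); elim: n c0 Cc0 => // n IH c0 Cc0 lt.
  have [[c Cc lt']|no] := EM (exists2 c, C c & d x c < d x c0).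
    by apply: (IH c) => //; lia.
  exists c0 => // c Cc; rewrite leqNgt; apply/negP => lt'; apply: no.
  by exists c.
have between c : C c -> d x c = d x p + d p c.
  move=> Cc; move En: (d x p) => n.
  elim: n x near En c Cc => [|n IH] y near En c Cc.
    by move/(qg_dist0 G): En => ->.
  have py : p <> y by move=> E; move: En; rewrite E distxx.
  have [y1 yy1 dy1] := qg_dist_pred G py.
  have near1 c1 : C c1 -> d y1 p <= d y1 c1.
    move=> Cc1; have := near _ Cc1; have := dtri y y1 c1.
    by rewrite (dist_adj1 yy1) (dsym y p) dy1 (dsym y1 p); lia.
  have En1 : d y1 p = n by move: dy1; rewrite !(dsym p) En; lia.
  have {}IH := IH y1 near1 En1.
  have [yc|yc] := dadj c yy1; first by rewrite (dsym y) yc (dsym c) IH//; lia.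
  (* Now the wall of [y y1] separates [p] from [c], so some edge inside [C] crosses it. Sliding this
     edge towards [p] by the quadrangle condition ends with a point of [C] nearer to [y] than
     [p]. *)
  exfalso.
  have hp : ~ side y y1 p by rewrite /side /= dy1; lia.
  have hc : side y y1 c by rewrite /side /=; lia.
  have hh : halfsp (side y y1) by apply: halfsp_side.
  have [e1 [e2 [e12 he1 he2 D]]] : exists e1 e2,
      [/\ adj e1 e2, ~ side y y1 e1, side y y1 e2 & C e1 /\ C e2].
    have [|e1 [e2 [e12 he1 /contrapT he2 D]]] :=
      @crossing_edge (~` side y y1) p c hp; first by move=> /(_ hc).
    have [D1 D2] : d p e1 + d e1 c = d p c /\ d p e2 + d e2 c = d p c.
      have := dtri p e1 c; have := dtri p e2 c; have := dtri e1 e2 c.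
      have := dtri p e1 e2; rewrite (dist_adj1 e12); lia.
    exists e1, e2; split=> //; split.
      exact: cC Cp Cc D1.
    exact: cC Cp Cc D2.
  move: D => [C1 C2].
  have [m] := ubnP (d p e1).
  elim: m e1 e2 e12 he1 he2 C1 C2 => // m IHm e1 e2 e12 he1 he2 C1 C2 lt.
  have S := crossing_parallel (adj_sym yy1) (e12).
  have [_ D] : parallel_edges y1 y e1 e2 /\ d y1 e1 = d y e2.
    by apply: S; rewrite sideC// /setC /= notK.
  have d1 := IH _ C1; have d2 := IH _ C2.
  have pe1 : p <> e1.
    move=> E; subst e1; have := near _ C2.
    by rewrite -D En1 En; lia.
  have [e1' e11' de1] := qg_dist_pred G pe1.
  have ae1' := dist_adj1 e11'.
  have C1' : C e1'.
    by apply: cC Cp C1 _; rewrite (dsym e1' e1) ae1'; lia.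
  have he1' : ~ side y y1 e1'.
    apply: (halfsp_convex (halfspC hh)) hp he1 _.
    by rewrite (dsym e1' e1) ae1'; lia.
  have d1' := IH _ C1'.
  have yd1 : d y e1 = (d y1 e1).+1.
    by move: he1; rewrite /side /= (dsym e1) (dsym e1 y1); have := dadj e1 yy1;
      rewrite (dsym e1) (dsym e1 y1); lia.
  have yd1' : d y e1' = (d y1 e1').+1.
    by move: he1'; rewrite /side /= (dsym e1') (dsym e1' y1); have := dadj e1' yy1;
      rewrite (dsym e1') (dsym e1' y1); lia.
  have ne : e1' <> e2 by move=> E; apply: he1'; rewrite E.
  have [||t S' dt] := @quad y e1 e1' e2 e11' e12 ne; [lia | lia | ].
  have e1't : adj e1' t by sqa.
  have te2 : adj t e2 by sqa.
  have Es : side y1 y = side e1' t.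
    have -> : side y1 y = side e1 e2.
      by apply: (@crossing_side y1 y e1 e2 (adj_sym yy1) e12); rewrite sideC.
    exact: (@side_opposite e1 e2 e1' t (sq_rot S')).
  have ht : side y y1 t.
    apply: contrapT => /= nt; apply: (side_r e1't); rewrite -Es sideC//.
  have Ct : C t.
    apply: cC C1' C2 _; rewrite (dist_adj1 e1't) (dist_adj1 te2).
    have := dadj e1' e12; rewrite (dsym e1' e1) ae1' => -[|->//].
    by move=> [/esym/(qg_dist0 G)/ne].
  by apply: (IHm e1' t) => //; lia.
exists p => // h hh hp hx c Cc; apply: contrapT => hc.
apply: (halfsp_convex (halfspC hh) hx hc _ hp).
by rewrite -between.
Qed.

Definition gate (C : set V) (x : V) : V :=
  xget x [set p | C p /\ forall h, halfsp h -> h p -> ~ h x -> C `<=` h].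

Section Gate.
Variable C : set V.
Hypotheses (cC : gconvex C) (C0 : C !=set0).

Lemma gateP x : C (gate C x) /\
  forall h, halfsp h -> h (gate C x) -> ~ h x -> C `<=` h.
Proof.
rewrite /gate; case: xgetP => [p _ //|no]; case: C0 => c Cc.
by have [p Cp gp] := gate_exists x cC Cc; case: (no p).
Qed.

Lemma gate_in x : C (gate C x). Proof. by have [] := gateP x. Qed.

Lemma gate_sub x h : halfsp h -> h (gate C x) -> ~ h x -> C `<=` h.
Proof. by have [_] := gateP x; apply. Qed.

Definition crosses (h : set V) := (exists2 u, C u & h u) /\ (exists2 u, C u & ~ h u).

Lemma crossesC h : crosses h -> crosses (~` h).
Proof. by case=> -[u Cu hu] [v Cv hv]; split; [exists v|exists u]. Qed.

Lemma gate_crosses x h : halfsp h -> crosses h -> h (gate C x) <-> h x.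
Proof.
move=> hh ch; have le k : halfsp k -> crosses k -> k (gate C x) -> k x.
  move=> hk [_ [v Cv kv]] kg; apply: contrapT => kx.
  exact: kv (gate_sub hk kg kx Cv).
split; first exact: le.
move=> hx; apply: contrapT => hg.
by apply: (le _ (halfspC hh) (crossesC ch)).
Qed.

Lemma gate_not_crosses x h : ~ crosses h -> h (gate C x) <-> C `<=` h.
Proof.
move=> nc; split=> [hg|]; last by apply; apply: gate_in.
move=> v Cv; apply: contrapT => hv; apply: nc; split; last by exists v.
by exists (gate C x) => //; apply: gate_in.
Qed.
End Gate.

Lemma separating u v : u <> v -> exists h, [/\ halfsp h, h u & ~ h v].
Proof.
move=> uv; have vu : v <> u by move/esym.
have [w uw dw] := qg_dist_pred G vu.
exists (side u w); split.
- by exists u, w.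
- by apply: side_l.
- by rewrite /side /=; rewrite !(dsym v) in dw *; lia.
Qed.

Lemma eq_vertex u v : (forall h, halfsp h -> h u -> h v) -> u = v.
Proof.
move=> H; apply: contrapT => /separating[h [hh hu]]; apply.
exact: H.
Qed.

Lemma gconvex_halfsp C v : gconvex C -> C !=set0 ->
  (forall h, halfsp h -> C `<=` h -> h v) -> C v.
Proof.
move=> cC C0 H; suff -> : v = gate C v by apply: gate_in.
symmetry; apply: eq_vertex => h hh hg.
by apply: contrapT => hv; exact: hv (H h hh (gate_sub cC C0 hh hg hv)).
Qed.

(** A wall separating the two gates crosses [C], hence also separates [x] from [y], and only the
    wall of the edge [xy] does. *)
Lemma gate_adj C x y : gconvex C -> C !=set0 -> adj x y -> crosses C (side x y) ->
  adj (gate C x) (gate C y) /\ side (gate C x) (gate C y) = side x y.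
Proof.
move=> cC C0 xy cr; have hs := halfsp_side xy.
have gx : side x y (gate C x) by apply/(gate_crosses cC) => //; exact: side_l.
have gy : ~ side x y (gate C y).
  by move/(gate_crosses cC C0 y hs cr); apply: side_r.
have [s [t [st hs1 ht D]]] := crossing_edge gx gy.
have Est : side x y = side s t by apply: crossing_halfsp.
have key h : halfsp h -> h (gate C x) -> ~ h (gate C y) -> h = side x y.
  move=> hh h1 h2; have ch : crosses C h.
    by split; [exists (gate C x)|exists (gate C y)] => //; apply: gate_in.
  apply: crossing_halfsp => //; first exact/(gate_crosses cC C0 x hh ch).
  by move/(gate_crosses cC C0 y hh ch).
have dst := dist_adj1 st.
have D1 : d (gate C x) s + d s (gate C y) = d (gate C x) (gate C y).
  have := dtri s t (gate C y); have := dtri (gate C x) s (gate C y); lia.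
have D2 : d (gate C x) t + d t (gate C y) = d (gate C x) (gate C y).
  have := dtri (gate C x) s t; have := dtri (gate C x) t (gate C y); lia.
have Es : gate C x = s.
  apply: eq_vertex => h hh hgx; apply: contrapT => hns.
  have hgy : ~ h (gate C y).
    by move=> hgy; apply: hns; apply: (halfsp_convex hh hgx hgy D1).
  by apply: hns; rewrite (key _ hh hgx hgy).
have Et : t = gate C y.
  apply: eq_vertex => h hh hht; apply: contrapT => hgy.
  have hgx : h (gate C x).
    apply: contrapT => hgx.
    exact: (halfsp_convex (halfspC hh) hgx hgy D2) hht.
  by apply: ht; rewrite -(key _ hh hgx hgy).
by rewrite Es -Et; split.
Qed.

Lemma finite_separating u v : exists L : seq (set V),
  forall h, halfsp h -> h u -> ~ h v -> h \in L.
Proof.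
move En: (d u v) => n; elim: n v En => [|n IH] v En.
  by exists [::] => h _; move/(qg_dist0 G): En => ->.
have uv : u <> v by move=> E; rewrite E distxx in En.
have [w vw dw] := qg_dist_pred G uv.
have [|L HL] := IH w; first by lia.
exists (side w v :: L) => h hh hu hv; rewrite inE.
have [hw|nw] := EM (h w); last by rewrite HL ?orbT.
by rewrite (crossing_halfsp hh (adj_sym vw) hw hv) eqxx.
Qed.

Lemma gate_halfsp a b x : halfsp a -> halfsp b -> (a `&` b) !=set0 -> b x ->
  b (gate a x).
Proof.
move=> ha hb [y [ay by_]] bx; apply: contrapT => nb.
have := gate_sub (halfsp_convex ha) _ (halfspC hb) nb.
by move=> /(_ _ _ y ay); apply=> //; exists y.
Qed.

(** The gate map of [a] preserves membership in every half-space that meets [a], so a common point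
    of the other half-spaces stays common when projected to [a]. *)
Lemma helly (F : seq (set V)) : F != [::] -> (forall h, h \in F -> halfsp h) ->
  (forall h k, h \in F -> k \in F -> (h `&` k) !=set0) ->
  exists v, forall h, h \in F -> h v.
Proof.
elim: F => // a F IH _ hF iF.
have ha : halfsp a by apply: hF; rewrite inE eqxx.
have [F0|F0] := eqVneq F [::].
  subst F; have [v [av _]] := iF a a (mem_head _ _) (mem_head _ _).
  by exists v => h; rewrite inE => /eqP ->.
have [||v hv] := IH F0.
- by move=> h hh; apply: hF; rewrite inE hh orbT.
- by move=> h k hh hk; apply: iF; rewrite inE ?hh ?hk orbT.
have a0 : a !=set0.
  by have [w [aw _]] := iF a a (mem_head _ _) (mem_head _ _); exists w.
exists (gate a v) => h; rewrite inE => /orP[/eqP ->|hh].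
  exact: gate_in (halfsp_convex ha) a0 v.
have hF' : h \in a :: F by rewrite inE hh orbT.
by apply: gate_halfsp => //; [exact: hF | apply: iF; rewrite ?mem_head | exact: hv].
Qed.
End Walls.

Import Order.TTheory GRing.Theory Num.Theory.
Import numFieldNormedType.Exports.

Local Open Scope ring_scope.

(** * Inequalities in the Euclidean plane *)

Section RealAux.
Variable R : realType.
Implicit Types x y u v : R.

Lemma ler_sqr_ge0 x y : 0 <= y -> x ^+ 2 <= y ^+ 2 -> x <= y.
Proof.
move=> y0 xy; rewrite leNgt; apply/negP => lt.
have : y ^+ 2 < x ^+ 2 by rewrite ltr_pXn2r// ?nnegrE; lra.
by rewrite ltNge xy.
Qed.

Lemma sqr_eq0_le x : x ^+ 2 <= 0 -> x = 0.
Proof. by move=> x0; apply/eqP; rewrite -sqrf_eq0 eq_le x0 sqr_ge0. Qed.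

Lemma plane_dot x1 y1 x2 y2 u v : 0 <= u -> 0 <= v ->
  u ^+ 2 = x1 ^+ 2 + y1 ^+ 2 -> v ^+ 2 = x2 ^+ 2 + y2 ^+ 2 ->
  x1 * x2 + y1 * y2 <= u * v.
Proof.
move=> u0 v0 eu ev; apply: ler_sqr_ge0; first exact: mulr_ge0.
rewrite exprMn eu ev -subr_ge0.
rewrite (_ : _ - _ = (x1 * y2 - x2 * y1) ^+ 2); last by lra.
exact: sqr_ge0.
Qed.

Lemma plane_triangle x1 y1 x2 y2 u v : 0 <= u -> 0 <= v ->
  u ^+ 2 = x1 ^+ 2 + y1 ^+ 2 -> v ^+ 2 = x2 ^+ 2 + y2 ^+ 2 ->
  (x1 + x2) ^+ 2 + (y1 + y2) ^+ 2 <= (u + v) ^+ 2.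
Proof.
move=> u0 v0 eu ev; have := plane_dot u0 v0 eu ev; rewrite !sqrrD eu ev; lra.
Qed.

(* sin(a+b) (1 + cos(a-b)) = (sin a + sin b) (cos a + cos b) *)
Lemma sin_sum_gt0 (k1 k2 s1 s2 : R) : s1 ^+ 2 = 1 - k1 ^+ 2 -> s2 ^+ 2 = 1 - k2 ^+ 2 ->
  0 < s1 + s2 -> 0 < k1 + k2 -> 0 < s2 * k1 + s1 * k2.
Proof.
move=> e1 e2 s0 k0.
have E : (s2 * k1 + s1 * k2) * (1 + k1 * k2 + s1 * s2) = (s1 + s2) * (k1 + k2).
  transitivity (s2 * k1 + s1 * k2 + k2 * s2 * (k1 ^+ 2 + s1 ^+ 2)
     + s1 * k1 * (k2 ^+ 2 + s2 ^+ 2)); first by lra.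
  by rewrite e1 e2; lra.
have c0 : 0 < 1 + k1 * k2 + s1 * s2.
  have e : 2 * (1 + k1 * k2 + s1 * s2) = (k1 + k2) ^+ 2 + (s1 + s2) ^+ 2.
    by rewrite !sqrrD e1 e2; lra.
  have h1 : 0 < (k1 + k2) ^+ 2 by rewrite exprn_gt0.
  have h2 : 0 < (s1 + s2) ^+ 2 by rewrite exprn_gt0.
  by lra.
by rewrite -(pmulr_lgt0 _ c0) E mulr_gt0.
Qed.

Lemma ratio01 x y : 0 < y -> 0 <= x <= y -> 0 <= x / y <= 1.
Proof.
move=> y0 /andP[x0 xy]; apply/andP; split; last by rewrite ler_pdivrMr// mul1r.
by apply: divr_ge0 => //; apply: ltW.
Qed.
End RealAux.

(** * Gluing CAT(0) sets *)

Section CatSets.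
Variables (R : realType) (X : metricType R).
Local Notation d := (@mdist R X).
Implicit Types (S A B C : set X) (x y z w c p q : X).

Lemma mdist_sym x y : d x y = d y x. Proof. exact: metric_sym. Qed.
Lemma mdist_tri x y z : d x z <= d x y + d y z. Proof. exact: metric_triangle. Qed.
Lemma mdist0 x y : d x y <= 0 -> x = y.
Proof. by move=> xy; apply: mdist_positivity; apply/eqP; rewrite eq_le xy mdist_ge0. Qed.

(** The right-hand side is Stewart's formula for the squared distance from the apex to the point at
    ratio [t] of the opposite side of a Euclidean triangle; for [t] one half this is the inequality
    of Bruhat and Tits. *)
Definition stewart x y z (t : R) w :=
  d x w ^+ 2 <= (1 - t) * d x y ^+ 2 + t * d x z ^+ 2 - t * (1 - t) * d y z ^+ 2.

(** The distance is that of [X], so [S] is in particular geodesic for it. One [w] serves all [x];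
    taking [x] to be [y] or [z] shows that [w] divides the segment in the ratio [t]. *)
Definition cat_on S := forall y z, S y -> S z -> forall t : R, 0 <= t <= 1 ->
  exists2 w, S w & forall x, S x -> stewart x y z t w.

Definition between_at y z (t : R) w :=
  d y w = t * d y z /\ d w z = (1 - t) * d y z.

Lemma between_at_sym y z t w : between_at y z t w -> between_at z y (1 - t) w.
Proof.
by case=> e1 e2; split; rewrite mdist_sym (mdist_sym z) ?e1 ?e2//; lra.
Qed.

Lemma stewart_sym x y z t w : stewart x y z t w -> stewart x z y (1 - t) w.
Proof. by rewrite /stewart (mdist_sym z y); lra. Qed.

Lemma stewart_between_at S y z t w : S y -> S z -> 0 <= t <= 1 ->
  (forall x, S x -> stewart x y z t w) -> between_at y z t w.
Proof.
move=> Sy Sz /andP[t0 t1] H.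
have D0 := mdist_ge0 y z; have t1' : 0 <= 1 - t by lra.
have h1 : d y w <= t * d y z.
  apply: ler_sqr_ge0; first exact: mulr_ge0.
  by have := H y Sy; rewrite /stewart mdistxx; lra.
have h2 : d w z <= (1 - t) * d y z.
  apply: ler_sqr_ge0; first exact: mulr_ge0.
  by have := H z Sz; rewrite /stewart mdistxx (mdist_sym z y) (mdist_sym z w); lra.
by have := mdist_tri y w z; split; lra.
Qed.

Lemma cat_between_at S : cat_on S -> forall y z, S y -> S z ->
  forall t : R, 0 <= t <= 1 -> exists2 w, S w & between_at y z t w.
Proof.
move=> cS y z Sy Sz t t01; have [w Sw H] := cS y z Sy Sz t t01.
by exists w => //; apply: stewart_between_at H.
Qed.

Lemma cat_stewart S x y z t w : cat_on S -> S x -> S y -> S z -> S w ->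
  0 <= t <= 1 -> between_at y z t w -> stewart x y z t w.
Proof.
move=> cS Sx Sy Sz Sw t01 [e1 e2]; have [w' Sw' H] := cS y z Sy Sz t t01.
suff -> : w = w' by apply: H.
apply: mdist0; have := H w Sw.
rewrite /stewart (mdist_sym w y) e1 e2 => H'.
suff -> : d w w' = 0 by [].
apply: sqr_eq0_le; apply: le_trans H' _.
by lra.
Qed.

Lemma cat_between_uniq S y z t w w' : cat_on S -> S y -> S z -> S w -> S w' ->
  0 <= t <= 1 -> between_at y z t w -> between_at y z t w' -> w = w'.
Proof.
move=> cS Sy Sz Sw Sw' t01 b1 [e1 e2].
have := cat_stewart cS Sw' Sy Sz Sw t01 b1.
rewrite /stewart (mdist_sym w' y) e1 e2 => H.
apply: mdist0; suff -> : d w w' = 0 by [].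
apply: sqr_eq0_le; rewrite mdist_sym; apply: le_trans H _.
by lra.
Qed.

(** Stewart's inequality used twice, once along each arm: the comparison angle does not increase
    when the arms are shortened. *)
Lemma cat_hinge S c x y e h p q : cat_on S -> S c -> S x -> S y -> S p -> S q ->
  0 <= e <= 1 -> 0 <= h <= 1 -> between_at c x e p -> between_at c y h q ->
  d p q ^+ 2 <= (e * d c x) ^+ 2 + (h * d c y) ^+ 2
              - e * h * (d c x ^+ 2 + d c y ^+ 2 - d x y ^+ 2).
Proof.
move=> cS Sc Sx Sy Sp Sq e01 h01 bp bq.
have h1 := cat_stewart cS Sq Sc Sx Sp e01 bp.
have h2 := cat_stewart cS Sx Sc Sy Sq h01 bq.
move: h1 h2; rewrite /stewart (mdist_sym q p) (mdist_sym q c) (mdist_sym q x).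
case: bq => -> _; rewrite (mdist_sym x c) => h1 h2.
have e0 : 0 <= e by lra.
have := ler_wpM2l e0 h2; move: h1; nra.
Qed.

(* Two unit speed germs issuing from a common point make an angle with cosine at
   least k/2. *)
Definition hinge (r k : R) (f g : R -> X) := forall a b, 0 < a <= r -> 0 < b <= r ->
  d (f a) (g b) ^+ 2 <= a ^+ 2 + b ^+ 2 - a * b * k.

Lemma hingeC r k f g : hinge r k f g -> hinge r k g f.
Proof. by move=> H a b ha hb; rewrite mdist_sym; have := H _ _ hb ha; lra. Qed.

Lemma hinge_le r r' k k' f g : r' <= r -> k' <= k -> hinge r k f g -> hinge r' k' f g.
Proof.
move=> rr kk H a b /andP[a0 ar] /andP[b0 br].
apply: le_trans (H a b _ _) _; rewrite ?a0 ?b0 ?(le_trans ar) ?(le_trans br)//.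
have : 0 <= a * b by rewrite mulr_ge0// ltW.
by nra.
Qed.

(** Twice the cosine of the comparison angle at [c], in the normalization of [hinge]. *)
Definition cosine2 c x y : R := (d c x ^+ 2 + d c y ^+ 2 - d x y ^+ 2) / (d c x * d c y).

Lemma cosine2C c x y : cosine2 c x y = cosine2 c y x.
Proof. by rewrite /cosine2 (mdist_sym x y) [d c x ^+ 2 + _]addrC [d c x * _]mulrC. Qed.

Definition germ S c x (r : R) : X :=
  xget c [set w | S w /\ between_at c x (r / d c x) w].

Lemma germP S c x r : cat_on S -> S c -> S x -> 0 < d c x -> 0 <= r <= d c x ->
  S (germ S c x r) /\ between_at c x (r / d c x) (germ S c x r).
Proof.
move=> cS Sc Sx cx /andP[r0 r1]; rewrite /germ; case: xgetP => [w _ //|no].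
have r01 : 0 <= r <= d c x by rewrite r0.
have [w Sw bw] := cat_between_at cS Sc Sx (ratio01 cx r01).
by case: (no w).
Qed.

Lemma germ_dist S c x r : cat_on S -> S c -> S x -> 0 < d c x -> 0 <= r <= d c x ->
  d c (germ S c x r) = r /\ d (germ S c x r) x = d c x - r.
Proof.
move=> cS Sc Sx cx r01; have [_ [-> ->]] := germP cS Sc Sx cx r01.
have D0 : d c x != 0 by rewrite gt_eqF.
by split; rewrite ?mulrBl ?mul1r divfK.
Qed.

Lemma germ_hinge S c x y r : cat_on S -> S c -> S x -> S y ->
  0 < d c x -> 0 < d c y -> r <= d c x -> r <= d c y ->
  hinge r (cosine2 c x y) (germ S c x) (germ S c y).
Proof.
move=> cS Sc Sx Sy cx cy rx ry a b /andP[a0 ar] /andP[b0 br].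
have a01 : 0 <= a <= d c x by rewrite ltW//= (le_trans ar).
have b01 : 0 <= b <= d c y by rewrite ltW//= (le_trans br).
have [Sp bp] := germP cS Sc Sx cx a01.
have [Sq bq] := germP cS Sc Sy cy b01.
have a1 := ratio01 cx a01; have b1 := ratio01 cy b01.
apply: le_trans (cat_hinge cS Sc Sx Sy Sp Sq a1 b1 bp bq) _.
by rewrite !divfK ?gt_eqF// /cosine2 invfM; lra.
Qed.

(* Two hinges with a common arm, whose outer arms form a geodesic, have angles
   adding up to at least a straight angle. *)
Lemma hinge_break r k1 k2 fy fx fz y z e a : 0 < r ->
  d y z = e + a -> (forall s, 0 < s <= r -> d (fy s) y <= e - s) ->
  (forall s, 0 < s <= r -> d (fz s) z <= a - s) ->
  hinge r k1 fy fx -> hinge r k2 fx fz -> k1 + k2 <= 0.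
Proof.
move=> r0 yz hy hz H1 H2; rewrite leNgt; apply/negP => k0.
(* With one arm of fixed length [r], the gain [r * b * (k1 + k2)] is linear in [b] and the error
   [2 * b ^+ 2] is quadratic; this [b] is small enough for the gain to win. *)
pose b := Num.min r (r * (k1 + k2) / 4).
have rk : 0 < r * (k1 + k2) / 4 by rewrite divr_gt0// mulr_gt0.
have b0 : 0 < b by rewrite lt_min r0.
have br : b <= r by rewrite ge_min lexx.
have bk : b <= r * (k1 + k2) / 4 by rewrite ge_min lexx orbT.
have rr : 0 < r <= r by rewrite r0 lexx.
have bb : 0 < b <= r by rewrite b0.
have h1 := H1 r b rr bb; have h2 := H2 b r bb rr.
have h3 := hy r rr; have h4 := hz r rr.
have h5 : 2 * r <= d (fy r) (fx b) + d (fx b) (fz r).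
  have := mdist_tri (fy r) (fx b) (fz r); have := mdist_tri y (fy r) z.
  have := mdist_tri (fy r) (fz r) z; rewrite (mdist_sym y (fy r)); lra.
have a1 := mdist_ge0 (fy r) (fx b); have a2 := mdist_ge0 (fx b) (fz r).
set u := d (fy r) (fx b) in h1 h5 a1 *; set v := d (fx b) (fz r) in h2 h5 a2 *.
have h6 : 4 * r ^+ 2 <= (u + v) ^+ 2.
  rewrite (_ : 4 * r ^+ 2 = (2 * r) ^+ 2); last by lra.
  by rewrite ler_pXn2r ?nnegrE//; lra.
have h7 : (u + v) ^+ 2 <= 2 * (u ^+ 2 + v ^+ 2).
  by have := sqr_ge0 (u - v); rewrite sqrrB sqrrD; lra.
have h8 : r * b * (k1 + k2) <= 2 * b ^+ 2 by nra.
have h9 : r * (k1 + k2) <= 2 * b.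
  by rewrite -(ler_pM2l b0); nra.
lra.
Qed.

(** The laws of cosines in the two comparison triangles at [c], weighted by [a] and [e] and
    added. *)
Lemma cosine2_stewart x y z c e a : 0 < e -> 0 < a -> 0 < d c x ->
  d c y = e -> d c z = a -> d y z = e + a ->
  cosine2 c y x + cosine2 c x z <= 0 -> stewart x y z (e / (e + a)) c.
Proof.
move=> e0 a0 D0 cy cz yz; rewrite /cosine2 cy cz /stewart yz.
rewrite (mdist_sym y x) (mdist_sym x c); set D := d c x in D0 *.
set Y := d x y ^+ 2; set Z := d x z ^+ 2 => H.
have n0 : 0 < e + a by lra.
pose U := (e ^+ 2 + D ^+ 2 - Y) / (e * D); pose W := (D ^+ 2 + a ^+ 2 - Z) / (D * a).
have eU : U * (e * D) = e ^+ 2 + D ^+ 2 - Y by rewrite divfK// mulf_neq0 ?gt_eqF.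
have eW : W * (D * a) = D ^+ 2 + a ^+ 2 - Z by rewrite divfK// mulf_neq0 ?gt_eqF.
have eD0 : 0 <= e * a * D by rewrite !mulr_ge0 ?ltW.
have H' : a * (e ^+ 2 + D ^+ 2 - Y) + e * (D ^+ 2 + a ^+ 2 - Z) <= 0.
  rewrite -eU -eW; have := ler_wpM2l eD0 H; rewrite mulr0 -/U -/W; lra.
set s := e / (e + a); have es : s * (e + a) = e by rewrite divfK ?gt_eqF.
have ea : (1 - s) * (e + a) = a by lra.
set n := e + a in n0 es ea *; clear cy cz yz H eD0 eU eW U W; clearbody s n; subst e a.
by rewrite -(ler_pM2r n0); lra.
Qed.

(* Adding the angles of two adjacent hinges, computed in the plane. *)
Lemma hinge_sum r fx fm fz c x c' z : 0 < r ->
  0 < d c x -> 0 < d c c' -> 0 < d c z -> d x z = d x c' + d c' z ->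
  (forall s, 0 < s <= r -> d (fx s) c <= s) ->
  (forall s, 0 < s <= r -> d (fz s) c <= s) ->
  hinge r (cosine2 c x c') fx fm -> hinge r (cosine2 c c' z) fm fz ->
  hinge r (cosine2 c x z) fx fz.
Proof.
move=> r0 b0 D0 a0 L hx hz H1 H2.
have u0 := mdist_ge0 x c'; have v0 := mdist_ge0 c' z.
have t1 := mdist_tri c x c'; have t2 := mdist_tri c c' x; have t3 := mdist_tri x c c'.
have t4 := mdist_tri c z c'; have t5 := mdist_tri c c' z; have t6 := mdist_tri z c c'.
have t7 := mdist_tri c x z; have t8 := mdist_tri c z x; have t9 := mdist_tri x c z.
rewrite (mdist_sym c' x) (mdist_sym x c) in t1 t2 t3 t7 t8 t9.
rewrite (mdist_sym z c') (mdist_sym z c) (mdist_sym z x) L in t4 t5 t6 t7 t8 t9.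
move: H1 H2; rewrite /cosine2 L.
set b := d c x in b0 t1 t2 t3 t7 t8 t9 *; set D := d c c' in D0 t1 t2 t3 t4 t5 t6 *.
set a := d c z in a0 t4 t5 t6 t7 t8 t9 *.
set u := d x c' in u0 t1 t2 t3 t7 t8 t9 *; set v := d c' z in v0 t4 t5 t6 t7 t8 t9 *.
pose k1 := (b ^+ 2 + D ^+ 2 - u ^+ 2) / (2 * b * D).
pose k2 := (D ^+ 2 + a ^+ 2 - v ^+ 2) / (2 * D * a).
pose K := (b ^+ 2 + a ^+ 2 - (u + v) ^+ 2) / (b * a).
rewrite -/K (_ : (b ^+ 2 + D ^+ 2 - u ^+ 2) / (b * D) = 2 * k1); last first.
  by rewrite /k1 !invfM; lra.
rewrite (_ : (D ^+ 2 + a ^+ 2 - v ^+ 2) / (D * a) = 2 * k2); last first.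
  by rewrite /k2 !invfM; lra.
move=> H1 H2.
have eu : u ^+ 2 = b ^+ 2 + D ^+ 2 - 2 * b * D * k1.
  have : k1 * (2 * b * D) = b ^+ 2 + D ^+ 2 - u ^+ 2.
    by rewrite divfK// !mulf_neq0 ?gt_eqF.
  lra.
have ev : v ^+ 2 = D ^+ 2 + a ^+ 2 - 2 * a * D * k2.
  have : k2 * (2 * D * a) = D ^+ 2 + a ^+ 2 - v ^+ 2.
    by rewrite divfK// !mulf_neq0 ?gt_eqF.
  lra.
have eK : (u + v) ^+ 2 = b ^+ 2 + a ^+ 2 - b * a * K.
  have : K * (b * a) = b ^+ 2 + a ^+ 2 - (u + v) ^+ 2.
    by rewrite divfK// !mulf_neq0 ?gt_eqF.
  lra.
have hb : 0 < 2 * b * D by rewrite !mulr_gt0.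
have ha : 0 < 2 * D * a by rewrite !mulr_gt0.
have k1M : k1 <= 1 by rewrite /k1 ler_pdivrMr//; nra.
have k1m : -1 <= k1 by rewrite /k1 ler_pdivlMr//; nra.
have k2M : k2 <= 1 by rewrite /k2 ler_pdivrMr//; nra.
have k2m : -1 <= k2 by rewrite /k2 ler_pdivlMr//; nra.
clear t1 t2 t3 t4 t5 t6 hb ha.
have : -2 >= K \/ u + v < a + b.
  have [uv|] := leP (a + b) (u + v); [left|by right].
  rewrite /K ler_pdivrMr ?mulr_gt0//.
  have : (a + b) ^+ 2 <= (u + v) ^+ 2 by rewrite ler_pXn2r ?nnegrE//; lra.
  by nra.
move=> hK; clear t7 t8 t9 L; clearbody K k1 k2 b D a u v.
pose s1 := Num.sqrt (1 - k1 ^+ 2); pose s2 := Num.sqrt (1 - k2 ^+ 2).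
have s10 : 0 <= s1 := sqrtr_ge0 _; have s20 : 0 <= s2 := sqrtr_ge0 _.
have es1 : s1 ^+ 2 = 1 - k1 ^+ 2 by rewrite sqr_sqrtr//; nra.
have es2 : s2 ^+ 2 = 1 - k2 ^+ 2 by rewrite sqr_sqrtr//; nra.
clearbody s1 s2.
move=> p q hp hq; have /andP[p0 pr] := hp; have /andP[q0 qr] := hq.
have w0 := mdist_ge0 (fx p) (fz q).
have ba0 : 0 < b * a by rewrite mulr_gt0.
(* Here the two angles add up to a straight angle at least. Then [u + v >= a + b], which forces
   [K <= -2], and the triangle inequality through [c] suffices. *)
have [k0|k0] := leP (k1 + k2) 0.
  have ub : b - D * k1 <= u.
    apply: ler_sqr_ge0 => //; rewrite eu.
    have : 0 <= D ^+ 2 * (1 - k1 ^+ 2) by rewrite -es1 mulr_ge0 ?sqr_ge0.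
    nra.
  have va : a - D * k2 <= v.
    apply: ler_sqr_ge0 => //; rewrite ev.
    have : 0 <= D ^+ 2 * (1 - k2 ^+ 2) by rewrite -es2 mulr_ge0 ?sqr_ge0.
    nra.
  have uv : a + b <= u + v by nra.
  have {}hK : K <= -2 by case: hK => //; lra.
  have le : d (fx p) (fz q) <= p + q.
    have := mdist_tri (fx p) c (fz q); have := hx p hp; have := hz q hq.
    rewrite (mdist_sym c (fz q)); lra.
  apply: (@le_trans _ _ ((p + q) ^+ 2)).
    by rewrite ler_pXn2r ?nnegrE//; lra.
  have : 0 <= p * q by rewrite mulr_ge0// ltW.
  by rewrite sqrrD; nra.
(* The comparison triangles are laid out on both sides of the middle arm: [c] at the origin, [c'] at
   [(D, 0)], [x] at [(b * k1, b * s1)], [z] at [(a * k2, - a * s2)]. The broken line through [c']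
   bounds the plane distance from [x] to [z], so [K] is at most twice the cosine of the sum of the
   angles. *)
have hT : K <= 2 * (k1 * k2 - s1 * s2).
  have := @plane_triangle _ (b * k1 - D) (b * s1) (D - a * k2) (a * s2) u v u0 v0.
  have -> : u ^+ 2 = (b * k1 - D) ^+ 2 + (b * s1) ^+ 2.
    by rewrite eu !exprMn sqrrB es1; lra.
  have -> : v ^+ 2 = (D - a * k2) ^+ 2 + (a * s2) ^+ 2.
    by rewrite ev !exprMn sqrrB es2; lra.
  move=> /(_ erefl erefl); rewrite eK.
  have -> : (b * k1 - D + (D - a * k2)) ^+ 2 + (b * s1 + a * s2) ^+ 2 =
     b ^+ 2 * (k1 ^+ 2 + s1 ^+ 2) + a ^+ 2 * (k2 ^+ 2 + s2 ^+ 2)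
     - b * a * (2 * (k1 * k2 - s1 * s2)) by lra.
  rewrite es1 es2 => HH; rewrite -(ler_pM2l ba0); lra.
clear eu ev eK ba0 u0 v0 b0 D0 a0 hK.
have pq0 : 0 < p * q by rewrite mulr_gt0.
apply: (@le_trans _ _ (p ^+ 2 + q ^+ 2 - p * q * (2 * (k1 * k2 - s1 * s2)))); last first.
  by rewrite lerD2l lerN2 ler_pM2l.
pose N := p * s1 + q * s2.
have N0 : 0 <= N by rewrite addr_ge0// mulr_ge0// ltW.
have ps1 : 0 <= p * s1 by rewrite mulr_ge0// ltW.
have qs2 : 0 <= q * s2 by rewrite mulr_ge0// ltW.
(* In this case both angles vanish, and [fx] coincides with the middle arm. *)
have [Nle|Npos] := leP N 0.
  have z1 : s1 = 0.
    have : p * s1 = 0 by rewrite /N in Nle; lra.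
    by move/eqP; rewrite mulf_eq0 (gt_eqF p0) => /eqP.
  have z2 : s2 = 0.
    have : q * s2 = 0 by rewrite /N in Nle; lra.
    by move/eqP; rewrite mulf_eq0 (gt_eqF q0) => /eqP.
  rewrite z1 expr0n /= in es1; rewrite z2 expr0n /= in es2.
  have e1 : k1 = 1 by nra.
  have e2 : k2 = 1 by nra.
  have hp1 := H1 p p hp hp; have hp2 := H2 p q hp hq.
  rewrite e1 in hp1; rewrite e2 in hp2.
  have d0 : d (fx p) (fm p) = 0 by apply: sqr_eq0_le; lra.
  have le : d (fx p) (fz q) <= d (fm p) (fz q).
    by have := mdist_tri (fx p) (fm p) (fz q); rewrite d0 add0r.
  apply: (@le_trans _ _ (d (fm p) (fz q) ^+ 2)).
    by rewrite ler_pXn2r ?nnegrE ?mdist_ge0.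
  by rewrite z1 z2 e1 e2; lra.
(* In the plane, the segment between the points at distances [p] and [q] on the outer arms meets the
   middle arm at distance [M] from the origin. This point divides the segment in the ratio [l], and
   [T] below is the squared length of the segment. *)
pose M := p * q * (s2 * k1 + s1 * k2) / N.
have M0 : 0 < M.
  rewrite divr_gt0// mulr_gt0//.
  apply: sin_sum_gt0 => //.
  rewrite lt_neqAle addr_ge0// andbT eq_sym; apply/eqP => E0.
  have z1 : s1 = 0 by lra.
  have z2 : s2 = 0 by lra.
  by move: Npos; rewrite /N z1 z2 !mulr0 addr0 ltxx.
have Mr : M <= r.
  rewrite ler_pdivrMr//.
  have : p * q * (s2 * k1 + s1 * k2) <= p * q * (s2 + s1).
    by rewrite ler_pM2l//; nra.
  have : p * (q * s2) <= r * (q * s2) by rewrite ler_wpM2r.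
  have : q * (p * s1) <= r * (p * s1) by rewrite ler_wpM2r.
  rewrite /N; nra.
have hM : 0 < M <= r by rewrite M0.
have h1 := H1 p M hp hM; have h2 := H2 M q hM hq.
pose T := (p * k1 - q * k2) ^+ 2 + N ^+ 2.
have T0 : 0 <= T by rewrite addr_ge0 ?sqr_ge0.
pose l := p * s1 / N.
have l0 : 0 <= l by rewrite divr_ge0.
have l1 : 0 <= 1 - l by rewrite subr_ge0 /l ler_pdivrMr// mul1r /N; lra.
have eN1 : l * N = p * s1 by rewrite divfK ?gt_eqF.
have eN2 : (1 - l) * N = q * s2 by rewrite mulrBl eN1 /N; lra.
have eM : M = (1 - l) * p * k1 + l * q * k2.
  apply: (mulIf (lt0r_neq0 Npos)); rewrite divfK ?gt_eqF//.
  transitivity ((1 - l) * N * p * k1 + l * N * q * k2); last by lra.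
  by rewrite eN1 eN2; lra.
clearbody M l.
have sT : Num.sqrt T ^+ 2 = T by rewrite sqr_sqrtr.
have g1 : d (fx p) (fm M) <= l * Num.sqrt T.
  apply: ler_sqr_ge0; first by rewrite mulr_ge0// sqrtr_ge0.
  apply: le_trans h1 _; rewrite exprMn sT le_eqVlt; apply/orP; left; apply/eqP.
  rewrite /T mulrDr -!exprMn eN1.
  rewrite (_ : l * (p * k1 - q * k2) = p * k1 - M); last by rewrite eM; lra.
  by rewrite [in RHS]exprMn es1; lra.
have g2 : d (fm M) (fz q) <= (1 - l) * Num.sqrt T.
  apply: ler_sqr_ge0; first by rewrite mulr_ge0// sqrtr_ge0.
  apply: le_trans h2 _; rewrite exprMn sT le_eqVlt; apply/orP; left; apply/eqP.
  rewrite /T mulrDr -!exprMn eN2.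
  rewrite (_ : (1 - l) * (p * k1 - q * k2) = M - q * k2); last by rewrite eM; lra.
  by rewrite [in RHS]exprMn es2; lra.
have g3 : d (fx p) (fz q) <= Num.sqrt T.
  by have := mdist_tri (fx p) (fm M) (fz q); lra.
apply: (@le_trans _ _ (Num.sqrt T ^+ 2)).
  by rewrite ler_pXn2r ?nnegrE ?sqrtr_ge0.
rewrite sT /T /N le_eqVlt; apply/orP; left; apply/eqP.
rewrite (_ : (p * k1 - q * k2) ^+ 2 + (p * s1 + q * s2) ^+ 2 =
  p ^+ 2 * (k1 ^+ 2 + s1 ^+ 2) + q ^+ 2 * (k2 ^+ 2 + s2 ^+ 2)
  - p * q * (2 * (k1 * k2 - s1 * s2))); last by lra.
by rewrite es1 es2; lra.
Qed.
End CatSets.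

Section CatGlue.
Variables (R : realType) (X : metricType R).
Local Notation d := (@mdist R X).
Implicit Types (S A B C : set X) (x y z w c p q : X).

Lemma mdistP x y : x = y \/ 0 < d x y.
Proof.
have [->|xy] := eqVneq x y; [by left|right].
by rewrite mdist_gt0.
Qed.

Lemma stewart_at y z t w : between_at y z t w -> stewart w y z t w.
Proof.
case=> e1 e2; rewrite /stewart mdistxx (mdist_sym w y) e1 e2.
by lra.
Qed.

Lemma stewart0 x y z : stewart x y z 0 y.
Proof. by rewrite /stewart; lra. Qed.

Lemma stewart1 x y z : stewart x y z 1 z.
Proof. by rewrite /stewart; lra. Qed.

Lemma stewart_const x y t : stewart x y y t y.
Proof. by rewrite /stewart mdistxx; lra. Qed.

Lemma stewart_trans x y z c w s t : 0 <= t -> d y c = s * d y z ->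
  stewart x y z s c -> stewart x y c t w -> stewart x y z (t * s) w.
Proof.
rewrite /stewart => t0 yc h1 h2; apply: le_trans h2 _; rewrite yc.
have := ler_wpM2l t0 h1; nra.
Qed.

Lemma hinge_stewart r fy fx fz x y z w : 0 < r ->
  0 < d w y -> 0 < d w z -> 0 < d w x -> d y z = d w y + d w z ->
  (forall s, 0 < s <= r -> d (fy s) y <= d w y - s) ->
  (forall s, 0 < s <= r -> d (fz s) z <= d w z - s) ->
  hinge r (cosine2 w y x) fy fx -> hinge r (cosine2 w x z) fx fz ->
  stewart x y z (d w y / (d w y + d w z)) w.
Proof.
move=> r0 e0 a0 D0 yz hy hz H1 H2.
apply: cosine2_stewart => //; exact: hinge_break r0 yz hy hz H1 H2.
Qed.

Lemma germ_near S c x r s : cat_on S -> S c -> S x -> r <= d c x -> 0 < s <= r ->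
  d (germ S c x s) x <= d c x - s.
Proof.
move=> cS Sc Sx rx /andP[s0 sr]; have sx := le_trans sr rx.
have s01 : 0 <= s <= d c x by rewrite ltW.
by have [_ ->] := germ_dist cS Sc Sx (lt_le_trans s0 sx) s01.
Qed.

Lemma germ_base S c x r s : cat_on S -> S c -> S x -> r <= d c x -> 0 < s <= r ->
  d (germ S c x s) c <= s.
Proof.
move=> cS Sc Sx rx /andP[s0 sr]; have sx := le_trans sr rx.
have s01 : 0 <= s <= d c x by rewrite ltW.
by rewrite mdist_sym; have [-> _] := germ_dist cS Sc Sx (lt_le_trans s0 sx) s01.
Qed.

Lemma hinge_ext r k (f f' g : R -> X) : (forall s, 0 < s <= r -> f s = f' s) ->
  hinge r k f g -> hinge r k f' g.
Proof. by move=> E H a b ha hb; rewrite -E//; apply: H. Qed.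

Lemma ratio_add (e a : R) : 0 < e + a -> exists s,
  [/\ e / (e + a) = s, e = s * (e + a) & a = (1 - s) * (e + a)].
Proof.
move=> n0; exists (e / (e + a)); have E : e / (e + a) * (e + a) = e.
  by rewrite divfK ?gt_eqF.
by split=> //; rewrite mulrBl E; lra.
Qed.

Lemma between_ratio y z c : 0 < d y c + d c z -> d y z = d y c + d c z ->
  between_at y z (d y c / (d y c + d c z)) c.
Proof.
move=> n0 D; rewrite /between_at D.
by have [s [-> h1 h2]] := ratio_add n0; split.
Qed.

Section Glue.
Variables A B : set X.
Hypotheses (cA : cat_on A) (cB : cat_on B).
Hypothesis cross : forall a b, A a -> B b ->
  exists c, [/\ A c, B c & d a b = d a c + d c b].
Hypothesis conv : forall c c' (t : R), A c -> B c -> A c' -> B c' -> 0 <= t <= 1 ->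
  exists m, [/\ A m, B m & between_at c c' t m].

Lemma germ_cap c c' r : A c -> B c -> A c' -> B c' -> 0 < r <= d c c' ->
  germ A c c' r = germ B c c' r.
Proof.
move=> Ac Bc Ac' Bc' /andP[r0 rD].
have D0 := lt_le_trans r0 rD.
have r01 : 0 <= r <= d c c' by rewrite ltW.
have [m [Am Bm bm]] := conv Ac Bc Ac' Bc' (ratio01 D0 r01).
have [SA bA] := germP cA Ac Ac' D0 r01; have [SB bB] := germP cB Bc Bc' D0 r01.
rewrite (cat_between_uniq cA Ac Ac' SA Am (ratio01 D0 r01) bA bm).
exact: cat_between_uniq cB Bc Bc' Bm SB (ratio01 D0 r01) bm bB.
Qed.

(** The geodesic from [x] to [z] meets the intersection in some [c']. The angle at [c] splits into
    one inside [A] and one inside [B], which share the germ towards [c'] and are added by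
    [hinge_sum]; for [c' = c] the angle is straight. *)
Lemma hinge_across c x z : A c -> B c -> A x -> B z -> 0 < d c x -> 0 < d c z ->
  exists2 r, 0 < r & hinge r (cosine2 c x z) (germ A c x) (germ B c z).
Proof.
move=> Ac Bc Ax Bz x0 z0; have [c' [Ac' Bc' D]] := cross Ax Bz.
have [cc'|c'0] := mdistP c c'.
  subst c'; exists (Num.min (d c x) (d c z)); first by rewrite lt_min x0.
  have rx : Num.min (d c x) (d c z) <= d c x by rewrite ge_min lexx.
  have rz : Num.min (d c x) (d c z) <= d c z by rewrite ge_min lexx orbT.
  move=> a b ha hb; rewrite /cosine2 D (mdist_sym x c).
  have h1 := germ_base cA Ac Ax rx ha; have h2 := germ_base cB Bc Bz rz hb.
  have h3 := mdist_tri (germ A c x a) c (germ B c z b).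
  rewrite (mdist_sym c (germ B c z b)) in h3.
  have xz0 : d c x * d c z != 0 by rewrite mulf_neq0 ?gt_eqF.
  rewrite (_ : _ / _ = - 2); last by apply: (mulIf xz0); rewrite divfK//; lra.
  apply: (@le_trans _ _ ((a + b) ^+ 2)); last by rewrite sqrrD; lra.
  by rewrite ler_pXn2r ?nnegrE ?mdist_ge0//; have := mdist_ge0 (germ A c x a) c; lra.
pose r := Num.min (d c c') (Num.min (d c x) (d c z)).
have r0 : 0 < r by rewrite !lt_min c'0 x0.
have rc : r <= d c c' by rewrite ge_min lexx.
have rx : r <= d c x by rewrite !ge_min lexx orbT.
have rz : r <= d c z by rewrite !ge_min lexx !orbT.
exists r => //.
apply: (@hinge_sum _ _ r _ (germ A c c') _ c x c' z) => //.
- by move=> s; apply: germ_base.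
- by move=> s; apply: germ_base.
- exact: germ_hinge.
- apply: hinge_ext (germ_hinge cB Bc Bc' Bz c'0 z0 rc rz) => s /andP[s0 sr].
  by rewrite germ_cap// s0 (le_trans sr).
Qed.

(** Stewart's inequality for the apex [z] and the side from [w] to [x], cut at [c], says that the
    comparison angle at [w] does not shrink when [c] is replaced by [x]. So the hinge towards [c],
    inside [B], obeys the bound computed with [x]. *)
Lemma hinge_behind w z x c : B w -> B z -> A x -> A c -> B c ->
  d w x = d w c + d c x -> 0 < d w c -> 0 < d w z ->
  exists2 r, 0 < r & hinge r (cosine2 w z x) (germ B w z) (germ B w c).
Proof.
move=> Bw Bz Ax Ac Bc D c0 z0.
have St : stewart z w x (d c w / (d c w + d c x)) c.
  have cw0 : 0 < d c w by rewrite mdist_sym.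
  have [cx|x0] := mdistP c x.
    by subst x; rewrite mdistxx addr0 divff ?lt0r_neq0//; apply: stewart1.
  have [cz|cz0] := mdistP c z.
    subst z; apply: stewart_at; rewrite (mdist_sym c w).
    by apply: between_ratio; rewrite ?D//; lra.
  have [r1 r10 H1] := hinge_across Ac Bc Ax Bz x0 cz0.
  pose r := Num.min r1 (Num.min (d c w) (Num.min (d c z) (d c x))).
  have r0 : 0 < r by rewrite !lt_min r10 cw0 cz0.
  have rr1 : r <= r1 by rewrite ge_min lexx.
  have rw : r <= d c w by rewrite !ge_min lexx !orbT.
  have rz : r <= d c z by rewrite !ge_min lexx !orbT.
  have rx : r <= d c x by rewrite !ge_min lexx !orbT.
  apply: (@hinge_stewart r (germ B c w) (germ B c z) (germ A c x)) => //.
  - by rewrite D (mdist_sym w c).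
  - by move=> s; apply: germ_near.
  - by move=> s; apply: germ_near.
  - exact: germ_hinge.
  - apply: hingeC; rewrite cosine2C; exact: hinge_le rr1 _ H1.
pose r := Num.min (d w z) (d w c).
have r0 : 0 < r by rewrite lt_min z0.
have rz : r <= d w z by rewrite ge_min lexx.
have rc : r <= d w c by rewrite ge_min lexx orbT.
exists r => //.
apply: (hinge_le (lexx r) _ (germ_hinge cB Bw Bz Bc z0 c0 rz rc)).
move: St; rewrite /stewart /cosine2 D (mdist_sym c w) (mdist_sym z w).
have a0 := mdist_ge0 c x.
set e := d w c in c0 *; set a := d c x in a0 *; set f := d w z in z0 *.
have n0 : 0 < e + a by lra.
have [s [-> h1 h2]] := ratio_add n0; set n := e + a in n0 h1 h2 *.
move=> St; rewrite ler_pdivrMr ?mulr_gt0// mulrAC ler_pdivlMr ?mulr_gt0//.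
clear rc; clearbody e a n f; clear r r0 rz; subst e a.
have fn0 : 0 <= f * n by rewrite mulr_ge0 ?ltW.
have := ler_wpM2l fn0 St; lra.
Qed.

(** At an interior point [w] the germs towards [y] and [z] are opposite, so by [hinge_break] their
    angles with the germ towards [x] add up to a straight angle at least, which amounts to Stewart's
    inequality. If the geodesic to [x] leaves [B] at a point [c] other than [w], the germ is taken
    towards [c]. *)
Lemma stewart_far x y z w t : A x -> B y -> B z -> B w -> 0 <= t <= 1 ->
  between_at y z t w -> stewart x y z t w.
Proof.
move=> Ax By Bz Bw t01 bw; have [e1 e2] := bw.
have [yz|D0] := mdistP y z.
  subst z; rewrite mdistxx !mulr0 in e1 e2.
  have -> : w = y by apply: mdist0; rewrite e2.
  exact: stewart_const.
have [wy|y0] := mdistP w y.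
  subst w; rewrite mdistxx in e1.
  have -> : t = 0 by apply/eqP; move/esym/eqP: e1; rewrite mulf_eq0 (gt_eqF D0) orbF.
  exact: stewart0.
have [wz|z0] := mdistP w z.
  subst w; rewrite mdistxx in e2.
  have -> : t = 1.
    by apply/eqP; move/esym/eqP: e2; rewrite mulf_eq0 (gt_eqF D0) orbF subr_eq0 eq_sym.
  exact: stewart1.
have [wx|x0] := mdistP w x; first by subst x; apply: stewart_at.
have -> : t = d w y / (d w y + d w z).
  rewrite (mdist_sym w y) e1 e2 (_ : t * _ + _ = d y z); last by lra.
  by rewrite mulfK ?gt_eqF.
have D : d y z = d w y + d w z by rewrite (mdist_sym w y) e1 e2; lra.
have [c [Ac Bc Dx]] := cross Ax Bw.
have [wc|c0] := mdistP w c.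
  subst c; have [r1 r10 H1] := hinge_across Ac Bc Ax By x0 y0.
  have [r2 r20 H2] := hinge_across Ac Bc Ax Bz x0 z0.
  pose r := Num.min (Num.min r1 r2) (Num.min (d w y) (d w z)).
  have r0 : 0 < r by rewrite !lt_min r10 r20 y0.
  have rr1 : r <= r1 by rewrite !ge_min lexx.
  have rr2 : r <= r2 by rewrite !ge_min lexx !orbT.
  have ry : r <= d w y by rewrite !ge_min lexx !orbT.
  have rz : r <= d w z by rewrite !ge_min lexx !orbT.
  apply: (@hinge_stewart r (germ B w y) (germ A w x) (germ B w z)) => //.
  - by move=> s; apply: germ_near.
  - by move=> s; apply: germ_near.
  - by apply: hingeC; rewrite cosine2C; apply: hinge_le H1.
  - exact: hinge_le H2.
have Dw : d w x = d w c + d c x by rewrite (mdist_sym w x) Dx (mdist_sym x c) (mdist_sym c w) addrC.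
have [r1 r10 H1] := hinge_behind Bw By Ax Ac Bc Dw c0 y0.
have [r2 r20 H2] := hinge_behind Bw Bz Ax Ac Bc Dw c0 z0.
pose r := Num.min (Num.min r1 r2) (Num.min (d w y) (d w z)).
have r0 : 0 < r by rewrite !lt_min r10 r20 y0.
have rr1 : r <= r1 by rewrite !ge_min lexx.
have rr2 : r <= r2 by rewrite !ge_min lexx !orbT.
have ry : r <= d w y by rewrite !ge_min lexx !orbT.
have rz : r <= d w z by rewrite !ge_min lexx !orbT.
apply: (@hinge_stewart r (germ B w y) (germ B w c) (germ B w z)) => //.
- by move=> s; apply: germ_near.
- by move=> s; apply: germ_near.
- exact: hinge_le H1.
- by apply: hingeC; rewrite cosine2C; apply: hinge_le H2.
Qed.

Lemma stewart_crossing x y z c : A x -> A y -> B z -> A c -> B c ->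
  0 < d y z -> d y z = d y c + d c z -> stewart x y z (d y c / d y z) c.
Proof.
move=> Ax Ay Bz Ac Bc D0 D.
have [yc|y0] := mdistP c y.
  by subst y; rewrite mdistxx mul0r; apply: stewart0.
have [cz|z0] := mdistP c z.
  by subst z; rewrite divff ?lt0r_neq0//; apply: stewart1.
rewrite {1}D (mdist_sym y c).
have [cx|x0] := mdistP c x.
  subst x; apply: stewart_at; rewrite (mdist_sym c y).
  by apply: between_ratio; rewrite ?D//; lra.
have [r1 r10 H1] := hinge_across Ac Bc Ax Bz x0 z0.
pose r := Num.min r1 (Num.min (d c y) (Num.min (d c z) (d c x))).
have r0 : 0 < r by rewrite !lt_min r10 y0 z0.
have rr1 : r <= r1 by rewrite ge_min lexx.
have ry : r <= d c y by rewrite !ge_min lexx !orbT.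
have rz : r <= d c z by rewrite !ge_min lexx !orbT.
have rx : r <= d c x by rewrite !ge_min lexx !orbT.
apply: (@hinge_stewart r (germ A c y) (germ A c x) (germ B c z)) => //.
- by rewrite D (mdist_sym y c).
- by move=> s; apply: germ_near.
- by move=> s; apply: germ_near.
- exact: germ_hinge.
- exact: hinge_le H1.
Qed.

Lemma stewart_mixed x y z c w t : A x -> A y -> B z -> A c -> B c ->
  0 < d y z -> d y z = d y c + d c z -> 0 <= t <= 1 ->
  (A w /\ between_at y c t w -> stewart x y z (t * (d y c / d y z)) w) /\
  (B w /\ between_at z c t w -> stewart x z y (t * (d z c / d y z)) w).
Proof.
move=> Ax Ay Bz Ac Bc D0 D t01; have /andP[t0 t1] := t01.
have St := stewart_crossing Ax Ay Bz Ac Bc D0 D.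
split=> -[Sw bw].
  apply: (stewart_trans t0 _ St); first by rewrite divfK ?gt_eqF.
  exact: cat_stewart cA Ax Ay Ac Sw t01 bw.
apply: (@stewart_trans _ _ _ c _ _ _ t0).
- by rewrite (mdist_sym z y) divfK ?gt_eqF.
- rewrite (_ : d z c / d y z = 1 - d y c / d y z); first exact: stewart_sym.
  apply: (mulIf (lt0r_neq0 D0)); rewrite mulrBl !divfK ?gt_eqF//.
  by rewrite D (mdist_sym z c); lra.
exact: stewart_far.
Qed.
End Glue.

(** Reshetnyak's gluing theorem for two subsets of one space. A geodesic from [A] to [B] is
    assembled at its crossing point [c]; Stewart's inequality holds at [c] by addition of angles and
    is interpolated on either side by [stewart_trans]. *)
Theorem cat_glue A B : cat_on A -> cat_on B ->
  (forall a b, A a -> B b -> exists c, [/\ A c, B c & d a b = d a c + d c b]) ->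
  (forall c c' (t : R), A c -> B c -> A c' -> B c' -> 0 <= t <= 1 ->
    exists m, [/\ A m, B m & between_at c c' t m]) ->
  cat_on (A `|` B).
Proof.
move=> cA cB cross conv.
have cross' b a : B b -> A a -> exists c, [/\ B c, A c & d b a = d b c + d c a].
  move=> Bb Aa; have [c [Ac Bc D]] := cross a b Aa Bb; exists c; split=> //.
  by rewrite mdist_sym D addrC (mdist_sym a c) (mdist_sym c b).
have conv' c c' (t : R) : B c -> A c -> B c' -> A c' -> 0 <= t <= 1 ->
    exists m, [/\ B m, A m & between_at c c' t m].
  move=> Bc Ac Bc' Ac' t01; have [m [Am Bm bm]] := conv c c' t Ac Bc Ac' Bc' t01.
  by exists m.
have mixed y z : A y -> B z -> forall t : R, 0 <= t <= 1 ->
    exists2 w, (A `|` B) w & forall x, (A `|` B) x -> stewart x y z t w.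
  move=> Ay Bz t t01; have /andP[t0 t1] := t01.
  have [yz|D0] := mdistP y z.
    by subst z; exists y; [left|move=> x _; apply: stewart_const].
  have [c [Ac Bc D]] := cross y z Ay Bz.
  have D' : d z y = d z c + d c y.
    by rewrite mdist_sym D addrC (mdist_sym y c) (mdist_sym c z).
  have D0' : 0 < d z y by rewrite mdist_sym.
  have yc0 := mdist_ge0 y c; have cz0 := mdist_ge0 c z.
  have [le|lt] := leP (t * d y z) (d y c).
    have [yc|y0] := mdistP y c.
      have t00 : t = 0.
        move: le; rewrite -yc mdistxx pmulr_lle0// => le0; lra.
      by subst t; exists y; [left|move=> x _; apply: stewart0].
    pose s := t * d y z / d y c.
    have s01 : 0 <= s <= 1 by apply: ratio01 => //; rewrite mulr_ge0// ltW.
    have [w Aw bw] := cat_between_at cA Ay Ac s01.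
    exists w; [by left|move=> x [Ax|Bx]].
      have [/(_ (conj Aw bw)) H _] := @stewart_mixed A B cA cB cross conv x y z c w s Ax Ay Bz Ac Bc D0 D s01.
      by move: H; rewrite (_ : s * _ = t)// /s mulrA divfK ?gt_eqF// mulfK ?gt_eqF.
    have [_ /(_ (conj Aw bw)) H] := @stewart_mixed B A cB cA cross' conv' x z y c w s Bx Bz Ay Bc Ac D0' D' s01.
    by move: H; rewrite (_ : s * _ = t)// /s (mdist_sym z y) mulrA divfK ?gt_eqF// mulfK ?gt_eqF.
  have [zc|z0] := mdistP z c.
    by subst c; move: lt; rewrite ltNge => /negP[]; rewrite ler_piMl// ltW.
  pose s := (1 - t) * d y z / d z c.
  have s01 : 0 <= s <= 1.
    apply: ratio01 => //; rewrite mulr_ge0 ?subr_ge0 ?(ltW D0)//=.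
    by rewrite (mdist_sym z c); lra.
  have [w Bw bw] := cat_between_at cB Bz Bc s01.
  have es : s * (d z c / d y z) = 1 - t.
    by rewrite /s mulrA divfK ?gt_eqF// mulfK ?gt_eqF.
  exists w; [by right|move=> x Sx]; rewrite (_ : t = 1 - (1 - t)); last by lra.
  apply: stewart_sym; case: Sx => [Ax|Bx].
    have [_ /(_ (conj Bw bw)) H] := @stewart_mixed A B cA cB cross conv x y z c w s Ax Ay Bz Ac Bc D0 D s01.
    by move: H; rewrite es.
  have [/(_ (conj Bw bw)) H _] := @stewart_mixed B A cB cA cross' conv' x z y c w s Bx Bz Ay Bc Ac D0' D' s01.
  by move: H; rewrite (mdist_sym z y) es.
move=> y z [Ay|By] [Az|Bz] t t01.
- have [w Aw bw] := cat_between_at cA Ay Az t01; exists w; [by left|move=> x [Ax|Bx]].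
    exact: cat_stewart cA Ax Ay Az Aw t01 bw.
  exact: (@stewart_far B A cB cA cross' conv' x y z w t Bx Ay Az Aw t01 bw).
- exact: mixed.
- have t01' : 0 <= 1 - t <= 1 by lra.
  have [w Sw H] := mixed z y Az By (1 - t) t01'; exists w => // x Sx.
  by rewrite (_ : t = 1 - (1 - t)); [apply: stewart_sym; exact: H|lra].
- have [w Bw bw] := cat_between_at cB By Bz t01; exists w; [by right|move=> x [Ax|Bx]].
    exact: (@stewart_far A B cA cB cross conv x y z w t Ax By Bz Bw t01 bw).
  exact: cat_stewart cB Bx By Bz Bw t01 bw.
Qed.
End CatGlue.

(** * Rays of steepest descent *)

Section SteepestRay.
Variables (R : realType) (X : metricType R).
Local Notation d := (@mdist R X).
Implicit Types (x y z w p q : X) (r s t e : R).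
Hypothesis catX : cat_on [set: X].

Lemma busemann_vertex x y z t p q : 0 <= t <= 1 ->
  between_at x y t p -> between_at x z t q -> d p q <= t * d y z.
Proof.
move=> t01 bp bq; apply: ler_sqr_ge0.
  by rewrite mulr_ge0 ?mdist_ge0//; case/andP: t01.
have := @cat_hinge _ _ setT x y z t t p q catX I I I I I t01 t01 bp bq.
by rewrite exprMn; lra.
Qed.

Lemma busemann y z y' z' t p q : 0 <= t <= 1 ->
  between_at y z t p -> between_at y' z' t q ->
  d p q <= (1 - t) * d y y' + t * d z z'.
Proof.
move=> t01 bp bq; have t01' : 0 <= 1 - t <= 1 by lra.
have [m _ bm] := cat_between_at catX (I : setT y) (I : setT z') t01.
have h1 := busemann_vertex t01 bp bm.
have h2 := busemann_vertex t01' (between_at_sym bm) (between_at_sym bq).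
by have := mdist_tri p m q; lra.
Qed.

Lemma between_at_trans y z c w s t : 0 <= s <= 1 -> 0 <= t <= 1 ->
  between_at y z s c -> between_at y c t w -> between_at y z (t * s) w.
Proof.
move=> s01 t01 [e1 e2] [e3 e4].
have yw : d y w = t * s * d y z by rewrite e3 e1; lra.
split=> //; have h1 := mdist_tri w c z; have h2 := mdist_tri y w z.
by move: h1 h2; rewrite e4 e2 e1 yw => h1 h2; lra.
Qed.

Lemma between_uniq y z t w w' : 0 <= t <= 1 -> between_at y z t w ->
  between_at y z t w' -> w = w'.
Proof. by move=> t01; apply: (@cat_between_uniq _ _ setT). Qed.

Hypothesis complete : forall u : nat -> X,
  (forall e : R, 0 < e -> exists n : nat, forall i j, (n <= i)%N -> (n <= j)%N ->
     d (u i) (u j) < e) ->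
  exists l, forall e : R, 0 < e -> exists n : nat, forall i, (n <= i)%N ->
    d (u i) l < e.

Variables (f : X -> R) (o : X) (N : R).
Hypothesis f_lip : forall x y, f x <= f y + d x y.
Hypothesis f_convex : forall y z (t : R) w, 0 <= t <= 1 -> between_at y z t w ->
  f w <= (1 - t) * f y + t * f z.
Hypothesis f_base : f o = 0.
Hypothesis N_gt0 : 0 < N.
Hypothesis f_descent : forall n : nat, exists2 x, d o x <= N * n%:R & f x <= - n%:R.

(** By convexity the largest descent within distance [r] of [o], divided by [r], does not increase
    with [r]; [best_rate] is its limit at infinity. *)
Definition descent_rate (l : R) :=
  forall r, 0 < r -> exists2 x, d o x <= r & l * r <= - f x.

Lemma descent_rate_exists : descent_rate N^-1.
Proof.
move=> r r0; have rN : 0 <= r / N by rewrite divr_ge0 // ltW.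
set n := Num.bound (r / N); have nr : r / N < n%:R by apply: archi_boundP.
have n0 : 0 < n%:R :> R by apply: le_lt_trans nr.
have [x dx fx] := f_descent n.
have Nn0 : N * n%:R != 0 by rewrite mulf_neq0 ?gt_eqF.
have t01 : 0 <= r / (N * n%:R) <= 1.
  by apply: ratio01; rewrite ?mulr_gt0// (ltW r0)//= mulrC -ler_pdivrMr// ltW.
have [y _ byx] := cat_between_at catX (I : setT o) (I : setT x) t01.
have /andP[t0 t1] := t01; exists y.
  have [-> _] := byx; apply: le_trans (ler_wpM2l t0 dx) _.
  by rewrite divfK.
have := f_convex t01 byx; rewrite f_base mulr0 add0r => h.
have h2 := ler_wpM2l t0 fx.
suff -> : N^-1 * r = r / (N * n%:R) * n%:R by lra.
by apply: (mulIf Nn0); rewrite [RHS]mulrAC divfK// mulrACA mulVf ?gt_eqF// mul1r.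
Qed.

Lemma descent_rate_le1 l : descent_rate l -> l <= 1.
Proof.
move=> /(_ 1 ltr01)[x dx fx]; have := f_lip o x; rewrite f_base; lra.
Qed.

Definition best_rate := sup [set l | descent_rate l].

Let has_sup_rate : has_sup [set l | descent_rate l].
Proof.
split; first by exists N^-1; apply: descent_rate_exists.
by exists 1 => l; apply: descent_rate_le1.
Qed.

Lemma best_rate_gt0 : 0 < best_rate.
Proof.
apply: (@lt_le_trans _ _ N^-1); first by rewrite invr_gt0.
by apply: ub_le_sup; [case: has_sup_rate|exact: descent_rate_exists].
Qed.

Lemma descent_rate_below l : l < best_rate -> descent_rate l.
Proof.
move=> lt r r0; have e0 : 0 < best_rate - l by lra.
have [l' hl'] := sup_adherent e0 has_sup_rate.
rewrite -/best_rate => lt'; have [x dx fx] := hl' r r0; exists x => //.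
apply: le_trans fx; apply: ler_wpM2r; lra.
Qed.

(** A rate above the best one fails at some radius [r], and convexity along the segment from [o]
    carries the failure to all points beyond. *)
Lemma descent_bound e : 0 < e ->
  exists2 r, 0 < r & forall x, - f x <= (best_rate + e) * Num.max (d o x) r.
Proof.
move=> e0; have no : ~ descent_rate (best_rate + e).
  move=> h; have : best_rate + e <= best_rate.
    by apply: ub_le_sup; [case: has_sup_rate|].
  lra.
have L0 := best_rate_gt0.
have [r [r0 hr]] : exists r, 0 < r /\
    forall x, d o x <= r -> - f x < (best_rate + e) * r.
  apply: contrapT => no'; apply: no => r r0; apply: contrapT => no''.
  apply: no'; exists r; split=> // x dx; rewrite ltNge; apply/negP => le.
  by apply: no''; exists x.
exists r => // x; have [le|lt] := leP (d o x) r; first by rewrite ltW// hr.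
have D0 : 0 < d o x by lra.
have t01 : 0 <= r / d o x <= 1 by apply: ratio01; rewrite ?(ltW r0) ?(ltW lt).
have [y _ byx] := cat_between_at catX (I : setT o) (I : setT x) t01.
have dy : d o y <= r by have [-> _] := byx; rewrite divfK// gt_eqF.
have := hr y dy; have := f_convex t01 byx; rewrite f_base mulr0 add0r => h1 h2.
have h3 : r / d o x * - f x <= (best_rate + e) * r by lra.
rewrite -(ler_pM2l r0).
have : d o x * (r / d o x * - f x) <= d o x * ((best_rate + e) * r).
  by rewrite ler_pM2l.
by rewrite mulrA mulrA [d o x * r]mulrC mulfK ?gt_eqF//; lra.
Qed.

(* Uniform convexity of balls in a CAT(0) space. *)
Lemma descent_cluster (eta : R) : 0 < eta ->
  exists k r0 : R, [/\ 0 < k, 0 < r0 & forall r y z, r0 <= r ->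
    d o y <= r * (1 + k) -> d o z <= r * (1 + k) ->
    (best_rate - k) * r <= - f y -> (best_rate - k) * r <= - f z ->
    d y z <= eta * r].
Proof.
move=> eta0; have L0 := best_rate_gt0; set L := best_rate in L0 *.
(* The estimate at the midpoint below is [d y z ^+ 2 <= 4 * r ^+ 2 * ((1 + k) ^+ 2 - th ^+ 2)],
   whose last factor is at most [3 * k + 4 * k / L]; the requirement is thus [k * C <= eta ^+ 2]. *)
pose C := 4 * (3 + 4 / L).
have C0 : 0 < C by rewrite mulr_gt0// addr_gt0// divr_gt0.
pose k := Num.min 1 (Num.min (L / 2) (eta ^+ 2 / C)).
have k0 : 0 < k by rewrite !lt_min ltr01 !divr_gt0// exprn_gt0.
have k1 : k <= 1 by rewrite ge_min lexx.
have kL : k <= L / 2 by rewrite !ge_min lexx orbT.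
have kC : k * C <= eta ^+ 2 by rewrite -ler_pdivlMr// !ge_min lexx !orbT.
have [rk rk0 hk] := descent_bound k0; rewrite -/L in hk.
exists k, (rk * (L + k) / (L - k) + 1); split=> //.
  by rewrite addr_gt0// divr_gt0 ?mulr_gt0//; lra.
move=> r y z hr dy dz fy fz; clearbody k.
have Lk : 0 < L - k by lra.
have rr : rk * (L + k) < (L - k) * r.
  by rewrite [ltRHS]mulrC -ltr_pdivrMr//; lra.
have r0 : 0 < r.
  have : 0 <= rk * (L + k) / (L - k) by rewrite divr_ge0 ?mulr_ge0//; lra.
  lra.
have h01 : 0 <= (2^-1 : R) <= 1 by lra.
have [w _ bw] := cat_between_at catX (I : setT y) (I : setT z) h01.
have fw := f_convex h01 bw.
have St := cat_stewart catX (I : setT o) (I : setT y) (I : setT z) (I : setT w) h01 bw.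
have hw := hk w.
have hD : (L - k) * r <= (L + k) * d o w.
  have [le|lt] := leP (d o w) rk.
    by rewrite max_r// in hw; lra.
  by rewrite max_l ?(ltW lt)// in hw; lra.
have D0 := mdist_ge0 o w.
have y2 : d o y ^+ 2 <= (r * (1 + k)) ^+ 2.
  by rewrite ler_pXn2r ?nnegrE ?mdist_ge0// mulr_ge0; lra.
have z2 : d o z ^+ 2 <= (r * (1 + k)) ^+ 2.
  by rewrite ler_pXn2r ?nnegrE ?mdist_ge0// mulr_ge0; lra.
pose th := (L - k) / (L + k).
have th0 : 0 <= th by rewrite divr_ge0; lra.
have th1 : 1 - 2 * k / L <= th.
  rewrite /th ler_pdivlMr; last by lra.
  have : 0 <= k / L by rewrite divr_ge0; lra.
  have -> : (1 - 2 * k / L) * (L + k) = L - k - 2 * k * (k / L).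
    have : k / L * L = k by rewrite divfK ?gt_eqF.
    lra.
  by nra.
have th2 : 1 - 4 * k / L <= th ^+ 2.
  have kl0 : 0 <= 1 - 2 * k / L.
    by rewrite subr_ge0 ler_pdivrMr// mul1r; lra.
  apply: (@le_trans _ _ ((1 - 2 * k / L) ^+ 2)).
    rewrite -subr_ge0 (_ : _ - _ = (2 * k / L) ^+ 2); last by lra.
    exact: sqr_ge0.
  by rewrite ler_pXn2r ?nnegrE.
have Dth : th * r <= d o w.
  have -> : th * r = (L - k) * r / (L + k) by rewrite /th; lra.
  by rewrite ler_pdivrMr ?[d o w * _]mulrC//; lra.
clearbody th.
have D2 : (th * r) ^+ 2 <= d o w ^+ 2 by rewrite ler_pXn2r ?nnegrE// mulr_ge0// ltW.
apply: ler_sqr_ge0; first by rewrite mulr_ge0// ltW.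
have h4 : d y z ^+ 2 <= 4 * (r * (1 + k)) ^+ 2 - 4 * (th * r) ^+ 2.
  move: St; rewrite /stewart => St; lra.
apply: le_trans h4 _.
have r2 : 0 <= r ^+ 2 by rewrite sqr_ge0.
have -> : 4 * (r * (1 + k)) ^+ 2 - 4 * (th * r) ^+ 2 =
  r ^+ 2 * (4 * ((1 + k) ^+ 2 - th ^+ 2)) by lra.
rewrite exprMn [eta ^+ 2 * _]mulrC; apply: ler_wpM2l => //.
apply: le_trans kC; rewrite /C.
have -> : k * (4 * (3 + 4 / L)) = 4 * (3 * k + 4 * k / L) by lra.
have : (1 + k) ^+ 2 <= 1 + 3 * k by nra.
lra.
Qed.

Lemma descent_sequence : exists x : nat -> X, forall n,
  d o (x n) <= n.+1%:R /\ best_rate * n.+1%:R - 1 <= - f (x n).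
Proof.
suff H (n : nat) : exists x, d o x <= n.+1%:R /\
    best_rate * n.+1%:R - 1 <= - f x.
  by have [x hx] := choice H; exists x.
have n0 : 0 < n.+1%:R :> R by [].
have lt : best_rate - n.+1%:R^-1 < best_rate.
  by rewrite ltrBlDr ltrDl invr_gt0.
have [x dx fx] := descent_rate_below lt n0; exists x; split=> //.
by move: fx; rewrite mulrBl mulVf ?gt_eqF.
Qed.

Section Limit.
Variable x : nat -> X.
Hypothesis x_dist : forall n, d o (x n) <= n.+1%:R.
Hypothesis x_desc : forall n, best_rate * n.+1%:R - 1 <= - f (x n).

Definition segment_pt n (t : R) : X :=
  xget o [set w | between_at o (x n) (t / n.+1%:R) w].

Lemma segment_ptP n t : 0 <= t <= n.+1%:R ->
  between_at o (x n) (t / n.+1%:R) (segment_pt n t).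
Proof.
move=> t01; rewrite /segment_pt; case: xgetP => [w _ //|no].
have [w _ bw] := cat_between_at catX (I : setT o) (I : setT (x n))
  (ratio01 (ltr0Sn R n) t01).
by case: (no w).
Qed.

Lemma large_nat (r : R) : exists n0, forall n, (n0 <= n)%N -> r <= n.+1%:R.
Proof.
exists (Num.bound (Num.max r 0)) => n le.
have : Num.max r 0 < (Num.bound (Num.max r 0))%:R.
  by apply: archi_boundP; rewrite le_max lexx orbT.
move=> lt; apply: (@le_trans _ _ (Num.max r 0)); first by rewrite le_max lexx.
by apply: (le_trans (ltW lt)); rewrite ler_nat leqW.
Qed.

(** The point of the [m]-th segment at the scale of [n] belongs to the same cluster as [x n], and
    two segments issuing from [o] diverge at most linearly up to there. *)
Lemma segment_pt_near (eta : R) : 0 < eta -> exists n0 : nat, forall (n m : nat) (t : R),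
  (n0 <= n)%N -> (n <= m)%N -> 0 <= t <= n.+1%:R ->
  d (segment_pt n t) (segment_pt m t) <= t * eta.
Proof.
move=> eta0; have [k [r0 [k0 r00 H]]] := descent_cluster eta0.
have [n1 h1] := large_nat r0; have [n2 h2] := large_nat k^-1.
exists (maxn n1 n2) => n m t; rewrite geq_max => /andP[le1 le2] nm t01.
have {}h1 := h1 n le1; have {}h2 := h2 n le2.
have n0 : 0 < n.+1%:R :> R by []; have m0 : 0 < m.+1%:R :> R by [].
have nm' : n.+1%:R <= m.+1%:R :> R by rewrite ler_nat.
have s01 : 0 <= (n.+1%:R / m.+1%:R : R) <= 1.
  by apply: ratio01 => //; rewrite ler0n.
have [z _ bz] := cat_between_at catX (I : setT o) (I : setT (x m)) s01.
have /andP[s0 s1] := s01; have /andP[t0 tn] := t01.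
have kn : 1 <= k * n.+1%:R by rewrite mulrC -ler_pdivrMr// mul1r.
have nk0 : 0 <= n.+1%:R * k by rewrite mulr_ge0// ltW.
have xz : d (x n) z <= eta * n.+1%:R.
  apply: H => //.
  - by have := x_dist n; lra.
  - have [-> _] := bz; apply: (@le_trans _ _ n.+1%:R).
      apply: le_trans (ler_wpM2l s0 (x_dist m)) _; by rewrite divfK ?gt_eqF.
    by lra.
  - by have := x_desc n; lra.
  - have := f_convex s01 bz; rewrite f_base mulr0 add0r.
    have := ler_wpM2l s0 (x_desc m).
    have -> : n.+1%:R / m.+1%:R * (best_rate * m.+1%:R - 1) =
      best_rate * n.+1%:R - n.+1%:R / m.+1%:R.
      by rewrite mulrBr mulr1 mulrCA divfK ?gt_eqF.
    clear bz s01; set q := _ / m.+1%:R in s0 s1 *; clearbody q.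
    by set a := n.+1%:R in n0 kn *; clearbody a; lra.
have t01n := ratio01 n0 t01.
have [w _ bw] := cat_between_at catX (I : setT o) (I : setT z) t01n.
have bw' := between_at_trans s01 t01n bz bw.
have t01m : 0 <= t <= m.+1%:R by rewrite t0 (le_trans tn).
have -> : segment_pt m t = w.
  apply: between_uniq (ratio01 m0 t01m) (segment_ptP t01m) _.
  suff <- : t / n.+1%:R * (n.+1%:R / m.+1%:R) = t / m.+1%:R by [].
  by rewrite mulrA divfK ?gt_eqF.
apply: le_trans (busemann_vertex t01n (segment_ptP t01) bw) _.
have /andP[tn0 _] := t01n.
apply: le_trans (ler_wpM2l tn0 xz) _.
by rewrite mulrCA divfK ?gt_eqF// mulrC.
Qed.

Lemma segment_pt_cvg (t : R) : 0 <= t -> exists l, forall e : R, 0 < e ->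
  exists n : nat, forall i, (n <= i)%N -> d (segment_pt i t) l < e.
Proof.
move=> t0; apply: complete => e e0.
have eta0 : 0 < e / (2 * (t + 1)) by rewrite divr_gt0//; lra.
have [n1 h1] := segment_pt_near eta0; have [n2 h2] := large_nat t.
have te : t * (e / (2 * (t + 1))) < e.
  rewrite mulrA ltr_pdivrMr; last by lra.
  by rewrite mulrC ltr_pM2l//; lra.
have near (i j : nat) : (maxn n1 n2 <= i)%N -> (i <= j)%N ->
    d (segment_pt i t) (segment_pt j t) < e.
  rewrite geq_max => /andP[le1 le2] ij; apply: le_lt_trans te.
  by apply: h1; rewrite ?t0 ?h2.
exists (maxn n1 n2) => i j hi hj; have [ij|/ltnW ji] := leqP i j; first exact: near.
by rewrite mdist_sym; apply: near.
Qed.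

Definition limit_ray (t : R) : X := xget o
  [set l | forall e : R, 0 < e -> exists n : nat, forall i, (n <= i)%N ->
     d (segment_pt i t) l < e].

Lemma limit_rayP t : 0 <= t -> forall e : R, 0 < e -> exists n : nat, forall i,
  (n <= i)%N -> d (segment_pt i t) (limit_ray t) < e.
Proof.
move=> t0; rewrite /limit_ray; case: xgetP => [w _ //|no].
by have [l hl] := segment_pt_cvg t0; case: (no l).
Qed.

(** A point much closer to [o] could not have descended so far, by [descent_bound]. This is what
    gives the limit ray unit speed. *)
Lemma x_dist_large e : 0 < e -> exists n0, forall n, (n0 <= n)%N ->
  (1 - e) * n.+1%:R <= d o (x n).
Proof.
move=> e0; have L0 := best_rate_gt0; set L := best_rate in L0 *.
have eL0 : 0 < e * L / 2 by rewrite divr_gt0// mulr_gt0.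
have [r r0 hr] := descent_bound eL0; rewrite -/L in hr.
have Le0 : 0 < L + e * L / 2 by lra.
have [n1 h1] := large_nat ((r * (L + e * L / 2) + 2) / L).
have [n2 h2] := large_nat (2 / (e * L)).
exists (maxn n1 n2) => n; rewrite geq_max => /andP[le1 le2].
have {}h1 := h1 n le1; have {}h2 := h2 n le2; have hx := x_desc n.
rewrite -/L in hx; have := hr (x n); set D := d o (x n).
have n0 : 0 < n.+1%:R :> R by [].
set m := n.+1%:R in h1 h2 hx n0 *; clearbody m.
have k1 : r * (L + e * L / 2) + 2 <= m * L by rewrite -ler_pdivrMr.
have k2 : 2 <= m * (e * L) by rewrite -ler_pdivrMr// mulr_gt0.
have [le|lt] := leP D r.
  by move=> h; lra.
move=> h; rewrite -(ler_pM2l Le0).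
have : 0 <= e ^+ 2 * (L * m) by rewrite mulr_ge0 ?sqr_ge0// mulr_ge0// ltW.
nra.
Qed.

Lemma segment_pt_dist n s t : 0 <= s -> s <= t -> t <= n.+1%:R ->
  d (segment_pt n s) (segment_pt n t) = (t - s) * (d o (x n) / n.+1%:R).
Proof.
move=> s0 st tn; have n0 : 0 < n.+1%:R :> R by [].
have t0 := le_trans s0 st.
have t01 : 0 <= t <= n.+1%:R by rewrite t0.
have s01 : 0 <= s <= n.+1%:R by rewrite s0 (le_trans st).
have bt := segment_ptP t01; have bs := segment_ptP s01.
have [t00|tne] := eqVneq t 0.
  have ss : s = 0 by lra.
  by subst t s; rewrite mdistxx subrr mul0r.
have tp : 0 < t by rewrite lt_neqAle eq_sym tne.
have st01 : 0 <= s <= t by rewrite s0.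
have r01 := ratio01 tp st01.
have [w _ bw] := cat_between_at catX (I : setT o) (I : setT (segment_pt n t)) r01.
have -> : segment_pt n s = w.
  apply: between_uniq (ratio01 n0 s01) bs _.
  suff <- : s / t * (t / n.+1%:R) = s / n.+1%:R.
    exact: between_at_trans (ratio01 n0 t01) r01 bt bw.
  by rewrite mulrA divfK.
have [_ ->] := bw; have [-> _] := bt.
have E : s / t * t = s by rewrite divfK.
set q := s / t in E *; clearbody q.
rewrite -[s in RHS]E; move: (n.+1%:R^-1) (d o (x n)) => i D; lra.
Qed.

Lemma limit_ray_geodesic : geodesic_ray limit_ray.
Proof.
have main s t : 0 <= s -> s <= t -> d (limit_ray s) (limit_ray t) = t - s.
  move=> s0 st; have t0 := le_trans s0 st.
  apply/eqP; rewrite eq_le; apply/andP; split; apply/ler_addgt0Pr => e e0.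
    have e20 : 0 < e / 2 by lra.
    have [n1 h1] := limit_rayP s0 e20; have [n2 h2] := limit_rayP t0 e20.
    have [n3 h3] := large_nat t.
    pose n := maxn n1 (maxn n2 n3).
    have l1 : (n1 <= n)%N by rewrite leq_maxl.
    have l2 : (n2 <= n)%N by rewrite /n; lia.
    have l3 : (n3 <= n)%N by rewrite /n; lia.
    have := segment_pt_dist s0 st (h3 n l3); have := h1 n l1; have := h2 n l2.
    have := mdist_tri (limit_ray s) (segment_pt n s) (limit_ray t).
    have := mdist_tri (segment_pt n s) (segment_pt n t) (limit_ray t).
    rewrite (mdist_sym (limit_ray s) (segment_pt n s)).
    have : (t - s) * (d o (x n) / n.+1%:R) <= (t - s) * 1.
      by apply: ler_wpM2l; rewrite ?subr_ge0// ler_pdivrMr// mul1r.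
    move: (d o (x n) / n.+1%:R) => q; lra.
  have ts0 : 0 < t - s + 1 by lra.
  have e30 : 0 < e / (3 * (t - s + 1)) by rewrite divr_gt0//; lra.
  have e20 : 0 < e / 3 by lra.
  have [n1 h1] := limit_rayP s0 e20; have [n2 h2] := limit_rayP t0 e20.
  have [n3 h3] := large_nat t; have [n4 h4] := x_dist_large e30.
  pose n := maxn (maxn n1 n4) (maxn n2 n3).
  have l1 : (n1 <= n)%N by rewrite /n; lia.
  have l2 : (n2 <= n)%N by rewrite /n; lia.
  have l3 : (n3 <= n)%N by rewrite /n; lia.
  have l4 : (n4 <= n)%N by rewrite /n; lia.
  have := segment_pt_dist s0 st (h3 n l3); have := h1 n l1; have := h2 n l2.
  have := mdist_tri (segment_pt n s) (limit_ray s) (segment_pt n t).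
  have := mdist_tri (limit_ray s) (limit_ray t) (segment_pt n t).
  rewrite (mdist_sym (limit_ray t) (segment_pt n t)).
  have : (t - s) * (1 - e / (3 * (t - s + 1))) <= (t - s) * (d o (x n) / n.+1%:R).
    by apply: ler_wpM2l; rewrite ?subr_ge0// ler_pdivlMr//; exact: h4.
  have : (t - s) * (e / (3 * (t - s + 1))) <= e / 3.
    have -> : e / 3 = (t - s + 1) * (e / (3 * (t - s + 1))).
      by rewrite mulrCA [3 * _]mulrC invfM mulVKf ?gt_eqF.
    by apply: ler_wpM2r; lra.
  move: (d o (x n) / n.+1%:R) => q; lra.
move=> s t s0 t0; have [st|/ltW ts] := leP s t.
  by rewrite main// distrC ger0_norm// subr_ge0.
by rewrite mdist_sym main// ger0_norm// subr_ge0.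
Qed.

Lemma limit_ray_dist t : 0 <= t -> d o (limit_ray t) <= t.
Proof.
move=> t0; apply/ler_addgt0Pr => e e0.
have [n1 h1] := limit_rayP t0 e0; have [n2 h2] := large_nat t.
pose n := maxn n1 n2.
have l1 : (n1 <= n)%N by rewrite /n; lia.
have l2 : (n2 <= n)%N by rewrite /n; lia.
have t01 : 0 <= t <= n.+1%:R by rewrite t0 h2.
have := mdist_tri o (segment_pt n t) (limit_ray t); have := h1 n l1.
have [-> _] := segment_ptP t01.
have /andP[r0 _] := ratio01 (ltr0Sn R n) t01.
have := ler_wpM2l r0 (x_dist n); rewrite divfK ?gt_eqF//.
move: (t / n.+1%:R * _) => q; lra.
Qed.

Lemma limit_ray_desc t : 0 <= t -> best_rate * t <= - f (limit_ray t).
Proof.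
move=> t0; apply/ler_addgt0Pr => e e0; have e20 : 0 < e / 2 by lra.
have [n1 h1] := limit_rayP t0 e20; have [n2 h2] := large_nat t.
have [n3 h3] := large_nat (t / (e / 2)).
pose n := maxn n1 (maxn n2 n3).
have l1 : (n1 <= n)%N by rewrite /n; lia.
have l2 : (n2 <= n)%N by rewrite /n; lia.
have l3 : (n3 <= n)%N by rewrite /n; lia.
have t01 : 0 <= t <= n.+1%:R by rewrite t0 h2.
have n0 : 0 < n.+1%:R :> R by [].
have r01 := ratio01 n0 t01; have /andP[r0 _] := r01.
have := f_convex r01 (segment_ptP t01); rewrite f_base mulr0 add0r.
have := ler_wpM2l r0 (x_desc n).
have -> : t / n.+1%:R * (best_rate * n.+1%:R - 1) = best_rate * t - t / n.+1%:R.
  by rewrite mulrBr mulr1 mulrCA divfK ?gt_eqF.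
have : t / n.+1%:R <= e / 2.
  by rewrite ler_pdivrMr// mulrC -ler_pdivrMr//; exact: h3.
have := f_lip (limit_ray t) (segment_pt n t); have := h1 n l1.
rewrite (mdist_sym (limit_ray t)); move: (t / n.+1%:R) => q; lra.
Qed.

(** At a large time [T] both [B] and the displacement of [o] are negligible, so the ray and its
    image lie in one cluster and are at most a small multiple of [T] apart. Convexity of the
    distance between the two rays carries this back to time [t]. *)
Lemma limit_ray_isometry (g : X -> X) (B : R) t :
  (forall y z, d (g y) (g z) = d y z) -> (forall y, f (g y) <= f y + B) ->
  0 <= t -> d (limit_ray t) (g (limit_ray t)) <= d (limit_ray 0) (g (limit_ray 0)).
Proof.
move=> gi gB t0; apply/ler_addgt0Pr => e e0.
have eta0 : 0 < e / (t + 1) by rewrite divr_gt0//; lra.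
have [k [r0 [k0 r00 H]]] := descent_cluster eta0.
pose D0 := d o (g o).
pose T := Num.max (Num.max r0 (t + 1)) (Num.max (D0 / k) (B / k)).
have T1 : r0 <= T by rewrite !le_max lexx.
have T2 : t + 1 <= T by rewrite !le_max lexx !orbT.
have T3 : D0 <= T * k by rewrite -ler_pdivrMr// !le_max lexx !orbT.
have T4 : B <= T * k by rewrite -ler_pdivrMr// !le_max lexx !orbT.
clearbody T; have T0 : 0 < T by lra.
have hc := limit_ray_desc (ltW T0); have hd := limit_ray_dist (ltW T0).
have Tk : 0 <= T * k by rewrite mulr_ge0// ltW.
have HT : d (limit_ray T) (g (limit_ray T)) <= e / (t + 1) * T.
  apply: H => //.
  - lra.
  - have := mdist_tri o (g o) (g (limit_ray T)); rewrite gi -/D0; lra.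
  - lra.
  - by have := gB (limit_ray T); lra.
have tT : 0 <= t <= T by rewrite t0; lra.
have r01 := ratio01 T0 tT.
have bc : between_at (limit_ray 0) (limit_ray T) (t / T) (limit_ray t).
  have G a b : 0 <= a -> a <= b -> d (limit_ray a) (limit_ray b) = b - a.
    move=> a0 ab; rewrite limit_ray_geodesic ?(le_trans a0)//.
    by rewrite distrC ger0_norm// subr_ge0.
  have /andP[_ tT'] := tT.
  rewrite /between_at !G ?(ltW T0)// !subr0.
  by split; rewrite ?mulrBl ?mul1r divfK ?gt_eqF.
have bg : between_at (g (limit_ray 0)) (g (limit_ray T)) (t / T) (g (limit_ray t)).
  by rewrite /between_at !gi.
have /andP[q0 q1] := r01.
have h1 := busemann r01 bc bg.
have h2 := ler_wpM2l q0 HT.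
have h3 : t / T * (e / (t + 1) * T) <= e.
  rewrite mulrCA divfK ?gt_eqF// mulrAC ler_pdivrMr; last by lra.
  by rewrite ler_pM2l//; lra.
have h4 : (1 - t / T) * d (limit_ray 0) (g (limit_ray 0)) <= d (limit_ray 0) (g (limit_ray 0)).
  by rewrite ler_piMl ?mdist_ge0//; lra.
lra.
Qed.
End Limit.

Theorem steepest_ray : exists2 c : R -> X, geodesic_ray c &
  forall (g : X -> X) (B : R), (forall y z, d (g y) (g z) = d y z) ->
    (forall y, f (g y) <= f y + B) ->
    forall t, 0 <= t -> d (c t) (g (c t)) <= d (c 0) (g (c 0)).
Proof.
have [x hx] := descent_sequence.
have hx1 n : d o (x n) <= n.+1%:R by have [] := hx n.
have hx2 n : best_rate * n.+1%:R - 1 <= - f (x n) by have [] := hx n.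
exists (limit_ray x); first exact: limit_ray_geodesic.
by move=> g B gi gB t; apply: limit_ray_isometry.
Qed.
End SteepestRay.

(** * Vertices and edges of a cube complex *)

Section CubeIsometries.
Variable R : realType.

Definition sqdist n (x y : 'rV[R]_n) : R := \sum_j (x ord0 j - y ord0 j) ^+ 2.

Lemma sqdist_ge0 n (x y : 'rV[R]_n) : 0 <= sqdist x y.
Proof. by apply: sumr_ge0 => j _; apply: sqr_ge0. Qed.

Lemma euclid_dist_sqr n (x y : 'rV[R]_n) : euclid_dist x y ^+ 2 = sqdist x y.
Proof. by rewrite sqr_sqrtr// sqdist_ge0. Qed.

Lemma euclid_dist_ge0 n (x y : 'rV[R]_n) : 0 <= euclid_dist x y.
Proof. exact: sqrtr_ge0. Qed.

Lemma sqdist_eq0 n (x y : 'rV[R]_n) : sqdist x y = 0 -> x = y.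
Proof.
move/eqP; rewrite psumr_eq0 => [/allP H|j _]; last exact: sqr_ge0.
apply/rowP => j; have := H j (mem_index_enum _); rewrite /= sqrf_eq0 subr_eq0.
by move/eqP.
Qed.

Lemma sqdistxx n (x : 'rV[R]_n) : sqdist x x = 0.
Proof. by rewrite /sqdist big1// => j _; rewrite subrr expr0n. Qed.

Definition corner n (b : {ffun 'I_n -> bool}) : 'rV[R]_n := \row_j (b j)%:R.

Definition flip n (b : {ffun 'I_n -> bool}) (j : 'I_n) : {ffun 'I_n -> bool} :=
  [ffun k => if k == j then ~~ b k else b k].

Lemma flipK n (b : {ffun 'I_n -> bool}) j : flip (flip b j) j = b.
Proof. by apply/ffunP => k; rewrite !ffunE; case: eqP; rewrite ?negbK. Qed.

Lemma flip_at n (b : {ffun 'I_n -> bool}) j : flip b j j = ~~ b j.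
Proof. by rewrite ffunE eqxx. Qed.

Lemma flip_other n (b : {ffun 'I_n -> bool}) j k : k != j -> flip b j k = b k.
Proof. by rewrite ffunE => /negPf ->. Qed.

Lemma flipC n (b : {ffun 'I_n -> bool}) j k : flip (flip b j) k = flip (flip b k) j.
Proof.
apply/ffunP => l; rewrite !ffunE.
by case: (l == k); case: (l == j).
Qed.

Lemma flip_neq n (b : {ffun 'I_n -> bool}) j : flip b j <> b.
Proof. by move=> /ffunP/(_ j); rewrite flip_at; case: (b j). Qed.

Definition in_face n (f : face n) (b : {ffun 'I_n -> bool}) :=
  forall j c, f j = Some c -> b j = c.

Lemma corner_face n (f : face n) b : face_set R f (corner b) <-> in_face f b.
Proof.
split=> [H j c fj|H j].
  have [_ /(_ c fj)] := H j; rewrite mxE.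
  by case: (b j) (c) => -[] //= /eqP; rewrite ?oner_eq0// eq_sym oner_eq0.
rewrite mxE; split=> [|c /H ->] //; by case: (b j); rewrite ?lexx ?ler01.
Qed.

Lemma corner_cube n (b : {ffun 'I_n -> bool}) : cube R n (corner b).
Proof. by apply/corner_face => j c; rewrite ffunE. Qed.

Lemma face_cube n (f : face n) (x : 'rV[R]_n) : face_set R f x -> cube R n x.
Proof. by move=> fx j; split=> [|b]; [case: (fx j)|rewrite ffunE]. Qed.

Lemma corner_inj n (b b' : {ffun 'I_n -> bool}) : corner b = corner b' -> b = b'.
Proof.
move=> /rowP E; apply/ffunP => j; have := E j; rewrite !mxE.
by case: (b j) (b' j) => -[] //= /eqP; rewrite ?oner_eq0// eq_sym oner_eq0.
Qed.

Lemma cornerP n (f : face n) (x : 'rV[R]_n) : face_set R f x ->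
  (forall j, x ord0 j = 0 \/ x ord0 j = 1) -> exists2 b, x = corner b & in_face f b.
Proof.
move=> fx H; have E : x = corner [ffun j => x ord0 j == 1].
  apply/rowP => j; rewrite !mxE ffunE; case: (H j) => ->; rewrite ?eqxx//.
  by rewrite eq_sym oner_eq0.
by exists [ffun j => x ord0 j == 1]; rewrite // -corner_face -E.
Qed.

Lemma sqdist_flip n (b : {ffun 'I_n -> bool}) j : sqdist (corner b) (corner (flip b j)) = 1.
Proof.
rewrite /sqdist (bigD1 j)//= big1 => [|k kj].
  by rewrite !mxE flip_at addr0; case: (b j); rewrite /= ?subr0 ?sub0r ?sqrrN expr1n.
by rewrite !mxE flip_other// subrr expr0n.
Qed.

Lemma sqdist_corner1 n (b b' : {ffun 'I_n -> bool}) :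
  sqdist (corner b) (corner b') = 1 -> exists j, b' = flip b j.
Proof.
have -> : sqdist (corner b) (corner b') = #|[pred j | b j != b' j]|%:R.
  rewrite -sum1_card natr_sum /sqdist [RHS]big_mkcond; apply: eq_bigr => j _.
  rewrite !mxE inE; case: (b j) (b' j) => -[];
    by rewrite /= ?subrr ?subr0 ?sub0r ?sqrrN ?expr1n ?expr0n.
move/eqP; rewrite pnatr_eq1 => /eqP/mem_card1[j Hj].
exists j; apply/ffunP => k; have := Hj k; rewrite !inE !ffunE => <-.
by case: (b k) (b' k) => -[].
Qed.

Definition sqdist_iso m n (f : face m) (g : face n) (h : 'rV[R]_m -> 'rV[R]_n) :=
  h @` face_set R f = face_set R g /\
  forall x y, face_set R f x -> face_set R f y -> sqdist (h x) (h y) = sqdist x y.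

Lemma face_isometry_sqdist m n (f : face m) (g : face n) h :
  face_isometry f g h -> sqdist_iso f g h.
Proof.
by case=> H1 H2; split=> // x y fx fy; rewrite -!euclid_dist_sqr H2.
Qed.

Section Iso.
Variables (m n : nat) (f : face m) (g : face n) (h : 'rV[R]_m -> 'rV[R]_n).
Hypothesis hI : sqdist_iso f g h.

Lemma iso_face x : face_set R f x -> face_set R g (h x).
Proof. by move=> fx; case: hI => <- _; exists x. Qed.

Lemma iso_surj y : face_set R g y -> exists2 x, face_set R f x & h x = y.
Proof. by case: hI => <- _. Qed.

(* A vertex is not the midpoint of a nontrivial segment of the cube. *)
Lemma iso_corner b : in_face f b -> exists2 b', h (corner b) = corner b' & in_face g b'.
Proof.
move=> fb; have fc := (corner_face f b).2 fb; have gc := iso_face fc.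
apply: cornerP => // k; apply: contrapT => nk.
have [/andP[k0 k1] gk] := gc k.
set s := h (corner b) ord0 k in k0 k1 gk nk.
pose e := Num.min s (1 - s).
have e0 : 0 < e.
  rewrite lt_min subr_gt0 !lt_neqAle k0 k1 !andbT.
  by apply/andP; split; apply/eqP => E; apply: nk; [left|right].
have es : e <= s by rewrite ge_min lexx.
have e1 : e <= 1 - s by rewrite ge_min lexx orbT.
pose pt (t : R) : 'rV[R]_n := \row_l (h (corner b) ord0 l + t * (l == k)%:R).
have gpt (t : R) : `|t| <= e -> face_set R g (pt t).
  rewrite ler_norml => /andP[t1 t2] l; rewrite mxE.
  have [->|lk] := eqVneq l k; last by rewrite mulr0 addr0; apply: gc.
  rewrite mulr1 -/s; split=> [|c gc']; first by apply/andP; split; lra.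
  by case: nk; rewrite (gk _ gc'); case: c gc'; [right|left].
have sq_pt (t : R) : sqdist (h (corner b)) (pt t) = t ^+ 2.
  rewrite /sqdist (bigD1 k)//= big1 => [|l lk]; rewrite mxE ?eqxx; last first.
    by rewrite (negPf lk) mulr0 addr0 subrr expr0n.
  by rewrite addr0 mulr1 opprD addrA subrr sub0r sqrrN.
have sq_pt2 : sqdist (pt e) (pt (- e)) = 4 * e ^+ 2.
  rewrite /sqdist (bigD1 k)//= big1 => [|l lk]; rewrite !mxE ?eqxx; last first.
    by rewrite (negPf lk) !mulr0 subrr expr0n.
  by rewrite addr0 !mulr1; lra.
have ne : `|e| <= e by rewrite ger0_norm// ltW.
have ne' : `|- e| <= e by rewrite normrN.
have [x1 fx1 E1] := iso_surj (gpt _ ne); have [x2 fx2 E2] := iso_surj (gpt _ ne').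
have [_ iso] := hI.
have q1 : sqdist (corner b) x1 = e ^+ 2 by rewrite -iso// E1 sq_pt.
have q2 : sqdist (corner b) x2 = e ^+ 2 by rewrite -iso// E2 sq_pt sqrrN.
have q3 : sqdist x1 x2 = 4 * e ^+ 2 by rewrite -iso// E1 E2.
(* Parallelogram law: the corner is the midpoint of [x1] and [x2]. *)
have q4 : \sum_j (x1 ord0 j + x2 ord0 j - 2 * corner b ord0 j) ^+ 2 = 0 :> R.
  have -> : \sum_j (x1 ord0 j + x2 ord0 j - 2 * corner b ord0 j) ^+ 2 =
      2 * sqdist (corner b) x1 + 2 * sqdist (corner b) x2 - sqdist x1 x2.
    rewrite /sqdist !mulr_sumr -big_split /= -sumrB; apply: eq_bigr => j _; lra.
  by rewrite q1 q2 q3; lra.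
have q5 : x1 = corner b.
  apply/rowP => j; move/eqP: q4; rewrite psumr_eq0 => [/allP/(_ j (mem_index_enum _))|l _];
    last exact: sqr_ge0.
  rewrite /= sqrf_eq0 => /eqP.
  have [/andP[]] := fx1 j; have [/andP[]] := fx2 j; rewrite mxE.
  by case: (b j) => /=; lra.
by move: q1; rewrite q5 sqdistxx => /esym/eqP; rewrite sqrf_eq0 gt_eqF.
Qed.

Lemma iso_inverse : exists h', sqdist_iso g f h' /\
  (forall x, face_set R f x -> h' (h x) = x) /\
  (forall y, face_set R g y -> h (h' y) = y).
Proof.
have [h' hh'] : exists h', forall y, face_set R g y -> face_set R f (h' y) /\ h (h' y) = y.
  have /choice[h' hh'] : forall y, exists x, face_set R g y -> face_set R f x /\ h x = y.
    move=> y; have [gy|] := EM (face_set R g y); last by exists 0.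
    by have [x fx <-] := iso_surj gy; exists x.
  by exists h'.
have [_ iso] := hI.
have inj x : face_set R f x -> h' (h x) = x.
  move=> fx; have [fx' E] := hh' _ (iso_face fx).
  by apply: sqdist_eq0; rewrite -iso// E sqdistxx.
exists h'; split; last by split=> // y /hh'[].
split; last first.
  move=> x y gx gy; have [fx Ex] := hh' _ gx; have [fy Ey] := hh' _ gy.
  by rewrite -iso// Ex Ey.
apply/seteqP; split=> [x [y gy <-]|x fx]; first by case: (hh' _ gy).
by exists (h x); [exact: iso_face|exact: inj].
Qed.

(** A coordinate is read off from the squared distances to two adjacent corners, so an isometry that
    matches these corners transports the coordinate. *)
Lemma sqdist_coord k (b : {ffun 'I_k -> bool}) j (x : 'rV[R]_k) :
  sqdist x (corner b) - sqdist x (corner (flip b j)) =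
  if b j then 1 - 2 * x ord0 j else 2 * x ord0 j - 1.
Proof.
rewrite /sqdist (bigD1 j)//= [X in _ - X](bigD1 j)//=.
rewrite [X in _ + X - _](eq_bigr (fun l => (x ord0 l - corner (flip b j) ord0 l) ^+ 2)).
  by rewrite !mxE flip_at; case: (b j) => /=; lra.
by move=> l lj; rewrite !mxE flip_other.
Qed.

Lemma iso_flip b b' b1 b1' j : in_face f b -> in_face f b1 ->
  h (corner b) = corner b' -> h (corner b1) = corner b1' -> b1 = flip b j ->
  exists k, b1' = flip b' k.
Proof.
move=> fb fb1 E E1 bj; apply: sqdist_corner1.
rewrite -E -E1; case: hI => _ ->; try exact/corner_face.
by rewrite bj sqdist_flip.
Qed.

Lemma in_face_flip b j : in_face f b -> f j = None -> in_face f (flip b j).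
Proof.
move=> fb fj l c fl; rewrite flip_other; first exact: fb.
by apply/eqP => lj; rewrite lj fj in fl.
Qed.

Lemma in_face_flip_free b j : in_face f b -> in_face f (flip b j) -> f j = None.
Proof.
move=> fb fb'; case E: (f j) => [c|//]; have := fb' _ _ E; rewrite flip_at (fb _ _ E).
by case: c {E}.
Qed.

Lemma face_corner : exists b, in_face f b.
Proof. by exists [ffun j => odflt false (f j)] => j c fj; rewrite ffunE fj. Qed.

Lemma iso_coord_fwd b b' j k : in_face f b -> in_face f (flip b j) ->
  h (corner b) = corner b' -> h (corner (flip b j)) = corner (flip b' k) ->
  forall x, face_set R f x ->
    h x ord0 k = if b j == b' k then x ord0 j else 1 - x ord0 j.
Proof.
move=> fb fb1 E E1 x fx; have [_ iso] := hI.
have := sqdist_coord b' k (h x); rewrite -E -E1 !iso//; try exact/corner_face.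
by rewrite sqdist_coord; case: (b j) (b' k) => -[] /=; lra.
Qed.
End Iso.

Lemma iso_coord m n (f : face m) (g : face n) h : sqdist_iso f g h ->
  forall k, g k = None -> exists j (e : bool), f j = None /\
    forall x, face_set R f x -> h x ord0 k = if e then x ord0 j else 1 - x ord0 j.
Proof.
move=> hI k gk; have [h' [hI' [hK hK']]] := iso_inverse hI.
have [b fb] := face_corner f.
have [b' E gb'] := iso_corner hI fb.
have gb1' := in_face_flip gb' gk.
have [b1 E1 fb1] := iso_corner hI' gb1'.
have E' : h' (corner b') = corner b by rewrite -E hK//; apply/corner_face.
have [j Ej] := iso_flip hI' gb' gb1' E' E1 erefl; subst b1.
exists j, (b j == b' k); split; first exact: in_face_flip_free fb fb1.
apply: (iso_coord_fwd hI fb fb1 E).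
by rewrite -E1 hK'//; apply/corner_face.
Qed.
End CubeIsometries.

Section Vertices.
Variables (R : realType) (X : metricType R) (K : cubeComplex X).

Notation cdim := (cube_dim K).
Notation bits i := {ffun 'I_(cdim i) -> bool}.

Lemma chart_meet_iso i i' a a' : cube R (cdim i) a -> cube R (cdim i') a' ->
  chart K i a = chart K i' a' ->
  exists (f : face (cdim i)) (g : face (cdim i')) h, sqdist_iso f g h /\
   forall x x', cube R (cdim i) x -> cube R (cdim i') x' ->
     (chart K i x = chart K i' x' <-> face_set R f x /\ x' = h x).
Proof.
move=> ca ca' E; have [|f [g [h [hI H]]]] := @chart_meet R X K i i'.
  by exists (chart K i a); split; [exists a | exists a'; rewrite ?E].
exists f, g, h; split=> //; exact: face_isometry_sqdist.
Qed.

Definition is_vertex (v : X) : Prop := cell K 0 [set v].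

Lemma vertexP v : is_vertex v <-> exists i b, v = chart K i (corner R b).
Proof.
split=> [[i [f [f0 E]]]|[i [b ->]]].
  have [b fb] := face_corner f; exists i, b.
  by have : [set v] (chart K i (corner R b));
    [rewrite E; exists (corner R b) => //; apply/corner_face|move=> /= ->].
exists i, [ffun j => Some (b j)]; split.
  by rewrite /face_dim eq_card0// => j; rewrite !inE ffunE.
apply/seteqP; split=> [x /= ->|x [a fa <-]].
  by exists (corner R b) => //; apply/corner_face => j c; rewrite ffunE => -[].
congr (chart K i _); apply/rowP => j; have [_] := fa j.
by rewrite ffunE => /(_ _ erefl) ->; rewrite mxE.
Qed.

Definition vtx := {v : X | `[< is_vertex v >]}.
HB.instance Definition _ := Choice.on vtx.

Lemma cv_subproof i (b : {ffun 'I_(cdim i) -> bool}) :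
  `[< is_vertex (chart K i (corner R b)) >].
Proof. by apply/asboolP/vertexP; exists i, b. Qed.

Definition cv i (b : {ffun 'I_(cdim i) -> bool}) : vtx :=
  exist (fun v => `[< is_vertex v >]) (chart K i (corner R b)) (cv_subproof b).

Lemma vtxP (v : vtx) : exists i b, v = @cv i b.
Proof.
case: v => x vx; have /asboolP/vertexP[i [b E]] := vx.
by exists i, b; apply: val_inj.
Qed.

Lemma cv_eq i i' b b' : @cv i b = @cv i' b' <->
  chart K i (corner R b) = chart K i' (corner R b').
Proof. by split=> [[]//|E]; apply: val_inj. Qed.

Lemma cv_inj i b b' : @cv i b = @cv i b' -> b = b'.
Proof.
move=> /cv_eq E; apply: (@corner_inj R); apply: chart_inj E; exact: corner_cube.
Qed.

(** No coordinate of [a] is at distance 1 from that of [b], so [b] lies in the face along which the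
    two cubes meet. The isometry of faces permutes and reflects the free coordinates, which
    preserves the sup distance to the corner. *)
Lemma corner_transfer i i' a a' (b : {ffun 'I_(cdim i) -> bool}) :
  cube R (cdim i) a -> cube R (cdim i') a' -> chart K i a = chart K i' a' ->
  (forall j, `|a ord0 j - (b j)%:R| < 1) ->
  exists2 b', @cv i b = @cv i' b' &
    forall r, 0 <= r -> (forall j, `|a ord0 j - (b j)%:R| <= r) ->
              (forall k, `|a' ord0 k - (b' k)%:R| <= r).
Proof.
move=> ca ca' E near; have [f [g [h [hI H]]]] := chart_meet_iso ca ca' E.
have [fa ea'] := (H _ _ ca ca').1 E.
have fb : in_face f b.
  move=> j c fj; have [_ /(_ c fj) ac] := fa j; have := near j; rewrite ac.
  by case: (b j) c {fj ac} => -[] //=; rewrite ?subr0 ?sub0r ?normrN normr1 ltxx.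
have [b' Eb gb'] := iso_corner hI fb.
exists b'.
  apply/cv_eq/H; [exact: corner_cube|exact: corner_cube|].
  by split=> //; apply/corner_face.
move=> r r0 le k; rewrite ea'; case gk: (g k) => [c|].
  have [_ /(_ _ gk) ->] := iso_face hI fa k.
  by rewrite (gb' _ _ gk) subrr normr0.
have [j [e [fj He]]] := iso_coord hI gk.
have -> : (b' k)%:R = h (corner R b) ord0 k by rewrite Eb mxE.
rewrite !He//; last exact/corner_face.
rewrite mxE; case: e {He}; first exact: le.
have -> : 1 - a ord0 j - (1 - (b j)%:R) = - (a ord0 j - (b j)%:R) by lra.
by rewrite normrN; apply: le.
Qed.

Section Transfer.
Variables (i i' : cube_index K).

Lemma cv_meet (b : bits i) (b' : bits i') : @cv i b = @cv i' b' ->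
  exists (f : face (cdim i)) (g : face (cdim i')) h, [/\ sqdist_iso f g h,
    in_face f b, in_face g b', h (corner R b) = corner R b' &
   forall x x', cube R (cdim i) x -> cube R (cdim i') x' ->
     (chart K i x = chart K i' x' <-> face_set R f x /\ x' = h x)].
Proof.
move=> /cv_eq E.
have [f [g [h [hI H]]]] := chart_meet_iso (corner_cube R b) (corner_cube R b') E.
have [fc ec] := (H _ _ (corner_cube R b) (corner_cube R b')).1 E.
exists f, g, h; split=> //; first exact/(corner_face R).
by apply/(corner_face R); rewrite ec; apply: iso_face hI _ fc.
Qed.

Lemma cv_flip_transfer (b : bits i) (b' : bits i') j (c' : bits i') : @cv i b = @cv i' b' ->
  @cv i (flip b j) = @cv i' c' -> exists k, c' = flip b' k.
Proof.
move=> E E1; have [f [g [h [hI fb gb e H]]]] := cv_meet E.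
have /cv_eq E1' := E1.
have [fc ec] := (H _ _ (corner_cube R _) (corner_cube R c')).1 E1'.
exact: (iso_flip hI fb ((corner_face R _ _).1 fc) e (esym ec) erefl).
Qed.

(** Two cubes meet in a face, and a face with two given corners contains every corner between
    them. *)
Lemma cv_between_transfer (b1 b2 : bits i) (b1' b2' : bits i') (b : bits i) : @cv i b1 = @cv i' b1' ->
  @cv i b2 = @cv i' b2' -> (forall j, b j = b1 j \/ b j = b2 j) ->
  exists b', @cv i b = @cv i' b'.
Proof.
move=> E1 E2 B; have [f [g [h [hI fb gb e H]]]] := cv_meet E1.
have /cv_eq E2' := E2.
have [fc _] := (H _ _ (corner_cube R _) (corner_cube R b2')).1 E2'.
have fb2 := (corner_face R _ _).1 fc.
have fbb : in_face f b.
  by move=> j c fj; case: (B j) => ->; [apply: fb|apply: fb2].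
have [b' Eb gb'] := iso_corner hI fbb; exists b'; apply/cv_eq/H.
- exact: corner_cube.
- exact: corner_cube.
- by split=> //; apply/(corner_face R).
Qed.

End Transfer.

Definition vadj (v w : vtx) : Prop := exists i b j, v = @cv i b /\ w = @cv i (flip b j).

Definition vsq (a b c d : vtx) : Prop := exists i e j k, [/\ j != k, a = @cv i e,
  b = @cv i (flip e j), c = @cv i (flip (flip e j) k) & d = @cv i (flip e k)].

Lemma vadj_sym v w : vadj v w -> vadj w v.
Proof.
by case=> i [b [j [-> ->]]]; exists i, (flip b j), j; rewrite flipK.
Qed.

Lemma vadj_irr v w : vadj v w -> v <> w.
Proof. by case=> i [b [j [-> ->]]] /cv_inj/esym/flip_neq. Qed.

Lemma vsq_adj a b c d : vsq a b c d -> vadj a b.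
Proof. by case=> i [e [j [k [_ -> -> _ _]]]]; exists i, e, j. Qed.

Lemma vsq_rev a b c d : vsq a b c d -> vsq a d c b.
Proof.
case=> i [e [j [k [jk -> -> -> ->]]]]; exists i, e, k, j; split=> //.
  by rewrite eq_sym.
by rewrite flipC.
Qed.

Lemma vsq_rot a b c d : vsq a b c d -> vsq b c d a.
Proof.
case=> i [e [j [k [jk -> -> -> ->]]]]; exists i, (flip e j), k, j; split=> //.
- by rewrite eq_sym.
- by rewrite (flipC (flip e j)) flipK.
- by rewrite flipK.
Qed.

Lemma vsq_ne a b c d : vsq a b c d -> a <> c.
Proof.
case=> i [e [j [k [jk -> _ -> _]]]] /cv_inj/ffunP/(_ j).
by rewrite flip_other// flip_at; case: (e j).
Qed.

Lemma vadj_cv i b w i' (b' : bits i') : @cv i b = @cv i' b' ->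
  vadj (@cv i b) w -> (exists c', w = @cv i' c') -> exists k, w = @cv i' (flip b' k).
Proof.
move=> E [i1 [b1 [j [E1 E2]]]] [c' E3]; rewrite E in E1.
have [k Ek] : exists k, c' = flip b' k.
  by apply: (@cv_flip_transfer i1 i' b1 b' j c'); rewrite -?E1 -?E2.
by exists k; rewrite E3 Ek.
Qed.

Lemma flip_square n (e : {ffun 'I_n -> bool}) j k l m : j != k ->
  flip (flip (flip e j) k) m = flip e l -> l <> j -> l = k.
Proof.
move=> jk E lj; apply/eqP/contraT => lk; exfalso.
move/ffunP: E => E; have := E j; have := E k.
rewrite !ffunE !eqxx (negPf jk) [k == j]eq_sym (negPf jk).
have -> : (j == l) = false by apply/eqP => jl; apply: lj.
have -> : (k == l) = false by rewrite eq_sym (negPf lk).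
case: (eqVneq k m) => [<-|km]; last by case: (e k).
by rewrite (negPf jk); case: (e j).
Qed.

(** The two cubes share the opposite corners [a] and [c], hence by [cv_between_transfer] the corner
    [d] between them; a corner adjacent to both [a] and [c] and other than [b] is unique in a
    cube. *)
Lemma vsq_uniq a b c d d' : vsq a b c d -> vsq a b c d' -> d = d'.
Proof.
move=> [i [e [j [k [jk Ea Eb Ec Ed]]]]] [i' [e' [j' [k' [jk' Ea' Eb' Ec' Ed']]]]].
have Eaa : cv e = cv e' by rewrite -Ea -Ea'.
have Ecc : cv (flip (flip e j) k) = cv (flip (flip e' j') k') by rewrite -Ec -Ec'.
have [x' Ex] : exists x', cv (flip e k) = @cv i' x'.
  apply: cv_between_transfer Eaa Ecc _ => l.
  have [->|lk] := eqVneq l k; [right|left]; last by rewrite flip_other.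
  by rewrite !flip_at flip_other// eq_sym.
have [l El] := cv_flip_transfer Eaa Ex.
have [|m Em] := @cv_flip_transfer i i' _ _ j x' Ecc.
  by rewrite (flipC (flip e j)) flipK.
have lj : l <> j'.
  move=> lj; apply: (vsq_ne (vsq_rot (ex_intro _ i (ex_intro _ e (ex_intro _ j
    (ex_intro _ k (And5 jk Ea Eb Ec Ed))))))).
  by rewrite Eb' Ed Ex El lj.
have := flip_square jk' (etrans (esym Em) El) lj.
by rewrite Ed Ex El Ed' => ->.
Qed.

Definition edge_face n (b : {ffun 'I_n -> bool}) (j : 'I_n) : face n :=
  [ffun l => if l == j then None else Some (b l)].

Lemma edge_face_flip n (b : {ffun 'I_n -> bool}) j :
  edge_face (flip b j) j = edge_face b j.
Proof. by apply/ffunP => l; rewrite !ffunE; case: eqP. Qed.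

Lemma edge_face_corner n (b c : {ffun 'I_n -> bool}) j :
  in_face (edge_face b j) c <-> c = b \/ c = flip b j.
Proof.
split=> [H|].
  have E l : l != j -> c l = b l.
    by move=> lj; apply: H; rewrite ffunE (negPf lj).
  have [e|ne] := eqVneq (c j) (b j); [left|right]; apply/ffunP => l.
    by have [->|/E] := eqVneq l j.
  have [->|lj] := eqVneq l j; last by rewrite flip_other// E.
  by rewrite flip_at; move: ne; case: (c j); case: (b j).
by case=> -> l d; rewrite !ffunE; case: eqP => // _ [].
Qed.

Lemma edge_face_dim n (b : {ffun 'I_n -> bool}) j : face_dim (edge_face b j) = 1%N.
Proof.
rewrite /face_dim; apply: (@fintype.eq_card1 _ j) => l.
by rewrite !inE ffunE; case: (l == j).
Qed.

Definition edge_set (v w : vtx) : set X := [set x | exists i b j,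
  [/\ v = @cv i b, w = cv (flip b j) & (chart K i @` face_set R (edge_face b j)) x]].

(** Any other chart containing both ends meets this one in a face in whose free directions the edge
    runs, so it gives the same set of points. *)
Lemma edge_set_cv i b j :
  edge_set (@cv i b) (cv (flip b j)) = chart K i @` face_set R (edge_face b j).
Proof.
apply/seteqP; split=> [x [i1 [b1 [j1 [E E1 [a fa <-]]]]]|x ex]; last first.
  by exists i, b, j.
have [f [g [h [hI fb gb e H]]]] := cv_meet (esym E).
have /cv_eq E1' := esym E1.
have [fc ec] := (H _ _ (corner_cube R _) (corner_cube R (flip b j))).1 E1'.
have fb1 := (corner_face R _ _).1 fc.
have ff := in_face_flip_free fb fb1.
have fa' : face_set R f a.
  move=> l; split; first by case: (fa l).
  move=> c fl; have lj : l != j1 by apply/eqP => lj; rewrite lj ff in fl.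
  have [_ /(_ (b1 l))] := fa l; rewrite ffunE (negPf lj) => /(_ erefl) ->.
  by rewrite (fb _ _ fl).
have ga := iso_face hI fa'.
exists (h a); last first.
  symmetry; apply/H; [exact: face_cube fa'|exact: face_cube ga|by []].
move=> l; split; first by case: (ga l).
move=> c; rewrite ffunE; have [//|lj] := eqVneq l j => -[<-].
case gl: (g l) => [d|].
  by have [_ /(_ _ gl) ->] := ga l; rewrite (gb _ _ gl).
have [m [s [fm Hm]]] := iso_coord hI gl.
have e1 := Hm _ ((corner_face R _ _).2 fb); have e2 := Hm _ fc.
rewrite e mxE in e1; rewrite -ec !mxE flip_other// in e2.
have mj : m != j1.
  apply/eqP => mj; subst m; move: e2; rewrite e1 mxE flip_at.
  by case: (s); case: (b1 j1) => /=; lra.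
have [_ /(_ (b1 m))] := fa m; rewrite ffunE (negPf mj) => /(_ erefl) am.
by rewrite Hm// am e1 mxE.
Qed.

Lemma edge_set_sym v w : vadj v w -> edge_set v w = edge_set w v.
Proof.
case=> i [b [j [-> ->]]]; rewrite edge_set_cv.
by rewrite -[X in edge_set _ (cv X)](flipK b j) edge_set_cv edge_face_flip.
Qed.

Lemma edge_set_cell v w : vadj v w -> cell K 1 (edge_set v w).
Proof.
case=> i [b [j [-> ->]]]; rewrite edge_set_cv.
by exists i, (edge_face b j); rewrite edge_face_dim.
Qed.

Lemma cell1P E : cell K 1 E <-> exists v w, vadj v w /\ E = edge_set v w.
Proof.
split=> [[i [f [f1 ->]]]|[v [w [vw ->]]]]; last exact: edge_set_cell.
have [b fb] := face_corner f.
have /mem_card1[j Hj] : face_dim f = 1%N by [].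
have fe : f = edge_face b j.
  apply/ffunP => l; have := Hj l; rewrite !inE ffunE => e.
  case fl: (f l) e => [c|] /esym; last by move=> ->.
  by move=> ->; rewrite (fb _ _ fl).
exists (cv b), (cv (flip b j)); rewrite edge_set_cv fe; split=> //.
by exists i, b, j.
Qed.

Lemma cv_in_face i (f : face (cdim i)) b :
  (chart K i @` face_set R f) (val (@cv i b)) <-> in_face f b.
Proof.
split=> [[a fa E]|fb]; last by exists (corner R b) => //; apply/corner_face.
have e : a = corner R b.
  by apply: chart_inj E; [exact: face_cube fa|exact: corner_cube].
by apply/(corner_face R); rewrite -e.
Qed.

Lemma vtx_in_chart i a (v : vtx) : cube R (cdim i) a -> val v = chart K i a ->
  exists2 b, v = @cv i b & a = corner R b.
Proof.
have [i1 [b1 ->]] := vtxP v => ca E.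
have [f [g [h [hI H]]]] := chart_meet_iso (corner_cube R b1) ca E.
have [fc ea] := (H _ _ (corner_cube R b1) ca).1 E.
have [b Eb gb] := iso_corner hI ((corner_face R _ _).1 fc).
exists b; last by rewrite ea Eb.
by apply/cv_eq; rewrite -Eb -ea.
Qed.

Lemma vtx_in_face i (f : face (cdim i)) (v : vtx) :
  (chart K i @` face_set R f) (val v) -> exists2 b, v = @cv i b & in_face f b.
Proof.
move=> [a fa E]; have [b Ev Ea] := vtx_in_chart (face_cube fa) (esym E).
by exists b => //; apply/(corner_face R); rewrite -Ea.
Qed.

Lemma vtx_in_edge v w u : vadj v w -> edge_set v w (val u) <-> u = v \/ u = w.
Proof.
case=> i [b [j [-> ->]]]; rewrite edge_set_cv; split.
  move=> /vtx_in_face[c ->] /edge_face_corner[->|->]; by [left|right].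
case=> ->; apply/cv_in_face; apply/edge_face_corner; by [left|right].
Qed.

Lemma link_face i b (f : face (cdim i)) : in_face f b ->
  [set E | [/\ cell K 1 E, E (val (@cv i b)) & E `<=` chart K i @` face_set R f]] =
  [set E | exists2 j, f j = None & E = edge_set (cv b) (cv (flip b j))].
Proof.
move=> fb; apply/seteqP; split=> E /=.
  case=> /cell1P[v [w [vw ->]]] Ev sub.
  wlog Evb : v w vw Ev sub / cv b = v.
    move=> W; have [e|e] := (vtx_in_edge (cv b) vw).1 Ev; first exact: W.
    by rewrite edge_set_sym//; apply: W; rewrite ?(edge_set_sym (vadj_sym vw))//; apply: vadj_sym.
  subst v; have [c wc fc] : exists2 c, w = cv c & in_face f c.
    by apply: vtx_in_face; apply: sub; apply/vtx_in_edge => //; right.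
  have [k Ek] : exists k, w = cv (flip b k).
    by apply: vadj_cv erefl vw _; exists c.
  exists k; last by rewrite Ek.
  apply: (in_face_flip_free fb); suff <- : c = flip b k by [].
  by apply: (@cv_inj i); rewrite -wc.
case=> j fj ->; split.
- by apply: edge_set_cell; exists i, b, j.
- by apply/(vtx_in_edge (cv b)); [exists i, b, j|left].
rewrite edge_set_cv => x [a fa <-]; exists a => // l; split; first by case: (fa l).
move=> c fl; have lj : l != j by apply/eqP => lj; rewrite lj fj in fl.
by have [_ /(_ (b l))] := fa l; rewrite ffunE (negPf lj) (fb _ _ fl); apply.
Qed.

Hypothesis flagK : forall v, cell K 0 [set v] -> flag (link K v).

Lemma link_edges v S : link K v S <-> exists n i (f : face (cdim i)),
  [/\ face_dim f = n.+1, (chart K i @` face_set R f) v &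
    S = [set E | [/\ cell K 1 E, E v & E `<=` chart K i @` face_set R f]]].
Proof.
split=> [[n [C [[i [f [fn ->]]] [Cv ->]]]]|[n [i [f [fn fv ->]]]]].
  by exists n, i, f; split=> //; apply/seteqP; split=> E /=; [case=> ? [? ?]|case].
exists n, (chart K i @` face_set R f); split; first by exists i, f.
by split=> //; apply/seteqP; split=> E /=; [case|case=> ? [? ?]].
Qed.

(** Flagness applied to the edges from [v] to [s]: pairwise squares make them the vertices of a
    simplex of the link, that is, the edges at [v] of one cell. *)
Lemma flag_chart (v : vtx) (s : seq vtx) : (forall w, w \in s -> vadj v w) ->
  (forall w w', w \in s -> w' \in s -> w <> w' -> exists z, vsq w v w' z) ->
  exists i b, v = @cv i b /\ forall w, w \in s -> exists j, w = cv (flip b j).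
Proof.
move=> vs ps; case: s vs ps => [|w0 s] vs ps.
  by have [i [b ->]] := vtxP v; exists i, b.
set t := w0 :: s in vs ps *.
have vv : cell K 0 [set val v] by case: v {vs ps} => x /= /asboolP.
pose S := [set E | exists2 w, w \in t & E = edge_set v w].
have Sfin : finite_set S.
  apply: (@sub_finite_set _ _ [set E | E \in [seq edge_set v w | w <- t]]).
    by move=> E [w wt ->]; apply: (map_f (edge_set v) wt).
  exact: finite_seq.
have S0 : S !=set0 by exists (edge_set v w0), w0; rewrite ?mem_head.
have pair E E' : S E -> S E' -> link K (val v) [set E; E'].
  move=> [w wt ->] [w' wt' ->]; apply/link_edges.
  have [<-|/eqP ww'] := eqVneq w w'.
    have [i [b [j [Ev Ew]]]] := vs _ wt; exists 0%N, i, (edge_face b j).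
    rewrite Ev Ew; split; first exact: edge_face_dim.
      by apply/cv_in_face/edge_face_corner; left.
    rewrite link_face; last by apply/edge_face_corner; left.
    rewrite setUid; apply/seteqP; split=> F /=.
      by move=> ->; exists j => //; rewrite ffunE eqxx.
    by case=> k; rewrite ffunE; case: eqP => // -> _.
  have [z Sq] := ps _ _ wt wt' ww'.
  have [i [e [j [k [jk Ev Ew' Ez Ew]]]]] := vsq_rot Sq.
  pose f : face (cdim i) := [ffun l => if (l == j) || (l == k) then None else Some (e l)].
  have fe : in_face f e by move=> l c; rewrite ffunE; case: ifP => // _ [].
  exists 1%N, i, f; rewrite Ev Ew Ew'; split.
  - have -> : face_dim f = #|pred2 j k|; last by rewrite card2 jk.
    by apply: fintype.eq_card => l; rewrite !inE ffunE; case: ifP.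
  - exact/cv_in_face.
  rewrite link_face//; apply/seteqP; split=> F /=.
    by case=> ->; [exists k|exists j] => //; rewrite ffunE eqxx ?orbT.
  case=> l; rewrite ffunE; case: ifP => // /orP[/eqP -> | /eqP ->] _ ->; by [right|left].
have /link_edges[n [i [f [fn fv ES]]]] := flagK vv Sfin S0 pair.
have [b Eb fb] := vtx_in_face fv.
exists i, b; split=> // w wt.
have : S (edge_set v w) by exists w.
rewrite ES /= => -[_ _ sub].
have [c wc fc] : exists2 c, w = cv c & in_face f c.
  by apply: vtx_in_face; apply: sub; apply/vtx_in_edge; [exact: vs|right].
apply: vadj_cv erefl _ _; last by exists c.
by rewrite -Eb; apply: vs.
Qed.

Lemma vsq_cube v a b c x y z : vsq a v b x -> vsq b v c y -> vsq a v c z ->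
  exists w, [/\ vsq a x w z, vsq b x w y & vsq c y w z].
Proof.
move=> S1 S2 S3.
have [||i [e [Ev H]]] := @flag_chart v [:: a; b; c].
- move=> w; rewrite !inE => /or3P[]/eqP ->.
  + exact: vadj_sym (vsq_adj S1).
  + exact: vadj_sym (vsq_adj S2).
  + exact: vsq_adj (vsq_rot S3).
- move=> w w'; rewrite !inE => /or3P[]/eqP -> /or3P[]/eqP -> ne.
  + by case: ne.
  + by exists x.
  + by exists z.
  + by exists x; exact: vsq_rot (vsq_rot (vsq_rev S1)).
  + by case: ne.
  + by exists y.
  + by exists z; exact: vsq_rot (vsq_rot (vsq_rev S3)).
  + by exists y; exact: vsq_rot (vsq_rot (vsq_rev S2)).
  + by case: ne.
have [j Ea] : exists j, a = cv (flip e j) by apply: H; rewrite !inE eqxx.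
have [k Eb] : exists k, b = cv (flip e k) by apply: H; rewrite !inE eqxx orbT.
have [l Ec] : exists l, c = cv (flip e l) by apply: H; rewrite !inE eqxx !orbT.
have jk : j != k by apply/eqP => E; apply: (vsq_ne S1); rewrite Ea Eb E.
have kl : k != l by apply/eqP => E; apply: (vsq_ne S2); rewrite Eb Ec E.
have jl : j != l by apply/eqP => E; apply: (vsq_ne S3); rewrite Ea Ec E.
have sqf m m' : m != m' -> forall u, vsq (cv (flip u m)) (@cv i u) (cv (flip u m'))
    (cv (flip (flip u m) m')).
  by move=> mm u; do 3!apply: vsq_rot; apply: vsq_rev; exists i, u, m, m'.
have Ex : x = cv (flip (flip e j) k).
  by apply: vsq_uniq S1 _; rewrite Ea Ev Eb; apply: sqf.
have Ey : y = cv (flip (flip e k) l).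
  by apply: vsq_uniq S2 _; rewrite Eb Ev Ec; apply: sqf.
have Ez : z = cv (flip (flip e j) l).
  by apply: vsq_uniq S3 _; rewrite Ea Ev Ec; apply: sqf.
exists (cv (flip (flip (flip e j) k) l)); rewrite Ex Ey Ez Ea Eb Ec; split.
- by exists i, (flip e j), k, l.
- exists i, (flip e k), j, l; split=> //; by rewrite (flipC e k j).
- exists i, (flip e l), k, j; split; rewrite 1?eq_sym//.
  + by rewrite (flipC e l k).
  + by rewrite (flipC e l k) (flipC (flip e k) l j) (flipC e j k).
  + by rewrite (flipC e l j).
Qed.
End Vertices.

(** * From paths of points to paths of vertices *)

Section Stars.
Variables (R : realType) (X : metricType R) (K : cubeComplex X).
Notation cdim := (cube_dim K).
Notation bits i := {ffun 'I_(cdim i) -> bool}.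
Notation cvt := (@cv R X K).
Notation V := (vtx K).

Lemma coord_le_euclid n (a b : 'rV[R]_n) j : `|a ord0 j - b ord0 j| <= euclid_dist a b.
Proof.
rewrite -sqrtr_sqr /euclid_dist ler_wsqrtr// (bigD1 j)//= lerDl.
by apply: sumr_ge0 => l _; apply: sqr_ge0.
Qed.

Lemma string_ge0 (x y : X) l : cube_string (@chart R X K) x y l -> 0 <= l.
Proof. by elim=> // i a b z m _ _ _ m0; rewrite addr_ge0// euclid_dist_ge0. Qed.

Lemma mdist_le_string (x y : X) l : cube_string (@chart R X K) x y l -> mdist x y <= l.
Proof.
move=> S; rewrite -lee_fin (mdist_length K); apply: ereal_inf_lbound.
by exists l.
Qed.

Lemma string_exists (x y : X) s : mdist x y < s ->
  exists2 l, cube_string (@chart R X K) x y l & l < s.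
Proof.
rewrite -lte_fin (mdist_length K) => /ereal_inf_lt[_ [l Sl <-]]; rewrite lte_fin.
by exists l.
Qed.

Lemma mdist_chart i a b : cube R (cdim i) a -> cube R (cdim i) b ->
  mdist (chart K i a) (chart K i b) <= euclid_dist a b.
Proof.
move=> ca cb; rewrite -[leRHS]addr0; apply: mdist_le_string.
by apply: cube_string_cons => //; apply: cube_string_nil.
Qed.

(** The sup distance to a corner, in some cube; for [r < 1] any cube containing [x] gives the same
    by [near_vtx_in], and along a string [r] grows by at most the length. *)
Definition near_vtx (v : V) (x : X) (r : R) := exists i (b : bits i) a,
  [/\ v = cvt b, cube R (cdim i) a, x = chart K i a &
      forall j, `|a ord0 j - (b j)%:R| <= r].

Lemma near_vtx_in v x r i a : near_vtx v x r -> 0 <= r -> r < 1 ->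
  cube R (cdim i) a -> x = chart K i a ->
  exists2 b, v = cvt b & forall j, `|a ord0 j - (b j)%:R| <= r.
Proof.
move=> [i1 [b1 [a1 [-> ca1 -> H]]]] r0 r1 ca E.
have [|b Eb Hb] := @corner_transfer R X K i1 i a1 a b1 ca1 ca E.
  by move=> j; apply: le_lt_trans (H j) r1.
by exists b => //; apply: Hb.
Qed.

Lemma near_vtx_exists x : exists v, near_vtx v x 2^-1.
Proof.
have [i [a ca <-]] := chart_cover K x.
exists (cvt [ffun j => 2^-1 < a ord0 j]), i, [ffun j => 2^-1 < a ord0 j], a.
split=> // j; rewrite ffunE; have [/andP[a0 a1] _] := ca j.
by case: ltP => h /=; rewrite ler_norml; apply/andP; split; lra.
Qed.

Lemma near_vtx_step v i a a' r : near_vtx v (chart K i a) r -> 0 <= r ->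
  r < 1 -> cube R (cdim i) a -> cube R (cdim i) a' ->
  near_vtx v (chart K i a') (r + euclid_dist a a').
Proof.
move=> nv r0 r1 ca ca'; have [b -> H] := near_vtx_in nv r0 r1 ca erefl.
exists i, b, a'; split=> // j.
have := coord_le_euclid a a' j; rewrite distrC; have := H j.
have := ler_normD (a' ord0 j - a ord0 j) (a ord0 j - (b j)%:R).
by rewrite subrKA; lra.
Qed.

Lemma near_vtx_string v x y l r : cube_string (@chart R X K) x y l ->
  near_vtx v x r -> 0 <= r -> r + l < 1 -> near_vtx v y (r + l).
Proof.
move=> S; elim: S r => [z|i a b z m ca cb S IH] r nv r0 rl; first by rewrite addr0.
have m0 := string_ge0 S; have e0 := euclid_dist_ge0 a b.
rewrite addrA; apply: IH; rewrite -?addrA ?addr_ge0//.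
by apply: near_vtx_step => //; lra.
Qed.

Lemma near_vtx_dist v x y : near_vtx v x 2^-1 -> mdist x y < 2^-1 ->
  exists r, [/\ near_vtx v y r, 0 <= r & r < 1].
Proof.
move=> nv /string_exists[l S l1]; have l0 := string_ge0 S.
exists (2^-1 + l); split; try lra.
by apply: near_vtx_string S nv _ _; lra.
Qed.

(** The vertex [v] stays within sup distance less than 1 as long as the point moves by less than one
    half. So vertices chosen for sufficiently close points lie in a common cube. *)
Lemma near_common v x i a : near_vtx v x 2^-1 -> cube R (cdim i) a ->
  mdist x (chart K i a) < 2^-1 -> exists b : bits i, v = cvt b.
Proof.
move=> nv ca /(near_vtx_dist nv)[r [nv' r0 r1]].
by have [b -> _] := near_vtx_in nv' r0 r1 ca erefl; exists b.
Qed.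

End Stars.

Section Hops.
Variables (R : realType) (X : metricType R) (K : cubeComplex X).
Notation cdim := (cube_dim K).
Notation bits i := {ffun 'I_(cdim i) -> bool}.
Notation cvt := (@cv R X K).
Notation V := (vtx K).
Notation adj := (@vadj R X K).
Notation sq := (@vsq R X K).
Variables (S : Type) (ok : S -> Prop) (pos : S -> V) (step : S -> V -> S).
Hypothesis stepP : forall s v, ok s -> adj (pos s) v ->
  [/\ ok (step s v), pos (step s v) = v & step (step s v) (pos s) = s].
Hypothesis stepsq : forall s b c d, ok s -> sq (pos s) b c d ->
  step (step s b) c = step (step s d) c.

Fixpoint flips n (b : {ffun 'I_n -> bool}) (w : seq 'I_n) :=
  if w is j :: w' then flips (flip b j) w' else b.

Lemma flips_count n (b : {ffun 'I_n -> bool}) w j :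
  flips b w j = b j (+) odd (count_mem j w).
Proof.
elim: w b => [|k w IH] b /=; first by rewrite addbF.
rewrite IH ffunE oddD [k == j]eq_sym; case: (j == k) => //=.
by case: (b j); case: (odd _).
Qed.

Lemma flips_cat n (b : {ffun 'I_n -> bool}) w w' :
  flips b (w ++ w') = flips (flips b w) w'.
Proof. by elim: w b => //=. Qed.

Fixpoint hops i (s : S) (b : bits i) (w : seq 'I_(cdim i)) : S :=
  if w is j :: w' then hops (step s (cvt (flip b j))) (flip b j) w' else s.

Section Chart.
Variable i : cube_index K.
Implicit Types (s : S) (b c : bits i) (w u : seq 'I_(cdim i)).

Lemma hops_cat s b w u : hops s b (w ++ u) = hops (hops s b w) (flips b w) u.
Proof. by elim: w s b => //=. Qed.

Lemma flip_adj b j : adj (cvt b) (cvt (flip b j)).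
Proof. by exists i, b, j. Qed.

Lemma hopsP s b w : ok s -> pos s = cvt b ->
  ok (hops s b w) /\ pos (hops s b w) = cvt (flips b w).
Proof.
elim: w s b => [|j w IH] s b os ps //=.
have aj := flip_adj b j; rewrite -ps in aj.
by have [os1 p1 _] := stepP os aj; apply: IH.
Qed.

Lemma hops_swap s b j k w : ok s -> pos s = cvt b ->
  hops s b [:: j, k & w] = hops s b [:: k, j & w].
Proof.
move=> os ps /=; have [->//|jk] := eqVneq j k.
rewrite (flipC b k j); congr hops; apply: stepsq => //; rewrite ps.
by exists i, b, j, k; split; rewrite // flipC.
Qed.

Lemma hops_cancel s b j w : ok s -> pos s = cvt b ->
  hops s b [:: j, j & w] = hops s b w.
Proof.
move=> os ps /=; rewrite flipK; congr hops.
have aj := flip_adj b j; rewrite -ps in aj *.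
by have [_ _] := stepP os aj.
Qed.

Lemma hops_move s b j w u : ok s -> pos s = cvt b ->
  hops s b (j :: w ++ j :: u) = hops s b (w ++ u).
Proof.
elim: w s b => [|k w IH] s b os ps; first exact: hops_cancel.
rewrite /= -/(hops s b [:: j, k & w ++ j :: u]).
have aj := flip_adj b k; rewrite -ps in aj.
have [os1 p1 _] := stepP os aj.
have := hops_swap j k (w ++ j :: u) os ps; rewrite /= => ->.
exact: IH.
Qed.

(** Cubes have trivial monodromy: the first direction of a closed word occurs again later, and
    commuting it past the letters in between cancels the pair. *)
Lemma hops_closed s b w : ok s -> pos s = cvt b -> flips b w = b -> hops s b w = s.
Proof.
have [n] := ubnP (size w); elim: n w s b => // n IH [|j w] s b //= sw os ps E.
have jw : j \in w.
  apply/negPn/negP => nj; move/ffunP: E => /(_ j).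
  by rewrite flips_count flip_at (count_memPn nj) addbF; case: (b j).
case/splitPr: jw E sw => u v E sw.
rewrite -[hops _ _ _]/(hops s b (j :: u ++ j :: v)) hops_move//.
apply: IH => //; first by move: sw; rewrite !size_cat /=; lia.
apply/ffunP => k; move/ffunP: E => /(_ k); rewrite !flips_count ffunE.
rewrite !count_cat /= !oddD [j == k]eq_sym; case: (k == j) => //=.
by case: (b k); case: (odd _); case: (odd _).
Qed.

Lemma hops_indep s b w u : ok s -> pos s = cvt b -> flips b w = flips b u ->
  hops s b w = hops s b u.
Proof.
move=> os ps E; have [os1 p1] := hopsP w os ps; have [os2 p2] := hopsP u os ps.
have e1 : hops s b (w ++ rev u) = s.
  apply: hops_closed => //; apply/ffunP => k; rewrite flips_cat E.
  by rewrite !flips_count count_rev -addbA addbb addbF.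
have e2 : hops (hops s b w) (flips b w) (rev u ++ u) = hops s b w.
  apply: hops_closed => //; apply/ffunP => k.
  by rewrite flips_count count_cat oddD count_rev addbb addbF.
rewrite hops_cat in e1; rewrite -[LHS]e2 hops_cat e1; congr hops.
apply/ffunP => k; rewrite E !flips_count count_rev.
by rewrite -addbA addbb addbF.
Qed.

Definition direct b c : seq 'I_(cdim i) := [seq j <- enum 'I_(cdim i) | b j != c j].

Lemma flips_direct b c : flips b (direct b c) = c.
Proof.
apply/ffunP => k; rewrite flips_count count_uniq_mem; last first.
  by rewrite filter_uniq// enum_uniq.
rewrite mem_filter mem_enum andbT oddb.
by case: (b k); case: (c k).
Qed.
End Chart.

Lemma hops_transfer i i' (b : bits i) (b' : bits i') s u : cvt b = cvt b' ->
  (forall k, exists c', cvt (flips b (take k u)) = cvt (c' : bits i')) ->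
  exists2 u', hops s b u = hops s b' u' & cvt (flips b u) = cvt (flips b' u').
Proof.
elim: u b b' s => [|j u IH] b b' s E H; first by exists [::].
have [c' Ec] := H 1%N; rewrite /= take0 /= in Ec.
have [k Ek] := cv_flip_transfer E Ec; subst c'.
have [|u' E1 E2] := IH (flip b j) (flip b' k) (step s (cvt (flip b j))) Ec.
  by move=> m; have [c Hc] := H m.+1; exists c.
by exists (k :: u'); rewrite /= ?E1 ?Ec.
Qed.

Definition hop_rel s w s' := exists i (b : bits i) u,
  [/\ pos s = cvt b, w = cvt (flips b u) & s' = hops s b u].

(** The path in the first cube can be replaced by a direct one, whose vertices lie between its ends
    and therefore in both cubes. *)
Lemma hop_rel_uniq s w s1 s2 : ok s -> hop_rel s w s1 -> hop_rel s w s2 -> s1 = s2.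
Proof.
move=> os [i [b [u [ps Ew ->]]]] [i' [b' [u' [ps' Ew' ->]]]].
have E : cvt b = cvt b' by rewrite -ps.
have -> : hops s b u = hops s b (direct b (flips b u)).
  by apply: hops_indep => //; rewrite flips_direct.
have [k|v E1 E2] := @hops_transfer i i' b b' s (direct b (flips b u)) E.
  apply: (cv_between_transfer E (etrans (esym Ew) Ew')) => j.
  set c := flips b u; have [e|ne] := eqVneq (b j) (c j); [left|].
    rewrite flips_count (count_memPn _) ?addbF//.
    apply/negP => /mem_take; rewrite mem_filter => /andP[]; by rewrite e eqxx.
  by move: ne; case: (flips b _ j); case: (b j); case: (c j); auto.
rewrite E1; apply: hops_indep => //.
by apply: (@cv_inj _ _ K i'); rewrite -E2 flips_direct -Ew.
Qed.

Definition hop s w : S :=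
  if pselect (exists s', hop_rel s w s') is left e then projT1 (cid e) else s.

Lemma hopE i (b : bits i) u s : ok s -> pos s = cvt b ->
  hop s (cvt (flips b u)) = hops s b u.
Proof.
move=> os ps; have H : hop_rel s (cvt (flips b u)) (hops s b u) by exists i, b, u.
rewrite /hop; case: pselect => [e|[]]; last by exists (hops s b u).
by case: (cid e) => s' /= H'; apply: hop_rel_uniq os H' H.
Qed.

Lemma hop_chart i (b c : bits i) s : ok s -> pos s = cvt b ->
  hop s (cvt c) = hops s b (direct b c).
Proof. by move=> os ps; rewrite -[c in LHS](flips_direct b c) hopE. Qed.

Lemma hop_ok i (b c : bits i) s : ok s -> pos s = cvt b ->
  ok (hop s (cvt c)) /\ pos (hop s (cvt c)) = cvt c.
Proof.
move=> os ps; rewrite (hop_chart c os ps).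
by have [? ->] := hopsP (direct b c) os ps; rewrite flips_direct.
Qed.

Lemma hop_hop i (b c e : bits i) s : ok s -> pos s = cvt b ->
  hop (hop s (cvt c)) (cvt e) = hop s (cvt e).
Proof.
move=> os ps; have [os1 p1] := hop_ok c os ps.
rewrite (hop_chart e os1 p1) (hop_chart c os ps) -{2}(flips_direct b c) -hops_cat.
rewrite -(hopE (direct b c ++ direct c e) os ps).
by rewrite flips_cat flips_direct flips_direct.
Qed.

Lemma hop_self s : ok s -> hop s (pos s) = s.
Proof.
move=> os; have [i [b E]] := vtxP (pos s).
by rewrite E -[b in cvt b]/(flips b [::]) hopE.
Qed.

Lemma hop_step s v : ok s -> adj (pos s) v -> hop s v = step s v.
Proof.
move=> os [i [b [j [E ->]]]].
by rewrite -[flip b j]/(flips b [:: j]) hopE.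
Qed.

Section Grid.
Variables (M : nat) (P : nat -> nat -> V) (s : S) (o : V).
Hypotheses (os : ok s) (ps : pos s = o).
Hypothesis grid : forall k l, (k < M)%N -> (l < M)%N -> exists i,
  [/\ exists b : bits i, P k l = cvt b, exists b : bits i, P k.+1 l = cvt b,
      exists b : bits i, P k l.+1 = cvt b & exists b : bits i, P k.+1 l.+1 = cvt b].
Hypotheses (left : forall l, (l <= M)%N -> P 0 l = o)
           (right : forall l, (l <= M)%N -> P M l = o)
           (top : forall k, (k <= M)%N -> P k M = o).

Fixpoint grid_row l k : S := if k is k'.+1 then hop (grid_row l k') (P k l) else s.

Lemma grid_row_ok l k : (0 < M)%N -> (l <= M)%N -> (k <= M)%N ->
  ok (grid_row l k) /\ pos (grid_row l k) = P k l.
Proof.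
move=> M0 lM; elim: k => [|k IH] kM /=; first by rewrite left.
have [os1 p1] := IH (ltnW kM).
have [i [b [c [E1 E2]]]] : exists i (b c : bits i), P k l = cvt b /\ P k.+1 l = cvt c.
  case: (ltnP l M) => [lM'|Ml].
    by have [i [[b Eb] [c Ec] _ _]] := grid kM lM'; exists i, b, c.
  have -> : l = M.-1.+1 by lia.
  have lM' : (M.-1 < M)%N by lia.
  by have [i [_ _ [b Eb] [c Ec]]] := grid kM lM'; exists i, b, c.
by rewrite E2; apply: (hop_ok c os1 (etrans p1 E1)).
Qed.

(** Each cell of the grid has its four vertices in one cube, where [hop_hop] makes transport
    independent of the route. *)
Lemma grid_row_up l k : (0 < M)%N -> (l < M)%N -> (k <= M)%N ->
  hop (grid_row l k) (P k l.+1) = grid_row l.+1 k.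
Proof.
move=> M0 lM; elim: k => [|k IH] kM /=.
  by rewrite left// -ps hop_self.
have [i [[b1 E1] [b2 E2] [b3 E3] [b4 E4]]] := grid kM lM.
have [os1 p1] := grid_row_ok M0 (ltnW lM) (ltnW kM).
rewrite -(IH (ltnW kM)) E2 E3 E4.
by rewrite !(@hop_hop i b1)//; rewrite p1.
Qed.

Lemma grid_row_bottom : (0 < M)%N -> grid_row 0 M = s.
Proof.
move=> M0.
have up l : (l < M)%N -> grid_row l.+1 M = grid_row l M.
  move=> lM; rewrite -grid_row_up// right//.
  have [os1 p1] := grid_row_ok M0 (ltnW lM) (leqnn M).
  by rewrite -(right (ltnW lM)) -p1 hop_self.
have -> : grid_row 0 M = grid_row M M.
  have H l : (l <= M)%N -> grid_row l M = grid_row 0 M.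
    by elim: l => // l IH lM; rewrite up// IH// ltnW.
  by rewrite H.
have H k : (k <= M)%N -> grid_row M k = s.
  elim: k => // k IH kM /=; rewrite IH ?(ltnW kM)// top// -ps.
  exact: hop_self.
exact: H.
Qed.
End Grid.
End Hops.

(** * Uniform continuity on compact sets *)

Section UniformContinuity.
Variables (R : realType) (T : pseudoMetricType R) (X : metricType R).

Lemma within_continuous_ball (A : set T) (F : T -> X) z (e : R) :
  {within A, continuous F} -> A z -> 0 < e ->
  exists2 r : R, 0 < r & forall y, A y -> ball z r y -> mdist (F z) (F y) < e.
Proof.
move=> /subspace_continuousP/(_ z) cF Az e0.
have /cvg_ballP/(_ e e0) := cF Az.
rewrite near_withinE => /nbhs_ballP[r /= r0 H]; exists r => // y Ay zy.
by have := H y zy Ay; rewrite ballEmdist.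
Qed.

Lemma compact_uniform_continuity (A : set T) (F : T -> X) (e : R) :
  compact A -> {within A, continuous F} -> 0 < e ->
  exists2 r : R, 0 < r & forall z y, A z -> A y -> ball z r y -> mdist (F z) (F y) < e.
Proof.
move=> /compact_near_coveringP cA cF e0.
pose P (r : R) (z : T) := A z -> forall y, A y -> ball z r y -> mdist (F z) (F y) < e.
have : \forall r \near (0 : R)^'+, A `<=` P r.
  apply: (cA R (0 : R)^'+ P) => z Az.
  have e20 : 0 < e / 2 by lra.
  have [r r0 H] := within_continuous_ball cF Az e20.
  have r20 : 0 < r / 2 by lra.
  near=> x s => Ax y Ay xy.
  have zx : ball z (r / 2) x.
    by near: x; apply/nbhs_ballP; exists (r / 2).
  have sr : s < r / 2 by near: s; exact: nbhs_right_lt.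
  have zx' : ball z r x by apply: le_ball zx; lra.
  have zy : ball z r y.
    rewrite [r]splitr; apply: ball_triangle zx _; apply: le_ball xy; exact: ltW.
  have := H x Ax zx'; have := H y Ay zy.
  by have := mdist_tri (F x) (F z) (F y); rewrite (mdist_sym (F x) (F z)); lra.
move=> near0; near (0 : R)^'+ => r.
have r0 : 0 < r by near: r; exact: nbhs_right_gt.
exists r => // z y Az Ay zy.
have : A `<=` P r by near: r.
by move=> /(_ z Az Az y Ay zy).
Unshelve. all: by end_near.
Qed.

Lemma lipschitz_continuous (p : R -> X) (C : R) : 0 <= C ->
  (forall s t, mdist (p s) (p t) <= C * `|s - t|) -> continuous p.
Proof.
move=> C0 H t; apply/cvg_ballP => e e0; apply/nbhs_ballP.
exists (e / (C + 1)) => /=; first by rewrite divr_gt0//; lra.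
move=> s ts'; have ts : `|t - s| < e / (C + 1) := ts'; rewrite ballEmdist /=.
apply: le_lt_trans (H t s) _.
have : C * `|t - s| <= C * (e / (C + 1)) by apply: ler_wpM2l => //; exact: ltW.
suff : C * (e / (C + 1)) < e by lra.
by rewrite mulrA ltr_pdivrMr; nra.
Qed.
End UniformContinuity.

(** * Concatenation of Lipschitz paths *)

Section PolygonalPaths.
Variables (R : realType) (X : metricType R) (q : nat -> R -> X).
Hypothesis q_join : forall j, q j 1 = q j.+1 0.
Hypothesis q_lip : forall j (s t : R), 0 <= s <= 1 -> 0 <= t <= 1 ->
  mdist (q j s) (q j t) <= `|s - t|.

Definition concat (x : R) : X := q (Num.trunc x) (x - (Num.trunc x)%:R).

Lemma concatE j t : 0 <= t <= 1 -> concat (j%:R + t) = q j t.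
Proof.
move=> /andP[t0 t1]; have [lt|le] := ltP t 1.
  have E : Num.trunc (j%:R + t) = j.
    by apply: truncn_def; rewrite -natr1; apply/andP; split; lra.
  by rewrite /concat E; congr q; lra.
have -> : t = 1 by lra.
have E : Num.trunc (j%:R + 1 : R) = j.+1 by rewrite natr1 natrK.
by rewrite /concat E natr1 subrr q_join.
Qed.

Lemma concat_le k j s t : 0 <= s <= 1 -> 0 <= t <= 1 -> (k = 0%N -> s <= t) ->
  mdist (concat (j%:R + s)) (concat ((j + k)%:R + t)) <= k%:R + t - s.
Proof.
elim: k j s => [|k IH] j s s01 t01 H.
  have st := H erefl; rewrite addn0 !concatE//; apply: le_trans (q_lip _ s01 t01) _.
  by rewrite distrC ger0_norm; lra.
have i1 : 0 <= (1 : R) <= 1 by lra.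
have i0 : 0 <= (0 : R) <= 1 by lra.
have h1 : mdist (concat (j%:R + s)) (concat (j.+1%:R + 0)) <= 1 - s.
  rewrite !concatE// -q_join; apply: le_trans (q_lip _ s01 i1) _.
  by rewrite distrC ger0_norm; lra.
have t0 : 0 <= t by lra.
have h2 := IH j.+1 0 i0 t01 (fun _ => t0).
have := mdist_tri (concat (j%:R + s)) (concat (j.+1%:R + 0)) (concat ((j.+1 + k)%:R + t)).
by rewrite addnS -addSn -[k.+1%:R]natr1; lra.
Qed.

Lemma concat_lip (s t : R) : 0 <= s -> 0 <= t ->
  mdist (concat s) (concat t) <= `|s - t|.
Proof.
have split_nat (x : R) : 0 <= x -> exists j (y : R), [/\ x = j%:R + y, 0 <= y & y < 1].
  move=> x0; exists (Num.trunc x), (x - (Num.trunc x)%:R); split; first by lra.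
    by rewrite subr_ge0 truncn_le.
  by have := truncnS_gt x; rewrite -natr1; lra.
have le x y : 0 <= x -> x <= y -> mdist (concat x) (concat y) <= y - x.
  move=> x0 xy; have y0 := le_trans x0 xy.
  have [j [s' [Es s0 s1]]] := split_nat x x0.
  have [l [t' [Et t0 t1]]] := split_nat y y0.
  have jl : (j <= l)%N.
    rewrite leqNgt; apply/negP => lj; have : l.+1%:R <= j%:R :> R by rewrite ler_nat.
    by rewrite -natr1; lra.
  have := @concat_le (l - j) j s' t'; rewrite subnKC// Es Et.
  have s01 : 0 <= s' <= 1 by lra.
  have t01 : 0 <= t' <= 1 by lra.
  move=> /(_ s01 t01) H; apply: le_trans (H _) _.
    move=> e; have ejl : j = l by apply/eqP; rewrite eqn_leq jl -subn_eq0 e.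
    by subst l; lra.
  by rewrite natrB//; lra.
move=> s0 t0; have [st|/ltW ts] := leP s t.
  by rewrite distrC ger0_norm ?subr_ge0//; exact: le.
by rewrite mdist_sym ger0_norm ?subr_ge0//; exact: le.
Qed.
End PolygonalPaths.

(** * Connectedness of the vertex graph *)

Section SimpleConnectivity.
Variables (R : realType) (X : metricType R) (K : cubeComplex X).
Notation cdim := (cube_dim K).
Notation bits i := {ffun 'I_(cdim i) -> bool}.
Notation cvt := (@cv R X K).
Notation V := (vtx K).
Notation adj := (@vadj R X K).
Notation sq := (@vsq R X K).

Lemma near_vtx_vtx (u v : V) : near_vtx u (val v) 2^-1 -> u = v.
Proof.
move=> nu; have [i [b Eb]] := vtxP v.
have h0 : 0 <= (2^-1 : R) by lra.
have h1 : (2^-1 : R) < 1 by lra.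
have [|c Ec H] := near_vtx_in nu h0 h1 (corner_cube R b); first by rewrite Eb.
rewrite Ec Eb; congr cvt; apply/ffunP => j; have := H j; rewrite mxE.
case: (b j) (c j) => -[] //=; rewrite ?subr0 ?sub0r ?normrN normr1; lra.
Qed.

Lemma edge_path (v w : V) : adj v w \/ v = w -> exists q : R -> X,
  [/\ q 0 = val v, q 1 = val w,
   forall s t, 0 <= s <= 1 -> 0 <= t <= 1 -> mdist (q s) (q t) <= `|s - t| &
   forall t u, 0 <= t <= 1 -> near_vtx u (q t) 2^-1 -> u = v \/ u = w].
Proof.
case=> [[i [b [j [Ev Ew]]]]|<-]; last first.
  exists (fun _ => val v); split=> // [s t _ _|t u _ /near_vtx_vtx]; last by left.
  by rewrite mdistxx.
pose a (t : R) : 'rV[R]_(cdim i) :=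
  \row_l (if l == j then (if b j then 1 - t else t) else (b l)%:R).
have ca t : 0 <= t <= 1 -> cube R (cdim i) (a t).
  move=> /andP[t0 t1] l; split; last by move=> c; rewrite ffunE.
  rewrite mxE; case: eqP => _; first by case: (b j); apply/andP; split; lra.
  by case: (b l); rewrite /= ?lexx ?ler01.
have E0 : a 0 = corner R b.
  apply/rowP => l; rewrite !mxE; case: eqP => [->|//]; case: (b j) => /=; lra.
have E1 : a 1 = corner R (flip b j).
  apply/rowP => l; rewrite !mxE ffunE; case: eqP => [->|//]; case: (b j) => /=; lra.
exists (fun t => chart K i (a t)); split.
- by rewrite E0 Ev.
- by rewrite E1 Ew.
- move=> s t s01 t01; apply: le_trans (mdist_chart (ca s s01) (ca t t01)) _.
  rewrite /euclid_dist (bigD1 j)//= big1 => [|l lj]; last first.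
    by rewrite !mxE (negPf lj) subrr expr0n.
  rewrite addr0 !mxE eqxx; case: (b j); last by rewrite sqrtr_sqr.
  by rewrite (_ : 1 - s - (1 - t) = t - s); [rewrite sqrtr_sqr distrC|lra].
move=> t u t01 nu.
have h0 : 0 <= (2^-1 : R) by lra.
have h1 : (2^-1 : R) < 1 by lra.
have [c Ec H] := near_vtx_in nu h0 h1 (ca t t01) erefl.
have Hl l : l != j -> c l = b l.
  move=> lj; have := H l; rewrite mxE (negPf lj).
  by case: (b l) (c l) => -[] //=; rewrite ?subr0 ?sub0r ?normrN normr1; lra.
have [e|ne] := eqVneq (c j) (b j); [left|right]; rewrite Ec ?Ev ?Ew; congr cvt.
  by apply/ffunP => l; have [->|/Hl] := eqVneq l j.
apply/ffunP => l; have [->|lj] := eqVneq l j; last by rewrite flip_other// Hl.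
by rewrite flip_at; move: ne; case: (c j); case: (b j).
Qed.

Lemma walk_chart i (b c : bits i) : exists p, walk adj (cvt b) (cvt c :: p).
Proof.
suff H u : exists p, walk adj (cvt b) (cvt (flips b u) :: p).
  by have := H (direct b c); rewrite flips_direct.
elim/last_ind: u => [|u j [p IH]]; first by exists [::]; apply: walk_nil.
exists (cvt (flips b u) :: p); rewrite -cats1 flips_cat /=.
by apply: walk_cons IH; exists i, (flips b u), j.
Qed.

Lemma large_inv (r : R) : 0 < r -> exists2 m, (0 < m)%N & m%:R^-1 < r.
Proof.
move=> r0; exists (Num.bound r^-1).+1 => //.
have : r^-1 < (Num.bound r^-1)%:R by apply: archi_boundP; rewrite invr_ge0 ltW.
move=> lt; rewrite -[ltRHS]invrK ltf_pV2 ?posrE ?invr_gt0//.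
by apply: lt_trans lt _; rewrite ltr_nat.
Qed.

Lemma near_vtx_choice (x : X) : exists v : V, near_vtx v x 2^-1.
Proof. exact: near_vtx_exists. Qed.

Lemma walk_connected : path_connected R X -> forall v w : V,
  exists p, walk adj v (w :: p).
Proof.
move=> pc v w; have [p [cp [p0 p1]]] := pc (val v) (val w).
have h0 : 0 < (2^-1 : R) by lra.
have [r r0 H] := compact_uniform_continuity (@segment_compact _ 0 1) cp h0.
have [m m0 mr] := large_inv r0.
have /choice[P hP] k : exists u : V, near_vtx u (p (k%:R / m%:R)) 2^-1.
  exact: near_vtx_choice.
have m0' : 0 < m%:R :> R by rewrite ltr0n.
have in01 k : (k <= m)%N -> `[0, 1]%classic (k%:R / m%:R : R).
  move=> km; rewrite /= in_itv /=; apply: ratio01 => //.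
  by rewrite ler0n ler_nat.
have adj_P k : (k < m)%N -> exists q, walk adj (P k) (P k.+1 :: q).
  move=> km; have [i [a ca Ea]] := chart_cover K (p (k%:R / m%:R)).
  have [|b Eb] := near_common (hP k) ca; first by rewrite Ea mdistxx.
  have [|c Ec] := near_common (hP k.+1) ca.
    rewrite Ea mdist_sym; apply: H; [exact/in01/ltnW|exact: in01|].
    rewrite /ball /= distrC -mulrBl -natr1 addrAC subrr add0r mul1r.
    by rewrite gtr0_norm ?invr_gt0.
  by rewrite Eb Ec; apply: walk_chart.
have P0 : P 0%N = v.
  by apply: near_vtx_vtx; have := hP 0%N; rewrite mul0r p0.
have Pm : P m = w.
  by apply: near_vtx_vtx; have := hP m; rewrite divff ?gt_eqF// p1.
have main k : (k <= m)%N -> exists q, walk adj v (P k :: q).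
  elim: k => [|k IH] km; first by rewrite P0; exists [::]; apply: walk_nil.
  have [q1 W1] := IH (ltnW km); have [q2 W2] := adj_P k km.
  by have [r' W _] := walk_cat W1 W2; exists r'.
by rewrite -Pm; apply: main.
Qed.
End SimpleConnectivity.

(** * Simple connectivity of the square complex *)

Section SquareSimpleConnectivity.
Variables (R : realType) (X : metricType R) (K : cubeComplex X).
Notation cdim := (cube_dim K).
Notation bits i := {ffun 'I_(cdim i) -> bool}.
Notation cvt := (@cv R X K).
Notation V := (vtx K).
Notation adj := (@vadj R X K).
Notation sq := (@vsq R X K).

Lemma walk_nth (o : V) q k : walk adj o q -> (k.+1 < size q)%N ->
  adj (nth o q k.+1) (nth o q k).
Proof.
move=> W; elim: W k => [|v a p va W IH] [|k] //= lt.
exact: IH.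
Qed.

Lemma walk_last (o : V) q : walk adj o q -> forall x, last x q = o.
Proof. by elim=> [|v a p va W IH] x //=; apply: (IH v). Qed.

(** A closed walk is realized by a loop, its contraction [F] is sampled on a fine grid, and each
    sample is rounded to a vertex. The top and both sides of the grid are constant, so transport
    along the bottom row is trivial, and the bottom row retraces the walk. *)
Lemma simply_connected_squares : simply_connected R X ->
  square_simply_connected adj sq.
Proof.
move=> [_ sc] S ok pos step stepP stepsq s o p os ps W.
case: p W => [|x0 p0] W //; set p := x0 :: p0 in W *.
pose W0 := o :: p; pose n := size p; have n0 : (0 < n)%N by [].
pose vs j := nth o W0 (n - j).
have vs0 : vs 0%N = o.
  rewrite /vs subn0 -[n]/((size W0).-1) nth_last; exact: walk_last W o.
have vsn : vs n = o by rewrite /vs subnn.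
have vs_adj j : (j < n)%N -> adj (vs j) (vs j.+1).
  move=> jn; rewrite /vs -(subnSK jn); apply: walk_nth => //=.
  by rewrite ltnS subnSK// leq_subr.
have vs_adj' j : adj (vs j) (vs j.+1) \/ vs j = vs j.+1.
  have [jn|nj] := ltnP j n; first by left; apply: vs_adj.
  right; rewrite /vs; have /eqP -> : (n - j)%N == 0%N by rewrite subn_eq0.
  by have /eqP -> : (n - j.+1)%N == 0%N by rewrite subn_eq0 leqW.
have /choice[q hq] j := edge_path (vs_adj' j).
have q_join j : q j 1 = q j.+1 0.
  by have [_ -> _ _] := hq j; have [-> _ _ _] := hq j.+1.
have q_lip j (a b : R) : 0 <= a <= 1 -> 0 <= b <= 1 -> mdist (q j a) (q j b) <= `|a - b|.
  by have [_ _ H _] := hq j; apply: H.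
have n0' : 0 < n%:R :> R by rewrite ltr0n.
(* [concat] is controlled on nonnegative arguments only; the absolute value gives a path that is
   continuous on the whole line. *)
pose path (t : R) := concat q (n%:R * `|t|).
have cpath : continuous path.
  apply: (@lipschitz_continuous _ _ _ n%:R) => [|a b]; first exact: ltW.
  apply: le_trans (concat_lip q_join q_lip _ _) _; try by rewrite mulr_ge0// ltW.
  by rewrite -mulrBr normrM ger0_norm ?(ltW n0')// ler_pM2l// ler_dist_dist.
have path0 : path 0 = val o.
  have h0 : 0 <= (0 : R) <= 1 by lra.
  have := concatE q_join 0 h0; rewrite add0r /path normr0 mulr0 => ->.
  by have [-> _ _ _] := hq 0%N; rewrite vs0.
have path1 : path 1 = val o.
  have h0 : 0 <= (0 : R) <= 1 by lra.
  have := concatE q_join n h0; rewrite addr0 /path normr1 mulr1 => ->.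
  by have [-> _ _ _] := hq n; rewrite vsn.
have [F [cF HF]] : exists F : R * R -> X,
      {within `[0, 1]%classic `*` `[0, 1]%classic, continuous F} /\
      forall t, 0 <= t <= 1 ->
        [/\ F (t, 0) = path t, F (t, 1) = path 0, F (0, t) = path 0 & F (1, t) = path 0].
  by apply: sc; [exact: continuous_subspaceT|rewrite path0 path1].
have h0 : 0 < (2^-1 : R) by lra.
have cp : compact (`[0, 1]%classic `*` `[0, 1]%classic : set (R * R)).
  by apply: compact_setX; exact: segment_compact.
have [r r0 H] := compact_uniform_continuity cp cF h0.
have [m m0 mr] := large_inv r0.
(* A multiple of the number [n] of edges: the ends of all edges are sampled, and each edge takes [m]
   grid steps. *)
pose M := (n * m)%N; have M0 : (0 < M)%N by rewrite muln_gt0 n0.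
have M0' : 0 < M%:R :> R by rewrite ltr0n.
have Mr : M%:R^-1 < r.
  apply: le_lt_trans mr; rewrite lef_pV2 ?posrE ?ltr0n// ler_nat /M.
  by rewrite leq_pmull.
pose pt k : R := k%:R / M%:R.
have pt01 k : (k <= M)%N -> 0 <= pt k <= 1.
  by move=> kM; apply: ratio01 => //; rewrite ler0n ler_nat.
have ptS k : `|pt k - pt k.+1| < r.
  rewrite distrC -mulrBl -natr1 addrAC subrr add0r mul1r.
  by rewrite gtr0_norm ?invr_gt0.
have pt_in k l : (k <= M)%N -> (l <= M)%N ->
    (`[0, 1]%classic `*` `[0, 1]%classic) (pt k, pt l).
  by move=> kM lM; split; rewrite /= in_itv /=; apply: pt01.
have /choice[P hP] k : exists u : nat -> V, forall l,
    near_vtx (u l) (F (pt k, pt l)) 2^-1.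
  have /choice[u hu] l := near_vtx_choice K (F (pt k, pt l)).
  by exists u.
have ball_pt (x y : R) : `|x - y| < r -> ball x r y by [].
have grid k l : (k < M)%N -> (l < M)%N -> exists i,
  [/\ exists b : bits i, P k l = cvt b, exists b : bits i, P k.+1 l = cvt b,
      exists b : bits i, P k l.+1 = cvt b & exists b : bits i, P k.+1 l.+1 = cvt b].
  move=> kM lM; have [i [a ca Ea]] := chart_cover K (F (pt k, pt l)).
  have nbr k' l' : (k' <= M)%N -> (l' <= M)%N -> `|pt k - pt k'| < r ->
      `|pt l - pt l'| < r -> exists b : bits i, P k' l' = cvt b.
    move=> k'M l'M dk dl; have := near_common (hP k' l') ca; apply.
    rewrite Ea mdist_sym; apply: H.
    - by apply: pt_in; apply: ltnW.
    - exact: pt_in.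
    - by split; apply: ball_pt.
  exists i; split; apply: nbr => //; rewrite ?subrr ?normr0 ?(ltnW kM) ?(ltnW lM)//.
have left l : (l <= M)%N -> P 0%N l = o.
  move=> lM; apply: near_vtx_vtx; have := hP 0%N l.
  have [_ _ E _] := HF _ (pt01 l lM).
  by rewrite (_ : pt 0%N = 0) ?E ?path0// /pt mul0r.
have right l : (l <= M)%N -> P M l = o.
  move=> lM; apply: near_vtx_vtx; have := hP M l.
  have [_ _ _ E] := HF _ (pt01 l lM).
  by rewrite (_ : pt M = 1) ?E ?path0// /pt divff// gt_eqF.
have top k : (k <= M)%N -> P k M = o.
  move=> kM; apply: near_vtx_vtx; have := hP k M.
  have [_ E _ _] := HF _ (pt01 k kM).
  by rewrite (_ : pt M = 1) ?E ?path0// /pt divff// gt_eqF.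
have := grid_row_bottom stepP stepsq os ps grid left right top M0.
set rw := grid_row pos step P s 0%N => rM.
pose L j := drop (n - j) W0.
have LS j : (j < n)%N -> L j.+1 = vs j.+1 :: L j.
  move=> jn; rewrite /L -(subnSK jn) (drop_nth o)//.
  by rewrite /= ltnS leq_subr.
have Ln : L n = W0 by rewrite /L subnn drop0.
have Lhead j : exists t, L j = vs j :: t.
  rewrite /L (drop_nth o); first by exists (drop (n - j).+1 W0).
  by rewrite /= ltnS leq_subr.
suff main j : (j <= n)%N -> rw (j * m)%N = transport step s (L j).
  by have := main n (leqnn n); rewrite Ln -/M rM => <-.
elim: j => [|j IH] jn.
  have [t Et] := Lhead 0%N; have : size (L 0%N) = 1%N by rewrite size_drop subn0 /= subSnn.
  by rewrite Et; case: t {Et}.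
have {}IH := IH (ltnW jn).
have jmM i : (i <= m)%N -> (j * m + i <= M)%N.
  move=> im; apply: (@leq_trans (j.+1 * m)%N); first by rewrite mulSn addnC leq_add2r.
  by rewrite leq_mul2r jn orbT.
have [os1 ps1] : ok (rw (j * m)%N) /\ pos (rw (j * m)%N) = P (j * m)%N 0%N.
  apply: (grid_row_ok stepP stepsq os ps grid left) => //.
  by rewrite -[X in (X <= _)%N]addn0; apply: jmM.
have m0' : 0 < m%:R :> R by rewrite ltr0n.
have Pji i : (i <= m)%N -> near_vtx (P (j * m + i)%N 0%N) (q j (i%:R / m%:R)) 2^-1.
  move=> im; have h := hP (j * m + i)%N 0%N.
  have i01 : 0 <= (i%:R / m%:R : R) <= 1 by apply: ratio01; rewrite // ler0n ler_nat.
  suff E : F (pt (j * m + i)%N, pt 0%N) = q j (i%:R / m%:R) by rewrite -E.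
  have -> : pt 0%N = 0 by rewrite /pt mul0r.
  have p01 := pt01 _ (jmM i im); have [-> _ _ _] := HF _ p01.
  rewrite /path ger0_norm; last by case/andP: p01.
  rewrite -concatE//; congr concat.
  rewrite /pt /M !natrM natrD natrM; apply: (mulIf (lt0r_neq0 m0')).
  rewrite [RHS]mulrDl divfK ?gt_eqF// mulrAC [LHS]mulrC divfK//.
  by rewrite mulf_neq0 ?gt_eqF.
have Pcase i : (i <= m)%N -> P (j * m + i)%N 0%N = vs j \/ P (j * m + i)%N 0%N = vs j.+1.
  move=> im; have [_ _ _] := hq j; apply; last exact: (Pji i im).
  by apply: ratio01; rewrite // ler0n ler_nat.
have Pj0 : P (j * m)%N 0%N = vs j.
  apply: near_vtx_vtx; have := Pji 0%N (leq0n m); rewrite addn0 mul0r.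
  by have [-> _ _ _] := hq j.
have Pjm : P (j.+1 * m)%N 0%N = vs j.+1.
  apply: near_vtx_vtx; have := Pji m (leqnn m); rewrite mulSn addnC divff ?gt_eqF//.
  by have [_ -> _ _] := hq j.
have [i [b [k [Eb Ec]]]] := vs_adj j jn.
have Pbits l : (l <= m)%N -> exists c : bits i, P (j * m + l)%N 0%N = cvt c.
  by move=> /Pcase[->|->]; [exists b|exists (flip b k)].
have along l : (l <= m)%N -> rw (j * m + l)%N =
    hop pos step (rw (j * m)%N) (P (j * m + l)%N 0%N).
  elim: l => [|l IHl] lm; first by rewrite addn0 -ps1 (hop_self stepP stepsq os1).
  have -> : rw (j * m + l.+1)%N =
      hop pos step (rw (j * m + l)%N) (P (j * m + l.+1)%N 0%N) by rewrite addnS.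
  rewrite (IHl (ltnW lm)).
  have [c1 Ec1] := Pbits l (ltnW lm); have [c2 Ec2] := Pbits l.+1 lm.
  rewrite Ec1 Ec2; apply: (hop_hop stepP stepsq _ _ os1 (b := b)).
  by rewrite ps1 Pj0.
have -> : (j.+1 * m)%N = (j * m + m)%N by rewrite mulSn addnC.
rewrite along// (_ : P (j * m + m)%N 0%N = vs j.+1); last by rewrite -Pjm mulSn addnC.
rewrite (hop_step stepP stepsq os1); last by rewrite ps1 Pj0; apply: vs_adj.
have [t Et] := Lhead j; rewrite IH LS// Et.
by [].
Qed.

Lemma cat0_quadrangle_graph : CAT0_cube_complex K ->
  square_simply_connected adj sq /\ forall v w, exists p, walk adj v (w :: p).
Proof.
move=> [sc _]; split; first exact: simply_connected_squares.
by case: sc => pc _; apply: walk_connected.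
Qed.
End SquareSimpleConnectivity.

(** * Wall coordinates of points *)

Section Coordinates.
Variables (R : realType) (X : metricType R) (K : cubeComplex X).
Notation cdim := (cube_dim K).
Notation bits i := {ffun 'I_(cdim i) -> bool}.
Notation cvt := (@cv R X K).
Notation V := (vtx K).
Notation adj := (@vadj R X K).
Notation sq := (@vsq R X K).
Variable d : V -> V -> nat.
Hypothesis G : quadrangle_graph adj sq d.
Notation halfsp := (@halfsp V adj d).
Notation side := (@side V d).

Lemma side_flip2 i (b : bits i) j k : j != k ->
  side (cvt (flip b j)) (cvt b) = side (cvt (flip (flip b k) j)) (cvt (flip b k)).
Proof.
move=> jk; apply: (side_opposite G); rewrite (flipC b k).
do 3!apply: (qg_sq_rot G); exists i, b, k, j; split=> //.
  by rewrite eq_sym.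
by rewrite flipC.
Qed.

Lemma side_flips i (b : bits i) j u : j \notin u ->
  side (cvt (flip b j)) (cvt b) = side (cvt (flip (flips b u) j)) (cvt (flips b u)).
Proof.
elim: u b => [|k u IH] b //=; rewrite inE negb_or => /andP[jk ju].
by rewrite (side_flip2 b jk) IH.
Qed.

Definition hs i (j : 'I_(cdim i)) : set V :=
  side (cvt (flip ([ffun=> false] : bits i) j)) (cvt ([ffun=> false] : bits i)).

Lemma hs_false i (b : bits i) j : b j = false ->
  side (cvt (flip b j)) (cvt b) = hs j.
Proof.
move=> bj; rewrite /hs (@side_flips i [ffun=> false] j (direct ([ffun=> false] : bits i) b)).
  by rewrite flips_direct.
by rewrite mem_filter ffunE bj.
Qed.

Lemma hs_true i (b : bits i) j : b j -> side (cvt (flip b j)) (cvt b) = ~` hs j.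
Proof.
move=> bj; rewrite (sideC G); last exact: flip_adj.
congr (~` _); rewrite -[in side (cvt b)](flipK b j); apply: hs_false.
by rewrite flip_at bj.
Qed.

Lemma halfsp_hs i (j : 'I_(cdim i)) : halfsp (hs j).
Proof. by apply: halfsp_side; apply: (qg_adj_sym G); apply: flip_adj. Qed.

Lemma hs_cv i (b : bits i) j : hs j (cvt b) <-> b j.
Proof.
case bj: (b j); split=> // H.
  have ab := flip_adj b j; rewrite -[hs j]setCK -(hs_true bj) (sideC G ab) setCK.
  exact: (side_l G).
have ab := qg_adj_sym G (flip_adj b j).
by case: (side_r G ab); rewrite hs_false.
Qed.

Lemma hsP i (b : bits i) j : side (cvt (flip b j)) (cvt b) =
  if b j then ~` hs j else hs j.
Proof. by case: ifPn => [/hs_true//|/negbTE/hs_false]. Qed.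

Lemma cube_side i h : halfsp h ->
  [\/ exists j : 'I_(cdim i), h = hs j, exists j : 'I_(cdim i), h = ~` hs j,
      forall b : bits i, h (cvt b) | forall b : bits i, ~ h (cvt b)].
Proof.
move=> hh.
have cut (b : bits i) u : h (cvt b) -> ~ h (cvt (flips b u)) ->
    exists (c : bits i) j, h (cvt c) /\ ~ h (cvt (flip c j)).
  elim: u b => [|j u IH] b hb //= nh.
  have [h1|h1] := EM (h (cvt (flip b j))); first exact: IH h1 nh.
  by exists b, j.
have [[b hb]|no] := EM (exists b : bits i, h (cvt b)); last first.
  by apply: Or44 => b hb; apply: no; exists b.
have [[c hc]|no] := EM (exists b : bits i, ~ h (cvt b)); last first.
  by apply: Or43 => c; apply: contrapT => hc; apply: no; exists c.
have [|e [j [he nhe]]] := cut b (direct b c) hb; first by rewrite flips_direct.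
have -> : h = ~` side (cvt (flip e j)) (cvt e).
  by rewrite (crossing_halfsp G hh (flip_adj e j) he nhe) (sideC G (flip_adj e j)) setCK.
rewrite hsP; case: ifP => _; first by apply: Or41; exists j; rewrite setCK.
by apply: Or42; exists j.
Qed.

Lemma hs_inj i (j k : 'I_(cdim i)) : hs j = hs k -> j = k.
Proof.
move=> E; pose b : bits i := [ffun l => l == j].
have : hs k (cvt b) by rewrite -E hs_cv ffunE eqxx.
by rewrite hs_cv ffunE => /eqP.
Qed.

Lemma hs_neqC i (j k : 'I_(cdim i)) : hs j <> ~` hs k.
Proof.
move=> E; pose b : bits i := [ffun => true].
have : hs j (cvt b) by rewrite hs_cv ffunE.
by rewrite E /= hs_cv ffunE.
Qed.

(** If the wall of [h] cuts the cube in direction [j], this is the [j]-th coordinate, reversed when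
    [h] points the other way. Otherwise all corners are on one side, and it does not matter which
    one is tested. *)
Definition ccoord (h : set V) i (a : 'rV[R]_(cdim i)) : R :=
  if pselect (exists j : 'I_(cdim i), h = hs j) is left e then a ord0 (projT1 (cid e))
  else if pselect (exists j : 'I_(cdim i), h = ~` hs j) is left e
       then 1 - a ord0 (projT1 (cid e))
  else (`[< h (cvt ([ffun=> false] : bits i)) >])%:R.

Lemma ccoord_hs i (j : 'I_(cdim i)) a : ccoord (hs j) a = a ord0 j.
Proof.
rewrite /ccoord; case: pselect => [e|[]]; last by exists j.
by case: (cid e) => k /= /hs_inj ->.
Qed.

Lemma ccoord_hsC i (j : 'I_(cdim i)) a : ccoord (~` hs j) a = 1 - a ord0 j.
Proof.
rewrite /ccoord; case: pselect => [[k /esym/hs_neqC//]|_].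
case: pselect => [e|[]]; last by exists j.
by case: (cid e) => k /= /setC_inj/hs_inj ->.
Qed.


Lemma ccoord_const i h (a : 'rV[R]_(cdim i)) (b : bool) :
  (forall c : bits i, h (cvt c) <-> b) -> ccoord h a = b%:R.
Proof.
move=> H; have no (k : 'I_(cdim i)) (e : bool) : ~ forall c : bits i, hs k (cvt c) <-> e.
  move=> /(_ [ffun=> ~~ e]); rewrite hs_cv ffunE.
  by case: e => -[h1 h2]; [have := h2 isT|have := h1 isT].
rewrite /ccoord; case: pselect => [[j Ej]|_]; first by case: (no j b) => c; rewrite -Ej.
case: pselect => [[j Ej]|_].
  case: (no j (~~ b)) => c; have := H c; rewrite Ej /=.
  by case: b {H}; have [] := EM (hs j (cvt c)); intuition.
by case: b H => H; [rewrite asboolT//; apply/H|rewrite asboolF// => /H].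
Qed.

Lemma ccoordC i h (a : 'rV[R]_(cdim i)) : halfsp h -> ccoord (~` h) a = 1 - ccoord h a.
Proof.
move=> hh; case: (cube_side i hh) => [[j ->]|[j ->]|H|H].
- by rewrite ccoord_hsC ccoord_hs.
- by rewrite setCK ccoord_hs ccoord_hsC; lra.
- rewrite (@ccoord_const i h a true)// (@ccoord_const i _ a false) ?subrr// => c.
  by split=> // -[]; apply: H.
- rewrite (@ccoord_const i h a false) ?(@ccoord_const i _ a true) ?subr0// => c.
    by split=> // _; apply: H.
  by split=> // /H.
Qed.

Lemma ccoord01 i h (a : 'rV[R]_(cdim i)) : halfsp h -> cube R (cdim i) a ->
  0 <= ccoord h a <= 1.
Proof.
move=> hh ca; case: (cube_side i hh) => [[j ->]|[j ->]|H|H].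
- by rewrite ccoord_hs; have [] := ca j.
- by rewrite ccoord_hsC; have [/andP[h0 h1] _] := ca j; apply/andP; split; lra.
- by rewrite (@ccoord_const i h a true)// ?ler01 ?lexx// => c; split.
- by rewrite (@ccoord_const i h a false)// ?ler01 ?lexx// => c; split=> // /H.
Qed.

Lemma ccoord_side i (b : bits i) j a :
  ccoord (side (cvt (flip b j)) (cvt b)) a = if b j then 1 - a ord0 j else a ord0 j.
Proof. by rewrite hsP; case: ifP; rewrite ?ccoord_hs ?ccoord_hsC. Qed.

Lemma ccoord_face i (f : face (cdim i)) b a h : halfsp h -> in_face f b ->
  face_set R f a ->
  (exists j, f j = None /\ (h = side (cvt (flip b j)) (cvt b) \/
                           h = ~` side (cvt (flip b j)) (cvt b))) \/
  ccoord h a = (`[< h (cvt b) >])%:R.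
Proof.
move=> hh fb fa; case: (cube_side i hh) => [[j Ej]|[j Ej]|H|H].
- case fj: (f j) => [c|]; last first.
    by left; exists j; rewrite hsP; case: ifP; rewrite ?setCK; auto.
  right; have [_ /(_ _ fj)] := fa j; rewrite Ej ccoord_hs => ->.
  have := hs_cv b j; rewrite (fb _ _ fj) => E; case: c fj E => fj E.
    by rewrite asboolT//; apply/E.
  by rewrite asboolF// => /E.
- case fj: (f j) => [c|]; last first.
    by left; exists j; rewrite hsP; case: ifP; rewrite ?setCK; auto.
  right; have [_ /(_ _ fj)] := fa j; rewrite Ej ccoord_hsC => ->.
  have := hs_cv b j; rewrite (fb _ _ fj) => E; case: c fj E => fj E.
    by rewrite asboolF ?subrr// => /=; rewrite E.
  by rewrite asboolT ?subr0// => /=; rewrite E.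
- by right; rewrite asboolT//; apply: ccoord_const => c; split.
- by right; rewrite asboolF//; apply: ccoord_const => c; split=> // /H.
Qed.

(** If the wall cuts the common face, the isometry of faces transports the coordinate; otherwise the
    coordinate is constant on that face and is read at any common corner. *)
Lemma ccoord_half i i' a a' h : cube R (cdim i) a -> cube R (cdim i') a' ->
  chart K i a = chart K i' a' -> halfsp h -> ccoord h a = ccoord h a' \/
  forall (b : bits i) (b' : bits i'), cvt b = cvt b' -> ccoord h a = (`[< h (cvt b) >])%:R.
Proof.
move=> ca ca' E hh; have [f [g [k [kI H]]]] := chart_meet_iso ca ca' E.
have [fa Ea] := (H _ _ ca ca').1 E.
have [b fb] := face_corner f.
have [|no] := EM (exists j, f j = None /\ (h = side (cvt (flip b j)) (cvt b) \/
                           h = ~` side (cvt (flip b j)) (cvt b))); last first.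
  right=> b1 b1' /cv_eq E1; have [fb1 _] := (H _ _ (corner_cube R b1) (corner_cube R b1')).1 E1.
  have [[j [fj D]]|//] := ccoord_face hh ((corner_face R f b1).1 fb1) fa.
  case: no; exists j; split=> //; move: D; rewrite !hsP.
  by case: ifP; case: ifP; rewrite ?setCK; tauto.
move=> [j [fj D]]; left.
have fbj := in_face_flip fb fj.
have [c Ec gc] := iso_corner kI fb; have [c1 Ec1 gc1] := iso_corner kI fbj.
have [l El] := iso_flip kI fb fbj Ec Ec1 erefl; subst c1.
have V0 : cvt b = cvt c.
  by apply/cv_eq/H; [exact: corner_cube|exact: corner_cube|split=> //; apply/corner_face].
have V1 : cvt (flip b j) = cvt (flip c l).
  by apply/cv_eq/H; [exact: corner_cube|exact: corner_cube|split=> //; apply/corner_face].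
have S : ccoord (side (cvt (flip b j)) (cvt b)) a = ccoord (side (cvt (flip b j)) (cvt b)) a'.
  rewrite ccoord_side V0 V1 ccoord_side Ea (iso_coord_fwd kI fb fbj Ec Ec1 fa).
  by case: (b j); case: (c l) => //=; lra.
case: D => -> //; rewrite !ccoordC ?S//.
all: by apply: halfsp_side; apply: (qg_adj_sym G); apply: flip_adj.
Qed.

Lemma ccoord_chart i i' a a' h : cube R (cdim i) a -> cube R (cdim i') a' ->
  chart K i a = chart K i' a' -> halfsp h -> ccoord h a = ccoord h a'.
Proof.
move=> ca ca' E hh.
have [//|H] := ccoord_half ca ca' E hh; have [//|H'] := ccoord_half ca' ca (esym E) hh.
have [f [g [k [kI M]]]] := chart_meet_iso ca ca' E.
have [b fb] := face_corner f; have [c Ec gc] := iso_corner kI fb.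
have V0 : cvt b = cvt c.
  by apply/cv_eq/M; [exact: corner_cube|exact: corner_cube|split=> //; apply/corner_face].
by rewrite (H _ _ V0) (H' _ _ (esym V0)) V0.
Qed.

Definition wcoord (h : set V) (x : X) : R := xget 0
  [set r | exists i a, [/\ cube R (cdim i) a, chart K i a = x & r = ccoord h a]].

Lemma coordE i a h : cube R (cdim i) a -> halfsp h -> wcoord h (chart K i a) = ccoord h a.
Proof.
move=> ca hh; rewrite /wcoord; case: xgetP => [r _ [i' [a' [ca' E ->]]]|no].
  exact: ccoord_chart.
by case: (no (ccoord h a)); exists i, a.
Qed.

Lemma coord01 h x : halfsp h -> 0 <= wcoord h x <= 1.
Proof.
move=> hh; have [i [a ca <-]] := chart_cover K x.
by rewrite coordE//; apply: ccoord01.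
Qed.

Lemma coordC h x : halfsp h -> wcoord (~` h) x = 1 - wcoord h x.
Proof.
move=> hh; have [i [a ca <-]] := chart_cover K x.
by rewrite !coordE//; [apply: ccoordC|apply: (halfspC G)].
Qed.

Lemma ccoord_corner i h (b : bits i) : halfsp h ->
  ccoord h (corner R b) = (`[< h (cvt b) >])%:R.
Proof.
move=> hh; have fb : in_face [ffun j => Some (b j)] b by move=> j c; rewrite ffunE => -[].
have [|[j [+ _]]|//] := @ccoord_face i [ffun j => Some (b j)] b (corner R b) h hh fb.
  exact/corner_face.
by rewrite ffunE.
Qed.

Lemma coord_vtx h v : halfsp h -> wcoord h (val v) = (`[< h v >])%:R.
Proof.
move=> hh; have [i [b ->]] := vtxP v.
by rewrite coordE ?ccoord_corner//; apply: corner_cube.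
Qed.

(** The length metric dominates every function with the triangle inequality that is bounded by the
    Euclidean distance on each cube. The Lipschitz estimates below are therefore checked cube by
    cube. *)
Lemma string_lower (rho : X -> X -> R) : (forall x, rho x x <= 0) ->
  (forall x y z, rho x z <= rho x y + rho y z) ->
  (forall i a b, cube R (cdim i) a -> cube R (cdim i) b ->
    rho (chart K i a) (chart K i b) <= euclid_dist a b) ->
  forall x y, rho x y <= mdist x y.
Proof.
move=> r0 rt rc x y; apply/ler_addgt0Pr => e e0.
have /(string_exists K)[l S le] : mdist x y < mdist x y + e by lra.
apply: (@le_trans _ _ l); last exact: ltW.
elim: S {le} => [z|i a b z m ca cb _ IH]; first exact: r0.
by apply: le_trans (rt _ (chart K i b) _) _; apply: lerD => //; apply: rc.
Qed.

Lemma ccoord_lip i h (a b : 'rV[R]_(cdim i)) : halfsp h ->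
  `|ccoord h a - ccoord h b| <= euclid_dist a b.
Proof.
move=> hh; case: (cube_side i hh) => [[j ->]|[j ->]|H|H].
- by rewrite !ccoord_hs; apply: coord_le_euclid.
- rewrite !ccoord_hsC; have -> : 1 - a ord0 j - (1 - b ord0 j) = b ord0 j - a ord0 j by lra.
  by rewrite distrC; apply: coord_le_euclid.
- by rewrite !(@ccoord_const i h _ true) ?subrr ?normr0 ?euclid_dist_ge0// => c; split.
- by rewrite !(@ccoord_const i h _ false) ?subrr ?normr0 ?euclid_dist_ge0// => c; split=> // /H.
Qed.

Lemma coord_lip h x y : halfsp h -> `|wcoord h x - wcoord h y| <= mdist x y.
Proof.
move=> hh; apply: (string_lower (rho := fun x y => `|wcoord h x - wcoord h y|)) => //=.
- by move=> z; rewrite subrr normr0.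
- by move=> u v w; apply: ler_distD.
- by move=> i a b ca cb; rewrite !coordE//; apply: ccoord_lip.
Qed.

(* The vertices of the smallest cell containing x. *)
Definition car (x : X) : set V := [set v | forall h, halfsp h -> h v -> 0 < wcoord h x].

Lemma car_chart i (b : bits i) a : cube R (cdim i) a ->
  (forall j, if b j then 0 < a ord0 j else a ord0 j < 1) -> car (chart K i a) (cvt b).
Proof.
move=> ca H h hh hb; rewrite coordE//.
case: (cube_side i hh) => [[j Ej]|[j Ej]|H'|H'].
- by rewrite Ej ccoord_hs; have := H j; rewrite Ej hs_cv in hb; rewrite hb.
- rewrite Ej ccoord_hsC; have := H j; rewrite Ej /= hs_cv in hb.
  by move/negP/negbTE: hb => ->; lra.
- by rewrite (@ccoord_const i h a true)// => c; split.
- by case: (H' b).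
Qed.

Lemma car_cv i a v : cube R (cdim i) a -> car (chart K i a) v ->
  exists2 b, v = cvt b & forall j, if b j then 0 < a ord0 j else a ord0 j < 1.
Proof.
move=> ca cv; pose b : bits i := [ffun j => `[< hs j v >]].
have E : v = cvt b.
  apply: (eq_vertex G) => h hh hv; apply: contrapT => hb.
  case: (cube_side i hh) => [[j Ej]|[j Ej]|H'|H'].
  - by apply: hb; rewrite Ej hs_cv ffunE; apply/asboolP; rewrite -Ej.
  - by move: hv hb; rewrite Ej /= hs_cv ffunE => ? []; apply/negP/asboolPn.
  - exact: hb (H' b).
  - have := cv h hh hv; rewrite coordE// (@ccoord_const i h a false) ?ltxx// => c.
    by split=> // /H'.
exists b => // j; have [/asboolP bj|bj] := ifPn.
  move: bj; rewrite ffunE => /asboolP/asboolP /(cv _ (halfsp_hs j)).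
  by rewrite coordE ?ccoord_hs//; apply: halfsp_hs.
move: bj; rewrite ffunE => /asboolPn bj.
have := cv _ (halfspC G (halfsp_hs j)) bj; rewrite coordE ?ccoord_hsC; first lra.
- by [].
- exact: (halfspC G (halfsp_hs j)).
Qed.
End Coordinates.

(** * Points and regions described by wall coordinates *)

Section Cones.
Variables (R : realType) (X : metricType R) (K : cubeComplex X).
Notation cdim := (cube_dim K).
Notation bits i := {ffun 'I_(cdim i) -> bool}.
Notation cvt := (@cv R X K).
Notation V := (vtx K).
Notation adj := (@vadj R X K).
Notation sq := (@vsq R X K).
Variable d : V -> V -> nat.
Hypothesis G : quadrangle_graph adj sq d.
Hypothesis flagK : forall v, cell K 0 [set v] -> flag (link K v).
Notation halfsp := (@halfsp V adj d).
Notation side := (@side V d).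
Notation coord := (@wcoord R X K d).
Notation hs := (@hs R X K d _).
Notation ccoord := (@ccoord R X K d).
Notation car := (@car R X K d).

Lemma same_wall v w w' : adj v w -> adj v w' -> side v w = side v w' -> w = w'.
Proof.
move=> vw vw' E; have [||_] := crossing_parallel G vw vw'.
- exact: (side_l G vw).
- by rewrite E; apply: (side_r G vw').
- by rewrite (distxx G) => /esym/(qg_dist0 G).
Qed.

Lemma four_cycle v w w' z : adj v w -> adj v w' -> adj z w -> adj z w' ->
  w <> w' -> v <> z -> sq w v w' z.
Proof.
move=> vw vw' zw zw' ww' vz.
have two u : adj v u -> adj z u -> d v z = (d v u).+1.
  move=> vu zu; case: (qg_dist_adj G v zu) => //; rewrite (dist_adj1 G vu) => -[/esym].
  by move/(qg_dist0 G).
have [c S] := qg_quadrangle G zw zw' ww' (two _ vw zw) (two _ vw' zw').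
by rewrite (dist_adj1 G vw) => -[/esym/(qg_dist0 G) E]; subst c; apply: (qg_sq_rev G).
Qed.

(** [car] depends on coordinates only, so a vertex [b] of the cell of [x] is also one of the cell of
    [y], and the two charts share [b]. A coordinate of [x] differing from its value at [b] belongs
    to a wall that must cut the chart of [y] next to [b] as well, so [x] lies in the common face. *)
Lemma coord_inj x y : (forall h, halfsp h -> coord h x = coord h y) -> x = y.
Proof.
move=> H; have [i [a ca Ex]] := chart_cover K x; have [i' [a' ca' Ey]] := chart_cover K y.
subst x y; pose b : bits i := [ffun j => 0 < a ord0 j].
have cb : car (chart K i a) (cvt b).
  by apply: (car_chart G) => // j; rewrite ffunE; case: ltP => //; lra.
have cb' : car (chart K i' a') (cvt b).
  by move=> h hh hb; rewrite -H//; apply: cb.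
have [b' Eb _] := car_cv G ca' cb'.
have [f [g [k [kI fb gb e M]]]] := cv_meet Eb.
have fa : face_set R f a.
  move=> j; split; first by case: (ca j).
  move=> c fj; have bc := fb _ _ fj; apply: contrapT => ne.
  have ab := flip_adj b j; have ba := qg_adj_sym G ab.
  have hh := halfsp_side d ba : halfsp (side (cvt (flip b j)) (cvt b)).
  have := H _ hh; rewrite !(coordE G)// (ccoord_side G).
  have [|[l [_ El]]|->] := @ccoord_face _ _ _ _ G i' (full_face _) b' a' _ hh _ ca'.
  - by move=> l c'; rewrite ffunE.
  - have al := flip_adj b' l; have la := qg_adj_sym G al.
    have El' : side (cvt (flip b j)) (cvt b) = side (cvt (flip b' l)) (cvt b').
      case: El => // El; case: (side_r G ba); rewrite El Eb; exact: (side_r G la).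
    have E1 : cvt (flip b j) = cvt (flip b' l).
      apply: (same_wall ab); first by rewrite Eb.
      by rewrite (sideC G ba) El' Eb (sideC G la).
    move=> _; have /cv_eq/M[||+ _] := E1; try exact: corner_cube.
    move/corner_face => /(_ j c fj); rewrite flip_at bc; by case: (c).
  - rewrite asboolF; last by rewrite -Eb; apply: (side_r G ba).
    by rewrite bc; move: ne; case: (c) => /= ne Ec; apply: ne; lra.
have ck : cube R (cdim i') (k a) by apply: face_cube (iso_face kI fa).
have E : chart K i a = chart K i' (k a) by apply/M.
rewrite E; congr chart; apply/rowP => l.
have hl := halfsp_hs G l.
by rewrite -(ccoord_hs G) -[RHS](ccoord_hs G) -!(coordE G)// -E H.
Qed.

Lemma chart_coords i (T : set V -> R) :
  (forall k, halfsp k -> T (~` k) = 1 - T k) -> (forall k, halfsp k -> 0 <= T k) ->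
  (forall k, halfsp k -> (forall b : bits i, k (cvt b)) -> T k = 1) ->
  exists2 a, cube R (cdim i) a & forall k, halfsp k -> ccoord k a = T k.
Proof.
move=> TC T0 T1; exists (\row_j T (hs j)).
  move=> j; split; last by move=> c; rewrite ffunE.
  have hj := halfsp_hs G j; rewrite mxE.
  have := T0 _ (halfspC G hj); rewrite TC// => h1; have h0 := T0 _ hj.
  by apply/andP; split; lra.
move=> k hk; case: (cube_side G i hk) => [[j ->]|[j ->]|H'|H'].
- by rewrite (ccoord_hs G) mxE.
- by rewrite (ccoord_hsC G) mxE TC//; apply: halfsp_hs.
- by rewrite (@ccoord_const _ _ _ _ G i k _ true) ?T1// => c; split.
- rewrite (@ccoord_const _ _ _ _ G i k _ false); last by move=> c; split=> // /H'.
  by have := T1 _ (halfspC G hk) H'; rewrite TC// mulr0n; lra.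
Qed.

(** Flagness puts [s] into one cube at [v]; the values of [T] along its directions are a point of
    that cube, and the hypotheses fix [T] on the walls that do not cut it. *)
Lemma cone (v : V) (s : seq V) : (forall w, w \in s -> adj v w) ->
  (forall w w', w \in s -> w' \in s -> w <> w' -> exists z, sq w v w' z) ->
  exists i (b : bits i), v = cvt b /\ forall T : set V -> R,
    (forall k, halfsp k -> T (~` k) = 1 - T k) -> (forall k, halfsp k -> 0 <= T k) ->
    (forall k, halfsp k -> k v -> (forall w, w \in s -> k w) -> T k = 1) ->
    exists2 a, cube R (cdim i) a & forall k, halfsp k -> ccoord k a = T k.
Proof.
move=> vs ps; have [i [b [Ev H]]] := flag_chart flagK vs ps.
exists i, b; split=> // T TC T0 T1; apply: chart_coords => // k hk kb.
by apply: T1 => //; [rewrite Ev|move=> w /H[j ->]].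
Qed.

(** The corner is chosen bit by bit: coordinates equal to 0 or 1 leave no choice, the wall of [k] is
    taken on the side of [k], and the remaining bits follow [x]. *)
Lemma car_toward x k u : halfsp k -> 0 < coord k u -> exists v, [/\ car u v, k v &
  forall h, halfsp h -> h x -> 0 < coord h u -> h <> ~` k -> h v].
Proof.
move=> hk; have [i [a ca <-]] := chart_cover K u; rewrite (coordE G)// => k0.
pose b : bits i := [ffun l => if `[< hs l = k >] then true else
  if `[< hs l = ~` k >] then false else
  if `[< hs l x >] then 0 < a ord0 l else ~~ (a ord0 l < 1)].
exists (cvt b); split.
- apply: (car_chart G) => // l; rewrite ffunE.
  case: asboolP => [E|_]; first by move: k0; rewrite -E (ccoord_hs G).
  case: asboolP => [E|_].
    by move: k0; rewrite -[k]setCK -E (ccoord_hsC G); lra.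
  case: asboolP => _; first by case: ltP => //; lra.
  by case: (ltP (a ord0 l) 1) => //=; lra.
- case: (cube_side G i hk) => [[l E]|[l E]|H|H].
  + by rewrite E (hs_cv G) ffunE asboolT.
  + rewrite E /= (hs_cv G) ffunE asboolF ?asboolT//; first by rewrite E setCK.
    by rewrite E; apply: hs_neqC.
  + exact: H.
  + by move: k0; rewrite (@ccoord_const _ _ _ _ G i k _ false) ?ltxx// => c; split=> // /H.
- move=> h hh hx; rewrite (coordE G)// => h0 hk'.
  case: (cube_side G i hh) => [[l E]|[l E]|H|H].
  + rewrite E (hs_cv G) ffunE; case: asboolP => // _.
    rewrite asboolF -?E// asboolT//; by rewrite E (ccoord_hs G) in h0.
  + rewrite E /= (hs_cv G) ffunE asboolF; last by move=> E'; apply: hk'; rewrite E E'.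
    case: asboolP => // _; rewrite asboolF; last by rewrite E in hx.
    by rewrite E (ccoord_hsC G) in h0; apply/negP; rewrite negbK; lra.
  + exact: H.
  + by move: h0; rewrite (@ccoord_const _ _ _ _ G i h _ false) ?ltxx// => c; split=> // /H.
Qed.

Lemma car_halfsp k u : halfsp k -> 0 < coord k u -> exists2 v, car u v & k v.
Proof.
move=> hk ku; have [i [a ca _]] := chart_cover K u.
by have [v [cv kv _]] := car_toward (cvt ([ffun => false] : bits i)) hk ku; exists v.
Qed.

Lemma car_two h k u : halfsp h -> halfsp k -> h <> ~` k -> 0 < coord h u ->
  0 < coord k u -> exists v, [/\ car u v, h v & k v].
Proof.
move=> hh hk hnk h0 k0; have [x _ hx] := car_halfsp hh h0.
by have [v [cv kv H]] := car_toward x hk k0; exists v; split=> //; apply: H.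
Qed.

Lemma coord1_car k x : halfsp k -> coord k x = 1 <-> car x `<=` k.
Proof.
move=> hk; split=> [E v cv|sub].
  apply: contrapT => nv; have := cv _ (halfspC G hk) nv.
  by rewrite (coordC G)// E subrr ltxx.
apply: contrapT => ne; have /andP[_ k1] := coord01 G x hk.
have : 0 < coord (~` k) x.
  by rewrite (coordC G)// subr_gt0 lt_neqAle k1 andbT; apply/eqP.
by case/(car_halfsp (halfspC G hk)) => v /sub kv.
Qed.

Lemma coord0_car k x : halfsp k -> coord k x = 0 <-> car x `<=` ~` k.
Proof.
move=> hk; have := coord1_car x (halfspC G hk); rewrite (coordC G)// => H.
by split=> [E|/H]; [apply/H; rewrite E subr0|lra].
Qed.

Lemma coord_mono h k x : halfsp h -> halfsp k -> h `<=` k -> coord h x <= coord k x.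
Proof.
move=> hh hk hk'; have [->//|ne] := EM (h = k).
have /andP[h0 h1] := coord01 G x hh; have /andP[k0 k1] := coord01 G x hk.
have [hle|h0'] := leP (coord h x) 0; first lra.
suff -> : coord k x = 1 by [].
apply: contrapT => k1'; have : 0 < coord (~` k) x.
  by rewrite (coordC G)// subr_gt0 lt_neqAle k1 andbT; apply/eqP.
move=> nk0; have hk2 : h <> ~` ~` k by rewrite setCK.
have [v [_ hv nkv]] := car_two hh (halfspC G hk) hk2 h0' nk0.
by case: nkv; apply: hk'.
Qed.

Lemma car_vtx v w : car (val v) w <-> w = v.
Proof.
split=> [cw|-> h hh hv]; last by rewrite (coord_vtx G)// asboolT.
apply: (eq_vertex G) => h hh hw; have := cw h hh hw.
by rewrite (coord_vtx G)//; case: asboolP => //; rewrite ltxx.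
Qed.

(** The full subcomplex on [Y]; for convex [Y] it is an intersection of level sets of coordinates,
    by [regP]. *)
Definition reg (Y : set V) : set X := [set x | car x `<=` Y].

Lemma regP Y x : gconvex d Y -> Y !=set0 ->
  reg Y x <-> forall k, halfsp k -> Y `<=` k -> coord k x = 1.
Proof.
move=> cY Y0; split=> [xY k hk Yk|H v cv].
  by apply/coord1_car => // v /xY/Yk.
apply: (gconvex_halfsp G cY Y0) => h hh Yh.
by have := H h hh Yh => /coord1_car; apply.
Qed.

Lemma reg_vtx Y v : reg Y (val v) <-> Y v.
Proof. by split=> [H|Yv w /car_vtx->//]; apply: H; apply/car_vtx. Qed.

Lemma regI Y Z : reg (Y `&` Z) = reg Y `&` reg Z.
Proof.
apply/seteqP; split=> x; first by move=> H; split=> v /H[].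
by case=> H1 H2 v cv; split; [apply: H1|apply: H2].
Qed.

Lemma reg_sub Y Z : Y `<=` Z -> reg Y `<=` reg Z.
Proof. by move=> YZ x xY v /xY/YZ. Qed.
End Cones.

(** * Retractions and strips *)

Section Lift.
Variables (R : realType) (X : metricType R) (K : cubeComplex X).
Notation cdim := (cube_dim K).
Notation bits i := {ffun 'I_(cdim i) -> bool}.
Notation cvt := (@cv R X K).
Notation V := (vtx K).
Notation adj := (@vadj R X K).
Notation sq := (@vsq R X K).
Variable d : V -> V -> nat.
Hypothesis G : quadrangle_graph adj sq d.
Hypothesis flagK : forall v, cell K 0 [set v] -> flag (link K v).
Notation halfsp := (@halfsp V adj d).
Notation side := (@side V d).
Notation coord := (@wcoord R X K d).
Notation hs := (@hs R X K d _).
Notation ccoord := (@ccoord R X K d).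
Notation car := (@car R X K d).
Notation gate := (@gate V adj d).

Variables (D : set V) (h : set V).
Hypotheses (cD : gconvex d D) (D0 : D !=set0).
Hypothesis strip : crosses D h -> halfsp h /\ forall v, D v ->
  exists w, [/\ D w, adj v w & (h = side v w \/ h = ~` side v w)].

Definition same_walls (k k' : set V) : bool := `[< k = k' \/ k = ~` k' >].

Lemma same_wallsC k k' : same_walls k k' -> same_walls k' k.
Proof. by move=> /asboolP[]->; apply/asboolP; [left|right; rewrite setCK]. Qed.

Lemma same_walls_trans k k' k'' : same_walls k k' -> same_walls k' k'' -> same_walls k k''.
Proof.
move=> /asboolP[]-> /asboolP[]->; apply/asboolP; rewrite ?setCK; by [left|right].
Qed.

Lemma same_walls_hs i (j k : 'I_(cdim i)) : same_walls (hs j) (hs k) -> j = k.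
Proof. by move=> /asboolP[/(hs_inj G)|/(hs_neqC G)]. Qed.

Lemma not_same_walls k k' : ~~ same_walls k k' -> k <> k' /\ k <> ~` k'.
Proof. by move=> /asboolPn H; split=> E; apply: H; [left|right]. Qed.

(** Both [v] and its neighbour [g] have partners across [h] in [D]. These two edges have the same
    wall, so their other ends are adjacent too and close the square. *)
Lemma gate_flip_strip v w g : D v -> D g -> adj v g -> ~~ same_walls (side v g) h ->
  D w -> adj v w -> (h = side v w \/ h = ~` side v w) -> crosses D h ->
  exists z, sq w v g z.
Proof.
move=> Dv Dg vg nh Dw vw Eh cr; have [hh st] := strip cr.
have [p [Dp gp Ep]] := st g Dg.
have wv := qg_adj_sym G vw.
have hk : halfsp (side w v) := halfsp_side d wv.
have kE : side w v = h \/ side w v = ~` h.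
  by rewrite (sideC G vw); case: Eh => ->; rewrite ?setCK; auto.
have kv : ~ side w v v := side_r G wv.
have kg : ~ side w v g.
  move=> kg; move/negP: nh; apply; apply/asboolP.
  have gv := qg_adj_sym G vg.
  rewrite (sideC G gv) -(crossing_halfsp G hk gv kg kv).
  by case: kE => ->; rewrite ?setCK; auto.
have kp : side w v p.
  have : side w v = side g p \/ side w v = ~` side g p.
    by case: kE => ->; case: Ep => ->; rewrite ?setCK; auto.
  case=> E; first by case: kg; rewrite E; apply: (side_l G gp).
  by rewrite E; apply: (side_r G gp).
have [_ wp] := crossing_parallel G wv (qg_adj_sym G gp) kp kg.
rewrite (dist_adj1 G vg) in wp.
exists p; apply: (four_cycle G) => //.
- exact: (qg_adj_sym G (dist1_adj G wp)).
- exact: (qg_adj_sym G gp).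
- by move=> E; apply: kg; rewrite -E; apply: (side_l G wv).
- by move=> E; rewrite -E in kp.
Qed.

Lemma hs_flip i (b : bits i) j : same_walls (hs j) (side (cvt b) (cvt (flip b j))).
Proof.
apply/asboolP; rewrite (sideC G (qg_adj_sym G (flip_adj b j))) (hsP G).
by case: ifP; rewrite ?setCK; auto.
Qed.

Lemma crosses_same_walls k k' : same_walls k k' -> crosses D k -> crosses D k'.
Proof. by move=> /asboolP[]-> //; move/crossesC; rewrite setCK. Qed.

Lemma gate_flip i (b : bits i) j : crosses D (hs j) ->
  adj (gate D (cvt b)) (gate D (cvt (flip b j))) /\
  side (gate D (cvt b)) (gate D (cvt (flip b j))) = side (cvt b) (cvt (flip b j)).
Proof.
move=> cr; apply: (gate_adj G) => //; first exact: flip_adj.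
exact: crosses_same_walls (hs_flip b j) cr.
Qed.

Lemma gate_flip_square i (b : bits i) j k : j != k -> crosses D (hs j) ->
  crosses D (hs k) -> exists z,
  sq (gate D (cvt (flip b j))) (gate D (cvt b)) (gate D (cvt (flip b k))) z.
Proof.
move=> jk cj ck; have [vj _] := gate_flip b cj; have [vk _] := gate_flip b ck.
have [kz _] := gate_flip (flip b k) cj; have [jz _] := gate_flip (flip b j) ck.
rewrite flipC in jz; exists (gate D (cvt (flip (flip b k) j))).
have hj := halfsp_hs G j.
apply: (four_cycle G) => //; try exact: (qg_adj_sym G).
- move=> E; have := gate_crosses G cD D0 (cvt (flip b j)) hj cj.
  rewrite E (gate_crosses G cD D0 (cvt (flip b k)) hj cj) !(hs_cv G) flip_at.
  by rewrite flip_other//; case: (b j) => -[h1 h2]; [have := h1 isT|have := h2 isT].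
- move=> E; have := gate_crosses G cD D0 (cvt b) hj cj.
  rewrite E (gate_crosses G cD D0 (cvt (flip (flip b k) j)) hj cj) !(hs_cv G) flip_at.
  by rewrite flip_other//; case: (b j) => -[h1 h2]; [have := h2 isT|have := h1 isT].
Qed.

(* Coordinates of the retraction onto the cells spanned by D, with the coordinate of
   the wall h set to t; taking h empty gives the plain retraction. *)
Definition lift_coord (c : set V -> R) (t : R) (k : set V) : R :=
  if `[< crosses D k >] then
    if `[< k = h >] then t else if `[< k = ~` h >] then 1 - t else c k
  else (`[< D `<=` k >])%:R.

Lemma halfsp_not_C (k : set V) : halfsp k -> k <> ~` k.
Proof.
by move=> [a [b [ab ->]]] E; have := side_l G ab; rewrite E; apply; apply: (side_l G ab).
Qed.

Lemma not_crosses_dec k : ~ crosses D k -> D `<=` k \/ D `<=` ~` k.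
Proof.
move=> nc; case: D0 => v Dv; have [kv|kv] := EM (k v); [left|right] => u Du.
  by apply: contrapT => ku; apply: nc; split; [exists v|exists u].
by move=> ku; apply: nc; split; [exists u|exists v].
Qed.

Lemma lift_coordC c t : (forall k, halfsp k -> c (~` k) = 1 - c k) ->
  forall k, halfsp k -> lift_coord c t (~` k) = 1 - lift_coord c t k.
Proof.
move=> cC k hk; rewrite /lift_coord.
case: (asboolP (crosses D k)) => [cr|ncr].
  rewrite (asboolT (crossesC cr)).
  case: (asboolP (k = h)) => [E|kh].
    subst k; have [hh _] := strip cr.
    rewrite (asboolT (erefl (~` h))) asboolF// => /esym; exact: halfsp_not_C.
  case: (asboolP (~` k = h)) => [<-|kh'].
    by rewrite setCK asboolT// opprB addrC subrK.
  by rewrite asboolF ?asboolF ?cC// => E; [apply: kh'; rewrite E setCK|apply: kh; apply: setC_inj].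
rewrite asboolF; last by move=> /crossesC; rewrite setCK.
case: (not_crosses_dec ncr) => H.
  rewrite (asboolT H) asboolF ?subrr// => H'; case: D0 => v Dv; exact: (H' v Dv (H v Dv)).
rewrite (asboolT H) asboolF ?subr0// => H'; case: D0 => v Dv; exact: (H v Dv (H' v Dv)).
Qed.

Lemma lift_coord_ge0 c t k : 0 <= t <= 1 -> 0 <= c k -> 0 <= lift_coord c t k.
Proof.
move=> /andP[t0 t1] c0; rewrite /lift_coord; do ?case: asboolP => _ //.
by rewrite subr_ge0.
Qed.

(** The gates of the corners of a cube lie in one cube: across walls that cross [D], adjacent
    corners have adjacent gates, pairwise on squares. The partner [w] across [h] joins these
    neighbours of [v], and [cone] realizes the coordinates. *)
Lemma lift_chart i : exists i', forall a t, cube R (cdim i) a -> 0 <= t <= 1 ->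
  exists2 a', cube R (cdim i') a' &
    forall k, halfsp k -> ccoord k a' = lift_coord (coord^~ (chart K i a)) t k.
Proof.
pose b : bits i := [ffun => false]; pose v := gate D (cvt b).
have Dv : D v := gate_in G cD D0 (cvt b).
pose s := [seq gate D (cvt (flip b j)) | j <- enum 'I_(cdim i) &
            `[< crosses D (hs j) >] && ~~ same_walls (hs j) h].
have sP u : u \in s -> exists j, [/\ crosses D (hs j), ~~ same_walls (hs j) h &
    u = gate D (cvt (flip b j))].
  case/mapP => j; rewrite mem_filter => /andP[/andP[/asboolP cj nj] _] ->.
  by exists j.
have [w Hw] : exists w, crosses D h ->
    [/\ D w, adj v w & (h = side v w \/ h = ~` side v w)].
  have [cr|nc] := EM (crosses D h); last by exists v.
  by have [_ /(_ v Dv)[w ?]] := strip cr; exists w.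
pose s' := if `[< crosses D h >] then w :: s else s.
have s'P u : u \in s' -> u \in s \/ crosses D h /\ u = w.
  rewrite /s'; case: asboolP => [cr|_ ->]; last by left.
  by rewrite inE => /orP[/eqP|->]; auto.
have vs u : u \in s -> adj v u by move=> /sP[j [cj _ ->]]; case: (gate_flip b cj).
have ws u : crosses D h -> u \in s -> exists z, sq w v u z.
  move=> cr /sP[j [cj nj ->]]; have [Dw vw Eh] := Hw cr.
  have [vj Ej] := gate_flip b cj.
  apply: gate_flip_strip => //; first exact: (gate_in G cD D0).
  rewrite Ej; apply: contra nj => H; exact: same_walls_trans (hs_flip b j) H.
have [||i' [b' [Ev H]]] := @cone _ _ _ _ G flagK v s'.
- by move=> u /s'P[/vs//|[cr ->]]; case: (Hw cr).
- move=> u u' /s'P[us|[cr ->]] /s'P[us'|[cr' ->]] // uu'.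
  + have [j [cj nj Ej]] := sP _ us; have [k [ck nk Ek]] := sP _ us'.
    rewrite Ej Ek; apply: gate_flip_square => //.
    by apply/eqP => jk; apply: uu'; rewrite Ej Ek jk.
  + have [z S] := ws u cr' us; exists z.
    by apply: (qg_sq_rev G); do 2!apply: (qg_sq_rot G).
  + exact: ws.
exists i' => a t ca t01; apply: H.
- apply: lift_coordC => k hk; exact: coordC.
- by move=> k hk; apply: lift_coord_ge0 => //; case/andP: (coord01 G (chart K i a) hk).
move=> k hk kv ks; rewrite /lift_coord; case: asboolP => [cr|nc]; last first.
  by rewrite asboolT//; apply/(gate_not_crosses G cD D0 (cvt b) nc).
have sw : crosses D h -> k w.
  move=> crh; apply: ks; rewrite /s' asboolT// inE eqxx//.
have nh : ~~ same_walls k h.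
  apply/negP => E; have crh := crosses_same_walls E cr.
  have [Dw vw Eh] := Hw crh; have kw := sw crh.
  have : k = side v w \/ k = ~` side v w.
    by case/asboolP: E => ->; case: Eh => ->; rewrite ?setCK; auto.
  by case=> E'; [case: (side_r G vw); rewrite -E'|move: kv; rewrite E' => -[]; apply: (side_l G)].
have [n1 n2] := not_same_walls nh; rewrite (asboolF n1) (asboolF n2).
have kb : k (cvt b) by apply/(gate_crosses G cD D0 (cvt b) hk cr).
have kbj j : same_walls k (hs j) -> k (cvt (flip b j)).
  move=> E; have cj := crosses_same_walls E cr.
  apply/(gate_crosses G cD D0 (cvt (flip b j)) hk cr); apply: ks.
  have us : gate D (cvt (flip b j)) \in s.
    apply/mapP; exists j => //; rewrite mem_filter mem_enum andbT asboolT//=.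
    by apply: contra nh => E'; apply: same_walls_trans E E'.
  by rewrite /s'; case: asboolP => // _; rewrite inE us orbT.
rewrite (coordE G)//; case: (cube_side G i hk) => [[j E]|[j E]|H'|H'].
- by move: kb; rewrite E (hs_cv G) ffunE.
- have := kbj j; rewrite E /same_walls => /(_ _)/=; rewrite (hs_cv G) flip_at ffunE /=.
  by move=> [] //; apply/asboolP; right.
- by rewrite (@ccoord_const _ _ _ _ G i k _ true)// => c; split.
- by case: (H' b).
Qed.
End Lift.

Lemma sum_if_uniq (R : realType) n (P : pred 'I_n) (c : R) : 0 <= c ->
  (forall k l, P k -> P l -> k = l) -> \sum_l (if P l then c else 0) <= c.
Proof.
move=> c0 U; rewrite -big_mkcond /=; case: (pickP P) => [k Pk|no].
  rewrite (bigD1 k)//= big_pred0 ?addr0// => l.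
  by apply/negbTE/negP => /andP[/U -/(_ k Pk)->]; rewrite eqxx.
by rewrite big_pred0.
Qed.

Lemma hypot_triangle (R : realType) (a b c e : R) : 0 <= a -> 0 <= b ->
  Num.sqrt ((a + b) ^+ 2 + (c + e) ^+ 2) <=
  Num.sqrt (a ^+ 2 + c ^+ 2) + Num.sqrt (b ^+ 2 + e ^+ 2).
Proof.
move=> a0 b0; apply: ler_sqr_ge0; first by rewrite addr_ge0 ?sqrtr_ge0.
rewrite sqr_sqrtr; last by rewrite addr_ge0 ?sqr_ge0.
by apply: plane_triangle; rewrite ?sqrtr_ge0// sqr_sqrtr// addr_ge0 ?sqr_ge0.
Qed.

Section LiftPoints.
Variables (R : realType) (X : metricType R) (K : cubeComplex X).
Notation cdim := (cube_dim K).
Notation bits i := {ffun 'I_(cdim i) -> bool}.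
Notation cvt := (@cv R X K).
Notation V := (vtx K).
Notation adj := (@vadj R X K).
Notation sq := (@vsq R X K).
Variable d : V -> V -> nat.
Hypothesis G : quadrangle_graph adj sq d.
Hypothesis flagK : forall v, cell K 0 [set v] -> flag (link K v).
Notation halfsp := (@halfsp V adj d).
Notation side := (@side V d).
Notation coord := (@wcoord R X K d).
Notation hs := (@hs R X K d _).
Notation ccoord := (@ccoord R X K d).
Notation car := (@car R X K d).
Notation gate := (@gate V adj d).
Notation reg := (@reg R X K d).

Variables (D : set V) (h : set V).
Hypotheses (cD : gconvex d D) (D0 : D !=set0).
Hypothesis strip : crosses D h -> halfsp h /\ forall v, D v ->
  exists w, [/\ D w, adj v w & (h = side v w \/ h = ~` side v w)].
Notation lcoord x t := (lift_coord D h (coord^~ x) t).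

Definition wlift x t : X :=
  xget x [set y | forall k, halfsp k -> coord k y = lcoord x t k].

Lemma lift_in_chart i : exists i', forall a t, cube R (cdim i) a -> 0 <= t <= 1 ->
  exists a', [/\ cube R (cdim i') a', chart K i' a' = wlift (chart K i a) t &
    forall k, halfsp k -> ccoord k a' = lcoord (chart K i a) t k].
Proof.
have [i' H] := lift_chart G flagK cD D0 strip i; exists i' => a t ca t01.
have [a' ca' Ea] := H a t ca t01; exists a'; split=> //.
rewrite /wlift; case: xgetP => [y _ Hy|/(_ (chart K i' a'))[]].
  by apply: (coord_inj G) => k hk; rewrite Hy// (coordE G)// Ea.
by move=> k hk; rewrite (coordE G)// Ea.
Qed.

Lemma coord_lift x t k : 0 <= t <= 1 -> halfsp k -> coord k (wlift x t) = lcoord x t k.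
Proof.
move=> t01 hk; have [i [a ca <-]] := chart_cover K x.
have [i' /(_ a t ca t01)[a' [ca' <- H]]] := lift_in_chart i.
by rewrite (coordE G)// H.
Qed.

(** The squared length is summed over the directions of the target cube. Each comes from at most one
    direction of the source cube or from the height, and none takes its value from the coordinate
    along [k0]; this leaves room for the displacement along [k0] on the left. *)
Lemma lift_cube i a b t t' k0 : cube R (cdim i) a -> cube R (cdim i) b ->
  0 <= t <= 1 -> 0 <= t' <= 1 -> halfsp k0 -> same_walls k0 h \/ ~ crosses D k0 ->
  mdist (wlift (chart K i a) t) (wlift (chart K i b) t') ^+ 2 +
    (ccoord k0 a - ccoord k0 b) ^+ 2 <= sqdist a b + (t - t') ^+ 2.
Proof.
move=> ca cb t01 t01' hk0 nk0; have [i' H] := lift_in_chart i.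
have [a' [ca' <- Ea]] := H a t ca t01; have [b' [cb' <- Eb]] := H b t' cb t01'.
pose w j := (a ord0 j - b ord0 j) ^+ 2.
have w0 j : 0 <= w j by apply: sqr_ge0.
have e0 : 0 <= (t - t') ^+ 2 by apply: sqr_ge0.
have swC (k k' : set V) : same_walls k k' -> crosses D k -> crosses D k'.
  exact: crosses_same_walls.
have bound l : (a' ord0 l - b' ord0 l) ^+ 2 <=
    (if same_walls (hs l) h then (t - t') ^+ 2 else 0) +
    \sum_j (if same_walls (hs l) (hs j) && ~~ same_walls (hs j) k0 then w j else 0).
  have s0 : 0 <= \sum_j (if same_walls (hs l) (hs j) && ~~ same_walls (hs j) k0
                        then w j else 0).
    by apply: sumr_ge0 => j _; case: ifP.
  have i0 : 0 <= if same_walls (hs l) h then (t - t') ^+ 2 else 0 by case: ifP.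
  have hl := halfsp_hs G l.
  rewrite -!(ccoord_hs G) Ea// Eb// /lift_coord.
  case: asboolP => [cr|_]; last by rewrite subrr expr0n addr_ge0.
  case: asboolP => [E|n1].
    by rewrite ifT ?lerDl//; apply/asboolP; left.
  case: asboolP => [E|n2].
    rewrite ifT; last by apply/asboolP; right.
    have -> : 1 - t - (1 - t') = - (t - t') by lra.
    by rewrite sqrrN lerDl.
  have nh : ~~ same_walls (hs l) h by apply/asboolPn; case.
  have nl : ~~ same_walls (hs l) k0.
    case: nk0 => [E|nc]; last by apply/negP => /swC/(_ cr).
    by apply: contra nh => E'; apply: same_walls_trans E' E.
  rewrite !(coordE G)// (negbTE nh) add0r.
  have one j : same_walls (hs l) (hs j) -> w j <=
      \sum_j (if same_walls (hs l) (hs j) && ~~ same_walls (hs j) k0 then w j else 0).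
    move=> sj; rewrite (bigD1 j)//= sj /= ifT; last first.
      by apply: contra nl => E'; apply: same_walls_trans sj E'.
    by rewrite lerDl; apply: sumr_ge0 => m _; case: ifP.
  case: (cube_side G i hl) => [[j E]|[j E]|H'|H'].
  - apply: le_trans (one j _); first by rewrite E !(ccoord_hs G).
    by apply/asboolP; left.
  - apply: le_trans (one j _); last by apply/asboolP; right.
    rewrite E !(ccoord_hsC G).
    have -> : 1 - a ord0 j - (1 - b ord0 j) = - (a ord0 j - b ord0 j) by lra.
    by rewrite sqrrN.
  - by rewrite !(@ccoord_const _ _ _ _ G i (hs l) _ true) ?subrr ?expr0n// => c; split.
  - rewrite !(@ccoord_const _ _ _ _ G i (hs l) _ false) ?subrr ?expr0n//.
      by move=> c; split=> // /H'.
    by move=> c; split=> // /H'.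
have sumA : \sum_l (if same_walls (hs (l : 'I_(cdim i'))) h then (t - t') ^+ 2 else 0)
    <= (t - t') ^+ 2.
  apply: sum_if_uniq => // k l /= hk hl; apply: (same_walls_hs G).
  exact: same_walls_trans hk (same_wallsC hl).
have sumB : \sum_l \sum_j (if same_walls (hs (l : 'I_(cdim i'))) (hs j) &&
    ~~ same_walls (hs j) k0 then w j else 0) <=
    \sum_j (if ~~ same_walls (hs j) k0 then w j else 0).
  rewrite exchange_big; apply: ler_sum => j _; case: ifP => nj.
    under eq_bigr do rewrite andbT.
    apply: sum_if_uniq => // k l /= hk hl; apply: (same_walls_hs G).
    exact: same_walls_trans hk (same_wallsC hl).
  by rewrite big1// => l _; rewrite andbF.
have sumC : \sum_j (if ~~ same_walls (hs j) k0 then w j else 0) +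
    (ccoord k0 a - ccoord k0 b) ^+ 2 <= sqdist a b.
  have le : \sum_j (if ~~ same_walls (hs j) k0 then w j else 0) <= sqdist a b.
    by apply: ler_sum => j _; case: ifP => // _; apply: sqr_ge0.
  have one j : same_walls (hs j) k0 -> (ccoord k0 a - ccoord k0 b) ^+ 2 = w j ->
      \sum_j (if ~~ same_walls (hs j) k0 then w j else 0) +
      (ccoord k0 a - ccoord k0 b) ^+ 2 <= sqdist a b.
    move=> sj ->; rewrite (bigD1 j)//= sj /= add0r addrC /sqdist [leRHS](bigD1 j)//=.
    by rewrite lerD2l; apply: ler_sum => l _; case: ifP => // _; apply: sqr_ge0.
  case: (cube_side G i hk0) => [[j E]|[j E]|H'|H'].
  - by apply: (one j); rewrite ?E ?(ccoord_hs G)//; apply/asboolP; left.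
  - apply: (one j); rewrite ?E ?(ccoord_hsC G)//; first by apply/asboolP; right; rewrite setCK.
    have -> : 1 - a ord0 j - (1 - b ord0 j) = - (a ord0 j - b ord0 j) by lra.
    by rewrite sqrrN.
  - by rewrite !(@ccoord_const _ _ _ _ G i k0 _ true) ?subrr ?expr0n ?addr0// => c; split.
  - rewrite !(@ccoord_const _ _ _ _ G i k0 _ false) ?subrr ?expr0n ?addr0//.
      by move=> c; split=> // /H'.
    by move=> c; split=> // /H'.
have sumT : sqdist a' b' <= (t - t') ^+ 2 +
    \sum_j (if ~~ same_walls (hs j) k0 then w j else 0).
  apply: le_trans (ler_sum _ (fun l _ => bound l)) _.
  by rewrite big_split /=; apply: lerD.
have : mdist (chart K i' a') (chart K i' b') ^+ 2 <= sqdist a' b'.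
  rewrite -euclid_dist_sqr ler_pXn2r// ?nnegrE ?mdist_ge0 ?euclid_dist_ge0//.
  exact: mdist_chart.
lra.
Qed.

(** The square root of the left-hand side satisfies the triangle inequality, so [string_lower]
    reduces the claim to a single cube. *)
Lemma lift_dist x y t k0 : 0 <= t <= 1 -> halfsp k0 ->
  same_walls k0 h \/ ~ crosses D k0 ->
  mdist (wlift x t) (wlift y t) ^+ 2 + (coord k0 x - coord k0 y) ^+ 2 <= mdist x y ^+ 2.
Proof.
move=> t01 hk0 nk0.
pose rho (x y : X) := Num.sqrt (mdist (wlift x t) (wlift y t) ^+ 2 +
  (coord k0 x - coord k0 y) ^+ 2).
have pos (u v : R) : 0 <= u ^+ 2 + v ^+ 2 by rewrite addr_ge0 ?sqr_ge0.
rewrite -[leLHS]sqr_sqrtr// -/(rho x y) ler_pXn2r ?nnegrE ?sqrtr_ge0 ?mdist_ge0//.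
apply: (string_lower (K := K)).
- by move=> z; rewrite /rho mdistxx subrr expr0n addr0 sqrtr0.
- move=> u v z; apply: le_trans (hypot_triangle _ _ (mdist_ge0 _ _) (mdist_ge0 _ _)).
  rewrite ler_wsqrtr//.
  have -> : coord k0 u - coord k0 v + (coord k0 v - coord k0 z) = coord k0 u - coord k0 z by lra.
  by rewrite lerD2r ler_pXn2r ?nnegrE ?addr_ge0 ?mdist_ge0//; apply: mdist_tri.
- move=> i a b ca cb; rewrite /rho -[leRHS]ger0_norm ?euclid_dist_ge0// -sqrtr_sqr.
  rewrite ler_wsqrtr// euclid_dist_sqr !(coordE G)//.
  by have := lift_cube ca cb t01 t01 hk0 nk0; rewrite subrr expr0n addr0.
Qed.

Section Strip.
Hypothesis crD : crosses D h.
Let hh : halfsp h. Proof. by case: (strip crD). Qed.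

Lemma lift_string x y l s t : cube_string (@chart R X K) x y l ->
  0 <= t <= 1 -> 0 <= t + s * l <= 1 ->
  mdist (wlift x t) (wlift y (t + s * l)) <= Num.sqrt (1 + s ^+ 2) * l.
Proof.
move=> S; elim: S t => [z|i a b z m ca cb S IH] t t01 t01'.
  by rewrite mulr0 addr0 mdistxx mulr0.
have m0 := string_ge0 S; have e0 := euclid_dist_ge0 a b; set e := euclid_dist a b in e0 t01' *.
have t01e : 0 <= t + s * e <= 1.
  have [s0|s0] := leP 0 s.
    have := mulr_ge0 s0 e0; have := mulr_ge0 s0 m0.
    by rewrite mulrDr in t01'; move: (s * e) (s * m) t01' => p q; lra.
  have ns : 0 <= - s by lra.
  have := mulr_ge0 ns e0; have := mulr_ge0 ns m0; rewrite !mulNr.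
  by rewrite mulrDr in t01'; move: (s * e) (s * m) t01' => p q; lra.
apply: le_trans (mdist_tri _ (wlift (chart K i b) (t + s * e)) _) _.
rewrite [in leRHS]mulrDr; apply: lerD; last first.
  by rewrite mulrDr addrA in t01' *; apply: IH.
have H := lift_cube ca cb t01 t01e hh (or_introl (asboolT (or_introl erefl))).
apply: ler_sqr_ge0; first by rewrite mulr_ge0 ?sqrtr_ge0.
rewrite exprMn sqr_sqrtr ?addr_ge0 ?sqr_ge0//.
have c0 := sqr_ge0 (ccoord h a - ccoord h b).
have : (t - (t + s * e)) ^+ 2 = s ^+ 2 * e ^+ 2 by lra.
move: H; rewrite -euclid_dist_sqr -/e => H E.
by rewrite E in H; lra.
Qed.

(** Along a string of nearly minimal length [l] the height varies with constant slope
    [(t' - t) / l], and each piece is at most as long as the corresponding hypotenuse. *)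
Lemma lift_interp x y t t' : 0 <= t <= 1 -> 0 <= t' <= 1 ->
  mdist (wlift x t) (wlift y t') ^+ 2 <= mdist x y ^+ 2 + (t - t') ^+ 2.
Proof.
move=> t01 t01'; have [D0'|Dpos] := leP (mdist x y) 0.
  have -> : y = x.
    by symmetry; apply: mdist0.
  have [i [a ca <-]] := chart_cover K x.
  have := lift_cube ca ca t01 t01' hh (or_introl (asboolT (or_introl erefl))).
  by rewrite subrr expr0n addr0 sqdistxx add0r mdistxx expr0n add0r.
rewrite leNgt; apply/negP => lt.
set Q := mdist (wlift x t) _ in lt.
have q0 : 0 <= Q ^+ 2 - (t - t') ^+ 2 by have := sqr_ge0 (mdist x y); lra.
have : mdist x y < Num.sqrt (Q ^+ 2 - (t - t') ^+ 2).
  rewrite -[ltLHS]ger0_norm ?mdist_ge0// -sqrtr_sqr ltr_sqrt; last first.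
    by have := exprn_gt0 2 Dpos; move: lt; lra.
  by move: lt; lra.
move=> /(string_exists K)[l S lQ]; have l0 := lt_le_trans Dpos (mdist_le_string S).
have lE : (t' - t) / l * l = t' - t by rewrite divfK// gt_eqF.
have := @lift_string _ _ _ ((t' - t) / l) t S t01.
rewrite lE addrC subrK => /(_ t01') => H.
have : Q ^+ 2 <= (Num.sqrt (1 + ((t' - t) / l) ^+ 2) * l) ^+ 2.
  by apply: lerXn2r => //; rewrite nnegrE ?mdist_ge0// mulr_ge0 ?sqrtr_ge0// ltW.
rewrite exprMn sqr_sqrtr ?addr_ge0 ?sqr_ge0// mulrDl -exprMn lE => H'.
have : l ^+ 2 < Q ^+ 2 - (t - t') ^+ 2.
  by rewrite -[ltRHS]sqr_sqrtr// ltr_pXn2r ?nnegrE ?sqrtr_ge0// ltW.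
by move: H'; rewrite mul1r -(sqrrN (t' - t)) opprB; lra.
Qed.
End Strip.

Lemma lift_reg x t : 0 <= t <= 1 -> reg D (wlift x t).
Proof.
move=> t01; apply/(regP G _ cD D0) => k hk Dk; rewrite coord_lift// /lift_coord.
by rewrite asboolF ?asboolT// => -[_ [u /Dk ku nk]].
Qed.

Lemma lift_id x t : reg D x -> 0 <= t <= 1 -> (crosses D h -> coord h x = t) ->
  wlift x t = x.
Proof.
move=> /(regP G _ cD D0) rx t01 ht; apply: (coord_inj G) => k hk.
rewrite coord_lift// /lift_coord; case: asboolP => [cr|nc].
  case: asboolP => [E|_]; first by rewrite -ht -E// E.
  case: asboolP => [E|_//].
  have crh : crosses D h by move/crossesC: cr; rewrite E setCK.
  by rewrite -ht// E (coordC G)//; case: (strip crh).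
case: (not_crosses_dec D0 nc) => Dk; first by rewrite asboolT// (rx k).
rewrite asboolF ?mulr0n; first by have := rx _ (halfspC G hk) Dk; rewrite (coordC G)//; lra.
by move=> Dk'; case: D0 => v Dv; exact: (Dk v Dv (Dk' v Dv)).
Qed.

Section Product.
Hypothesis crD : crosses D h.
Let hh : halfsp h. Proof. by case: (strip crD). Qed.

Let zero01 : 0 <= (0 : R) <= 1. Proof. by rewrite lexx ler01. Qed.

Lemma coord_lift_height x t : 0 <= t <= 1 -> coord h (wlift x t) = t.
Proof.
by move=> t01; rewrite coord_lift// /lift_coord asboolT// (asboolT (erefl h)).
Qed.

Lemma lift_lift x s t : 0 <= s <= 1 -> 0 <= t <= 1 -> wlift (wlift x s) t = wlift x t.
Proof.
move=> s01 t01; apply: (coord_inj G) => k hk; rewrite !coord_lift// /lift_coord.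
case: asboolP => // cr; case: asboolP => // n1; case: asboolP => // n2.
by rewrite coord_lift// /lift_coord asboolT// asboolF// asboolF.
Qed.

(** The strip is the metric product of its base with an interval: [lift_dist] is one inequality of
    Pythagoras' formula and [lift_interp] the other. *)
Lemma strip_dist x y : reg D x -> reg D y -> mdist x y ^+ 2 =
  mdist (wlift x 0) (wlift y 0) ^+ 2 + (coord h x - coord h y) ^+ 2.
Proof.
move=> rx ry; apply/eqP; rewrite eq_le; apply/andP; split; last first.
  by apply: lift_dist => //; left; apply/asboolP; left.
have hx := coord01 G x hh; have hy := coord01 G y hh.
have Ex : wlift (wlift x 0) (coord h x) = x by rewrite lift_lift// lift_id.
have Ey : wlift (wlift y 0) (coord h y) = y by rewrite lift_lift// lift_id.
by rewrite -{1}Ex -{1}Ey; apply: lift_interp.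
Qed.

Lemma strip_base x : reg (D `&` ~` h) (wlift x 0).
Proof.
rewrite regI; split; first exact: lift_reg.
by apply/(coord0_car G) => //; rewrite coord_lift_height.
Qed.

Lemma strip_cat : cat_on (reg (D `&` ~` h)) -> cat_on (reg D).
Proof.
move=> cat0 y z ry rz t t01.
have [w0 rw0 H] := cat0 _ _ (@strip_base y) (@strip_base z) t t01.
have hy := coord01 G y hh; have hz := coord01 G z hh.
have m01 : 0 <= (1 - t) * coord h y + t * coord h z <= 1.
  have /andP[t0 t1] := t01; have /andP[y0 y1] := hy; have /andP[z0 z1] := hz.
  have t1' : 0 <= 1 - t by lra.
  have h1 := mulr_ge0 t1' y0; have h2 := mulr_ge0 t0 z0.
  have h3 : 0 <= (1 - t) * (1 - coord h y) by rewrite mulr_ge0//; lra.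
  have h4 : 0 <= t * (1 - coord h z) by rewrite mulr_ge0//; lra.
  by apply/andP; split; lra.
exists (wlift w0 ((1 - t) * coord h y + t * coord h z)); first exact: lift_reg.
move=> x rx; have := H _ (@strip_base x); rewrite /stewart.
rewrite (strip_dist rx (@lift_reg w0 _ m01)) (strip_dist rx ry) (strip_dist rx rz) (strip_dist ry rz).
rewrite coord_lift_height// lift_lift//.
have -> : wlift w0 0 = w0.
  move: rw0; rewrite regI => -[r1 r2]; apply: lift_id => // _.
  by apply/(coord0_car G).
by move: (mdist _ _) (mdist _ _) (mdist _ _) (mdist _ _) => p q r s; lra.
Qed.
End Product.
End LiftPoints.

Lemma cauchy_limit (R : realType) (w : nat -> R) :
  (forall e, 0 < e -> exists n : nat, forall i j, (n <= i)%N -> (n <= j)%N ->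
     `|w i - w j| < e) ->
  exists l, forall e (n : nat), (forall i j, (n <= i)%N -> (n <= j)%N -> `|w i - w j| < e) ->
    forall i, (n <= i)%N -> `|l - w i| <= e.
Proof.
move=> H; have : cauchy (w @ \oo).
  apply: cauchy_exP => e e0; have [n Hn] := H e e0; exists (w n).
  by exists n => //= i ni; apply: Hn.
move=> /cauchy_cvgP/cvg_ex[l Hl]; exists l => e n Hn i ni.
apply/ler_addgt0Pr => r r0; move/cvgrPdist_lt: Hl => /(_ r r0)[m _ Hm].
have := Hm (maxn m n) (leq_maxl _ _); have := Hn i (maxn m n) ni (leq_maxr _ _).
have := ler_distD (w (maxn m n)) l (w i); rewrite (distrC (w i)); lra.
Qed.

Lemma maximal_seq (T : choiceType) (P : set T) (N : nat) :
  (forall s : seq T, uniq s -> (forall w, w \in s -> P w) -> (size s <= N)%N) ->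
  exists s : seq T, uniq s /\ forall w, w \in s <-> P w.
Proof.
move=> H.
pose Q n := `[< exists s : seq T, [/\ uniq s, forall w, w \in s -> P w & size s = n] >].
have exQ : exists n, Q n by exists 0%N; apply/asboolP; exists [::].
have ubQ n : Q n -> (n <= N)%N by move=> /asboolP[s [us sP <-]]; apply: H.
case: (ex_maxnP exQ ubQ) => n /asboolP[s [us sP <-]] mx.
exists s; split=> // w; split; first exact: sP.
move=> Pw; apply/negPn/negP => ws; suff /mx : Q (size s).+1 by rewrite ltnn.
apply/asboolP; exists (w :: s); split=> //=; first by rewrite ws.
by move=> u; rewrite inE => /orP[/eqP->//|/sP].
Qed.

(** * Completeness *)

Section Complete.
Variables (R : realType) (X : metricType R) (K : cubeComplex X).
Notation cdim := (cube_dim K).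
Notation bits i := {ffun 'I_(cdim i) -> bool}.
Notation cvt := (@cv R X K).
Notation V := (vtx K).
Notation adj := (@vadj R X K).
Notation sq := (@vsq R X K).
Variable d : V -> V -> nat.
Hypothesis G : quadrangle_graph adj sq d.
Notation halfsp := (@halfsp V adj d).
Notation side := (@side V d).
Notation coord := (@wcoord R X K d).
Notation hs := (@hs R X K d _).
Notation ccoord := (@ccoord R X K d).
Notation car := (@car R X K d).

Lemma cdim_le (N : nat) i : (forall n C, cell K n C -> (n <= N)%N) -> (cdim i <= N)%N.
Proof.
move=> H; apply: (H _ (chart K i @` cube R (cdim i))).
exists i, (full_face (cdim i)); split=> //; rewrite /face_dim -[RHS]card_ord.
by apply: fintype.eq_card => j; rewrite !inE ffunE.
Qed.

Lemma wall_in_chart i a v k : cube R (cdim i) a -> car (chart K i a) v -> halfsp k ->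
  k v -> coord k (chart K i a) < 1 ->
  exists2 w, k = side v w & exists (b : bits i) j, v = cvt b /\ w = cvt (flip b j).
Proof.
move=> ca cv hk kv k1; have [b Ev _] := car_cv G ca cv.
have bnd j : k = side (cvt (flip b j)) (cvt b) \/ k = ~` side (cvt (flip b j)) (cvt b) ->
    exists2 w, k = side v w & exists (b : bits i) j, v = cvt b /\ w = cvt (flip b j).
  have ab := flip_adj b j; have ba := qg_adj_sym G ab.
  case=> E; first by case: (side_r G ba); rewrite -E -Ev.
  by exists (cvt (flip b j)); [rewrite E -(sideC G ba) Ev|exists b, j].
have hP j := hsP G b j; rewrite (coordE G)// in k1.
case: (cube_side G i hk) => [[j E]|[j E]|H|H].
- by apply: (bnd j); rewrite hP E; case: ifP; rewrite ?setCK; auto.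
- by apply: (bnd j); rewrite hP E; case: ifP; rewrite ?setCK; auto.
- by move: k1; rewrite (@ccoord_const _ _ _ _ G i k _ true) ?ltxx// => c; split.
- by case: (H b); rewrite -Ev.
Qed.

Lemma near_car v x r : near_vtx v x r -> r < 1 -> car x v.
Proof.
move=> [i [b [a [-> ca -> H]]]] r1; apply: (car_chart G) => // j.
by have := H j; case: (b j) => /=; rewrite ler_norml => /andP[]; lra.
Qed.

Lemma euclid_dist_small n (N : nat) (a b : 'rV[R]_n) e : (n <= N)%N -> 0 <= e ->
  (forall j, `|a ord0 j - b ord0 j| <= e) -> euclid_dist a b <= N.+1%:R * e.
Proof.
move=> nN e0 H; apply: ler_sqr_ge0; first by rewrite mulr_ge0.
rewrite euclid_dist_sqr; apply: (@le_trans _ _ (\sum_(j < n) e ^+ 2)).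
  apply: ler_sum => j _; rewrite -real_normK ?num_real//.
  by apply: lerXn2r; rewrite ?nnegrE.
rewrite sumr_const card_ord -[leLHS]mulr_natl exprMn; apply: ler_wpM2r; first exact: sqr_ge0.
rewrite -natrX ler_nat; apply: leq_trans (leq_trans nN (leqnSn N)) _.
by rewrite -mulnn leq_pmull.
Qed.

(** A Cauchy sequence ends up in the star of one vertex [v], and its wall coordinates converge. Any
    neighbours of [v] across walls with positive limit coordinate lie in a common cube, so there are
    at most [N], and every chart containing a late term realizes the limit coordinates. *)
Theorem complex_complete : finite_dimensional K -> forall u : nat -> X,
  (forall e : R, 0 < e -> exists n : nat, forall i j, (n <= i)%N -> (n <= j)%N ->
     mdist (u i) (u j) < e) ->
  exists l, forall e : R, 0 < e -> exists n : nat, forall i, (n <= i)%N ->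
    mdist (u i) l < e.
Proof.
move=> [N dimN] u cau.
have half0 : 0 < 2^-1 :> R by rewrite invr_gt0.
have [n0 H0] := cau _ half0.
have [v nv] := near_vtx_exists K (u n0).
have cuv m : (n0 <= m)%N -> car (u m) v.
  move=> nm; have [r [nr _ r1]] := near_vtx_dist nv (H0 _ _ (leqnn _) nm).
  exact: near_car nr r1.
have /choice[T HT] : forall k, exists l, halfsp k -> forall e (n : nat),
    (forall i j, (n <= i)%N -> (n <= j)%N -> mdist (u i) (u j) < e) ->
    forall i, (n <= i)%N -> `|l - coord k (u i)| <= e.
  move=> k; have [hk|nk] := EM (halfsp k); last by exists 0.
  have lip i j : `|coord k (u i) - coord k (u j)| <= mdist (u i) (u j) by apply: (coord_lip G).
  have [|l Hl] := @cauchy_limit R (fun m => coord k (u m)).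
    move=> e /cau[n Hn]; exists n => i j ni nj; apply: le_lt_trans (lip i j) (Hn _ _ ni nj).
  exists l => _ e n Hn; apply: Hl => i j ni nj.
  exact: le_lt_trans (lip i j) (Hn _ _ ni nj).
have approx k e : halfsp k -> 0 < e ->
    exists2 n, (n0 <= n)%N & forall i, (n <= i)%N -> `|T k - coord k (u i)| <= e.
  move=> hk e0; have [n Hn] := cau e e0; exists (maxn n0 n); first exact: leq_maxl.
  move=> i ni; apply: (HT k hk e n Hn); exact: leq_trans (leq_maxr _ _) ni.
have TC k : halfsp k -> T (~` k) = 1 - T k.
  move=> hk; apply/eqP; rewrite -subr_eq0 -normr_le0; apply/ler_addgt0Pr => e e0.
  have e2 : 0 < e / 2 by rewrite divr_gt0.
  have [n1 _ h1] := approx k _ hk e2; have [n2 _ h2] := approx _ _ (halfspC G hk) e2.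
  have := h1 (maxn n1 n2) (leq_maxl _ _); have := h2 (maxn n1 n2) (leq_maxr _ _).
  rewrite (coordC G)// add0r.
  by rewrite !ler_norml => /andP[? ?] /andP[? ?]; apply/andP; split; lra.
have T0 k : halfsp k -> 0 <= T k.
  move=> hk; apply/ler_addgt0Pr => e e0; have [n _ h] := approx k e hk e0.
  have /andP[? _] := coord01 G (u n) hk.
  by have := h n (leqnn _); rewrite ler_norml => /andP[? ?]; lra.
have pos k : halfsp k -> 0 < T k ->
    exists2 n, (n0 <= n)%N & forall i, (n <= i)%N -> 0 < coord k (u i).
  move=> hk Tk; have T2 : 0 < T k / 2 by rewrite divr_gt0.
  have [n nn h] := approx k _ hk T2.
  by exists n => // i /h; rewrite ler_norml => /andP[? ?]; lra.
pose P w := adj v w /\ 0 < T (side w v).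
have posP (s : seq V) : (forall w, w \in s -> P w) -> exists2 n, (n0 <= n)%N &
    forall i, (n <= i)%N -> forall w, w \in s -> 0 < coord (side w v) (u i).
  elim: s => [|w s IH] Hs; first by exists n0.
  have [|n1 nn1 h1] := IH; first by move=> x xs; apply: Hs; rewrite inE xs orbT.
  have [vw Tw] := Hs w (mem_head _ _).
  have [n2 _ h2] := pos _ (halfsp_side d (qg_adj_sym G vw)) Tw.
  exists (maxn n1 n2); first by rewrite (leq_trans nn1)// leq_maxl.
  move=> i; rewrite geq_max => /andP[i1 i2] x; rewrite inE => /orP[/eqP->|xs]; first exact: h2.
  exact: h1.
have inchart (s : seq V) i a m : (n0 <= m)%N -> cube R (cdim i) a -> chart K i a = u m ->
    (forall w, w \in s -> adj v w) -> (forall w, w \in s -> 0 < coord (side w v) (u m)) ->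
    exists (b : bits i), v = cvt b /\ forall w, w \in s -> exists j, w = cvt (flip b j).
  move=> nm ca Ea vs Hs; have cvm : car (chart K i a) v by rewrite Ea; apply: cuv.
  have [b Ev _] := car_cv G ca cvm; exists b; split=> // w ws; have vw := vs w ws.
  have k1 : coord (side v w) (chart K i a) < 1.
    have hvw := halfsp_side d vw.
    by have := Hs w ws; rewrite (sideC G vw) (coordC G)// -Ea; lra.
  have [w' E1 [b' [j [Eb' Ew']]]] := wall_in_chart ca cvm (halfsp_side d vw) (side_l G vw) k1.
  exists j; have eb : b = b' by apply: (@cv_inj _ _ K i); rewrite -Eb' -Ev.
  rewrite -eb in Ew'; rewrite -Ew'; apply: (same_wall G vw) => //.
  by rewrite Ew' Ev; apply: flip_adj.
have [|s [us sP]] := @maximal_seq V P N.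
  move=> s us Hs; have [m nm Hm] := posP s Hs.
  have [i [a ca Ea]] := chart_cover K (u m).
  have [|b [Ev Hb]] := inchart s i a m nm ca Ea _ (Hm m (leqnn _)).
    by move=> w /Hs[].
  apply: leq_trans (cdim_le i dimN).
  have : {subset s <= [seq cvt (flip b j) | j <- enum 'I_(cdim i)]}.
    by move=> w /Hb[j ->]; apply: map_f; rewrite mem_enum.
  by move/(uniq_leq_size us); rewrite size_map size_enum_ord.
have [n1 nn1 Hn1] := posP s (fun w => (sP w).1).
have point m i a : (n1 <= m)%N -> cube R (cdim i) a -> chart K i a = u m ->
    exists2 a', cube R (cdim i) a' & forall k, halfsp k -> ccoord k a' = T k.
  move=> nm ca Ea; have nm0 := leq_trans nn1 nm.
  have [|b [Ev Hb]] := inchart s i a m nm0 ca Ea _ (Hn1 m nm).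
    by move=> w /sP[].
  apply: (chart_coords G) => // k hk kb; apply/eqP; rewrite eq_le; apply/andP; split.
    by have := T0 _ (halfspC G hk); rewrite TC//; lra.
  (* Were the limit below 1, the wall of [k] would be dual to an edge at [v] whose far end satisfies
     [P]; this end would lie in the cube, hence in [k]. *)
  rewrite leNgt; apply/negP => Tk.
  have Tk' : 0 < T (~` k) by rewrite TC//; lra.
  have [n2 _ h2] := pos _ (halfspC G hk) Tk'.
  pose M := maxn n1 n2; have [i' [a' ca' Ea']] := chart_cover K (u M).
  have cv' : car (chart K i' a') v.
    by rewrite Ea'; apply: cuv; apply: leq_trans nn1 (leq_maxl _ _).
  have kv : k v by rewrite Ev.
  have [|w Ek [b' [j [Eb' Ew']]]] := wall_in_chart ca' cv' hk kv.
    by have := h2 M (leq_maxr _ _); rewrite (coordC G)// Ea'; lra.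
  have vw : adj v w by rewrite Eb' Ew'; apply: flip_adj.
  have /sP/Hb[l El] : P w by split=> //; rewrite (sideC G vw) -Ek TC//; lra.
  by have := kb (flip b l); rewrite -El Ek; apply: (side_r G).
have [i1 [a1 ca1 Ea1]] := chart_cover K (u n1).
have [a' ca' Ha'] := point n1 i1 a1 (leqnn _) ca1 Ea1.
exists (chart K i1 a') => e e0.
have e2 : 0 < e / 2 / N.+1%:R by rewrite !divr_gt0.
have [n2 Hn2] := cau _ e2; exists (maxn n1 n2) => m; rewrite geq_max => /andP[m1 m2].
have [i [a ca Ea]] := chart_cover K (u m); have [c cc Hc] := point m i a m1 ca Ea.
have -> : chart K i1 a' = chart K i c.
  by apply: (coord_inj G) => k hk; rewrite !(coordE G)// Ha'// Hc.
rewrite -Ea; apply: le_lt_trans (mdist_chart ca cc) _.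
apply: (@le_lt_trans _ _ (e / 2)); last lra.
have -> : e / 2 = N.+1%:R * (e / 2 / N.+1%:R) by rewrite mulrCA divff ?mulr1// pnatr_eq0.
apply: euclid_dist_small; [exact: cdim_le|exact: ltW|move=> j].
have hj := halfsp_hs G j.
rewrite -!(ccoord_hs G) Hc// -(coordE G)// Ea distrC; exact: HT Hn2 _ m2.
Qed.
End Complete.

(** * Approximate projections to nested convex sets *)

Section NestedConvex.
Variables (R : realType) (X : metricType R).
Hypothesis complete : forall u : nat -> X,
  (forall e : R, 0 < e -> exists n : nat, forall i j, (n <= i)%N -> (n <= j)%N ->
     mdist (u i) (u j) < e) ->
  exists l, forall e : R, 0 < e -> exists n : nat, forall i, (n <= i)%N ->
    mdist (u i) l < e.
Variables (S : nat -> set X) (a : X) (M : R).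
Hypothesis S0 : forall n, S n !=set0.
Hypothesis S_sub : forall m n, (m <= n)%N -> S n `<=` S m.
Hypothesis S_mid : forall n c c', S n c -> S n c' -> exists2 m, S n m &
  mdist a m ^+ 2 <= (mdist a c ^+ 2 + mdist a c' ^+ 2) / 2 - mdist c c' ^+ 2 / 4.
Hypothesis S_bound : forall c, S 0%N c -> mdist a c <= M.

(* The approximate projections of a to the S n form a Cauchy sequence. *)
Lemma nested_convex : exists l, forall e : R, 0 < e -> forall N, exists n c,
  [/\ (N <= n)%N, S n c & mdist c l < e].
Proof.
pose r n := inf [set mdist a c | c in S n].
have hasinf n : has_inf [set mdist a c | c in S n].
  split; first by have [c Sc] := S0 n; exists (mdist a c), c.
  by exists 0 => _ [c _ <-]; apply: mdist_ge0.
have rle n c : S n c -> r n <= mdist a c.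
  by move=> Sc; apply: ge_inf; [case: (hasinf n)|exists c].
have r_mono m n : (m <= n)%N -> r m <= r n.
  move=> mn; apply: lb_le_inf; first by case: (hasinf n).
  by move=> _ [c Sc <-]; apply: rle; apply: S_sub Sc.
have hassup : has_sup (range r).
  split; first by exists (r 0%N), 0%N.
  by exists M => _ [n _ <-]; have [c Sc] := S0 n; apply: le_trans (rle n c Sc) (S_bound (S_sub (leq0n n) Sc)).
pose s := sup (range r).
have rs n : r n <= s by apply: sup_upper_bound => //; exists n.
have s0 : 0 <= s.
  apply: le_trans (rs 0%N); apply: lb_le_inf; first by case: (hasinf 0%N).
  by move=> _ [c _ <-]; apply: mdist_ge0.
have /choice[c cP] n : exists c, S n c /\ mdist a c < r n + n.+1%:R^-1.
  have [|_ [c Sc <-] lt] := @inf_adherent _ _ n.+1%:R^-1 _ (hasinf n).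
    by rewrite invr_gt0.
  by exists c.
have [|l Hl] := @complete c.
  (* Two approximate projections at distance at most [s + t] from [a] have a midpoint at distance
     more than [s - t], so their squared distance is less than [16 * t * (s + 1)]. *)
  move=> e e0; pose t := Num.min 1 (e ^+ 2 / (16 * s + 16)).
  have den : 0 < 16 * s + 16 by lra.
  have t0 : 0 < t by rewrite lt_min ltr01 divr_gt0 ?exprn_gt0.
  have t1 : t <= 1 by rewrite ge_min lexx.
  have te : t * (16 * s + 16) <= e ^+ 2 by rewrite -ler_pdivlMr// ge_min lexx orbT.
  have [_ [n1 _ <-] h1] := sup_adherent t0 hassup.
  rewrite -/s in h1; clearbody t s.
  have [n2 h2] := ltr_add_invr t0; rewrite add0r in h2.
  exists (maxn n1 n2) => i j; rewrite !geq_max => /andP[i1 i2] /andP[j1 j2].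
  have near k : (n1 <= k)%N -> (n2 <= k)%N -> S n1 (c k) /\ mdist a (c k) <= s + t.
    move=> k1 k2; have [Sc lt] := cP k; split; first exact: S_sub Sc.
    have : k.+1%:R^-1 <= n2.+1%:R^-1 :> R by rewrite lef_pV2 ?posrE// ler_nat.
    move/le_trans/(_ (ltW h2)) => h3; have := rs k; move: lt h3.
    by move: (k.+1%:R^-1) => q; lra.
  have [Si di] := near i i1 i2; have [Sj dj] := near j j1 j2.
  have [m Sm Hm] := S_mid Si Sj; have rm := rle _ _ Sm.
  have am0 := mdist_ge0 a m.
  have lower : (s + t) ^+ 2 - 4 * t * (s + 1) < mdist a m ^+ 2.
    have [st|st] := leP t s.
      apply: (@lt_le_trans _ _ ((s - t) ^+ 2)); first by lra.
      by apply: lerXn2r; rewrite ?nnegrE//; lra.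
    apply: lt_le_trans (sqr_ge0 _).
    have : t * t <= t * 1 by rewrite ler_wpM2l// ltW.
    have : s * s <= s * t by rewrite ler_wpM2l// ltW.
    have : 0 <= s * t by rewrite mulr_ge0// ltW.
    by lra.
  have dsq x : 0 <= x -> x <= s + t -> x ^+ 2 <= (s + t) ^+ 2.
    by move=> x0 xs; apply: lerXn2r; rewrite ?nnegrE//; lra.
  have := dsq _ (mdist_ge0 _ _) di; have := dsq _ (mdist_ge0 _ _) dj => h4 h5.
  rewrite -(ltr_pXn2r (n := 2))// ?nnegrE ?mdist_ge0 ?ltW//.
  apply: lt_le_trans te.
  by move: Hm h4 h5 lower; move: (mdist _ _ ^+ 2) (mdist _ _ ^+ 2) (mdist _ _ ^+ 2) (mdist _ _ ^+ 2) => p q u v; lra.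
exists l => e e0 N; have [n Hn] := Hl e e0; exists (maxn N n), (c (maxn N n)).
by split; [exact: leq_maxl|case: (cP (maxn N n))|apply: Hn; apply: leq_maxr].
Qed.
End NestedConvex.

(** * Retractions onto convex regions, and extremal walls *)

Section Retraction.
Variables (R : realType) (X : metricType R) (K : cubeComplex X).
Notation cdim := (cube_dim K).
Notation bits i := {ffun 'I_(cdim i) -> bool}.
Notation cvt := (@cv R X K).
Notation V := (vtx K).
Notation adj := (@vadj R X K).
Notation sq := (@vsq R X K).
Variable d : V -> V -> nat.
Hypothesis G : quadrangle_graph adj sq d.
Hypothesis flagK : forall v, cell K 0 [set v] -> flag (link K v).
Notation halfsp := (@halfsp V adj d).
Notation side := (@side V d).
Notation coord := (@wcoord R X K d).
Notation ccoord := (@ccoord R X K d).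
Notation car := (@car R X K d).
Notation gate := (@gate V adj d).
Notation reg := (@reg R X K d).

Section Retr.
Variable (Y : set V).
Hypotheses (cY : gconvex d Y) (Y0 : Y !=set0).

(** The empty set is not a half-space, so no wall gets a prescribed height and the parameter 0 is
    immaterial. *)
Definition retr x : X := @wlift R X K d Y set0 x 0.

Lemma no_strip : crosses Y set0 -> halfsp set0 /\ forall v, Y v ->
  exists w, [/\ Y w, adj v w & (set0 = side v w \/ set0 = ~` side v w)].
Proof. by move=> [[v _ []]]. Qed.

Let zero01 : 0 <= (0 : R) <= 1. Proof. by rewrite lexx ler01. Qed.

Lemma halfsp_proper k : halfsp k -> k <> set0 /\ k <> ~` set0.
Proof.
move=> [v [w [vw ->]]]; split=> E.
  by have := side_l G vw; rewrite E.
by case: (side_r G vw); rewrite E => -[].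
Qed.

Lemma coord_retr x k : halfsp k ->
  coord k (retr x) = if `[< crosses Y k >] then coord k x else (`[< Y `<=` k >])%:R.
Proof.
move=> hk; have [n1 n2] := halfsp_proper hk.
rewrite /retr (coord_lift G flagK cY Y0 no_strip)// /lift_coord.
by rewrite (asboolF n1) (asboolF n2).
Qed.

Lemma retr_reg x : reg Y (retr x).
Proof. exact: (lift_reg G flagK cY Y0 no_strip). Qed.

Lemma retr_id x : reg Y x -> retr x = x.
Proof. by move=> rx; apply: (lift_id G flagK cY Y0 no_strip) => // -[[v _ []]]. Qed.

Lemma retr_dist x y k : halfsp k -> ~ crosses Y k ->
  mdist (retr x) (retr y) ^+ 2 + (coord k x - coord k y) ^+ 2 <= mdist x y ^+ 2.
Proof.
by move=> hk nk; apply: (lift_dist G flagK cY Y0 no_strip) => //; right.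
Qed.

Lemma retr_lip x y : mdist (retr x) (retr y) <= mdist x y.
Proof.
have [[k [hk nk]]|no] := EM (exists k, halfsp k /\ ~ crosses Y k).
  apply: ler_sqr_ge0; first exact: mdist_ge0.
  apply: le_trans (_ : _ <= _) (retr_dist x y hk nk).
  by rewrite lerDl sqr_ge0.
have E z : retr z = z.
  apply: (coord_inj G) => k hk; rewrite coord_retr// asboolT//.
  by apply: contrapT => nk; apply: no; exists k.
by rewrite !E.
Qed.

Lemma retr_in_chart i : exists i', forall a, cube R (cdim i) a ->
  exists a', cube R (cdim i') a' /\ chart K i' a' = retr (chart K i a).
Proof.
have [i' H] := lift_in_chart G flagK cY Y0 no_strip i; exists i' => a ca.
by have [a' [ca' Ea _]] := H a 0 ca zero01; exists a'.
Qed.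
End Retr.

Lemma car_midpoint i a b : cube R (cdim i) a -> cube R (cdim i) b ->
  exists2 m, cube R (cdim i) m & forall k, halfsp k ->
    coord k (chart K i m) = (coord k (chart K i a) + coord k (chart K i b)) / 2.
Proof.
move=> ca cb; pose T k := (coord k (chart K i a) + coord k (chart K i b)) / 2.
have [||k hk kb|m cm Hm] := @chart_coords _ _ _ _ G i T.
- by move=> k hk; rewrite /T !(coordC G)//; lra.
- move=> k hk; rewrite /T.
  by have := coord01 G (chart K i a) hk; have := coord01 G (chart K i b) hk; lra.
- rewrite /T !(coordE G)// !(@ccoord_const _ _ _ _ G i k _ true); last 2 first.
    by move=> c; split.
    by move=> c; split.
  by rewrite !mulr1n; lra.
by exists m => // k hk; rewrite (coordE G)// Hm.
Qed.

Section Extremal.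
Variables (Y h : set V).
Hypotheses (cY : gconvex d Y) (hh : halfsp h) (crh : crosses Y h).
Hypothesis extr : forall k, halfsp k -> crosses Y k ->
  Y `&` k `<=` Y `&` h -> Y `&` h `<=` Y `&` k.

Lemma between_vertices u x y v : d u x + (d y v).+1 = d u v -> adj x y ->
  d u x + d x v = d u v /\ d u y + d y v = d u v.
Proof.
move=> D xy; have := qg_dist_triangle G u x v; have := qg_dist_triangle G u y v.
have := qg_dist_triangle G u x y; have := qg_dist_triangle G x y v.
rewrite (dist_adj1 G xy); lia.
Qed.

(** If [v] is not the last vertex [x] of [h] on the way to its gate beyond [h], some half-space
    contains [v] but not [x]. By the gate property its trace on [Y] is inside [h], and it misses
    [x], against minimality. *)
Lemma extremal_partner v : Y v -> h v -> exists w, [/\ Y w, ~ h w & adj v w].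
Proof.
move=> Yv hv; have cZ := gconvexI cY (halfsp_convex G (halfspC G hh)).
have Z0 : (Y `&` ~` h) !=set0 by case: crh => _ [u Yu nhu]; exists u.
have [Yg nhg] := gate_in G cZ Z0 v; set g := gate _ _ in Yg nhg.
have [x [y [xy hx nhy D]]] := crossing_edge G hv nhg.
have [D1 D2] := between_vertices D xy.
have Yx := cY Yv Yg D1; have Yy := cY Yv Yg D2.
have [E|vx] := EM (v = x); first by exists y; rewrite E.
have [k [hk kv nkx]] := separating G vx.
have nkg : ~ k g by move=> kg; exact: nkx (halfsp_convex G hk kv kg D1).
have sub := gate_sub G cZ Z0 (halfspC G hk) nkg (fun H => H kv).
have [] := extr hk (conj (ex_intro2 _ _ v Yv kv) (ex_intro2 _ _ x Yx nkx)) _ (conj Yx hx).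
  move=> u [Yu ku]; split=> //; apply: contrapT => nhu.
  exact: sub u (conj Yu nhu) ku.
by [].
Qed.

(* When Y meets the far side of h in as few vertices as possible, these vertices and
   their neighbours across h span a product of a convex set with an edge. *)
Definition strip_of : set V :=
  Y `&` [set v | forall k, halfsp k -> Y `&` h `<=` k -> k <> h -> k v].

Lemma strip_convex : gconvex d strip_of.
Proof.
apply: gconvexI => // u v w Hu Hv D k hk sub kh.
exact: (halfsp_convex G hk) (Hu k hk sub kh) (Hv k hk sub kh) D.
Qed.

Lemma strip_side v : Y v -> h v -> strip_of v.
Proof. by move=> Yv hv; split=> // k _ sub _; apply: sub. Qed.

(** For [v] outside [h], the only wall between [v] and its gate in the part of [Y] inside [h] is
    that of [h], so the gate is the partner. For [v] in [h] it comes from [extremal_partner]. *)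
Lemma strip_partner v : strip_of v -> exists w,
  [/\ strip_of w, adj v w, (h = side v w \/ h = ~` side v w) & (h v <-> ~ h w)].
Proof.
move=> [Yv Hv]; have [hv|nhv] := EM (h v).
  have [w [Yw nhw vw]] := extremal_partner Yv hv.
  have E := crossing_halfsp G hh vw hv nhw.
  exists w; split=> //; last by left.
  split=> // k hk sub kh; apply: contrapT => nkw; apply: kh.
  by rewrite E; apply: (crossing_halfsp G) => //; apply: sub.
have cC := gconvexI cY (halfsp_convex G hh).
have C0 : (Y `&` h) !=set0 by case: crh => -[u Yu hu] _; exists u.
have [Yg hg] := gate_in G cC C0 v; set g := gate _ _ in Yg hg.
have [x [y [xy hx nhy D]]] := crossing_edge G hg nhv.
have [D1 D2] := between_vertices D xy.
have sep k : halfsp k -> k g -> ~ k v -> k = h.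
  move=> hk kg nkv; apply: contrapT => kh.
  exact: nkv (Hv k hk (gate_sub G cC C0 hk kg nkv) kh).
have gx : g = x.
  apply: contrapT => gx; have [k [hk kg nkx]] := separating G gx.
  have nkv : ~ k v by move=> kv; exact: nkx (halfsp_convex G hk kg kv D1).
  by case: nkx; rewrite (sep k hk kg nkv).
have yv : y = v.
  apply: contrapT => yv; have [k [hk ky nkv]] := separating G yv.
  have kg : k g.
    apply: contrapT => nkg.
    exact: (halfsp_convex G (halfspC G hk)) nkg nkv D2 ky.
  by case: nhy; rewrite -(sep k hk kg nkv).
subst y; rewrite -gx in xy; exists g; split.
- exact: strip_side.
- exact: (qg_adj_sym G).
- by right; rewrite (crossing_halfsp G hh xy hg nhv) (sideC G (qg_adj_sym G xy)).
- by split=> // nh; case: nh.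
Qed.
End Extremal.
End Retraction.

Lemma minimal_in_seq (T : eqType) (V : Type) (f : T -> set V) (Q : T -> Prop) (L : seq T) :
  (exists2 a, a \in L & Q a) -> exists a, [/\ a \in L, Q a &
    forall b, b \in L -> Q b -> f b `<=` f a -> f a `<=` f b].
Proof.
elim: L => [|a L IH] [b bL Qb]; first by rewrite in_nil in bL.
have [/IH[m [mL Qm Hm]]|no] := EM (exists2 a, a \in L & Q a); last first.
  have Qa : Q a.
    by move: bL; rewrite inE => /orP[/eqP<-//|bL]; case: no; exists b.
  exists a; split=> //; first exact: mem_head.
  by move=> c; rewrite inE => /orP[/eqP->//|cL Qc]; case: no; exists c.
have [[Qa am]|na] := EM (Q a /\ f a `<=` f m).
  exists a; split=> //; first exact: mem_head.
  move=> c; rewrite inE => /orP[/eqP->//|cL Qc ca] z az.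
  apply: (Hm c cL Qc) (am z az) => y cy; exact/am/ca.
exists m; split=> //; first by rewrite inE mL orbT.
move=> c; rewrite inE => /orP[/eqP->|cL Qc]; last exact: Hm.
by move=> Qa am; case: na.
Qed.

(** * The complex is CAT(0) *)

Section CatComplex.
Variables (R : realType) (X : metricType R) (K : cubeComplex X).
Notation cdim := (cube_dim K).
Notation bits i := {ffun 'I_(cdim i) -> bool}.
Notation cvt := (@cv R X K).
Notation V := (vtx K).
Notation adj := (@vadj R X K).
Notation sq := (@vsq R X K).
Variable d : V -> V -> nat.
Hypothesis G : quadrangle_graph adj sq d.
Hypothesis flagK : forall v, cell K 0 [set v] -> flag (link K v).
Hypothesis complete : forall u : nat -> X,
  (forall e : R, 0 < e -> exists n : nat, forall i j, (n <= i)%N -> (n <= j)%N ->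
     mdist (u i) (u j) < e) ->
  exists l, forall e : R, 0 < e -> exists n : nat, forall i, (n <= i)%N ->
    mdist (u i) l < e.
Notation halfsp := (@halfsp V adj d).
Notation side := (@side V d).
Notation coord := (@wcoord R X K d).
Notation ccoord := (@ccoord R X K d).
Notation car := (@car R X K d).
Notation gate := (@gate V adj d).
Notation reg := (@reg R X K d).
Notation retr Y := (@retr R X K d Y).

Lemma reg_closed Z l : gconvex d Z -> Z !=set0 ->
  (forall e, 0 < e -> exists2 c, reg Z c & mdist c l < e) -> reg Z l.
Proof.
move=> cZ Z0 H; apply/(regP G _ cZ Z0) => k hk Zk.
apply/eqP; rewrite eq_le; apply/andP; split; first by case/andP: (coord01 G l hk).
apply/ler_addgt0Pr => e /H[c /(regP G _ cZ Z0)/(_ k hk Zk) c1 ce].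
by have := coord_lip G c l hk; rewrite c1 ler_norml => /andP[? ?]; lra.
Qed.

Lemma midpoint_le (p q r s : R) : 0 <= p -> 0 <= q -> `|p - q| <= s ->
  r ^+ 2 <= (p ^+ 2 + q ^+ 2) / 2 - s ^+ 2 / 4 -> r <= (p + q) / 2.
Proof.
move=> p0 q0 pq H; apply: ler_sqr_ge0; first lra.
have : (p - q) ^+ 2 <= s ^+ 2.
  rewrite -real_normK ?num_real//; apply: lerXn2r; rewrite ?nnegrE//.
  exact: le_trans pq.
move: H; lra.
Qed.

Section Glue.
Variables (Y h : set V).
Hypotheses (cY : gconvex d Y) (hh : halfsp h) (crh : crosses Y h).
Hypothesis extr : forall k, halfsp k -> crosses Y k ->
  Y `&` k `<=` Y `&` h -> Y `&` h `<=` Y `&` k.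
Notation D := (@strip_of R X K d Y h).
Notation A := (reg (Y `&` ~` h)).
Notation B := (reg D).
Notation C := (reg (D `&` ~` h)).

Let Y0 : Y !=set0. Proof. by case: crh => -[u Yu _] _; exists u. Qed.
Let cD : gconvex d D := @strip_convex _ _ _ _ G Y h cY.
Let DY : D `<=` Y. Proof. by move=> v []. Qed.
Let D0 : D !=set0.
Proof. by case: crh => -[u Yu hu] _; exists u; apply: strip_side. Qed.

Lemma strip_crosses : crosses D h.
Proof.
case: crh => -[u Yu hu] _; have Du := @strip_side R X K d Y h u Yu hu.
have [w [Dw _ _ E]] := strip_partner G cY hh crh extr Du.
by split; [exists u|exists w => //; apply/E].
Qed.

Lemma strip_hyp : crosses D h -> halfsp h /\ forall v, D v ->
  exists w, [/\ D w, adj v w & (h = side v w \/ h = ~` side v w)].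
Proof.
move=> _; split=> // v /(strip_partner G cY hh crh extr)[w [Dw vw E _]].
by exists w.
Qed.

(** If a half-space [k] violated the condition at a vertex of the cell of [x], [car_two] would give
    a vertex of that cell in [h] and outside [k], although this vertex lies in [Y]. *)
Lemma reg_strip x : reg Y x -> 0 < coord h x -> B x.
Proof.
move=> xY h0 v cv; split; first exact: xY.
move=> k hk sub kh; apply: contrapT => nkv.
have k0 : 0 < coord (~` k) x by apply: cv => //; apply: (halfspC G).
have hnk : h <> ~` ~` k by rewrite setCK => /esym.
have [u [cu hu nku]] := car_two G hh (halfspC G hk) hnk h0 k0.
by apply: nku; apply: sub; split=> //; apply: xY.
Qed.

Lemma reg_split x : reg Y x -> A x \/ B x.
Proof.
move=> xY; have [h0|h0] := leP (coord h x) 0; last by right; apply: reg_strip.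
left; rewrite regI; split=> //; apply/(coord0_car G) => //.
by have /andP[? _] := coord01 G x hh; lra.
Qed.

Lemma string_cross x b l : cube_string (@chart R X K) x b l -> coord h x = 0 ->
  0 < coord h b -> exists i a a', [/\ cube R (cdim i) a, cube R (cdim i) a',
    coord h (chart K i a) = 0, 0 < coord h (chart K i a') &
    mdist x (chart K i a) + mdist (chart K i a) b <= l].
Proof.
elim=> [z|i a a' z m ca ca' S IH] x0 b0; first by rewrite x0 ltxx in b0.
have [p0|p0] := leP (coord h (chart K i a')) 0; last first.
  exists i, a, a'; split=> //; rewrite mdistxx add0r.
  exact: mdist_le_string (cube_string_cons ca ca' S).
have [|//|j [c [c' [cc cc' c0 c0' le]]]] := IH.
  by have /andP[? _] := coord01 G (chart K i a') hh; lra.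
exists j, c, c'; split=> //.
have := mdist_chart ca ca'; have := mdist_tri (chart K i a) (chart K i a') (chart K j c); lra.
Qed.

(** A short string is cut in the cube where it leaves the zero level of [h], then retracted onto
    [Y]. The cutting point lands in the strip because the midpoint of the next piece has positive
    height. *)
Lemma approx_cross a b e : A a -> B b -> 0 < e ->
  exists2 c, C c & mdist a c + mdist c b < mdist a b + e.
Proof.
rewrite [A]regI => -[aY ah] bD e0.
have a0 : coord h a = 0 by apply/(coord0_car G).
have [b0|b0] := leP (coord h b) 0.
  exists b; last by rewrite mdistxx; lra.
  rewrite regI; split=> //; apply/(coord0_car G) => //.
  by have /andP[? _] := coord01 G b hh; lra.
have /(string_exists K)[l S le] : mdist a b < mdist a b + e by lra.
have [i [p [q [cp cq p0 q0 pl]]]] := string_cross S a0 b0.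
have ra := retr_id G flagK cY Y0 aY.
have rb := retr_id G flagK cY Y0 (reg_sub DY bD).
exists (retr Y (chart K i p)); last first.
  apply: le_lt_trans le; apply: le_trans pl.
  by rewrite -{1}ra -{1}rb; apply: lerD; apply: retr_lip.
have [i' H] := retr_in_chart G flagK cY Y0 i.
have [p' [cp' Ep]] := H p cp; have [q' [cq' Eq]] := H q cq.
have coordh z : coord h (retr Y z) = coord h z.
  by rewrite (coord_retr G flagK cY Y0)// asboolT.
have [m cm Hm] := car_midpoint G cp' cq'.
have rm : reg Y (chart K i' m).
  apply/(regP G _ cY Y0) => k hk Yk; rewrite Hm// Ep Eq.
  have rY z : coord k (retr Y z) = 1 by apply: ((regP G _ cY Y0).1 (@retr_reg _ _ _ _ G flagK _ cY Y0 z) k hk Yk).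
  by rewrite !rY; lra.
have mD : B (chart K i' m).
  by apply: reg_strip => //; rewrite Hm// Ep Eq !coordh p0; lra.
rewrite regI; split; last by apply/(coord0_car G) => //; rewrite coordh.
move=> v cv; apply: mD => k hk kv; have := cv k hk kv; rewrite Hm// Ep => h1.
by have /andP[? _] := coord01 G (chart K i' q') hk; lra.
Qed.

Lemma exact_cross a b : cat_on A -> cat_on B -> cat_on C -> A a -> B b ->
  exists2 c, C c & mdist a b = mdist a c + mdist c b.
Proof.
move=> catA catB catC Aa Bb.
have CA : C `<=` A by apply: reg_sub => v [/DY].
have CB : C `<=` B by apply: reg_sub => v [].
pose S (n : nat) := [set c | C c /\ mdist a c + mdist c b <= mdist a b + n.+1%:R^-1].
have half : 0 <= (2^-1 : R) <= 1 by apply/andP; split; lra.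
have [||||l Hl] := @nested_convex R X complete S a (mdist a b + 1).
- move=> n; have n1 : 0 < n.+1%:R^-1 :> R by rewrite invr_gt0.
  have [c Cc lt] := approx_cross Aa Bb n1.
  by exists c; split=> //; apply: ltW.
- move=> m n mn c [Cc le]; split=> //; apply: le_trans le _.
  by rewrite lerD2l lef_pV2 ?posrE// ler_nat.
- move=> n c c' [Cc le] [Cc' le'].
  have [m Cm bm] := cat_between_at catC Cc Cc' half.
  have sa : mdist a m ^+ 2 <= (mdist a c ^+ 2 + mdist a c' ^+ 2) / 2 - mdist c c' ^+ 2 / 4.
    have := cat_stewart catA Aa (CA _ Cc) (CA _ Cc') (CA _ Cm) half bm.
    by rewrite /stewart; lra.
  have sb : mdist b m ^+ 2 <= (mdist b c ^+ 2 + mdist b c' ^+ 2) / 2 - mdist c c' ^+ 2 / 4.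
    have := cat_stewart catB Bb (CB _ Cc) (CB _ Cc') (CB _ Cm) half bm.
    by rewrite /stewart; lra.
  exists m => //; split=> //.
  have tri z : `|mdist z c - mdist z c'| <= mdist c c'.
    rewrite ler_norml; have := mdist_tri z c c'; have := mdist_tri z c' c.
    by rewrite (mdist_sym c' c); lra.
  have := midpoint_le (mdist_ge0 a c) (mdist_ge0 a c') (tri a) sa.
  have := midpoint_le (mdist_ge0 b c) (mdist_ge0 b c') (tri b) sb.
  rewrite (mdist_sym m b); move: le le'; rewrite (mdist_sym c b) (mdist_sym c' b).
  by move: (_^-1) => q; lra.
- move=> c [_]; rewrite invr1; have := mdist_ge0 c b; lra.
have cC : gconvex d (D `&` ~` h) by apply: gconvexI => //; apply: (halfsp_convex G (halfspC G hh)).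
have C0 : (D `&` ~` h) !=set0 by case: strip_crosses => _ [u Du nhu]; exists u.
exists l.
  by apply: reg_closed => // e e0; have [n [c [_ [Cc _] ce]]] := Hl e e0 0%N; exists c.
apply/eqP; rewrite eq_le mdist_tri /=; apply/ler_addgt0Pr => e e0.
have e4 : 0 < e / 4 by lra.
have [n1 h1] := ltr_add_invr e4; rewrite add0r in h1.
have [n [c [n1n [_ le] ce]]] := Hl _ e4 n1.
have : n.+1%:R^-1 <= n1.+1%:R^-1 :> R by rewrite lef_pV2 ?posrE// ler_nat.
move/le_trans/(_ (ltW h1)) => h2.
have := mdist_tri a c l; have := mdist_tri l c b; rewrite (mdist_sym l c).
by move: le h2; move: (n.+1%:R^-1) => q; lra.
Qed.

Lemma cat_reg_step : cat_on A -> cat_on C -> cat_on (reg Y).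
Proof.
move=> catA catC.
have catB : cat_on B := strip_cat G flagK cD D0 strip_hyp strip_crosses catC.
have CA : C `<=` A by apply: reg_sub => v [/DY].
have CB : C `<=` B by apply: reg_sub => v [].
have -> : reg Y = A `|` B.
  apply/seteqP; split=> x; first exact: reg_split.
  by case; apply: reg_sub => // v [].
apply: cat_glue => //.
  move=> a b Aa Bb; have [c Cc E] := exact_cross catA catB catC Aa Bb.
  by exists c; split=> //; [apply: CA|apply: CB].
have AB z : A z -> B z -> C z.
  by rewrite !regI => -[_ zh] zB; split.
move=> c c' t Ac Bc Ac' Bc' t01.
have [m Cm bm] := cat_between_at catC (AB _ Ac Bc) (AB _ Ac' Bc') t01.
by exists m; split=> //; [apply: CA|apply: CB].
Qed.
End Glue.

(** Induction on the number of walls crossing [Y]. The part outside a minimal half-space and the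
    base of its strip are both crossed by fewer walls; a region crossed by none is a single
    vertex. *)
Theorem cat_reg (L : seq (set V)) Y : gconvex d Y -> Y !=set0 ->
  (forall k, halfsp k -> crosses Y k -> k \in L) -> cat_on (reg Y).
Proof.
have [n] := ubnP (size L); elim: n L Y => // n IH L Y sL cY Y0 HL.
have [ex|no] := EM (exists2 k, k \in L & halfsp k /\ crosses Y k); last first.
  have [v Yv] := Y0.
  have E x : reg Y x -> x = val v.
    move=> rx; apply: (coord_inj G) => k hk; rewrite (coord_vtx G)//.
    have nc : ~ crosses Y k by move=> cr; apply: no; exists k => //; apply: HL.
    case: (not_crosses_dec Y0 nc) => sub.
      rewrite asboolT; last exact: sub.
      exact: ((regP G _ cY Y0).1 rx k hk sub).
    rewrite asboolF; last exact: sub.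
    by have := (regP G _ cY Y0).1 rx _ (halfspC G hk) sub; rewrite (coordC G)// mulr0n; lra.
  move=> y z /E-> /E-> t t01; exists (val v); first exact/(reg_vtx G).
  by move=> x _; apply: stewart_const.
have [h [hL [hh crh] Hh]] := minimal_in_seq (fun k => Y `&` k) ex.
have extr k : halfsp k -> crosses Y k -> Y `&` k `<=` Y `&` h -> Y `&` h `<=` Y `&` k.
  by move=> hk cr; apply: Hh => //; apply: HL.
have sub_case Z : Z `<=` Y -> Z `<=` ~` h -> gconvex d Z -> Z !=set0 -> cat_on (reg Z).
  move=> ZY Zh cZ Z0; apply: (IH (rem h L)) => //.
    rewrite size_rem//; move: sL hL; case: (L) => //= ? s; lia.
  move=> k hk [[u Zu ku] [w Zw nkw]].
  have kL : k \in L by apply: HL => //; split; [exists u|exists w] => //; apply: ZY.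
  have kh : k != h by apply/eqP => E; apply: (Zh u Zu); rewrite -E.
  move: kL; rewrite (perm_mem (perm_to_rem hL)) inE.
  by move=> /orP[/eqP E|//]; rewrite E eqxx in kh.
apply: (cat_reg_step cY hh crh extr); apply: sub_case.
- by move=> v [].
- by move=> v [].
- exact: gconvexI cY (halfsp_convex G (halfspC G hh)).
- by case: crh => _ [u Yu nhu]; exists u.
- by move=> v [[]].
- by move=> v [].
- exact: gconvexI (@strip_convex _ _ _ _ G Y h cY) (halfsp_convex G (halfspC G hh)).
- by case: (strip_crosses cY hh crh extr) => _ [u Yu nhu]; exists u.
Qed.

Definition hull (s : seq V) : set V :=
  [set v | forall k, halfsp k -> (forall w, w \in s -> k w) -> k v].

Lemma hull_convex s : gconvex d (hull s).
Proof.
move=> u v w Hu Hv D k hk sk.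
exact: (halfsp_convex G hk) (Hu k hk sk) (Hv k hk sk) D.
Qed.

Lemma hull_in s w : w \in s -> hull s w.
Proof. by move=> ws k _; apply. Qed.

Lemma hull_sub s s' : {subset s <= s'} -> hull s `<=` hull s'.
Proof. by move=> ss v Hv k hk Hk; apply: Hv => // w /ss; apply: Hk. Qed.

Lemma hull_crosses s k : halfsp k -> crosses (hull s) k ->
  exists u w, [/\ u \in s, w \in s, k u & ~ k w].
Proof.
move=> hk [[u Hu ku] [w Hw nkw]].
have [u' us ku'] : exists2 u, u \in s & k u.
  apply: contrapT => no; apply: (Hu _ (halfspC G hk)) => // x xs kx.
  by apply: no; exists x.
have [w' ws nkw'] : exists2 w, w \in s & ~ k w.
  apply: contrapT => no; apply: nkw; apply: Hw => // x xs.
  by apply: contrapT => nkx; apply: no; exists x.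
by exists u', w'.
Qed.

Lemma hull_finite s : exists L : seq (set V),
  forall k, halfsp k -> crosses (hull s) k -> k \in L.
Proof.
have /choice[f Hf] (p : V * V) : exists L : seq (set V),
    forall k, halfsp k -> k p.1 -> ~ k p.2 -> k \in L.
  exact: (finite_separating G p.1 p.2).
exists (flatten [seq f p | p <- allpairs pair s s]) => k hk /(hull_crosses hk).
move=> [u [w [us ws ku nkw]]]; apply/flattenP; exists (f (u, w)); last exact: Hf.
by apply: map_f; apply: allpairs_f.
Qed.

Lemma hull_reg x : exists s, reg (hull s) x /\ s != [::].
Proof.
have [i [a ca <-]] := chart_cover K x.
exists [seq cvt b | b <- enum {ffun 'I_(cdim i) -> bool}]; split.
  move=> v /(car_cv G ca)[b -> _]; apply: hull_in.
  by apply: map_f; rewrite mem_enum.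
rewrite -size_eq0 size_map -cardE -lt0n; apply/card_gt0P.
by exists [ffun => false].
Qed.

(** Only finitely many walls cross the hull of finitely many vertices. The point [w] is found in the
    hull of the cells of [y] and [z], and it satisfies Stewart's inequality in the larger hull that
    also contains the cell of [x]. *)
Theorem cat_complex : cat_on [set: X].
Proof.
move=> y z _ _ t t01.
have [sy [ry sy0]] := hull_reg y; have [sz [rz _]] := hull_reg z.
have cat s : s != [::] -> cat_on (reg (hull s)).
  move=> s0; have [L HL] := hull_finite s; apply: (cat_reg (L := L)) => //.
    exact: hull_convex.
  by case: s s0 {L HL} => // v s _; exists v; apply: hull_in; apply: mem_head.
have sub1 s s' : reg (hull s) `<=` reg (hull (s ++ s')).
  by apply: reg_sub; apply: hull_sub => v; rewrite mem_cat => ->.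
have sub2 s s' : reg (hull s') `<=` reg (hull (s ++ s')).
  by apply: reg_sub; apply: hull_sub => v; rewrite mem_cat => ->; rewrite orbT.
have n0 s s' : s != [::] -> s ++ s' != [::] :> seq V by case: s.
have [w rw bw] := cat_between_at (cat _ (n0 sy sz sy0)) (sub1 _ _ _ ry) (sub2 _ _ _ rz) t01.
exists w => // x _; have [sx [rx _]] := hull_reg x.
apply: (cat_stewart (cat _ (n0 (sy ++ sz) sx (n0 _ _ sy0)))) => //.
- exact: sub2.
- exact: (sub1 _ _ _ (sub1 _ _ _ ry)).
- exact: (sub1 _ _ _ (sub2 _ _ _ rz)).
- exact: sub1.
Qed.
End CatComplex.

Lemma mdist_diff (R : realType) (X : metricType R) (x y z : X) :
  `|mdist x z - mdist y z| <= mdist x y.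
Proof.
have := mdist_tri x y z; have := mdist_tri y x z; rewrite (mdist_sym y x) ler_norml => h1 h2.
by apply/andP; split; lra.
Qed.

(** * A fixed point at infinity *)

Section Descent.
Variables (R : realType) (X : metricType R) (K : cubeComplex X).
Notation cdim := (cube_dim K).
Notation bits i := {ffun 'I_(cdim i) -> bool}.
Notation cvt := (@cv R X K).
Notation V := (vtx K).
Notation adj := (@vadj R X K).
Notation sq := (@vsq R X K).
Variable d : V -> V -> nat.
Hypothesis G : quadrangle_graph adj sq d.
Hypothesis flagK : forall v, cell K 0 [set v] -> flag (link K v).
Notation halfsp := (@halfsp V adj d).
Notation side := (@side V d).
Notation coord := (@wcoord R X K d).
Notation ccoord := (@ccoord R X K d).
Notation car := (@car R X K d).
Notation gate := (@gate V adj d).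
Notation reg := (@reg R X K d).
Notation retr Y := (@retr R X K d Y).
Notation hull := (@hull R X K d).

Definition rdist (C : set V) (x : X) : R := inf [set mdist x c | c in reg C].

Section Distance.
Variable C : set V.
Hypotheses (cC : gconvex d C) (C0 : C !=set0).

Lemma rdist_has_inf x : has_inf [set mdist x c | c in reg C].
Proof.
split; first by case: C0 => v Cv; exists (mdist x (val v)), (val v) => //; apply/(reg_vtx G).
by exists 0 => _ [c _ <-]; apply: mdist_ge0.
Qed.

Lemma rdist_le x c : reg C c -> rdist C x <= mdist x c.
Proof. by move=> rc; apply: ge_inf; [case: (rdist_has_inf x)|exists c]. Qed.

Lemma rdist_ge x r : (forall c, reg C c -> r <= mdist x c) -> r <= rdist C x.
Proof.
move=> H; apply: lb_le_inf; first by case: (rdist_has_inf x).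
by move=> _ [c rc <-]; apply: H.
Qed.

Lemma rdist_near x e : 0 < e -> exists2 c, reg C c & mdist x c < rdist C x + e.
Proof.
by move=> e0; have [_ [c rc <-] lt] := inf_adherent e0 (rdist_has_inf x); exists c.
Qed.

Lemma rdist_lip x y : rdist C x <= rdist C y + mdist x y.
Proof.
rewrite -lerBlDr; apply: rdist_ge => c rc.
by have := rdist_le x rc; have := mdist_tri x y c; lra.
Qed.

Lemma rdist_convex y z t w : cat_on [set: X] -> 0 <= t <= 1 -> between_at y z t w ->
  rdist C w <= (1 - t) * rdist C y + t * rdist C z.
Proof.
move=> catX t01 bw; apply/ler_addgt0Pr => e e0.
have [p rp pe] := rdist_near y e0; have [q rq qe] := rdist_near z e0.
have [m _ bm] := cat_between_at catX (I : setT p) (I : setT q) t01.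
have rm : reg C m.
  (* The retraction is 1-Lipschitz and fixes [p] and [q], so the image of [m] divides the segment in
     the same ratio and is [m] by uniqueness: the region is convex. *)
  suff <- : retr C m = m by apply: (retr_reg G flagK cC C0).
  apply: (between_uniq catX t01 _ bm).
  have hp := retr_lip G flagK cC C0 p m; have hq := retr_lip G flagK cC C0 m q.
  rewrite (retr_id G flagK cC C0 rp) in hp; rewrite (retr_id G flagK cC C0 rq) in hq.
  have := mdist_tri p (retr C m) q; case: bm => e1 e2 e3.
  by split; move: hp hq e3; rewrite e1 e2; lra.
have := busemann catX t01 bw bm; have := rdist_le w rm.
have /andP[t0 t1] := t01; have t1' : 0 <= 1 - t by lra.
have := ler_wpM2l t1' (ltW pe); have := ler_wpM2l t0 (ltW qe).
by lra.
Qed.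
End Distance.

Section Step.
Variables (C : set V) (x : V) (s : seq V).
Hypotheses (cC : gconvex d C) (C0 : C !=set0).
Hypothesis sP : forall w, w \in s <-> adj x w /\ C `<=` side w x.
Variables (i : cube_index K) (b : bits i).
Hypothesis xb : x = cvt b.
Hypothesis sb : forall w, w \in s -> exists j, w = cvt (flip b j).
Hypothesis s0 : s != [::].

(* The vertex opposite to x in the cube spanned by the edges from x to s. *)
Definition jump : bits i := [ffun j => b j (+) (cvt (flip b j) \in s)].

Let g := gate C x.
Let I := hull [:: x; g].
Let Z : set V := [set v | forall w, w \in s -> side w x v].
Let Cg : C g. Proof. exact: (gate_in G cC C0). Qed.
Let cI : gconvex d I. Proof. exact: hull_convex. Qed.
Let I0 : I !=set0. Proof. by exists x; apply: hull_in; apply: mem_head. Qed.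

Let sadj w : w \in s -> adj w x.
Proof. by move=> /sP[/(qg_adj_sym G)]. Qed.

Let hs_s w : w \in s -> halfsp (side w x).
Proof. by move/sadj/(halfsp_side d). Qed.

Let cZ : gconvex d Z.
Proof.
move=> u v w Hu Hv D y ys; exact: (halfsp_convex G (hs_s ys)) (Hu y ys) (Hv y ys) D.
Qed.

Let gZ : Z g. Proof. by move=> w /sP[_]; apply. Qed.
Let Z0 : Z !=set0. Proof. by exists g. Qed.
Let xI : I x. Proof. by apply: hull_in; apply: mem_head. Qed.
Let gI : I g. Proof. by apply: hull_in; rewrite !inE eqxx orbT. Qed.

Let nx w : w \in s -> ~ side w x x.
Proof. by move/sadj; apply: (side_r G). Qed.

Let not_crosses_side w : w \in s -> ~ crosses Z (side w x).
Proof. by move=> ws [_ [v Zv []]]; apply: Zv. Qed.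

Let crosses_side w : w \in s -> crosses I (side w x).
Proof. by move=> ws; split; [exists g => //; apply: gZ|exists x => //; apply: nx]. Qed.

(** Walls between [x] and its gate have all of [C] on the far side, so the retraction onto the hull
    of [x] and [g] collapses the region of [C] to [g]. Hence [g] is also nearest to [x] for the
    metric of [X]. *)
Lemma gate_point c : reg C c -> retr I c = val g.
Proof.
move=> rc; apply: (coord_inj G) => k hk.
rewrite (coord_retr G flagK cI I0)// (coord_vtx G)//.
have one k' : halfsp k' -> k' g -> ~ k' x -> coord k' c = 1.
  by move=> hk' kg nkx; apply: ((regP G _ cC C0).1 rc) => //; apply: (gate_sub G cC C0 hk' kg nkx).
case: asboolP => [cr|nc].
  have [kg|nkg] := EM (k g).
    rewrite asboolT// one// => kx.
    have [u [w [us ws ku []]]] := hull_crosses G hk cr.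
    by move: ws; rewrite !inE => /orP[]/eqP->.
  rewrite asboolF// mulr0n; have kx : k x.
    have [u [w [us ws ku nkw]]] := hull_crosses G hk cr.
    by move: us; rewrite !inE => /orP[]/eqP E; subst u.
  have := one _ (halfspC G hk) nkg (fun H => H kx); rewrite (coordC G)//; lra.
congr (_%:R); case: (not_crosses_dec I0 nc) => sub.
  by rewrite !asboolT//; apply: sub.
by rewrite !asboolF// => [|H]; [apply: sub|exact: (sub g gI (H g gI))].
Qed.

Lemma jump_Z : Z (cvt jump).
Proof.
move=> w ws; have [j Ej] := sb ws; rewrite Ej xb (hsP G).
have H := hs_cv G jump j; move: H; rewrite ffunE -Ej ws addbT.
by case: (b j) => H /=; [move/H|apply/H].
Qed.

Lemma jump_side k : halfsp k -> crosses Z k -> k (cvt jump) <-> k x.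
Proof.
move=> hk cr; rewrite xb.
have E j : k = hs d j \/ k = ~` hs d j -> jump j = b j.
  move=> kj; rewrite ffunE; case ws: (_ \in s); last by rewrite addbF.
  case: (not_crosses_side ws); rewrite xb (hsP G).
  by case: ifP => _; case: kj cr => -> //; move/crossesC; rewrite ?setCK.
case: (cube_side G i hk) => [[j Ej]|[j Ej]|H|H].
- by rewrite Ej !(hs_cv G) E//; left.
- by rewrite Ej /= !(hs_cv G) E//; right.
- by split=> _; apply: H.
- by split=> [/H|/H].
Qed.

Lemma retr_jump u : (forall k, halfsp k -> crosses I k -> crosses Z k -> ~ k x ->
    coord k u = 0) -> retr Z (retr I u) = val (cvt jump).
Proof.
move=> H; apply: (coord_inj G) => k hk.
rewrite (coord_retr G flagK cZ Z0)// (coord_vtx G)//.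
case: asboolP => [cr|nc].
  rewrite (coord_retr G flagK cI I0)//; case: asboolP => [crI|ncI].
    have [kx|nkx] := EM (k x).
      rewrite asboolT; last exact/jump_side.
      have := H _ (halfspC G hk) (crossesC crI) (crossesC cr) (fun F => F kx).
      by rewrite (coordC G)// mulr1n; lra.
    rewrite asboolF; first by rewrite mulr0n H.
    by move=> kj; apply: nkx; apply/(jump_side hk cr).
  congr (_%:R); case: (not_crosses_dec I0 ncI) => sub.
    by rewrite !asboolT//; apply/(jump_side hk cr); apply: sub.
  rewrite !asboolF// => [/(jump_side hk cr)/(sub x xI)//|H'].
  exact: (sub x xI (H' x xI)).
congr (_%:R); case: (not_crosses_dec Z0 nc) => sub.
  by rewrite !asboolT//; apply/sub/jump_Z.
rewrite !asboolF// => [/(sub _ jump_Z)//|H']; exact: (sub g gZ (H' g gZ)).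
Qed.

(* A vertex of the hull of x and g on the side of k but of no wall of s would be
   reached from x across a wall outside s separating x from C. *)
Lemma other_coord0 m k : (forall w, w \in s -> coord (side w x) m < 1) ->
  halfsp k -> crosses I k -> crosses Z k -> ~ k x -> coord k m = 0.
Proof.
move=> m1 hk crI crZ nkx; apply: contrapT => km.
have {}km : 0 < coord k m.
  by have /andP[k0 _] := coord01 G m hk; rewrite lt_neqAle k0 andbT eq_sym; apply/eqP.
have eI z k' : halfsp k' -> crosses I k' -> coord k' (retr I z) = coord k' z.
  by move=> hk' cr; rewrite (coord_retr G flagK cI I0)// asboolT.
have kp : 0 < coord k (retr I m) by rewrite eI.
have [v [cv kv Hv]] := car_toward G x hk kp.
have vI : I v := retr_reg G flagK cI I0 cv.
have vx : v <> x by move=> E; apply: nkx; rewrite -E.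
have [w xw Dw] := qg_dist_pred G vx.
have wx := qg_adj_sym G xw.
have wv : side w x v by rewrite /side /= Dw.
have wg : side w x g.
  apply: contrapT => ng; have nwv : (~` side w x) v.
    apply: vI; first exact: (halfspC G (halfsp_side d wx)).
    by move=> u; rewrite !inE => /orP[]/eqP-> //; apply: (side_r G wx).
  exact: nwv.
have ws : w \in s.
  apply/sP; split=> //; exact: (gate_sub G cC C0 (halfsp_side d wx) wg (side_r G wx)).
have hC := halfspC G (hs_s ws).
have : (~` side w x) v; last by [].
apply: Hv => //; first exact: nx.
  by rewrite eI//; [rewrite (coordC G)//; [have := m1 w ws; lra|exact: hs_s]|apply/crossesC/crosses_side].
by move=> /setC_inj E; apply: (not_crosses_side ws); rewrite E.
Qed.

Definition top_coord u : R := \big[Order.max/0]_(w <- s) coord (side w x) u.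

Lemma top_coord_ge w u : w \in s -> coord (side w x) u <= top_coord u.
Proof. by move=> ws; rewrite /top_coord; apply: (le_bigmax_seq _ w). Qed.

Lemma top_coord_le u r : 0 <= r -> (forall w, w \in s -> coord (side w x) u <= r) ->
  top_coord u <= r.
Proof. by move=> r0 H; rewrite /top_coord big_seq; apply: bigmax_le => // w /H. Qed.

Lemma top_coord_lip u v : top_coord u <= top_coord v + mdist u v.
Proof.
apply: top_coord_le => [|w ws].
  apply: addr_ge0; last exact: mdist_ge0.
  apply: (@le_trans _ _ (coord (side (head x s) x) v)).
    have hs : head x s \in s by case: (s) s0 => // a l _; apply: mem_head.
    by case/andP: (coord01 G v (hs_s hs)).
  by apply: top_coord_ge; case: (s) s0 => // a l _; apply: mem_head.
have := coord_lip G u v (hs_s ws); have := top_coord_ge v ws.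
by rewrite ler_norml => h1 /andP[? ?]; lra.
Qed.

(** The function [F] is 1-Lipschitz: where [top_coord] is less than 1, the double retraction [Q] is
    constantly the jump vertex, and where it equals 1 only the first term varies. The values of [F]
    at [x] and [g] are the distance from the jump to [g] and -1. *)
Lemma jump_closer : mdist (val (cvt jump)) (val g) + 1 <= mdist (val x) (val g).
Proof.
pose Q u := retr Z (retr I u).
pose F u := mdist (Q u) (val g) - top_coord u.
have sw : head x s \in s by case: (s) s0 => // a l _; apply: mem_head.
have lipQ u v : mdist (Q u) (Q v) <= mdist u v.
  by apply: le_trans (retr_lip G flagK cZ Z0 _ _) _; apply: (retr_lip G flagK cI I0).
have lipM u v : `|top_coord u - top_coord v| <= mdist u v.
  by rewrite ler_norml; have := top_coord_lip u v; have := top_coord_lip v u; rewrite (mdist_sym v u); lra.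
have le1 u : top_coord u <= 1.
  by apply: top_coord_le => // w ws; case/andP: (coord01 G u (hs_s ws)).
have base i0 a1 a2 : cube R (cdim i0) a1 -> cube R (cdim i0) a2 ->
    top_coord (chart K i0 a1) < 1 -> Q (chart K i0 a1) = val (cvt jump) /\
    Q (chart K i0 a2) = val (cvt jump).
  (* At the midpoint all coordinates along the walls of [s] are still less than 1, so [other_coord0]
     applies there; a coordinate vanishing at the midpoint vanishes at both ends. *)
  move=> c1 c2 lt1; have [m cm Hm] := car_midpoint G c1 c2.
  have zero k : halfsp k -> crosses I k -> crosses Z k -> ~ k x ->
      coord k (chart K i0 a1) = 0 /\ coord k (chart K i0 a2) = 0.
    move=> hk c3 c4 nk; have := @other_coord0 (chart K i0 m) k _ hk c3 c4 nk.
    rewrite Hm// => H; have {}H := H _.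
    have h1 := coord01 G (chart K i0 a1) hk; have h2 := coord01 G (chart K i0 a2) hk.
    suff : (coord k (chart K i0 a1) + coord k (chart K i0 a2)) / 2 = 0 by lra.
    apply: H => w ws; rewrite Hm; last exact: hs_s.
    have := top_coord_ge (chart K i0 a1) ws.
    by have /andP[_] := coord01 G (chart K i0 a2) (hs_s ws); lra.
  by split; apply: retr_jump => k hk c3 c4 nk; case: (zero k hk c3 c4 nk).
have main : `|F (val x) - F (val g)| <= mdist (val x) (val g).
  apply: (string_lower (K := K) (rho := fun u v => `|F u - F v|)).
  - by move=> z; rewrite subrr normr0.
  - by move=> u v w; apply: ler_distD.
  - move=> i0 a1 a2 c1 c2; apply: le_trans _ (mdist_chart c1 c2).
    set u := chart K i0 a1; set v := chart K i0 a2.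
    have same : Q u = Q v -> `|F u - F v| <= mdist u v.
      move=> E; rewrite /F E; have -> : mdist (Q v) (val g) - top_coord u -
        (mdist (Q v) (val g) - top_coord v) = top_coord v - top_coord u by lra.
      by rewrite distrC.
    have [l1|l1] := ltP (top_coord u) 1.
      by apply: same; have [-> ->] := base i0 a1 a2 c1 c2 l1.
    have [l2|l2] := ltP (top_coord v) 1.
      by apply: same; have [-> ->] := base i0 a2 a1 c2 c1 l2.
    have same_top (p q : R) : 1 <= p -> p <= 1 -> 1 <= q -> q <= 1 -> p = q by lra.
    have E : top_coord u = top_coord v := same_top _ _ l1 (le1 u) l2 (le1 v).
    rewrite /F E opprB addrA subrK.
    exact: le_trans (mdist_diff _ _ _) (lipQ u v).
have Fx : F (val x) = mdist (val (cvt jump)) (val g).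
  rewrite /F; have -> : top_coord (val x) = 0.
    apply/eqP; rewrite eq_le; apply/andP; split.
      apply: top_coord_le => // w ws; rewrite (coord_vtx G _ (hs_s ws)) asboolF//.
      exact: nx.
    apply: le_trans (top_coord_ge _ sw).
    by case/andP: (coord01 G (val x) (hs_s sw)).
  rewrite subr0 /Q retr_jump// => k hk _ _ nkx.
  by rewrite (coord_vtx G)// asboolF.
have Fg : F (val g) = - 1.
  have -> : F (val g) = 0 - top_coord (val g).
    rewrite /F /Q (retr_id G flagK cI I0) ?(retr_id G flagK cZ Z0) ?mdistxx//.
      exact/(reg_vtx G).
    exact/(reg_vtx G).
  have : 1 <= top_coord (val g).
    apply: le_trans (top_coord_ge _ sw); rewrite (coord_vtx G _ (hs_s sw)) asboolT//.
    exact: gZ.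
  by have := le1 (val g); lra.
by move: main; rewrite Fx Fg ler_norml => /andP[_]; lra.
Qed.

Lemma rdist_jump : rdist C (val (cvt jump)) <= rdist C (val x) - 1.
Proof.
have h1 : rdist C (val (cvt jump)) <= mdist (val (cvt jump)) (val g).
  by apply: rdist_le => //; apply/(reg_vtx G).
have h2 : mdist (val x) (val g) <= rdist C (val x).
  apply: rdist_ge => // c rc; rewrite -(gate_point rc).
  rewrite -{1}(retr_id G flagK cI I0 (x := val x)); last exact/(reg_vtx G).
  exact: (retr_lip G flagK cI I0).
by have := jump_closer; lra.
Qed.
End Step.
End Descent.

(** * Automorphisms *)

Section Cubical.
Variables (R : realType) (X : metricType R) (K : cubeComplex X).
Notation cdim := (cube_dim K).
Notation bits i := {ffun 'I_(cdim i) -> bool}.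
Notation cvt := (@cv R X K).
Notation V := (vtx K).
Notation adj := (@vadj R X K).
Notation sq := (@vsq R X K).

Definition vmap (g : X -> X) (v : V) : V := xget v [set w : V | val w = g (val v)].

Section One.
Variable g : X -> X.
Hypothesis cg : cubical K g.

Lemma cubical_string x y l : cube_string (@chart R X K) x y l ->
  cube_string (@chart R X K) (g x) (g y) l.
Proof.
elim=> [z|i a b z m ca cb S IH]; first exact: cube_string_nil.
have [j [f [k [[kf kd] kE]]]] := cg i.
have fk c : cube R (cdim i) c -> cube R (cdim j) (k c).
  by move=> cc; apply: (@face_cube _ _ f); rewrite -kf; exists c.
rewrite -(kd a b ca cb) (kE a)//; apply: cube_string_cons; [exact: fk|exact: fk|].
by rewrite -(kE b).
Qed.

Lemma cubical_lip x y : mdist (g x) (g y) <= mdist x y.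
Proof.
apply/ler_addgt0Pr => e e0.
have /(string_exists K)[l S le] : mdist x y < mdist x y + e by lra.
exact: le_trans (mdist_le_string (cubical_string S)) (ltW le).
Qed.

Lemma vmap_chart i : exists j (f : face (cdim j)) k, [/\ sqdist_iso (full_face (cdim i)) f k,
  forall a, cube R (cdim i) a -> g (chart K i a) = chart K j (k a) &
  forall b : bits i, exists c : bits j, [/\ in_face f c, k (corner R b) = corner R c &
    vmap g (cvt b) = cvt c]].
Proof.
have [j [f [k [/face_isometry_sqdist kI kE]]]] := cg i; exists j, f, k; split=> // b.
have fb : in_face (full_face (cdim i)) b by move=> l c; rewrite ffunE.
have [c Ec fc] := iso_corner kI fb; exists c; split=> //.
have Ev : val (cvt c) = g (val (cvt b)) by rewrite /= (kE _ (corner_cube R b)) Ec.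
rewrite /vmap; case: xgetP => [w _ Ew|/(_ (cvt c))]; last by case.
by apply: val_inj; rewrite Ev Ew.
Qed.

Lemma vmapE v : val (vmap g v) = g (val v).
Proof.
have [i [b ->]] := vtxP v; have [j [f [k [kI kE /(_ b)[c [fc Ec ->]]]]]] := vmap_chart i.
by rewrite /= (kE _ (corner_cube R b)) Ec.
Qed.

Lemma full_in_face i (b : bits i) : in_face (full_face (cdim i)) b.
Proof. by move=> l c; rewrite ffunE. Qed.

Lemma vmap_adj v w : adj v w -> adj (vmap g v) (vmap g w).
Proof.
case=> i [b [l [-> ->]]]; have [j [f [k [kI kE kv]]]] := vmap_chart i.
have [c [fc Ec ->]] := kv b; have [c1 [fc1 Ec1 ->]] := kv (flip b l).
have [m ->] := iso_flip kI (full_in_face b) (full_in_face (flip b l)) Ec Ec1 erefl.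
exact: flip_adj.
Qed.
End One.

Variable d : V -> V -> nat.
Hypothesis G : quadrangle_graph adj sq d.
Notation halfsp := (@halfsp V adj d).
Notation side := (@side V d).
Notation coord := (@wcoord R X K d).
Notation ccoord := (@ccoord R X K d).
Notation car := (@car R X K d).
Notation reg := (@reg R X K d).

Lemma vmap_dist_le g u v : cubical K g -> (d (vmap g u) (vmap g v) <= d u v)%N.
Proof.
move=> cg; move En: (d u v) => n; elim: n v En => [|n IH] v En.
  by move/(qg_dist0 G): En => ->; rewrite (distxx G).
have uv : u <> v by move=> E; rewrite E (distxx G) in En.
have [w vw dw] := qg_dist_pred G uv.
have := IH w; rewrite dw in En; move/(_ ltac:(lia)).
have := qg_dist_triangle G (vmap g u) (vmap g w) (vmap g v).
rewrite (dist_adj1 G (vmap_adj cg (qg_adj_sym G vw))); lia.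
Qed.

Section Inverse.
Variables g g' : X -> X.
Hypotheses (gK : cancel g g') (gK' : cancel g' g) (cg : cubical K g) (cg' : cubical K g').

Lemma cubical_isometry x y : mdist (g x) (g y) = mdist x y.
Proof.
apply/eqP; rewrite eq_le cubical_lip//=.
by rewrite -{1}(gK x) -{1}(gK y) cubical_lip.
Qed.

Lemma vmapK v : vmap g' (vmap g v) = v.
Proof. by apply: val_inj; rewrite !vmapE// gK. Qed.

Lemma vmapK' v : vmap g (vmap g' v) = v.
Proof. by apply: val_inj; rewrite !vmapE// gK'. Qed.

Lemma vmap_dist u v : d (vmap g u) (vmap g v) = d u v.
Proof.
apply/eqP; rewrite eqn_leq vmap_dist_le//=.
by rewrite -{1}(vmapK u) -{1}(vmapK v) vmap_dist_le.
Qed.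

Lemma vmap_side a b : vmap g' @^-1` side a b = side (vmap g a) (vmap g b).
Proof.
have E v u : d (vmap g' v) u = d v (vmap g u) by rewrite -vmap_dist vmapK'.
by apply/seteqP; split=> v; rewrite /side /= !E.
Qed.

Lemma vmap_halfsp h : halfsp h -> halfsp (vmap g' @^-1` h).
Proof. by move=> [a [b [ab ->]]]; rewrite vmap_side; apply: halfsp_side; apply: vmap_adj. Qed.

(** The preimage under [vmap g'] is the image of [h] under [g]. A wall missing the cube cannot cut
    the image face, since the corners of that face are images of corners of the cube. *)
Lemma coord_vmap h x : halfsp h -> coord (vmap g' @^-1` h) (g x) = coord h x.
Proof.
move=> hh; have [i [a ca <-]] := chart_cover K x.
have [j [f [k [kI kE kv]]]] := vmap_chart cg i.
have fa : face_set R (full_face (cdim i)) a by [].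
have hk : cube R (cdim j) (k a) by apply: face_cube (iso_face kI fa).
rewrite (kE a ca) !(coordE G)//; last exact: vmap_halfsp.
pose b : bits i := [ffun => false]; have [c [fc Ec Evc]] := kv b.
have sides l : ccoord (side (vmap g (cvt (flip b l))) (vmap g (cvt b))) (k a) =
    ccoord (side (cvt (flip b l)) (cvt b)) a.
  have [c1 [fc1 Ec1 Evc1]] := kv (flip b l).
  have [m Em] := iso_flip kI (full_in_face b) (full_in_face (flip b l)) Ec Ec1 erefl.
  subst c1; rewrite Evc Evc1 !(ccoord_side G).
  rewrite (iso_coord_fwd kI (full_in_face b) (full_in_face (flip b l)) Ec Ec1 fa).
  by rewrite ffunE; case: (c m) => //=; lra.
have sb l : side (cvt (flip b l)) (cvt b) = hs d l by rewrite (hsP G) ffunE.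
have const (e : bool) : (forall u : bits i, h (cvt u) <-> e) ->
    ccoord (vmap g' @^-1` h) (k a) = e%:R.
  move=> He; have Hc (u : bits i) (c1 : bits j) : vmap g (cvt u) = cvt c1 -> h (vmap g' (cvt c1)) <-> e.
    by move=> <-; rewrite vmapK.
  have [[m [fm Em]]|->] := ccoord_face G (vmap_halfsp hh) fc (iso_face kI fa); last first.
    have := Hc b c Evc; case: e {He Hc} => H; first by rewrite asboolT//; apply/H.
    by rewrite asboolF// => /H.
  have [k' [kI' [_ kK']]] := iso_inverse kI.
  have fcm := in_face_flip fc fm.
  have [u Eu _] := iso_corner kI' fcm.
  have Evu : vmap g (cvt u) = cvt (flip c m).
    have [c2 [_ Ec2 ->]] := kv u; congr cvt; apply: (@corner_inj R).
    by rewrite -Ec2 -Eu kK'//; apply/corner_face.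
  have h1 := Hc b c Evc; have h2 := Hc u _ Evu.
  have ab := flip_adj c m; have ba := qg_adj_sym G ab.
  have s1 : side (cvt (flip c m)) (cvt c) (cvt (flip c m)) := side_l G ba.
  have s2 := side_r G ba; exfalso.
  case: Em => Em.
    have h3 : h (vmap g' (cvt (flip c m))).
      by have : (vmap g' @^-1` h) (cvt (flip c m)) by rewrite Em.
    have h4 : ~ h (vmap g' (cvt c)).
      by move=> h4; apply: s2; rewrite -Em.
    by apply/h4/h1/h2.
  have h3 : ~ h (vmap g' (cvt (flip c m))).
    by move=> h3; have : (vmap g' @^-1` h) (cvt (flip c m)) by []; rewrite Em; apply.
  have h4 : h (vmap g' (cvt c)).
    by have : (vmap g' @^-1` h) (cvt c) by rewrite Em.
  by apply/h3/h2/h1.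
case: (cube_side G i hh) => [[l El]|[l El]|H|H].
- by rewrite El -sb vmap_side sides.
- rewrite El -sb -preimage_setC vmap_side.
  have ab := flip_adj b l; have ba := qg_adj_sym G ab.
  by rewrite !(ccoordC G) ?sides//; apply: halfsp_side => //; apply: vmap_adj.
- by rewrite (const true) ?(@ccoord_const _ _ _ _ G i h a true)// => u; split.
- by rewrite (const false) ?(@ccoord_const _ _ _ _ G i h a false)// => u; split=> // /H.
Qed.
End Inverse.

Section Aut.
Variables g g' : X -> X.
Hypotheses (gK : cancel g g') (gK' : cancel g' g) (cg : cubical K g) (cg' : cubical K g').

Lemma car_vmap x v : car x v -> car (g x) (vmap g v).
Proof.
move=> cv k hk kv; rewrite -(coord_vmap gK' gK cg' cg _ hk) gK.
by apply: cv => //; apply: vmap_halfsp.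
Qed.
End Aut.

Section Aut2.
Variables g g' : X -> X.
Hypotheses (gK : cancel g g') (gK' : cancel g' g) (cg : cubical K g) (cg' : cubical K g').

Lemma reg_vmap C x : reg (vmap g @^-1` C) x <-> reg C (g x).
Proof.
split=> [H u cu|H v cv]; last by apply: H; apply: car_vmap cv.
rewrite -(vmapK' gK' cg cg' u); apply: H.
by rewrite -(gK x); apply: (car_vmap gK' gK cg' cg).
Qed.

Lemma rdist_vmap C x : rdist d C (g x) = rdist d (vmap g @^-1` C) x.
Proof.
rewrite /rdist; congr inf; apply/seteqP; split=> r [c rc <-].
  exists (g' c); first by apply/reg_vmap; rewrite gK'.
  by rewrite -(cubical_isometry gK cg cg') gK'.
exists (g c); first exact/reg_vmap.
exact: cubical_isometry gK cg cg' _ _.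
Qed.
End Aut2.
End Cubical.

(** * The horofunction of an orbit of pairwise meeting half-spaces *)

Section FixedPoint.
Variables (R : realType) (X : metricType R) (K : cubeComplex X).
Notation cdim := (cube_dim K).
Notation bits i := {ffun 'I_(cdim i) -> bool}.
Notation cvt := (@cv R X K).
Notation V := (vtx K).
Notation adj := (@vadj R X K).
Notation sq := (@vsq R X K).
Notation vmap := (@vmap R X K).
Variable d : V -> V -> nat.
Hypothesis G : quadrangle_graph adj sq d.
Hypothesis flagK : forall v, cell K 0 [set v] -> flag (link K v).
Variable N : nat.
Hypothesis dimN : forall n C, cell K n C -> (n <= N)%N.
Notation halfsp := (@halfsp V adj d).
Notation side := (@side V d).
Notation reg := (@reg R X K d).

Variable Gam : set (X -> X).
Hypothesis GamK : subgroup_Aut K Gam.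
Variable a : set V.
Hypothesis ha : halfsp a.
Hypothesis meet : forall g g', Gam g -> Gam g' ->
  ((vmap g @^-1` a) `&` (vmap g' @^-1` a)) !=set0.
Hypothesis no_common : forall v, exists2 g, Gam g & ~ a (vmap g v).

Definition orbit_walls : set (set V) := [set vmap g @^-1` a | g in Gam].

Lemma Gam_inverse g : Gam g -> exists g', [/\ Gam g', cubical K g, cubical K g',
  cancel g g' & cancel g' g].
Proof.
case: GamK => sub _ _ inv Gg; have [g' [Gg' gK gK']] := inv g Gg.
have [_ [_ _ cg _]] := sub g Gg; have [_ [_ _ cg' _]] := sub g' Gg'.
by exists g'.
Qed.

Lemma orbit_halfsp h : orbit_walls h -> halfsp h.
Proof.
by move=> [g /Gam_inverse[g' [Gg' cg cg' gK gK']] <-]; apply: (vmap_halfsp G gK' gK).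
Qed.

Lemma orbit_vmap g h : Gam g -> orbit_walls h -> orbit_walls (vmap g @^-1` h).
Proof.
move=> Gg [k Gk <-]; case: GamK => sub _ comp _.
have [_ [_ _ cg _]] := sub g Gg; have [_ [_ _ ck _]] := sub k Gk.
have [_ [_ _ ckg _]] := sub _ (comp _ _ Gk Gg).
exists (k \o g); first exact: comp.
apply/seteqP; split=> v; rewrite /preimage /=.
  by have -> : vmap (k \o g) v = vmap k (vmap g v) by apply: val_inj; rewrite !vmapE.
by have -> : vmap (k \o g) v = vmap k (vmap g v) by apply: val_inj; rewrite !vmapE.
Qed.

Definition walls (F : seq (set V)) := forall h, h \in F -> orbit_walls h.

Definition core (F : seq (set V)) : set V := [set v | forall h, h \in F -> h v].

(** The filter of finite subsets of the orbit, ordered by inclusion. *)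
Definition eventually_walls (P : seq (set V) -> Prop) := exists2 F0, walls F0 &
  forall F, walls F -> {subset F0 <= F} -> P F.

Lemma eventually_and P Q : eventually_walls P -> eventually_walls Q ->
  eventually_walls (fun F => P F /\ Q F).
Proof.
move=> [F1 w1 h1] [F2 w2 h2]; exists (F1 ++ F2).
  by move=> h; rewrite mem_cat => /orP[/w1|/w2].
move=> F wF sub; split; [apply: h1|apply: h2] => // h hF; apply: sub.
  by rewrite mem_cat hF.
by rewrite mem_cat hF orbT.
Qed.

Lemma eventually_weaken (P Q : seq (set V) -> Prop) :
  (forall F, walls F -> P F -> Q F) -> eventually_walls P -> eventually_walls Q.
Proof. by move=> PQ [F0 w0 h0]; exists F0 => // F wF /(h0 F wF); apply: PQ. Qed.

Lemma eventually_ex P : eventually_walls P -> exists2 F, walls F & P F.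
Proof. by move=> [F wF H]; exists F => //; apply: H. Qed.

Lemma eventually_true (P : seq (set V) -> Prop) : (forall F, walls F -> P F) ->
  eventually_walls P.
Proof. by move=> H; exists [::] => // F wF _; apply: H. Qed.

Lemma core_convex F : walls F -> gconvex d (core F).
Proof.
move=> wF u v w Hu Hv D h hF.
exact: (halfsp_convex G (orbit_halfsp (wF h hF))) (Hu h hF) (Hv h hF) D.
Qed.

Lemma core_nonempty F : walls F -> (core F) !=set0.
Proof.
move=> wF; have [F0|F0] := eqVneq F [::].
  by case: ha => [u _]; exists u; rewrite F0 => h; rewrite in_nil.
have [|h k hF kF|v Hv] := helly G F0; last by exists v.
  by move=> h /wF/orbit_halfsp.
by have [g Gg <-] := wF h hF; have [k' Gk <-] := wF k kF; apply: meet.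
Qed.

Lemma core_sub F F' : {subset F <= F'} -> core F' `<=` core F.
Proof. by move=> sub v Hv h /sub/Hv. Qed.

Notation D F x := (rdist d (core F) x).

Let catX : cat_on [set: X].
Proof. apply: (cat_complex G flagK); apply: (complex_complete G); by exists N. Qed.

Let D_lip F x y : walls F -> D F x <= D F y + mdist x y.
Proof. by move=> wF; apply: (rdist_lip G); apply: core_nonempty. Qed.

Section Step.
Variable x : V.

Let sep : set V := [set w | adj x w /\ exists2 F, walls F & core F `<=` side w x].

Lemma separators_core (s : seq V) : (forall w, w \in s -> sep w) ->
  exists2 F, walls F & forall w, w \in s -> core F `<=` side w x.
Proof.
elim: s => [|w s IH] Hs; first by exists [::].
have [|F1 w1 h1] := IH; first by move=> u us; apply: Hs; rewrite inE us orbT.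
have [_ [F2 w2 h2]] := Hs w (mem_head _ _).
exists (F1 ++ F2); first by move=> h; rewrite mem_cat => /orP[/w1|/w2].
move=> u; rewrite inE => /orP[/eqP->|us] v Hv.
  by apply: h2; apply: core_sub Hv => h hF; rewrite mem_cat hF orbT.
by apply: (h1 u us); apply: core_sub Hv => h hF; rewrite mem_cat hF.
Qed.

(** All members of [s] are nearer than [x] to a common vertex [c] of a core, so the quadrangle
    condition puts them pairwise on squares. *)
Lemma separators_chart (s : seq V) : (forall w, w \in s -> sep w) ->
  exists i (b : bits i), x = cvt b /\ forall w, w \in s -> exists j, w = cvt (flip b j).
Proof.
move=> Hs; have [F wF HF] := separators_core Hs.
have [c Cc] := core_nonempty wF.
apply: (flag_chart flagK) => [w /Hs[]//|w w' ws ws' ww'].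
have dw u : u \in s -> d c x = (d c u).+1.
  move=> us; have [xu _] := Hs u us; have := HF u us c Cc; rewrite /side /=.
  by case: (qg_dist_adj G c xu); lia.
have [xw _] := Hs w ws; have [xw' _] := Hs w' ws'.
by have [z S _] := qg_quadrangle G xw xw' ww' (dw w ws) (dw w' ws'); exists z.
Qed.

(** By dimension at most [N] neighbours of [x] lie across walls separating [x] from some core. Once
    [F] contains the subsets witnessing all of them, the list [s], and with it the jump, no longer
    depends on [F]. *)
Lemma descent_step : exists y : V, mdist (val x) (val y) <= N.+1%:R /\
  eventually_walls (fun F => D F (val y) <= D F (val x) - 1).
Proof.
have [|s [us sP]] := @maximal_seq V sep N.
  move=> s us Hs; have [i [b [xb Hb]]] := separators_chart Hs.
  apply: leq_trans (cdim_le i dimN).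
  have : {subset s <= [seq cvt (flip b j) | j <- enum 'I_(cdim i)]}.
    by move=> w /Hb[j ->]; apply: map_f; rewrite mem_enum.
  by move/(uniq_leq_size us); rewrite size_map size_enum_ord.
have Hs w : w \in s -> sep w by move/sP.
have [i [b [xb Hb]]] := separators_chart Hs; have [F1 w1 h1] := separators_core Hs.
(* A translate that misses [x] keeps [x] out of the core, so that there is a wall to cross. *)
have [g Gg ng] := no_common x; pose h0 := vmap g @^-1` a.
have wF0 : walls (h0 :: F1).
  by move=> h; rewrite inE => /orP[/eqP->|/w1//]; exists g.
exists (cvt (jump s b)); split.
  rewrite xb /= -[leRHS]mulr1; apply: le_trans (mdist_chart (corner_cube R _) (corner_cube R _)) _.
  apply: euclid_dist_small => // [|j]; first exact: cdim_le.
  rewrite !mxE; case: (b j) (jump s b j) => -[]; rewrite ?subrr ?subr0 ?sub0r ?normrN ?normr0 ?normr1 //.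
exists (h0 :: F1) => // F wF sub.
have cC := core_convex wF; have C0 := core_nonempty wF.
have sF w : w \in s <-> adj x w /\ core F `<=` side w x.
  split=> [ws|[xw cw]]; last by apply/sP; split=> //; exists F.
  split; first by case: (Hs w ws).
  move=> v Hv; apply: (h1 w ws); apply: core_sub Hv => h hF; apply: sub.
  by rewrite inE hF orbT.
rewrite xb in sF *.
apply: (rdist_jump G flagK cC C0 sF erefl) => //.
have [gC gs] := gateP G cC C0 x.
have xC : ~ core F x by move=> /(_ h0 (sub _ (mem_head _ _))).
have gx : gate adj d (core F) x <> x by move=> E; apply: xC; rewrite -E.
have [w xw Dw] := qg_dist_pred G gx.
have wx := qg_adj_sym G xw.
have ws : w \in s.
  rewrite sF -xb; split=> //; apply: gs; first exact: halfsp_side.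
    by rewrite /side /= Dw.
  exact: (side_r G wx).
by case: (s) ws.
Qed.
End Step.

Let o : V := projT1 (cid ha).

(* The upper limit, along the finite subsets F of the orbit, of the normalized distances to
   the intersections of the walls in F. *)
Definition horo (x : X) : R :=
  inf [set r | eventually_walls (fun F => D F x - D F (val o) <= r)].

Lemma horo_inf x : has_inf [set r | eventually_walls (fun F => D F x - D F (val o) <= r)].
Proof.
split.
  exists (mdist x (val o)); apply: eventually_true => F wF.
  by have := D_lip x (val o) wF; lra.
exists (- mdist x (val o)) => r /eventually_ex[F wF].
by have := D_lip (val o) x wF; rewrite (mdist_sym _ x); lra.
Qed.

Lemma horo_le x r : eventually_walls (fun F => D F x - D F (val o) <= r) -> horo x <= r.
Proof. by move=> H; apply: ge_inf => //; case: (horo_inf x). Qed.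

Lemma horo_eventually x e : 0 < e ->
  eventually_walls (fun F => D F x - D F (val o) <= horo x + e).
Proof.
move=> e0; have [r H lt] := inf_adherent e0 (horo_inf x).
by apply: eventually_weaken H => F wF; move: lt; rewrite -/(horo x); lra.
Qed.

Lemma horo_lip x y : horo x <= horo y + mdist x y.
Proof.
apply/ler_addgt0Pr => e e0; apply: horo_le.
apply: eventually_weaken (horo_eventually y e0) => F wF.
by have := D_lip x y wF; lra.
Qed.

Lemma horo_convex y z (t : R) w : 0 <= t <= 1 -> between_at y z t w ->
  horo w <= (1 - t) * horo y + t * horo z.
Proof.
move=> t01 bw; apply/ler_addgt0Pr => e e0; apply: horo_le.
apply: eventually_weaken (eventually_and (horo_eventually y e0) (horo_eventually z e0)).
move=> F wF [hy hz].
have := rdist_convex G flagK (core_convex wF) (core_nonempty wF) catX t01 bw.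
have /andP[t0 t1] := t01; have t1' : 0 <= 1 - t by lra.
have := ler_wpM2l t1' hy; have := ler_wpM2l t0 hz; lra.
Qed.

Lemma horo_base : horo (val o) = 0.
Proof.
apply/eqP; rewrite eq_le; apply/andP; split.
  by apply: horo_le; apply: eventually_true => F _; rewrite subrr.
apply/ler_addgt0Pr => e e0; have [F _] := eventually_ex (horo_eventually (val o) e0).
by rewrite subrr.
Qed.

(** Translation by [g] permutes the finite subsets of the orbit; only the base point changes, at the
    cost of its displacement. *)
Lemma horo_vmap g y : Gam g -> horo (g y) <= horo y + mdist (g (val o)) (val o).
Proof.
move=> Gg; have [g' [Gg' cg cg' gK gK']] := Gam_inverse Gg.
apply/ler_addgt0Pr => e e0; apply: horo_le.
have [F0 w0 h0] := horo_eventually y e0.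
exists [seq vmap g' @^-1` h | h <- F0].
  by move=> _ /mapP[h hF ->]; apply: orbit_vmap => //; apply: w0.
move=> F wF sub; pose Fg := [seq vmap g @^-1` h | h <- F].
have DE z : D F (g z) = D Fg z.
  rewrite (rdist_vmap G gK gK' cg cg'); congr (rdist d _ z).
  apply/seteqP; split=> v Hv.
    by move=> _ /mapP[h hF ->]; apply: Hv.
  move=> h hF; exact: (Hv (vmap g @^-1` h) (map_f _ hF)).
have wg : walls Fg by move=> _ /mapP[h hF ->]; apply: orbit_vmap => //; apply: wF.
have subg : {subset F0 <= Fg}.
  move=> h hF; apply/mapP; exists (vmap g' @^-1` h); first by apply: sub; apply: map_f.
  by apply/seteqP; split=> v; rewrite /preimage /= (vmapK gK cg cg').
have := h0 Fg wg subg; rewrite -!DE; have := D_lip (g (val o)) (val o) wF; lra.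
Qed.

Lemma horo_descent (n : nat) : exists y : V, mdist (val o) (val y) <= N.+1%:R * n%:R /\
  eventually_walls (fun F => D F (val y) - D F (val o) <= - n%:R).
Proof.
elim: n => [|n [y [dy Hy]]].
  exists o; rewrite mdistxx mulr0; split=> //; apply: eventually_true => F _.
  by rewrite subrr oppr0.
have [z [dz Hz]] := descent_step y; exists z; split.
  apply: le_trans (mdist_tri _ (val y) _) _.
  by rewrite -[n.+1]addn1 natrD mulrDr mulr1; apply: lerD.
apply: eventually_weaken (eventually_and Hy Hz) => F _ [h1 h2].
by rewrite -[n.+1]addn1 natrD; move: h1 h2; move: (n%:R) => q; lra.
Qed.

Theorem orbit_fixed_point : fixed_point_at_infinity Gam.
Proof.
have complete := complex_complete G (ex_intro _ N dimN).
have N0 : 0 < N.+1%:R :> R by rewrite ltr0n.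
have desc n : exists2 x, mdist (val o) x <= N.+1%:R * n%:R & horo x <= - n%:R.
  by have [y [dy Hy]] := horo_descent n; exists (val y) => //; apply: horo_le.
have [c gc Hc] := steepest_ray catX complete horo_lip horo_convex horo_base N0 desc.
have bound g : Gam g -> exists B : R, forall t, 0 <= t -> mdist (c t) (g (c t)) <= B.
  move=> Gg; have [g' [_ cg cg' gK gK']] := Gam_inverse Gg.
  exists (mdist (c 0) (g (c 0))); apply: (Hc g (mdist (g (val o)) (val o))).
    exact: (cubical_isometry gK cg cg').
  by move=> y; apply: horo_vmap.
pose xi : set (R -> X) := [set c' | geodesic_ray c' /\ asymptotic c c'].
have moves g c' : Gam g -> xi c' -> xi (g \o c').
  move=> Gg [gc' [B HB]]; have [g' [_ cg cg' gK gK']] := Gam_inverse Gg.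
  have iso := cubical_isometry gK cg cg'.
  split; first by move=> s t s0 t0; rewrite /= iso; apply: gc'.
  have [B' HB'] := bound g Gg; exists (B' + B) => t t0.
  apply: le_trans (mdist_tri _ (g (c t)) _) _.
  by apply: lerD; [apply: HB'|rewrite /= iso; apply: HB].
exists xi; first by exists c.
move=> g Gg; apply/seteqP; split=> [_ [c' xc' <-]|c' xc']; first exact: moves.
have [g' [Gg' _ _ _ gK']] := Gam_inverse Gg.
exists (g' \o c'); first exact: moves.
by apply: funext => t; rewrite /= gK'.
Qed.
End FixedPoint.

Lemma bit_not_half (R : realType) (e : bool) : e%:R <> 2^-1 :> R.
Proof. by case: e => /= h; lra. Qed.

(** * Hyperplanes and half-spaces *)

Section Hyperplanes.
Variables (R : realType) (X : metricType R) (K : cubeComplex X).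
Notation cdim := (cube_dim K).
Notation bits i := {ffun 'I_(cdim i) -> bool}.
Notation cvt := (@cv R X K).
Notation V := (vtx K).
Notation adj := (@vadj R X K).
Notation sq := (@vsq R X K).
Variable d : V -> V -> nat.
Hypothesis G : quadrangle_graph adj sq d.
Notation halfsp := (@halfsp V adj d).
Notation side := (@side V d).
Notation coord := (@wcoord R X K d).
Notation hs := (@hs R X K d _).
Notation ccoord := (@ccoord R X K d).
Notation car := (@car R X K d).
Notation edge := (@edge_set R X K).

Lemma side_flipE v w i (b : bits i) j : adj v w ->
  (cvt b = v \/ cvt b = w) -> (cvt (flip b j) = v \/ cvt (flip b j) = w) ->
  same_walls (side v w) (hs j).
Proof.
move=> vw h1 h2; have ab := flip_adj b j.
have : same_walls (side (cvt (flip b j)) (cvt b)) (hs j).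
  by rewrite (hsP G); apply/asboolP; case: ifP; [right|left].
case: h1 => e1; case: h2 => e2.
- by case: (vadj_irr ab); rewrite e1 e2.
- rewrite e1 e2 => H; apply: same_walls_trans H; apply/asboolP; right.
  by rewrite (sideC G vw) setCK.
- by rewrite e1 e2.
- by case: (vadj_irr ab); rewrite e1 e2.
Qed.

(** Both half-spaces of the dual wall, since an edge given as a set of points carries no
    orientation. *)
Definition edge_walls (E : set X) : set (set V) :=
  [set k | exists v w, [/\ adj v w, E = edge v w & same_walls k (side v w)]].

Lemma edge_wallsP v w k : adj v w -> edge_walls (edge v w) k <-> same_walls k (side v w).
Proof.
move=> vw; split=> [[v' [w' [vw' E kS]]]|kS]; last by exists v, w.
apply: same_walls_trans kS _.
have e1 : v' = v \/ v' = w by apply/(vtx_in_edge _ vw); rewrite E; apply/(vtx_in_edge _ vw'); left.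
have e2 : w' = v \/ w' = w by apply/(vtx_in_edge _ vw); rewrite E; apply/(vtx_in_edge _ vw'); right.
have ne := vadj_irr vw'.
case: e1 => E1; case: e2 => E2; subst v' w'; try by case: ne.
  by apply/asboolP; left.
by apply/asboolP; right; rewrite (sideC G vw).
Qed.

(** Edges of a square in different directions would share the corner [e], whose bit [j] comes from
    the second edge and whose other bits come from the first. So disjoint edges have the same
    direction, hence the same wall. *)
Lemma opposite_walls E E' : opposite K E E' -> edge_walls E = edge_walls E'.
Proof.
case=> /cell1P[v [w [vw ->]]] /cell1P[v' [w' [vw' ->]]] dis [_ [[i [f [f2 ->]]] sub]].
have inQ u : edge v w (val u) \/ edge v' w' (val u) -> exists2 b : bits i, u = cvt b & in_face f b.
  by move=> H; apply: vtx_in_face; apply: sub; case: H; [left|right].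
have inv u : u = v \/ u = w -> exists2 b : bits i, u = cvt b & in_face f b.
  by move=> H; apply: inQ; left; apply/(vtx_in_edge _ vw).
have inv' u : u = v' \/ u = w' -> exists2 b : bits i, u = cvt b & in_face f b.
  by move=> H; apply: inQ; right; apply/(vtx_in_edge _ vw').
have [b Ev fb] := inv v (or_introl erefl); have [b1 Ew fb1] := inv w (or_intror erefl).
have [c Ev' fc] := inv' v' (or_introl erefl); have [c1 Ew' fc1] := inv' w' (or_intror erefl).
have [j Ej] : exists j, w = cvt (flip b j).
  by rewrite Ev in vw; apply: (vadj_cv (erefl (cvt b)) vw); exists b1.
have [k Ek] : exists k, w' = cvt (flip c k).
  by rewrite Ev' in vw'; apply: (vadj_cv (erefl (cvt c)) vw'); exists c1.
have fbj : in_face f (flip b j).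
  by have <- : b1 = flip b j by apply: (@cv_inj _ _ K i); rewrite -Ew.
have fck : in_face f (flip c k).
  by have <- : c1 = flip c k by apply: (@cv_inj _ _ K i); rewrite -Ew'.
have fj := in_face_flip_free fb fbj; have fk := in_face_flip_free fc fck.
have jk : j = k.
  apply/eqP/negPn/negP => jk.
  have ud : forall l, f l = None -> l = j \/ l = k.
    move=> l fl; have : [:: j; k] =i [pred j | f j == None].
      have un : uniq [:: j; k] by rewrite /= inE jk.
      have cE : #|[:: j; k]| = #|[pred j | f j == None]|.
        by rewrite (card_uniqP un) -[RHS]/(face_dim f) f2.
      apply/(subset_cardP cE).
      by apply/fintype.subsetP => x; rewrite !inE => /orP[]/eqP ->; apply/eqP.
    move/(_ l); rewrite !inE fl eqxx => /orP[]/eqP; by [left|right].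
  have agree l : l != j -> l != k -> b l = c l.
    move=> lj lk; case fl: (f l) => [e|]; first by rewrite (fb _ _ fl) (fc _ _ fl).
    by case: (ud l fl) => El; rewrite El eqxx in lj lk.
  pose e : bits i := [ffun l => if l == j then c l else b l].
  have e1 : e = b \/ e = flip b j.
    case cb: (c j == b j); [left|right]; apply/ffunP => l; rewrite !ffunE; case: eqP => // ->.
      exact/eqP.
    by move/negbT: cb; case: (c j) (b j) => -[].
  have e2 : e = c \/ e = flip c k.
    case cb: (b k == c k); [left|right]; apply/ffunP => l; rewrite !ffunE.
      case: (eqVneq l j) => // lj; case: (eqVneq l k) => [->|lk]; first exact/eqP.
      exact: agree.
    case: (eqVneq l j) => [->|lj]; first by rewrite (negbTE jk).
    case: (eqVneq l k) => [->|lk]; first by move/negbT: cb; case: (c k) (b k) => -[].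
    exact: agree.
  have : (edge v w `&` edge v' w') (val (cvt e)).
    split.
      apply/(vtx_in_edge _ vw); rewrite Ev Ej; case: e1 => ->; by [left|right].
    apply/(vtx_in_edge _ vw'); rewrite Ev' Ek; case: e2 => ->; by [left|right].
  by rewrite dis.
have S : same_walls (side v w) (side v' w').
  have h1 : same_walls (side v w) (hs j).
    by apply: (side_flipE vw (b := b)); rewrite ?Ev ?Ej; auto.
  have h2 : same_walls (side v' w') (hs j).
    by rewrite jk; apply: (side_flipE vw' (b := c)); rewrite ?Ev' ?Ek; auto.
  exact: same_walls_trans h1 (same_wallsC h2).
apply/seteqP; split=> z Hz.
  apply/(edge_wallsP _ vw'); apply: same_walls_trans S; exact/(edge_wallsP _ vw).
apply/(edge_wallsP _ vw); apply: same_walls_trans (same_wallsC S); exact/(edge_wallsP _ vw').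
Qed.

Lemma parallel_walls E E' : parallel K E E' -> edge_walls E = edge_walls E'.
Proof.
elim=> [A B|A|A B _ ->|A B C _ -> _ ->] //; exact: opposite_walls.
Qed.

Lemma square_opposite a b c e : sq a b e c -> opposite K (edge a b) (edge c e).
Proof.
move=> S; have ab := vsq_adj S; have ec := vsq_adj (vsq_rot (vsq_rot S)).
have ce := vadj_sym ec; case: S => i [x [j [k [jk Ea Eb Ee Ec]]]].
rewrite flipC in Ee.
have E1 : edge a b = chart K i @` face_set R (edge_face x j) by rewrite Ea Eb edge_set_cv.
have E2 : edge c e = chart K i @` face_set R (edge_face (flip x k) j) by rewrite Ec Ee edge_set_cv.
split; [exact: edge_set_cell|exact: edge_set_cell| |].
  rewrite E1 E2 -subset0 => y [[p fp <-] [q fq E]].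
  have pq := chart_inj (face_cube fq) (face_cube fp) E; subst q.
  have kj : k != j by rewrite eq_sym.
  have [_ /(_ (x k))] := fp k; rewrite ffunE (negbTE kj) => /(_ erefl) h1.
  have [_ /(_ (~~ x k))] := fq k; rewrite ffunE (negbTE kj) flip_at => /(_ erefl).
  by rewrite h1; case: (x k) => /= /eqP; rewrite ?oner_eq0// eq_sym oner_eq0.
pose f : face (cdim i) := [ffun l => if (l == j) || (l == k) then None else Some (x l)].
exists (chart K i @` face_set R f); split.
  exists i, f; split=> //; rewrite /face_dim -(_ : #|[:: j; k]| = 2%N).
    by apply: fintype.eq_card => l; rewrite !inE ffunE; case: ifP.
  by rewrite (card_uniqP _)//= inE jk.
have sub y : y \in [:: x; flip x k] -> chart K i @` face_set R (edge_face y j) `<=` chart K i @` face_set R f.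
  move=> yx _ [p fp <-]; exists p => // l; have [pl Hl] := fp l; split=> // z.
  rewrite ffunE; case: (eqVneq l j) => //= lj; case: (eqVneq l k) => //= lk -[<-].
  apply: Hl; rewrite ffunE (negbTE lj); move: yx; rewrite !inE => /orP[]/eqP-> //.
  by rewrite flip_other.
by rewrite E1 E2 => y [] H; apply: (sub _ _ _ H); rewrite !inE eqxx ?orbT.
Qed.

Lemma parallel_edges_parallel a b c e : adj a b -> parallel_edges sq a b c e ->
  parallel K (edge a b) (edge c e).
Proof.
move=> ab; elim=> [|c1 e1 e2 c2 _ IH S]; first exact: rst_refl.
by apply: rst_trans IH _; apply: rst_step; apply: square_opposite.
Qed.

Lemma midpoint_wall E m k : midpoint K E m -> halfsp k -> coord k m = 2^-1 -> edge_walls E k.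
Proof.
move=> [/cell1P[v [w [vw Ev]]] [i [f [j [fj [Ef Em]]]]]] hk k2; subst E.
have [a [fa aj] am] : (chart K i @` (face_set R f `&` [set a | a ord0 j = 2^-1])) m.
  by rewrite -Em.
have inE' c : in_face f c -> cvt c = v \/ cvt c = w.
  by move=> fc; apply/(vtx_in_edge _ vw); rewrite Ef; apply/cv_in_face.
have free l : f l = None -> same_walls (side v w) (hs l).
  move=> fl; have [b fb] := face_corner f.
  by apply: (side_flipE vw (b := b)); apply: inE' => //; apply: in_face_flip.
have notbit := @bit_not_half R.
have fl l : a ord0 l = 2^-1 -> f l = None.
  by move=> al; case E: (f l) => [e|//]; have [_ /(_ _ E)] := fa l; rewrite al => /esym/notbit.
apply/(edge_wallsP _ vw); move: k2; rewrite -am (coordE G)//; last exact: face_cube fa.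
case: (cube_side G i hk) => [[l El]|[l El]|H|H].
- by rewrite El (ccoord_hs G) => /fl/free; apply: same_wallsC.
- rewrite El (ccoord_hsC G) => al; have /fl/free H : a ord0 l = 2^-1 by move: al; clear; lra.
  by apply: same_walls_trans (same_wallsC H); apply/asboolP; right.
- by rewrite (@ccoord_const _ _ _ _ G i k _ true) => [/notbit//|c]; split.
- by rewrite (@ccoord_const _ _ _ _ G i k _ false) => [/notbit//|c]; split=> // /H.
Qed.

Lemma coord_half_same k k' x : halfsp k' -> same_walls k k' -> coord k x = 2^-1 -> coord k' x = 2^-1.
Proof.
move=> hk' /asboolP[->//|->]; rewrite (coordC G)//; lra.
Qed.

(** On a midcube one coordinate is one half, and parallel edges have the same wall; conversely
    [crossing_parallel] provides the chain of squares to an edge of any cube cut by the wall. *)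
Lemma dual_hyperplaneE v w : adj v w ->
  dual_hyperplane K (edge v w) = [set x | coord (side v w) x = 2^-1].
Proof.
move=> vw; have hvw := halfsp_side d vw; apply/seteqP; split=> x /=.
  move=> [E' [m [C [M [par [mid [[i [f [j [fj [_ ->]]]]] [[a' [fa' aj'] Em] [a [fa aj] Ex]]]]]]]]].
  have hj := halfsp_hs G j.
  have /(midpoint_wall mid hj) : coord (hs j) m = 2^-1.
    by rewrite -Em (coordE G) ?(ccoord_hs G)//; apply: face_cube fa'.
  rewrite -(parallel_walls par) => /(edge_wallsP _ vw) S.
  apply: (coord_half_same hvw S); rewrite -Ex (coordE G) ?(ccoord_hs G)//.
  exact: face_cube fa.
have [i [a ca <-]] := chart_cover K x; rewrite (coordE G)// => a2.
have [j Ej] : exists j : 'I_(cdim i), side v w = hs j \/ side v w = ~` hs j.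
  case: (cube_side G i hvw) => [[l El]|[l El]|H|H]; try by exists l; auto.
    by move: a2; rewrite (@ccoord_const _ _ _ _ G i _ a true) => [/=|c]; [lra|split].
  by move: a2; rewrite (@ccoord_const _ _ _ _ G i _ a false) => [/=|c]; [lra|split=> // /H].
have aj : a ord0 j = 2^-1.
  by case: Ej a2 => ->; rewrite ?(ccoord_hs G) ?(ccoord_hsC G)//; lra.
pose b : bits i := [ffun => false]; have bb' := flip_adj b j.
have hb : ~ hs j (cvt b) by rewrite (hs_cv G) ffunE.
have hb' : hs j (cvt (flip b j)) by rewrite (hs_cv G) flip_at ffunE.
have par : parallel K (edge v w) (edge (cvt b) (cvt (flip b j))).
  case: Ej => Ej.
    rewrite (edge_set_sym bb'); apply: parallel_edges_parallel => //.
    have b'b := vadj_sym bb'.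
    have [||] := crossing_parallel G vw b'b; by rewrite ?Ej.
  apply: parallel_edges_parallel => //.
  have [||] := crossing_parallel G vw bb'; rewrite ?Ej//.
pose mp : 'rV[R]_(cdim i) := \row_l (if l == j then 2^-1 else (b l)%:R).
have cm : face_set R (edge_face b j) mp.
  move=> l; rewrite mxE [edge_face b j l]ffunE; case: eqP => _.
    by split=> //; apply/andP; split; lra.
  by split=> [|e [<-]//]; case: (b l); rewrite ?lexx ler01.
have mj : mp ord0 j = 2^-1 by rewrite mxE eqxx.
exists (edge (cvt b) (cvt (flip b j))), (chart K i mp), (chart K i @` cube R (cdim i)),
  (chart K i @` (face_set R (full_face (cdim i)) `&` [set a | a ord0 j = 2^-1])).
split=> //; split; last first.
  split; first by exists i, (full_face (cdim i)), j; rewrite ffunE.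
  by split; [exists mp => //; split=> //; apply: face_cube cm|exists a].
split; first exact: edge_set_cell.
exists i, (edge_face b j), j; rewrite edge_set_cv ffunE eqxx; split=> //; split=> //.
apply/seteqP; split=> [_ ->|_ [c [fc cj] <-]]; first by exists mp.
congr chart; apply/rowP => l; have [_ Hl] := fc l; have [_ Ml] := cm l.
have [->|lj] := eqVneq l j; first by rewrite cj mj.
by rewrite (Hl (b l)) ?(Ml (b l))// ffunE (negbTE lj).
Qed.
End Hyperplanes.

(** * Components of the complement of a hyperplane *)

Section Halfspaces.
Variables (R : realType) (X : metricType R) (K : cubeComplex X).
Notation cdim := (cube_dim K).
Notation bits i := {ffun 'I_(cdim i) -> bool}.
Notation cvt := (@cv R X K).
Notation V := (vtx K).
Notation adj := (@vadj R X K).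
Notation sq := (@vsq R X K).
Variable d : V -> V -> nat.
Hypothesis G : quadrangle_graph adj sq d.
Notation halfsp := (@halfsp V adj d).
Notation side := (@side V d).
Notation coord := (@wcoord R X K d).
Notation hs := (@hs R X K d _).
Notation ccoord := (@ccoord R X K d).
Notation car := (@car R X K d).
Notation edge := (@edge_set R X K).

Lemma coord_continuous h : halfsp h -> continuous (coord h).
Proof.
move=> hh x; apply/cvg_ballP => e e0; apply/nbhs_ballP; exists e => //= y.
rewrite ballEmdist /= => xy; apply: le_lt_trans xy.
by have := coord_lip G x y hh.
Qed.

(** Extends a segment parametrized by the unit interval to a Lipschitz map on the line. *)
Definition clamp (t : R) : R := if t <= 0 then 0 else if 1 <= t then 1 else t.

Lemma clamp01 t : 0 <= clamp t <= 1.
Proof.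
rewrite /clamp; case: (leP t 0) => h1; first by rewrite lexx ler01.
by case: (leP 1 t) => h2; [rewrite lexx ler01|apply/andP; split; lra].
Qed.

Lemma clamp_id t : 0 <= t <= 1 -> clamp t = t.
Proof.
by move=> /andP[t0 t1]; rewrite /clamp; case: (leP t 0) => h1; [lra|case: (leP 1 t) => h2; lra].
Qed.

Lemma clamp_lip s t : `|clamp s - clamp t| <= `|s - t|.
Proof.
have le u v : u <= v -> 0 <= clamp v - clamp u /\ clamp v - clamp u <= v - u.
  rewrite /clamp => uv; case: (leP u 0) => h1; case: (leP v 0) => h3; try lra;
  case: (leP 1 u) => h2; case: (leP 1 v) => h4; lra.
have [st|ts] := leP s t.
  have [h1 h2] := le _ _ st; rewrite distrC [leRHS]distrC !ger0_norm; lra.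
by have [h1 h2] := le _ _ (ltW ts); rewrite !ger0_norm; lra.
Qed.

Definition segment n (a c : 'rV[R]_n) (t : R) : 'rV[R]_n := a + t *: (c - a).

Lemma segmentE n (a c : 'rV[R]_n) t l :
  segment a c t ord0 l = (1 - t) * a ord0 l + t * c ord0 l.
Proof. by rewrite !mxE; lra. Qed.

Lemma segment_cube n (a c : 'rV[R]_n) t : cube R n a -> cube R n c -> 0 <= t <= 1 ->
  cube R n (segment a c t).
Proof.
move=> ca cc /andP[t0 t1] l; split; last by move=> b; rewrite ffunE.
have [/andP[a0 a1] _] := ca l; have [/andP[c0 c1] _] := cc l; rewrite segmentE.
have t1' : 0 <= 1 - t by lra.
have h1 := mulr_ge0 t1' a0; have h2 := mulr_ge0 t0 c0.
have h3 : 0 <= (1 - t) * (1 - a ord0 l) by rewrite mulr_ge0//; lra.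
have h4 : 0 <= t * (1 - c ord0 l) by rewrite mulr_ge0//; lra.
by apply/andP; split; lra.
Qed.

Lemma segment_dist n (a c : 'rV[R]_n) s t :
  euclid_dist (segment a c s) (segment a c t) = `|s - t| * euclid_dist a c.
Proof.
apply/eqP; rewrite -(eqrXn2 (n := 2)) ?mulr_ge0 ?euclid_dist_ge0//.
rewrite exprMn !euclid_dist_sqr real_normK ?num_real// /sqdist mulr_sumr.
by apply/eqP; apply: eq_bigr => l _; rewrite !segmentE; lra.
Qed.

Lemma ccoord_segment i k (a c : 'rV[R]_(cdim i)) t : halfsp k ->
  ccoord k (segment a c t) = (1 - t) * ccoord k a + t * ccoord k c.
Proof.
move=> hk; case: (cube_side G i hk) => [[j ->]|[j ->]|H|H].
- by rewrite !(ccoord_hs G) segmentE.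
- by rewrite !(ccoord_hsC G) segmentE; lra.
- by rewrite !(@ccoord_const _ _ _ _ G i k _ true) ?mulr1n => [|u|u|u]; first lra; split.
- rewrite !(@ccoord_const _ _ _ _ G i k _ false) ?mulr0n => [|u|u|u]; first lra.
  all: by split=> // /H.
Qed.

Lemma segment_component (A : set X) i (a c : 'rV[R]_(cdim i)) :
  cube R (cdim i) a -> cube R (cdim i) c ->
  (forall t, 0 <= t <= 1 -> A (chart K i (segment a c t))) ->
  connected_component A (chart K i a) (chart K i c).
Proof.
move=> ca cc H; pose q t := chart K i (segment a c (clamp t)).
have cq : continuous q.
  apply: (@lipschitz_continuous _ _ q (euclid_dist a c)); first exact: euclid_dist_ge0.
  move=> s t; apply: le_trans (mdist_chart _ _) _; try exact: segment_cube (clamp01 _).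
  rewrite segment_dist mulrC; apply: ler_wpM2l; first exact: euclid_dist_ge0.
  exact: clamp_lip.
have zero01 : 0 <= (0 : R) <= 1 by rewrite lexx ler01.
have one01 : 0 <= (1 : R) <= 1 by rewrite lexx ler01.
have q0 : q 0 = chart K i a by rewrite /q clamp_id// /segment scale0r addr0.
have q1 : q 1 = chart K i c by rewrite /q clamp_id// /segment scale1r addrC subrK.
apply: (@connected_component_max _ A (q @` `[0, 1]%classic)).
- by exists 0 => //=; rewrite in_itv /= lexx ler01.
- move=> _ [t _ <-]; apply: H; exact: clamp01.
- apply: connected_continuous_connected; first exact: segment_connected.
  exact: continuous_subspaceT.
- by exists 1 => //=; rewrite in_itv /= lexx ler01.
Qed.

Variable h : set V.
Hypothesis hh : halfsp h.
Notation H := [set x | coord h x = 2^-1].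
Notation U := [set x | 2^-1 < coord h x].

Lemma segment_U i (a c : 'rV[R]_(cdim i)) : cube R (cdim i) a -> cube R (cdim i) c ->
  2^-1 <= ccoord h a -> 2^-1 < ccoord h c ->
  forall t, 0 < t <= 1 -> U (chart K i (segment a c t)).
Proof.
move=> ca cc ha hc t /andP[t0 t1].
have t01 : 0 <= t <= 1 by rewrite ltW.
rewrite /= (coordE G)//; last exact: segment_cube.
rewrite ccoord_segment//.
have h1 : 0 <= (1 - t) * (ccoord h a - 2^-1) by rewrite mulr_ge0//; lra.
have h2 : 0 < t * (ccoord h c - 2^-1) by rewrite mulr_gt0//; lra.
by lra.
Qed.

Lemma chart_component i (a c : 'rV[R]_(cdim i)) : cube R (cdim i) a -> cube R (cdim i) c ->
  2^-1 < ccoord h a -> 2^-1 < ccoord h c ->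
  connected_component (~` H) (chart K i a) (chart K i c).
Proof.
move=> ca cc ha hc; apply: segment_component => // t /andP[t0 t1] /= E.
have [t0'|t0'] := ltP 0 t.
  have := segment_U ca cc (ltW ha) hc (t := t); rewrite t0' t1 => /(_ isT) /=.
  by rewrite E ltxx.
have t00 : t = 0 by lra.
by move: E; rewrite t00 /segment scale0r addr0 (coordE G)//; lra.
Qed.

Lemma vertex_component v w : h v -> h w -> connected_component (~` H) (val v) (val w).
Proof.
move En: (d v w) => n; elim: n w En => [|n IH] w En hv hw.
  move/(qg_dist0 G): En => <-; apply: connected_component_refl => /=.
  by rewrite (coord_vtx G)// asboolT// mulr1n; lra.
have vw : v <> w by move=> E; rewrite E (distxx G) in En.
have [u wu du] := qg_dist_pred G vw.
have uw := qg_adj_sym G wu.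
have hu : h u.
  by apply: (halfsp_convex G hh hv hw); rewrite du (dist_adj1 G uw) addn1.
apply: connected_component_trans (IH u _ hv hu) _; first by lia.
case: uw hu hw => i [b [j [-> ->]]] hu hw.
by apply: chart_component; try exact: corner_cube;
  rewrite (ccoord_corner G)// asboolT// mulr1n; lra.
Qed.

Lemma toward_vertex x : 0 < coord h x -> exists i a (b : bits i),
  [/\ cube R (cdim i) a, chart K i a = x, h (cvt b) & ccoord h (corner R b) = 1].
Proof.
move=> x0; have [v cv hv] := car_halfsp G hh x0.
have [i [a ca Ea]] := chart_cover K x; rewrite -Ea in cv.
have [b Ev _] := car_cv G ca cv; exists i, a, b; split=> //; first by rewrite -Ev.
by rewrite (ccoord_corner G)// asboolT// -Ev.
Qed.

(** A connected set that leaves [U] takes the value one half. Conversely every point of [U] is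
    joined inside its cube to a vertex of [h], and vertices of [h] are joined along edges, by
    convexity of [h]. *)
Lemma componentE x : U x -> connected_component (~` H) x = U.
Proof.
move=> xU; apply/seteqP; split=> y.
  move=> [B [Bx BH cB] By].
  have cI : is_interval (coord h @` B).
    apply/connected_intervalP; apply: connected_continuous_connected => //.
    exact/continuous_subspaceT/coord_continuous.
  rewrite /= ltNge; apply/negP => y2.
  have [z Bz Ez] : (coord h @` B) 2^-1.
    apply: (cI (coord h y) (coord h x)); [by exists y|by exists x|].
    by rewrite y2 ltW.
  exact: BH z Bz Ez.
move=> yU; have pos z : U z -> 0 < coord h z by move=> /= zU; apply: lt_trans zU; rewrite invr_gt0.
have toV z : U z -> exists2 v, h v & connected_component (~` H) z (val v).
  move=> zU; have [i [a [b [ca Ea hb b1]]]] := toward_vertex (pos z zU).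
  exists (cvt b) => //; rewrite -Ea; apply: chart_component => //.
  - exact: corner_cube.
  - by rewrite -(coordE G)// Ea.
  - by rewrite b1; lra.
have [v hv xv] := toV x xU; have [w hw yw] := toV y yU.
apply: connected_component_trans xv _; apply: connected_component_trans (vertex_component hv hw) _.
exact: connected_component_sym.
Qed.

(** A point at height one half is approached along the segment to a corner of its cube that belongs
    to [h]. *)
Lemma closureE : closure U = [set x | 2^-1 <= coord h x].
Proof.
apply/seteqP; split=> x /= Hx.
  rewrite leNgt; apply/negP => lt.
  have e0 : 0 < 2^-1 - coord h x by lra.
  have [y [yU]] := Hx _ (nbhsx_ballx x _ e0); rewrite ballEmdist /= => xy.
  by have := coord_lip G x y hh; rewrite ler_norml => /andP[? ?]; move: yU; rewrite /=; lra.
move=> B /nbhs_ballP[e /= e0 sub].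
have x0 : 0 < coord h x by lra.
have [i [a [b [ca Ea hb b1]]]] := toward_vertex x0.
have D0 := euclid_dist_ge0 a (corner R b); set D := euclid_dist _ _ in D0.
pose t := Num.min 1 (e / (D + 1) / 2).
have D1 : 0 < D + 1 by lra.
have eD : 0 < e / (D + 1) / 2 by rewrite !divr_gt0.
have t0 : 0 < t by rewrite lt_min ltr01.
have t1 : t <= 1 by rewrite ge_min lexx.
have te : t * (D + 1) <= e / 2.
  have : t <= e / (D + 1) / 2 by rewrite ge_min lexx orbT.
  by rewrite -(ler_pM2r D1) mulrAC divfK ?gt_eqF.
exists (chart K i (segment a (corner R b) t)); split.
  apply: segment_U => //; [exact: corner_cube| | |].
  - by rewrite -(coordE G)// Ea.
  - by rewrite b1; lra.
  - by rewrite t0 t1.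
apply: sub; rewrite ballEmdist /= -Ea.
have -> : chart K i a = chart K i (segment a (corner R b) 0).
  by rewrite /segment scale0r addr0.
apply: le_lt_trans (mdist_chart _ _) _; try apply: segment_cube => //; try exact: corner_cube.
- by rewrite lexx ler01.
- by rewrite t1 ltW.
rewrite segment_dist -/D sub0r normrN gtr0_norm//.
have : t * D <= t * (D + 1) by rewrite ler_wpM2l// ltW//; lra.
by lra.
Qed.
End Halfspaces.

Section HalfspaceP.
Variables (R : realType) (X : metricType R) (K : cubeComplex X).
Variable d : vtx K -> vtx K -> nat.
Hypothesis G : quadrangle_graph (@vadj R X K) (@vsq R X K) d.
Notation halfsp := (@halfsp _ (@vadj R X K) d).
Notation side := (@side _ d).
Notation coord := (@wcoord R X K d).

(** A base point of the component with coordinate below one half is handled by the complementary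
    half-space, which has the same hyperplane. *)
Lemma halfspaceP S : halfspace K S <-> exists2 h, halfsp h & S = [set x | 2^-1 <= coord h x].
Proof.
split=> [[_ [x [[E0 [/cell1P[v [w [vw ->]]] ->]] [nx ->]]]]|[_ [v [w [vw ->]]] ->]]; last first.
  have hvw := halfsp_side d vw.
  exists (dual_hyperplane K (edge_set v w)), (val v); split.
    by exists (edge_set v w); split=> //; apply: edge_set_cell.
  rewrite (dual_hyperplaneE G vw).
  have v1 : 2^-1 < coord (side v w) (val v).
    by rewrite (coord_vtx G)// asboolT ?mulr1n; [lra|apply: (side_l G)].
  split; first by move=> /= v2; rewrite v2 ltxx in v1.
  by rewrite (componentE G hvw v1) (closureE G hvw).
have hvw := halfsp_side d vw; rewrite (dual_hyperplaneE G vw) in nx *.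
have [lt|lt] := ltP 2^-1 (coord (side v w) x).
  by exists (side v w) => //; rewrite (componentE G hvw lt) (closureE G hvw).
have hwv := halfspC G hvw; exists (~` side v w) => //.
have HE : [set x | coord (side v w) x = 2^-1] = [set x | coord (~` side v w) x = 2^-1].
  by apply/seteqP; split=> y /=; rewrite (coordC G)//; lra.
have lt' : 2^-1 < coord (~` side v w) x.
  rewrite (coordC G)// lt_neqAle; apply/andP; split; last by lra.
  by apply/eqP => x2; apply: nx => /=; lra.
by rewrite HE (componentE G hwv lt') (closureE G hwv).
Qed.
End HalfspaceP.

Lemma cat0_gdist (R : realType) (X : metricType R) (K : cubeComplex X) :
  CAT0_cube_complex K ->
  quadrangle_graph (@vadj R X K) (@vsq R X K) (gdist (@vadj R X K) (@vsq R X K)).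
Proof.
move=> cat0; have [sconn conn] := cat0_quadrangle_graph cat0.
pose cb := vsq_cube (proj2 cat0).
split.
- exact: vadj_sym.
- exact: vsq_adj.
- exact: vsq_rot.
- exact: vsq_rev.
- exact: vsq_ne.
- exact: vsq_uniq.
- exact: (gdist0 (@vadj_sym _ _ K) (@vsq_adj _ _ K) (@vsq_rot _ _ K) (@vsq_rev _ _ K)
    (@vsq_ne _ _ K) (@vsq_uniq _ _ K) cb sconn conn).
- exact: (gdist_sym (@vadj_sym _ _ K) (@vsq_adj _ _ K) (@vsq_rot _ _ K) (@vsq_rev _ _ K)
    (@vsq_ne _ _ K) (@vsq_uniq _ _ K) cb sconn conn).
- exact: (gdist_triangle (@vadj_sym _ _ K) (@vsq_adj _ _ K) (@vsq_rot _ _ K) (@vsq_rev _ _ K)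
    (@vsq_ne _ _ K) (@vsq_uniq _ _ K) cb sconn conn).
- exact: (gdist_adj (@vadj_sym _ _ K) (@vsq_adj _ _ K) (@vsq_rot _ _ K) (@vsq_rev _ _ K)
    (@vsq_ne _ _ K) (@vsq_uniq _ _ K) cb sconn conn).
- exact: (gdist_pred (@vadj_sym _ _ K) (@vsq_adj _ _ K) (@vsq_rot _ _ K) (@vsq_rev _ _ K)
    (@vsq_ne _ _ K) (@vsq_uniq _ _ K) cb sconn conn).
- exact: (gdist_quadrangle (@vadj_sym _ _ K) (@vsq_adj _ _ K) (@vsq_rot _ _ K) (@vsq_rev _ _ K)
    (@vsq_ne _ _ K) (@vsq_uniq _ _ K) cb sconn conn).
Qed.

(** * Double skewering *)

Section Skewering.
Variables (R : realType) (X : metricType R) (K : cubeComplex X).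
Notation V := (vtx K).
Notation adj := (@vadj R X K).
Notation sq := (@vsq R X K).
Notation vmap := (@vmap R X K).
Variable d : V -> V -> nat.
Hypothesis G : quadrangle_graph adj sq d.
Hypothesis flagK : forall v, cell K 0 [set v] -> flag (link K v).
Hypothesis finK : finite_dimensional K.
Notation halfsp := (@halfsp V adj d).
Notation coord := (@wcoord R X K d).
Variable Gam : set (X -> X).
Hypothesis GamK : subgroup_Aut K Gam.
Hypothesis essK : essential K Gam.
Hypothesis nofix : ~ fixed_point_at_infinity Gam.

Lemma half_vtx h v : halfsp h -> 2^-1 <= coord h (val v) <-> h v.
Proof.
move=> hh; rewrite (coord_vtx G)//; case: asboolP => hv; rewrite ?mulr1n ?mulr0n.
  by split=> // _; lra.
by split=> //; lra.
Qed.

Lemma essential_escape h v r : halfsp h -> exists2 g, Gam g &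
  forall u, h u -> r < mdist (val (vmap g v)) (val u).
Proof.
move=> hh; apply: contrapT => no.
have hS : halfspace K [set x | 2^-1 <= coord h x] by apply/(halfspaceP G); exists h.
apply: (essK hS (x := val v)); exists r => g Gg; apply: contrapT => far.
have [g' [_ cg _ _ _]] := Gam_inverse GamK Gg.
apply: no; exists g => // u hu; rewrite ltNge; apply/negP => le; apply: far.
by exists (val u); split; [apply/half_vtx|rewrite -vmapE].
Qed.

Lemma flipping h : halfsp h -> exists2 g, Gam g & forall v, h v -> ~ h (vmap g v).
Proof.
move=> hh; apply: contrapT => no; apply: nofix; case: finK => N dimN.
apply: (orbit_fixed_point G flagK dimN GamK hh) => [g1 g2 G1 G2|v]; last first.
  have [g Gg Hg] := essential_escape v 0 hh; exists g => // hv.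
  by have := Hg _ hv; rewrite mdistxx ltxx.
have [g2' [G2' c2 c2' K2 K2']] := Gam_inverse GamK G2.
have [_ [_ c1 _ _ _]] := Gam_inverse GamK G1.
(* The translates by [g1] and [g2] meet as soon as [g1 \o g2'] is not a flip. *)
have Gk : Gam (g1 \o g2') by case: GamK => _ _ comp _; apply: comp.
have [v [hv kv]] : exists v, h v /\ h (vmap (g1 \o g2') v).
  apply: contrapT => no'; apply: no; exists (g1 \o g2') => // v hv kv.
  by apply: no'; exists v.
have [_ [_ ck _ _ _]] := Gam_inverse GamK Gk.
exists (vmap g2' v); split; rewrite /preimage /=.
  have E : vmap (g1 \o g2') v = vmap g1 (vmap g2' v) by apply: val_inj; rewrite !vmapE.
  by rewrite -E.
by rewrite (vmapK' K2' c2 c2').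
Qed.

(** Essentiality, used for the complement, gives a vertex [v] more than 1 away from it. The geodesic
    from [v] to its gate there leaves [h] from a vertex [x] other than [v], and by the gate property
    a half-space containing [v] but not [x] avoids the complement. *)
Lemma smaller_halfsp h : halfsp h -> exists k, [/\ halfsp k, k `<=` h & exists2 v, h v & ~ k v].
Proof.
move=> hh; have [p _] := hh; have hC := halfspC G hh.
have [g Gg Hg] := essential_escape p 1 hC; set v := vmap g p in Hg.
have hv : h v.
  by apply: contrapT => nv; have := Hg v nv; rewrite mdistxx ltNge ler01.
have Z0 : (~` h) !=set0.
  case: hh => [a [b [ab ->]]]; exists b; exact: (side_r G ab).
have cZ := halfsp_convex G hC.
have nhg := gate_in G cZ Z0 v; set z := gate _ _ _ _ in nhg.
have [x [y [xy hx nhy D]]] := crossing_edge G hv nhg.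
have [D1 _] := between_vertices G D xy.
have vx : v <> x.
  move=> E; have := Hg y nhy; rewrite E => lt.
  case: xy lt => i [b [j [-> ->]]]; apply/negP; rewrite -leNgt.
  apply: le_trans (mdist_chart (corner_cube R _) (corner_cube R _)) _.
  apply: ler_sqr_ge0 => //; rewrite euclid_dist_sqr sqdist_flip expr1n//.
have [k [hk kv nkx]] := separating G vx.
have nkz : ~ k z by move=> kz; exact: nkx (halfsp_convex G hk kv kz D1).
have sub := gate_sub G cZ Z0 (halfspC G hk) nkz (fun H => H kv).
exists k; split=> //; last by exists x.
by move=> u ku; apply: contrapT => nu; apply: (sub u nu).
Qed.

Lemma double_skewering h k : halfsp h -> halfsp k -> k `<=` h ->
  exists2 g, Gam g & forall v, h v -> k (vmap g v).
Proof.
move=> hh hk kh; have [g1 G1 H1] := flipping hh; have [g2 G2 H2] := flipping (halfspC G hk).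
have G21 : Gam (g2 \o g1) by case: GamK => _ _ comp _; apply: comp.
exists (g2 \o g1) => // v hv.
have [_ [_ c1 _ _ _]] := Gam_inverse GamK G1.
have [_ [_ c2 _ _ _]] := Gam_inverse GamK G2.
have [_ [_ c21 _ _ _]] := Gam_inverse GamK G21.
have -> : vmap (g2 \o g1) v = vmap g2 (vmap g1 v) by apply: val_inj; rewrite !vmapE.
apply: contrapT => nk; apply: (H2 (vmap g1 v)) => //.
by move=> /kh; apply: H1.
Qed.

Lemma halfspace_skewering A B : halfspace K A -> halfspace K B -> A `<=` B ->
  exists g, Gam g /\ g @` B `<` A /\ A `<=` B.
Proof.
move=> /(halfspaceP G)[a ha ->] /(halfspaceP G)[b hb ->] AB.
have ab : a `<=` b by move=> v av; apply/(half_vtx v hb)/AB/(half_vtx v ha).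
(* Mapping into a strictly smaller half-space makes the inclusion proper; [w] is the point that is
   missed. *)
have [k [hk ka [w aw nkw]]] := smaller_halfsp ha.
have [g Gg Hg] := double_skewering hb hk (subset_trans ka ab).
have [g' [_ cg cg' gK gK']] := Gam_inverse GamK Gg.
have mono x : coord b x <= coord k (g x).
  rewrite -(coord_vmap G gK gK' cg cg' x hb); apply: (coord_mono G) => //.
    exact: (vmap_halfsp G gK gK').
  by move=> v /Hg; rewrite (vmapK' gK' cg cg').
exists g; split=> //; split=> //; split.
  move=> _ [x xb <-] /=; apply: le_trans (xb : 2^-1 <= _) _.
  by apply: le_trans (mono x) _; apply: (coord_mono G).
move=> /(_ (val w)); case; first exact/(half_vtx w ha).
move=> x xb E; apply: nkw; apply/(half_vtx w hk); rewrite -E.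
exact: le_trans (xb : 2^-1 <= _) (mono x).
Qed.
End Skewering.

Theorem mainTheorem11 (R : realType) (X : metricType R) (K : cubeComplex X)
    (Gamma : set (X -> X)) :
  CAT0_cube_complex K ->
  finite_dimensional K ->
  subgroup_Aut K Gamma ->
  essential K Gamma ->
  ~ fixed_point_at_infinity Gamma ->
  forall d h : set X, halfspace K d -> halfspace K h -> d `<=` h ->
    exists g : X -> X, Gamma g /\ g @` h `<` d /\ d `<=` h.
Proof.
move=> cat0 fin sub ess nofix A B hA hB AB.
exact: (halfspace_skewering (cat0_gdist cat0) (proj2 cat0) fin sub ess nofix hA hB AB).
Qed.
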